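(* Let $p\in(5/2,5)$. Then the Schrödinger–Born–Infeld system \[ \begin{cases} -\Delta u+u+\phi u= |u|^{p-1}u & \text{in }\mathbb{R}^3,\\[1mm] -\operatorname{div}\left(\dfrac{\nabla \phi}{\sqrt{1-|\nabla \phi|^2}}\right)=u^2 & \text{in }\mathbb{R}^3,\\ u(x)\to 0,\ \phi(x)\to 0 & \text{as }|x|\to \infty, \end{cases} \] possesses a radial ground state solution, namely a weak solution $(u,\phi)\in H^1_r(\mathbb{R}^3)\times \mathcal{X}_r$ with $u\neq 0$ which minimizes the functional $F$ among all nontrivial radial weak solutions. Moreover both $u$ and $\phi$ are of class $C^2(\mathbb{R}^3)$.
   Context: $D^{1,2}(\mathbb{R}^3)$ is the completion of $C_c^\infty(\mathbb{R}^3)$ with respect to the norm $\|\nabla\cdot\|_{L^2}$. Set $\mathcal{X}:=D^{1,2}(\mathbb{R}^3)\cap\{\phi\in C^{0,1}(\mathbb{R}^3): \|\nabla\phi\|_\infty\le 1\}$. $H^1_r(\mathbb{R}^3)$ and $\mathcal{X}_r$ denote the subsets of radially symmetric functions of $H^1(\mathbb{R}^3)$ and $\mathcal{X}$. A weak solution of the system is a pair $(u,\phi)\in H^1(\mathbb{R}^3)\times\mathcal{X}$ such that for all $v,\psi\in C_c^\infty(\mathbb{R}^3)$: $\int \nabla u\cdot\nabla v+uv+\phi uv=\int |u|^{p-1}uv$ and $\int \frac{\nabla\phi\cdot\nabla\psi}{\sqrt{1-|\nabla\phi|^2}}=\int u^2\psi$ (integrals over $\mathbb{R}^3$). Nontrivial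 means $u\ne 0$. The action functional is $F(u,\phi)=\frac12\int(|\nabla u|^2+u^2)+\frac12\int\phi u^2-\frac1{p+1}\int|u|^{p+1}-\frac12\int\left(1-\sqrt{1-|\nabla\phi|^2}\right)$. *)

(* Defs.v *)
From HB Require Import structures.
From mathcomp Require Import all_boot all_order all_algebra.
From mathcomp Require Import all_classical all_reals all_analysis.
Set Implicit Arguments. Unset Strict Implicit. Unset Printing Implicit Defensive.
Import Order.TTheory GRing.Theory Num.Theory.
Import numFieldNormedType.Exports.
Local Open Scope classical_set_scope.
Local Open Scope ring_scope.

Section SBI.
Context {R : realType}.

Definition pt := (R * R * R)%type.

Definition mu3 := ((@lebesgue_measure R \x @lebesgue_measure R) \x @lebesgue_measure R)%E.

Definition coord3 (i : 'I_3) (x : pt) : R :=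
  if val i == 0%N then x.1.1 else if val i == 1%N then x.1.2 else x.2.
Definition ebasis (i : 'I_3) : pt :=
  if val i == 0%N then (1, 0, 0) else if val i == 1%N then (0, 1, 0) else (0, 0, 1).
Definition dot3 (x y : pt) : R := x.1.1 * y.1.1 + x.1.2 * y.1.2 + x.2 * y.2.
Definition enorm (x : pt) : R := Num.sqrt (dot3 x x).

Fixpoint dpart (l : seq 'I_3) (f : pt -> R) : pt -> R :=
  match l with
  | [::] => f
  | i :: l' => 'D_(ebasis i) (dpart l' f)
  end.

Definition cgrad (f : pt -> R) (x : pt) : pt :=
  (dpart [:: 0%R] f x, dpart [:: 1%R] f x, dpart [:: 2%R] f x).

Definition smooth3 (f : pt -> R) : Prop :=
  forall l : seq 'I_3, continuous (dpart l f) /\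
    (forall (i : 'I_3) (x : pt), derivable (dpart l f) x (ebasis i)).

Definition test_fun (f : pt -> R) : Prop :=
  smooth3 f /\ exists M : R, forall x, M < enorm x -> f x = 0.

Definition C2 (f : pt -> R) : Prop :=
  forall l : seq 'I_3, (size l <= 2)%N ->
    continuous (dpart l f) /\
    ((size l < 2)%N -> forall (i : 'I_3) (x : pt), derivable (dpart l f) x (ebasis i)).

Definition radial (f : pt -> R) : Prop :=
  forall x y, enorm x = enorm y -> f x = f y.

Definition loc_integrable (f : pt -> R) : Prop :=
  measurable_fun setT f /\
  forall r : R, mu3.-integrable [set x | enorm x <= r] (fun x => (f x)%:E).

Definition weak_grad (u : pt -> R) (g : pt -> pt) : Prop :=
  loc_integrable u /\ (forall i, loc_integrable (fun x => coord3 i (g x))) /\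
  forall psi, test_fun psi -> forall i : 'I_3,
    Rintegral mu3 setT (fun x => u x * dpart [:: i] psi x)
    = - Rintegral mu3 setT (fun x => coord3 i (g x) * psi x).

Definition L2 (f : pt -> R) : Prop := mu3.-integrable setT (fun x => (f x ^+ 2)%:E).
Definition L6 (f : pt -> R) : Prop := mu3.-integrable setT (fun x => (f x ^+ 6)%:E).

Definition H1_with_grad (u : pt -> R) (g : pt -> pt) : Prop :=
  L2 u /\ weak_grad u g /\ L2 (fun x => enorm (g x)).

(* phi in D^{1,2}(R^3) (realized as {phi in L^6 : grad phi in L^2}) with weak gradient g *)
Definition D12_with_grad (phi : pt -> R) (g : pt -> pt) : Prop :=
  L6 phi /\ weak_grad phi g /\ L2 (fun x => enorm (g x)).

Definition X_with_grad (phi : pt -> R) (g : pt -> pt) : Prop :=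
  D12_with_grad phi g /\
  (exists L : R, forall x y, `|phi x - phi y| <= L * enorm (x - y)) /\
  {ae mu3, forall x, enorm (g x) <= 1}.

Definition weak_solution (p : R) (u : pt -> R) (gu : pt -> pt)
    (phi : pt -> R) (gphi : pt -> pt) : Prop :=
  (forall v, test_fun v ->
     Rintegral mu3 setT
       (fun x => dot3 (gu x) (cgrad v x) + u x * v x + phi x * u x * v x)
     = Rintegral mu3 setT (fun x => `|u x| `^ (p - 1) * u x * v x)) /\
  (forall psi, test_fun psi ->
     Rintegral mu3 setT
       (fun x => dot3 (gphi x) (cgrad psi x) / Num.sqrt (1 - enorm (gphi x) ^+ 2))
     = Rintegral mu3 setT (fun x => u x ^+ 2 * psi x)).

Definition F_action (p : R) (u : pt -> R) (gu : pt -> pt)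
    (phi : pt -> R) (gphi : pt -> pt) : R :=
  2^-1 * Rintegral mu3 setT (fun x => enorm (gu x) ^+ 2 + u x ^+ 2)
  + 2^-1 * Rintegral mu3 setT (fun x => phi x * u x ^+ 2)
  - (p + 1)^-1 * Rintegral mu3 setT (fun x => `|u x| `^ (p + 1))
  - 2^-1 * Rintegral mu3 setT (fun x => 1 - Num.sqrt (1 - enorm (gphi x) ^+ 2)).

Definition nontrivial (u : pt -> R) : Prop := ~ {ae mu3, forall x, u x = 0}.

End SBI.

(* Main.v *)
Require Import Defs.
From HB Require Import structures.
From mathcomp Require Import all_boot all_order all_algebra.
From mathcomp Require Import all_classical all_reals all_analysis.
From mathcomp Require Import measurable_realfun.
From mathcomp Require Import ring lra.
Set Implicit Arguments. Unset Strict Implicit. Unset Printing Implicit Defensive.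
Import Order.TTheory GRing.Theory Num.Theory.
Import numFieldNormedType.Exports.
Local Open Scope classical_set_scope.
Local Open Scope ring_scope.

(* For radial pairs the system is one-dimensional: with [m(r) = \int_0^r U^2 s^2 ds] the field equation
   integrates to [phi' = - m / sqrt (r^4 + m^2)], which makes [F] a functional of the profile [U] alone.
   Along the rescaling [t^2 U(t r)], [s = t^3], this functional [PP p U U' s] is concave in [s]; the level
   [clev p] is the infimum over nonzero profiles of its supremum in [s]. Radial compactness yields a
   minimizer, whose Euler-Lagrange equation is the first equation of the system, and a bootstrap at the
   origin gives C^2 regularity. Conversely a radial weak solution has absolutely continuous profiles which
   solve the same ODE, and by Pohozaev's identity [s = 1] maximizes [PP] along its rescaling; hence its
   action is at least [kap * clev p], with [kap] the area of the unit sphere. *)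

(** The field term enters [F] with a negative sign and is singular where the gradient has length
    one. Solving the field equation radially removes both obstacles: by Legendre duality the field
    contributes a nonnegative energy of the mass function. The difficulty then lies with the
    minimizer. A minimizing sequence converges only pointwise, to a function [u] known to be
    continuous, and the derivatives need not converge. So its integrals are kept as limit numbers,
    and the sequence itself is perturbed with step [1/(n+1)] while minimal up to [c/(n+1)^2]; the
    error is of second order, and dividing by the step leaves an identity for [u] with all
    derivatives on the test function. Differentiability of [u] comes out of that identity, and lower
    semicontinuity of the gradient term is proved afterwards. On the other side, a competitor
    satisfies weak conditions only, read with an integral that is 0 on non-integrable functions and
    a quotient that is 0 at a zero denominator. Integrability of the flux and strict positivity of
    the mass rule out both default values before the field equation is inverted. *)

Import HBNNSimple.

(** * Integrals of real-valued functions: domination, Fatou, almost everywhere equality *)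

Section GeneralIntegral.
Context d (T : measurableType d) (R : realType) (mu : {measure set T -> \bar R}).
Variables (D : set T) (mD : measurable D).
Implicit Types f g : T -> R.
Local Notation ig f := (mu.-integrable D (EFin \o f)).

Lemma ig_meas f : ig f -> measurable_fun D f.
Proof. by move=> /integrableP[/measurable_EFinP]. Qed.

Lemma ig_dom f g : measurable_fun D f -> ig g ->
  (forall x, D x -> `|f x| <= g x) -> ig f.
Proof.
move=> mf igg fg; apply: (le_integrable mD _ _ igg); first exact/measurable_EFinP.
by move=> x Dx /=; rewrite lee_fin (le_trans (fg _ Dx))// ler_norm.
Qed.

Lemma ig_eq f g : (forall x, D x -> f x = g x) -> ig f -> ig g.
Proof. by move=> fg; apply: eq_integrable => // x /set_mem Dx /=; rewrite fg. Qed.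

Lemma igD f g : ig f -> ig g -> ig (fun x => f x + g x).
Proof.
by move=> hf hg; apply: eq_integrable (integrableD mD hf hg).
Qed.

Lemma igB f g : ig f -> ig g -> ig (fun x => f x - g x).
Proof.
by move=> hf hg; apply: eq_integrable (integrableB mD hf hg).
Qed.

Lemma igZ (k : R) f : ig f -> ig (fun x => k * f x).
Proof. by move=> hf; apply: eq_integrable (integrableZl mD k hf). Qed.

Lemma igN f : ig f -> ig (fun x => - f x).
Proof. by move=> hf; apply: (ig_eq _ (igZ (-1) hf)) => x _; rewrite mulN1r. Qed.

Lemma igabs f : ig f -> ig (fun x => `|f x|).
Proof. by move=> hf; apply: eq_integrable (integrable_abse hf). Qed.

Lemma eq_RintD f g : (forall x, D x -> f x = g x) ->
  \int[mu]_(x in D) f x = \int[mu]_(x in D) g x.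
Proof. by move=> fg; apply: eq_Rintegral => x /set_mem; exact: fg. Qed.

Lemma RintZ (k : R) f : ig f ->
  \int[mu]_(x in D) (k * f x) = k * \int[mu]_(x in D) f x.
Proof. by move=> hf; rewrite RintegralZl. Qed.

Lemma Rint_cst0 : \int[mu]_(x in D) (0 : R) = 0.
Proof. by rewrite Rintegral_cst// mul0r. Qed.

(* A non-integrable function has one infinite part, which [fine] sends to 0. *)
Lemma Rint_non_ig f : measurable_fun D f -> ~ ig f -> \int[mu]_(x in D) f x = 0.
Proof.
move=> mf nf; rewrite /Rintegral.
have [h|] := boolP ((\int[mu]_(x in D) (f x)%:E)%E \is a fin_num); last first.
  by rewrite fin_numE negb_and !negbK => /orP[] /eqP ->.
exfalso; apply: nf; apply/integrableP; split; first exact/measurable_EFinP.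
by rewrite /= integral_fin_num_abs.
Qed.

Lemma DCT (f : nat -> T -> R) (F g : T -> R) :
  (forall n, measurable_fun D (f n)) -> ig g ->
  (forall n x, D x -> `|f n x| <= g x) ->
  (forall x, D x -> f n x @[n --> \oo] --> F x) ->
  ig F /\ (\int[mu]_(x in D) f n x) @[n --> \oo] --> \int[mu]_(x in D) F x.
Proof.
move=> mf igg fg fF.
have mF : measurable_fun D F by apply: (measurable_fun_cvg (h := f)).
have [] := @dominated_convergence _ _ _ mu D mD (fun n => EFin \o f n) (EFin \o F) (EFin \o g).
- by move=> n; exact/measurable_EFinP.
- exact/measurable_EFinP.
- by apply: aeW => x Dx; apply: cvg_EFin; [exact: nearW | exact: fF].
- exact: igg.
- by apply: aeW => x n Dx /=; rewrite lee_fin fg.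
move=> igF _ cv; split => //.
by apply: fine_cvg; rewrite fineK//; apply: integrable_fin_num.
Qed.

Lemma le_Rint f g : ig f -> ig g -> (forall x, D x -> f x <= g x) ->
  \int[mu]_(x in D) f x <= \int[mu]_(x in D) g x.
Proof. by move=> hf hg; apply: le_Rintegral. Qed.

Lemma abs_Rint f g : ig f -> ig g -> (forall x, D x -> `|f x| <= g x) ->
  `|\int[mu]_(x in D) f x| <= \int[mu]_(x in D) g x.
Proof.
move=> hf hg fg; apply: le_trans (le_normr_Rintegral mD hf) _.
by apply: le_Rint => //; exact: igabs.
Qed.

(** Fatou's lemma in the form used for limits of profiles: a uniform bound on the integrals yields
    integrability of the pointwise limit together with the same bound. *)
Lemma Rfatou (f : nat -> T -> R) (F : T -> R) (M : R) :
  (forall n, ig (f n)) -> (forall n x, D x -> 0 <= f n x) ->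
  (forall x, D x -> f n x @[n --> \oo] --> F x) ->
  (forall n, \int[mu]_(x in D) f n x <= M) ->
  ig F /\ \int[mu]_(x in D) F x <= M.
Proof.
move=> igf f0 fF fM.
have mf n : measurable_fun D (f n) by exact: ig_meas.
have mF : measurable_fun D F by apply: (measurable_fun_cvg (h := f)).
have F0 x : D x -> 0 <= F x.
  move=> Dx; rewrite -(cvg_lim _ (fF x Dx))//; apply: limr_ge; first by apply/cvg_ex; exists (F x); exact: fF.
  by apply: nearW => n; exact: f0.
have key : (\int[mu]_(x in D) (F x)%:E <= M%:E)%E.
  have : (\int[mu]_(x in D) limn_einf (fun n => (f n x)%:E) <=
          limn_einf (fun n => \int[mu]_(x in D) (f n x)%:E))%E.
    by apply: fatou => //; move=> n; exact/measurable_EFinP.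
  rewrite (@eq_integral _ _ _ _ _ (EFin \o F)); last first.
    move=> x /set_mem Dx /=.
    have h : (f n x)%:E @[n --> \oo] --> (F x)%:E.
      by apply: cvg_EFin; [exact: nearW | exact: fF].
    by have [] := cvg_limn_einf_sup h.
  move=> /le_trans; apply; rewrite limn_einf_lim.
  apply: lime_le; first exact: is_cvg_einfs.
  apply: nearW => n.
  apply: le_trans (_ : _ <= \int[mu]_(x in D) (f n x)%:E)%E _.
    by apply: ereal_inf_lbound; exists n => /=.
  have hn := integrable_fin_num mD (igf n).
  by move: (fM n); rewrite -lee_fin /Rintegral fineK.
have igF : ig F.
  apply/integrableP; split; first exact/measurable_EFinP.
  apply: le_lt_trans (_ : _ <= M%:E)%E (ltry _).
  apply: le_trans key; rewrite le_eqVlt; apply/orP; left; apply/eqP.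
  by apply: eq_integral => x /set_mem Dx /=; rewrite ger0_norm// F0.
split => //; rewrite -lee_fin /Rintegral fineK//; exact: integrable_fin_num.
Qed.

Lemma eq_Rint_ae f g : measurable_fun D f -> measurable_fun D g ->
  {ae mu, forall x, D x -> f x = g x} ->
  \int[mu]_(x in D) f x = \int[mu]_(x in D) g x.
Proof.
move=> mf mg fg; rewrite /Rintegral; congr fine; apply: ae_eq_integral => //.
- exact/measurable_EFinP.
- exact/measurable_EFinP.
- by apply: filterS fg => x h Dx; rewrite h.
Qed.

Lemma ig_ae f g : measurable_fun D g -> ig f ->
  {ae mu, forall x, D x -> f x = g x} -> ig g.
Proof.
move=> mg igf fg; have mf := ig_meas igf.
apply/integrableP; split; first exact/measurable_EFinP.
have /integrableP[_] := igf; congr (_ < _)%E; apply: ae_eq_integral => //.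
- by apply: measurableT_comp => //; exact/measurable_EFinP.
- by apply: measurableT_comp => //; exact/measurable_EFinP.
- by apply: filterS fg => x h Dx /=; rewrite h.
Qed.

Lemma igS f (E : set T) : measurable E -> E `<=` D -> ig f ->
  mu.-integrable E (EFin \o f).
Proof. by move=> mE ED; apply: integrableS. Qed.

Lemma Rint_restr f (E : set T) : measurable E -> E `<=` D ->
  \int[mu]_(x in E) f x = \int[mu]_(x in D) (f \_ E) x.
Proof.
move=> mE ED; rewrite -Rintegral_mkcondr; congr Rintegral.
by apply/seteqP; split => [x Ex|x []//]; split => //; exact: ED.
Qed.

Lemma ig_restr f (E : set T) : measurable E -> E `<=` D ->
  mu.-integrable E (EFin \o f) -> ig (f \_ E).
Proof.
move=> mE ED h.
rewrite -restrict_EFin; apply/(integrable_restrict mu mE mD).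
by rewrite (_ : D `&` E = E)//; apply/seteqP; split => [x []//|x Ex]; split => //; exact: ED.
Qed.

Lemma meas_restr f (E : set T) : measurable E -> measurable_fun D f ->
  measurable_fun D (f \_ E).
Proof.
move=> mE mf; apply/(measurable_restrict f mE mD).
by apply: measurable_funS mf => // x [].
Qed.

End GeneralIntegral.

Section LinearCombination.
Context d (T : measurableType d) {R : realType} (mu : {measure set T -> \bar R}) (D : set T).
Hypothesis mD : measurable D.
Local Notation ig f := (mu.-integrable D (EFin \o f)).

Lemma ig2 (k l : R) f g : ig f -> ig g -> ig (fun r => k * f r + l * g r) /\
  \int[mu]_(r in D) (k * f r + l * g r) = k * (\int[mu]_(r in D) f r) + l * (\int[mu]_(r in D) g r).
Proof.
move=> hf hg; have h1 := igZ mD k hf; have h2 := igZ mD l hg.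
by split; [exact: igD|rewrite RintegralD// !RintZ].
Qed.

Lemma ig3 (k l : R) f g h : ig f -> ig g -> ig h -> ig (fun r => f r + k * g r + l * h r) /\
  \int[mu]_(r in D) (f r + k * g r + l * h r) =
  \int[mu]_(r in D) f r + k * (\int[mu]_(r in D) g r) + l * (\int[mu]_(r in D) h r).
Proof.
move=> hf hg hh; have h1 := igZ mD k hg; have h2 := igZ mD l hh; have h3 := igD mD hf h1.
by split; [exact: igD|rewrite RintegralD// RintegralD// !RintZ].
Qed.

(** Negation exchanges the positive and negative parts; when a part is infinite, [fine] returns 0 on
    both sides, so the identity holds for every function. *)
Lemma RintN_all (f : T -> R) : \int[mu]_(x in D) (- f x) = - \int[mu]_(x in D) f x.
Proof.
rewrite /Rintegral integralE [in RHS]integralE.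
rewrite (_ : (fun x => (- f x)%:E) = (\- (fun x => (f x)%:E))%E)//.
rewrite funeposN funenegN.
move: (\int[mu]_(x in D) _)%E (\int[mu]_(x in D) _)%E => [x| |] [y| |] //=; rewrite ?oppr0//.
by rewrite opprB.
Qed.

End LinearCombination.

(** * Products of sigma-finite measures and Fubini *)

Section ProductSigmaFinite.
Context d1 d2 (T1 : measurableType d1) (T2 : measurableType d2) (R : realType).
Variables (m1 : {sigma_finite_measure set T1 -> \bar R}) (m2 : {sigma_finite_measure set T2 -> \bar R}).
Lemma product_sigma_finite : sigma_finite setT (m1 \x m2)%E.
Proof.
have /sigma_finiteP[F [FT Fmono Ffin]] := sigma_finiteT m1.
have /sigma_finiteP[G [GT Gmono Gfin]] := sigma_finiteT m2.
exists (fun n => F n `*` G n) => [|n].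
  apply/seteqP; split => // -[x y] _.
  have [i _ Fx] : (\bigcup_i F i) x by rewrite -FT.
  have [j _ Gy] : (\bigcup_i G i) y by rewrite -GT.
  exists (maxn i j) => //; split => /=.
    by move: Fx; apply/subsetPset/Fmono/leq_maxl.
  by move: Gy; apply/subsetPset/Gmono/leq_maxr.
have [mF fF] := Ffin n; have [mG fG] := Gfin n.
split; first exact: measurableX.
by rewrite product_measure1E// lte_mul_pinfty// ge0_fin_numE.
Qed.
(** The first factor of [mu3] is itself a product measure; this packs it as a sigma-finite measure
    so that Fubini applies to the outer product. *)
Definition prod_sf : {sigma_finite_measure set (T1 * T2)%type -> \bar R} :=
  HB.pack_for {sigma_finite_measure set (T1 * T2)%type -> \bar R} (m1 \x m2)%E (Measure_isSigmaFinite.Build _ _ _ (m1 \x m2)%E product_sigma_finite).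
End ProductSigmaFinite.

Section FubiniZero.
Context d1 d2 (T1 : measurableType d1) (T2 : measurableType d2) (R : realType).
Variables (m1 : {sigma_finite_measure set T1 -> \bar R}) (m2 : {sigma_finite_measure set T2 -> \bar R}).
Variable f : T1 * T2 -> R.
Hypothesis fi : (m1 \x m2)%E.-integrable setT (fun z => (f z)%:E).

Lemma fubini0_21 : (forall y, (\int[m1]_x (f (x, y))%:E = 0)%E) -> (\int[m1 \x m2]_z (f z)%:E = 0)%E.
Proof.
move=> h; rewrite -(integral21_prod_meas1 fi); apply: integral0_eq => y _; exact: h.
Qed.

Lemma fubini0_12 : (forall x, (\int[m2]_y (f (x, y))%:E = 0)%E) -> (\int[m1 \x m2]_z (f z)%:E = 0)%E.
Proof.
move=> h; rewrite -(integral12_prod_meas1 fi); apply: integral0_eq => x _; exact: h.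
Qed.
End FubiniZero.

(** * Measures with a density *)

Section Density.
Context d (T : measurableType d) {R : realType} (mu : {measure set T -> \bar R}).
Variable h : T -> R.
Hypothesis mh : measurable_fun setT h.
Hypothesis h0 : forall x, 0 <= h x.
Local Open Scope ereal_scope.

(** The two proofs are arguments of the definition so that the measure structure can be attached to
    the term [dmeas mh h0]. *)
Definition dmeas of measurable_fun setT h & (forall x, (0 <= h x)%R) := fun A : set T => \int[mu]_(x in A) (h x)%:E.
Local Notation nu := (dmeas mh h0).

Let dm0 : nu set0 = 0. Proof. by rewrite /dmeas integral_set0. Qed.
Let dm_ge0 A : 0 <= nu A. Proof. by apply: integral_ge0 => x _; rewrite lee_fin. Qed.
Let dm_add : semi_sigma_additive nu.
Proof.
apply: semi_sigma_additive_nng_induced; first exact/measurable_EFinP.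
by move=> x; rewrite lee_fin.
Qed.

HB.instance Definition _ := isMeasure.Build _ _ _ nu dm0 dm_ge0 dm_add.

Lemma integral_dmeas_nnsfun (g : {nnsfun T >-> R}) (D : set T) : measurable D ->
  \int[nu]_(x in D) (g x)%:E = \int[mu]_(x in D) ((g x)%:E * (h x)%:E).
Proof.
move=> mD; have mhD : measurable_fun D (EFin \o h) by apply/measurable_EFinP; exact: measurable_funTS.
transitivity (\int[nu]_(x in D) (\sum_(y \in range g) (y * \1_(g @^-1` [set y]) x)%:E)).
  by apply: eq_integral => x _; rewrite fimfunE -fsumEFin.
have mind r : measurable_fun D (fun x => (r * \1_(g @^-1` [set r]) x)%:E).
  by apply: (measurable_comp measurableT) => //; exact: measurable_funM.
rewrite ge0_integral_fsum//; last by move=> r x Dx; exact: nnfun_muleindic_ge0.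
transitivity (\int[mu]_(x in D) (\sum_(y \in range g) ((y * \1_(g @^-1` [set y]) x)%:E * (h x)%:E))); last first.
  apply: eq_integral => x _; rewrite -ge0_mule_fsuml; last by move=> y; exact: nnfun_muleindic_ge0.
  by rewrite fsumEFin // -(fimfunE _ x).
rewrite ge0_integral_fsum//; last 2 first.
- by move=> r; exact: emeasurable_funM.
- by move=> r x Dx; apply: mule_ge0; [rewrite EFinM; exact: nnfun_muleindic_ge0|rewrite lee_fin].
apply: eq_fsbigr => r rg.
have r0 : (0 <= r)%R by move: rg; rewrite inE => -[x _ <-].
have mi : measurable_fun D (fun x => (\1_(g @^-1` [set r]) x : R)%:E).
  by apply/measurable_EFinP; apply: measurable_funTS; exact: measurable_indic.
under eq_integral do rewrite EFinM.
rewrite ge0_integralZl//.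
under [RHS]eq_integral do rewrite EFinM -muleA.
rewrite ge0_integralZl//; last 2 first.
- by apply: emeasurable_funM.
- by move=> x Dx; rewrite mule_ge0 ?lee_fin.
congr (_ * _); rewrite integral_indic//.
transitivity (dmeas mh h0 (g @^-1` [set r] `&` D)) => //; rewrite /dmeas.
rewrite setIC [LHS]integral_mkcondr/=; apply: eq_integral => x _.
by rewrite /patch indicE; case: ifPn => hx; rewrite ?mul1e ?mul0e.
Qed.

Lemma integral_dmeas (f : T -> \bar R) (D : set T) : measurable D -> measurable_fun D f ->
  (forall x, 0 <= f x) -> \int[nu]_(x in D) f x = \int[mu]_(x in D) (f x * (h x)%:E).
Proof.
move=> mD mf f0; pose g := nnsfun_approx mD mf.
have -> : \int[nu]_(x in D) f x = lim (\int[nu]_(x in D) (EFin \o g n) x @[n --> \oo]).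
  have fE x : D x -> f x = lim ((EFin \o g n) x @[n --> \oo]).
    by move=> Dx; apply/esym/cvg_lim => //; exact: cvg_nnsfun_approx.
  under eq_integral => x /[!inE] /fE -> //.
  apply: monotone_convergence => //.
  - by move=> n; apply/measurable_EFinP; exact: measurable_funTS.
  - by move=> n x Dx /=; rewrite lee_fin.
  - by move=> x Dx a b ab; rewrite lee_fin; exact/lefP/nd_nnsfun_approx.
have -> : \int[mu]_(x in D) (f x * (h x)%:E) = lim (\int[mu]_(x in D) ((g n x)%:E * (h x)%:E) @[n --> \oo]).
  have fE x : D x -> f x * (h x)%:E = lim (((g n x)%:E * (h x)%:E) @[n --> \oo]).
    move=> Dx; apply/esym/cvg_lim => //; apply: cvgeZr => //; exact: (cvg_nnsfun_approx mD mf).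
  under eq_integral => x /[!inE] /fE -> //.
  apply: monotone_convergence => //.
  - by move=> n; apply: emeasurable_funM => //; apply/measurable_EFinP; exact: measurable_funTS.
  - by move=> n x Dx; rewrite mule_ge0 ?lee_fin.
  - by move=> x Dx a b ab; rewrite lee_wpmul2r ?lee_fin//; exact/lefP/nd_nnsfun_approx.
by under eq_fun do rewrite integral_dmeas_nnsfun//.
Qed.
End Density.

(** * Functions all of whose integrals vanish *)

Section ZeroIntegrals.
Context d d' (T : measurableType d) (U : measurableType d') {R : realType}.
Variables (mu : {measure set T -> \bar R}) (f : T -> R) (phi : T -> U) (K : set T).
Hypothesis fi : mu.-integrable setT (EFin \o f).
Hypothesis mphi : measurable_fun setT phi.
Hypothesis mK : measurable K.
Local Open Scope ereal_scope.

(** The sets [A] with zero integral over [phi^-1 A] inside [K] form a Dynkin system, so a generating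
    family closed under intersection suffices. [phi] singles out one coordinate and [K] freezes the
    others, which allows treating the coordinates one by one. *)
Lemma zero_integrals (G : set (set U)) : measurable = <<s G >> -> setI_closed G ->
  \int[mu]_(x in K) (f x)%:E = 0 ->
  (forall A, G A -> \int[mu]_(x in phi @^-1` A `&` K) (f x)%:E = 0) ->
  forall A, measurable A -> \int[mu]_(x in phi @^-1` A `&` K) (f x)%:E = 0.
Proof.
move=> mG IG PT PG A mA.
have mf := measurable_int mu fi.
have mpre B : measurable B -> measurable (phi @^-1` B `&` K).
  by move=> mB; apply: measurableI => //; rewrite -[X in measurable X]setTI; exact: mphi.
apply: (dynkin_induction (G := G) (P := fun A => \int[mu]_(x in phi @^-1` A `&` K) (f x)%:E = 0)) => //.
- by rewrite preimage_setT setTI.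
- move=> S mS PS.
  have KE : K = (phi @^-1` S `&` K) `|` (phi @^-1` (~` S) `&` K).
    by rewrite -setIUl -preimage_setU setUv preimage_setT setTI.
  have := PT; rewrite {1}KE integral_setU//.
  + by rewrite PS add0e.
  + exact: mpre.
  + by apply: mpre; exact: measurableC.
  + exact: measurable_funTS.
  + by apply/disj_setPS => x [[/= h _] [/= h' _]].
- move=> F mF tF PF; rewrite preimage_bigcup setI_bigcupl integral_bigcup//.
  + by apply: eseries0 => n _ _; exact: PF.
  + by move=> i j _ _ [x [[/= Fi _] [/= Fj _]]]; apply: tF => //; exists (phi x).
  + by move=> k; exact: mpre.
  + by apply: (integrableS measurableT) => //; apply: bigcup_measurable => k _; exact: mpre.
- by rewrite -mG.
Qed.

End ZeroIntegrals.

Section ZeroAe.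
Context d (T : measurableType d) {R : realType}.
Variables (mu : {measure set T -> \bar R}) (f : T -> R).
Hypothesis fi : mu.-integrable setT (EFin \o f).

Lemma zero_ae : (forall A, measurable A -> \int[mu]_(x in A) (f x)%:E = 0)%E -> {ae mu, forall x, f x = 0}.
Proof.
move=> h; have : ae_eq mu setT (EFin \o f) (cst 0%E).
  apply: integral_ae_eq => // A _ mA; rewrite integral0; exact: h.
by apply: filterS => x /(_ I) /= [].
Qed.
End ZeroAe.

#[global] Instance mu3_ae_filter {R : realType} : Filter (almost_everywhere (@mu3 R)).
Proof. exact: ae_filter_ringOfSetsType. Qed.

#[global] Instance leb_ae_filter {R : realType} : Filter (almost_everywhere (@lebesgue_measure R)).
Proof. exact: ae_filter_ringOfSetsType. Qed.

Section HalfLine.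
Context {R : realType}.
Local Notation leb := (@lebesgue_measure R).
Local Notation mR := (measurableTypeR R).
Local Notation pt := (@pt R).
Local Notation mu3 := (@mu3 R).
Local Notation int3 f := (mu3.-integrable setT (EFin \o f)).
Local Notation Int3 := (Rintegral mu3 setT).

Definition pos : set R := `]0, +oo[%classic.
Local Notation ip f := (leb.-integrable pos (EFin \o f)).
Local Notation Ip f := (Rintegral leb pos f).

(** * Calculus on the open half-line *)

Section Half.
Implicit Types (f g F : R -> R) (a b r s t e k N : R).

Lemma posE r : pos r = (0 < r) :> Prop.
Proof. by rewrite /pos /= in_itv /= andbT. Qed.

Lemma pos_gt0 r : pos r -> 0 < r.
Proof. by rewrite posE. Qed.

Lemma mpos : @measurable _ mR pos.
Proof. exact: measurable_itv. Qed.
#[local] Hint Resolve mpos : core.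

(** The derivative is a relation restricted to positive points: profiles carry no information at 0
    or below, and a formula for [f] can be chosen freely. *)
Definition D1 F f := forall r, 0 < r -> is_derive r 1 F (f r).
Definition cpos f := forall r, 0 < r -> f x @[x --> r] --> f r.

Lemma D1_cpos F f : D1 F f -> cpos F.
Proof.
move=> h r r0; have := h r r0 => /@ex_derive; move/derivable1_diffP/differentiable_continuous; exact.
Qed.

Lemma cpos_meas f : cpos f -> measurable_fun pos f.
Proof.
move=> cf; apply: open_continuous_measurable_fun; first exact: interval_open.
by move=> r /set_mem; rewrite posE; exact: cf.
Qed.

Lemma cpos_within f a b : cpos f -> 0 < a -> {within `[a, b], continuous f}.
Proof.
move=> cf a0; apply: continuous_in_subspaceT => x /set_mem /=.
by rewrite in_itv /= => /andP[ax _]; apply: cf; exact: lt_le_trans ax.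
Qed.

Lemma cpos_ig_seg f a b : cpos f -> 0 < a -> leb.-integrable `[a, b] (EFin \o f).
Proof.
by move=> cf a0; apply: continuous_compact_integrable;
  [exact: segment_compact|exact: cpos_within].
Qed.

Lemma cpos_igS f a b (D : set R) : cpos f -> 0 < a -> @measurable _ mR D ->
  D `<=` `[a, b] -> leb.-integrable D (EFin \o f).
Proof.
move=> cf a0 mD Dab; apply: (integrableS _ mD Dab (cpos_ig_seg b cf a0)).
exact: measurable_itv.
Qed.

Lemma FTC2 F f a b : D1 F f -> cpos f -> 0 < a -> a <= b ->
  \int[leb]_(x in `[a, b]) f x = F b - F a.
Proof.
move=> dF cf a0; rewrite le_eqVlt => /predU1P[<-|ab].
  by rewrite set_itv1 Rintegral_set1 subrr.
rewrite /Rintegral (@continuous_FTC2 _ _ F)//.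
- exact: cpos_within.
- have cF := D1_cpos dF; split.
  + move=> x; rewrite in_itv /= => /andP[ax _].
    by have := dF x (lt_trans a0 ax) => /@ex_derive.
  + by apply: cvg_at_right_filter; exact: cF.
  + by apply: cvg_at_left_filter; apply: cF; exact: lt_trans ab.
- move=> x; rewrite in_itv /= => /andP[ax _].
  by rewrite derive1E; have := dF x (lt_trans a0 ax) => /@derive_val.
Qed.

Lemma seg_pos a b : 0 < a -> `[a, b]%classic `<=` pos.
Proof.
by move=> a0 x /=; rewrite in_itv /= posE => /andP[ax _]; exact: lt_le_trans ax.
Qed.

Lemma oseg_pos r : `]0, r]%classic `<=` pos.
Proof. by move=> x /=; rewrite in_itv /= posE => /andP[]. Qed.

(** On [[1/(n+1), n+1]] the integral of [f] is a difference of two values of [F], hence at most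
    [M + M]; Fatou passes to the whole half-line. *)
Lemma ip_bounded_prim F f (M : R) : D1 F f -> cpos f -> (forall r, 0 < r -> 0 <= f r) ->
  (forall r, 0 < r -> `|F r| <= M) -> ip f.
Proof.
move=> dF cf f0 FM.
pose E n : set R := `[n.+1%:R^-1, n.+1%:R]%classic.
have Ep n : E n `<=` pos by apply: seg_pos; rewrite invr_gt0 ltr0n.
have h : (forall x, pos x -> (f \_ (E n)) x @[n --> \oo] --> f x).
  move=> x; rewrite posE => x0; apply: cvg_near_cst.
  near=> n; rewrite patchE mem_set// /E /= in_itv /=; apply/andP; split.
    rewrite -[leRHS]invrK lef_pV2 ?posrE ?invr_gt0 ?ltr0n//.
    by apply: le_trans (_ : n%:R <= _); [near: n; exact: nbhs_infty_ger|rewrite ler_nat].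
  by apply: le_trans (_ : n%:R <= _); [near: n; exact: nbhs_infty_ger|rewrite ler_nat].
suff [] : ip f /\ Ip f <= M + M by [].
apply: (@Rfatou _ _ _ leb pos mpos (fun n => f \_ (E n)) f (M + M) _ _ h _).
- move=> n; apply: ig_restr => //; first exact: measurable_itv.
  by apply: cpos_ig_seg => //; rewrite invr_gt0 ltr0n.
- move=> n x; rewrite posE => x0; rewrite /patch; case: ifP => // _; exact: f0.
- move=> n; rewrite -Rint_restr//; last exact: measurable_itv.
  have n1 : (1 : R) <= n.+1%:R by rewrite ler1n.
  have nn : n.+1%:R^-1 <= n.+1%:R :> R.
    by apply: le_trans n1; rewrite invf_le1 ?ltr0n// ler1n.
  rewrite /E (FTC2 dF cf _ nn)//.
  apply: le_trans (ler_norm _) _; apply: le_trans (ler_normB _ _) _.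
  by rewrite lerD// FM// ?invr_gt0 ltr0n.
Unshelve. all: by end_near. Qed.

Definition prim f r : R := \int[leb]_(t in `]0, r]) f t.

Lemma prim_restr f r : prim f r = Ip (f \_ `]0, r]).
Proof. by rewrite /prim -Rint_restr//; exact: oseg_pos. Qed.

Lemma ip_oseg f r : ip f -> leb.-integrable `]0, r] (EFin \o f).
Proof. by move=> fi; apply: (igS mpos _ _ fi) => //; exact: oseg_pos. Qed.

Lemma ig_oseg_cst k r : leb.-integrable `]0, r] (EFin \o (fun=> k)).
Proof.
apply: measurable_bounded_integrable.
- exact: measurable_itv.
- apply: (@le_lt_trans _ _ (@lebesgue_measure R [set` `]0, r]])) => //.
  by rewrite lebesgue_measure_itv /=; case: ifP => // _; rewrite -EFinD ltry.
- exact: measurable_cst.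
- by exists `|k|; split => [|M kM x _ /=]; [exact: num_real|exact: ltW].
Qed.

Lemma prim_D1 f : cpos f -> ip f -> D1 (prim f) f.
Proof.
move=> cf fi r r0.
have rr : r < r + 1 by rewrite ltrDl.
have br : (BRight 0 < BRight r :> itv_bound R)%O by rewrite bnd_simp.
have [dF F'] := @continuous_FTC1 R f (BRight 0) r (r + 1) rr (ip_oseg _ fi) br (cf r r0).
by apply: (@DeriveDef _ _ _ _ _ _ _ dF); rewrite -derive1E.
Qed.

Lemma prim_ge0 f r : (forall t, 0 < t -> 0 <= f t) -> 0 <= prim f r.
Proof. by move=> f0; apply: Rintegral_ge0 => x /oseg_pos; rewrite posE; exact: f0. Qed.

Lemma prim_cvgy f : ip f -> prim f r @[r --> +oo] --> Ip f.
Proof.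
move=> fi; apply/cvg_pinftyP => u uy; rewrite (_ : (fun n => prim f (u n)) = fun n => Ip (f \_ `]0, u n])); last first.
  by apply/funext => n; rewrite prim_restr.
suff [] : ip f /\ Ip (f \_ `]0, u n]) @[n --> \oo] --> Ip f by [].
apply: (@DCT _ _ _ leb pos mpos (fun n => f \_ `]0, u n]) f (fun x => `|f x|) _ (igabs mpos fi) _ _).
- move=> n; apply: meas_restr => //; exact: ig_meas fi.
- by move=> n x _; rewrite patchE; case: ifP => // _; rewrite normr0.
- move=> x; rewrite posE => x0; apply: cvg_near_cst; near=> n.
  rewrite patchE mem_set//= in_itv /= x0 /=.
  by near: n; move/cvgryPge : uy; exact.
Unshelve. all: by end_near. Qed.

Lemma prim_cvg0 f : ip f -> prim f r @[r --> 0^'+] --> 0.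
Proof.
move=> fi; apply/cvg_at_rightP => u [u0 uu]; rewrite (_ : (fun n => prim f (u n)) = fun n => Ip (f \_ `]0, u n])); last first.
  by apply/funext => n; rewrite prim_restr.
suff [] : ip (fun=> 0) /\ Ip (f \_ `]0, u n]) @[n --> \oo] --> Ip (fun=> 0).
  by rewrite Rint_cst0.
apply: (@DCT _ _ _ leb pos mpos (fun n => f \_ `]0, u n]) (fun=> 0) (fun x => `|f x|) _ (igabs mpos fi) _ _).
- move=> n; apply: meas_restr => //; exact: ig_meas fi.
- by move=> n x _; rewrite patchE; case: ifP => // _; rewrite normr0.
- move=> x; rewrite posE => x0; apply: cvg_near_cst; near=> n.
  rewrite patchE memNset//= in_itv /= x0 /=; apply/negP; rewrite -ltNge.
  by near: n; apply: (cvgr_lt 0) => //.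
Unshelve. all: by end_near. Qed.

Lemma prim_seg f a b : cpos f -> ip f -> 0 < a -> a <= b ->
  \int[leb]_(x in `[a, b]) f x = prim f b - prim f a.
Proof. by move=> cf fi a0 ab; apply: FTC2 => //; exact: prim_D1. Qed.

Lemma FTC_prim F f a b : D1 F f -> cpos f -> ip f -> 0 < a -> 0 < b ->
  F b - F a = prim f b - prim f a.
Proof.
move=> dF cf fi a0 b0; have [ab|/ltW ba] := leP a b.
  by rewrite -prim_seg// (FTC2 dF).
apply: oppr_inj; rewrite !opprB.
by rewrite -prim_seg// (FTC2 dF).
Qed.

Lemma prim_le_Ip f r : ip f -> (forall t, 0 < t -> 0 <= f t) -> prim f r <= Ip f.
Proof.
move=> fi f0; rewrite prim_restr; apply: le_Rint => //.
- by apply: ig_restr => //; [exact: oseg_pos|exact: ip_oseg].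
- move=> x; rewrite posE => x0; rewrite /patch; case: ifP => // _; exact: f0.
Qed.

Lemma seg_le_Ip f a b : cpos f -> ip f -> (forall t, 0 < t -> 0 <= f t) -> 0 < a ->
  \int[leb]_(x in `[a, b]) f x <= Ip f.
Proof.
move=> cf fi f0 a0; rewrite (@Rint_restr _ _ _ leb pos f `[a, b])//; last exact: seg_pos.
apply: le_Rint => //.
- by apply: ig_restr => //; [exact: (seg_pos a0)|exact: cpos_ig_seg].
- by move=> x /pos_gt0 x0; rewrite /patch; case: ifP => // _; exact: f0.
Qed.

Lemma prim_mono f a b : cpos f -> ip f -> (forall t, 0 < t -> 0 <= f t) ->
  0 < a -> a <= b -> prim f a <= prim f b.
Proof.
move=> cf fi f0 a0 ab; rewrite -subr_ge0 -prim_seg//; apply: Rintegral_ge0 => x /(seg_pos a0).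
by rewrite posE; exact: f0.
Qed.

(** Limits of [F] are asked only along one sequence at each end, since integrability of an energy
    density supplies good points but no full limit. Convergence of [prim f] at both ends does the
    rest. *)
Lemma FTC_lim F f (l0 l1 : R) (u w : nat -> R) : D1 F f -> cpos f -> ip f ->
  (forall n, 0 < u n) -> u n @[n --> \oo] --> 0 -> F (u n) @[n --> \oo] --> l0 ->
  (forall n, 0 < w n) -> w n @[n --> \oo] --> +oo -> F (w n) @[n --> \oo] --> l1 ->
  Ip f = l1 - l0.
Proof.
move=> dF cf fi u0 uu Fu w0 wy Fw.
have h1 : F (w n) - F (u n) @[n --> \oo] --> l1 - l0 by apply: cvgB.
have h2 : prim f (w n) - prim f (u n) @[n --> \oo] --> Ip f - 0.
  apply: cvgB; first by move/cvg_pinftyP : (prim_cvgy fi); exact.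
  by move/cvg_at_rightP : (prim_cvg0 fi); apply.
rewrite subr0 in h2; apply: (cvg_unique _ h2); first exact: Rhausdorff.
have -> : (fun n => prim f (w n) - prim f (u n)) = (fun n => F (w n) - F (u n)).
  by apply/funext => n; rewrite (FTC_prim dF cf fi (u0 n) (w0 n)).
exact: h1.
Qed.

Lemma cpos_cst (k : R) : cpos (fun=> k).
Proof. by move=> r _; exact: cvg_cst. Qed.
Lemma cpos_id : cpos id.
Proof. by move=> r _; exact: cvg_id. Qed.
Lemma cposD f g : cpos f -> cpos g -> cpos (fun r => f r + g r).
Proof. by move=> cf cg r r0; apply: cvgD; [exact: cf|exact: cg]. Qed.
Lemma cposN f : cpos f -> cpos (fun r => - f r).
Proof. by move=> cf r r0; apply: cvgN; exact: cf. Qed.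
Lemma cposB f g : cpos f -> cpos g -> cpos (fun r => f r - g r).
Proof. by move=> cf cg r r0; apply: cvgB; [exact: cf|exact: cg]. Qed.
Lemma cposM f g : cpos f -> cpos g -> cpos (fun r => f r * g r).
Proof. by move=> cf cg r r0; apply: cvgM; [exact: cf|exact: cg]. Qed.
Lemma cposX f n : cpos f -> cpos (fun r => f r ^+ n).
Proof. by move=> cf r r0; elim: n => [|n IH]; [exact: cvg_cst|under eq_fun do rewrite exprS; rewrite exprS; apply: cvgM => //; exact: cf]. Qed.
Lemma cpos_comp (h : R -> R) f : continuous h -> cpos f -> cpos (fun r => h (f r)).
Proof. by move=> ch cf r r0; apply: (cvg_comp _ _ (cf r r0)); exact: ch. Qed.
Lemma cpos_abs f : cpos f -> cpos (fun r => `|f r|).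
Proof. by move=> cf r r0; apply: cvg_norm; exact: cf. Qed.
Lemma cposV f : (forall r, 0 < r -> f r != 0) -> cpos f -> cpos (fun r => (f r)^-1).
Proof. by move=> f0 cf r r0; apply: cvgV; [exact: f0|exact: cf]. Qed.
Lemma cpos_scale f t : 0 < t -> cpos f -> cpos (fun r => f (t * r)).
Proof.
move=> t0 cf r r0; apply: (@cvg_comp _ _ _ (fun r => t * r) f _ (nbhs (t * r))).
  by apply: cvgM; [exact: cvg_cst|exact: cvg_id].
by apply: cf; exact: mulr_gt0.
Qed.

Lemma cpos_sqrt f : cpos f -> cpos (fun r => Num.sqrt (f r)).
Proof. by apply: cpos_comp; exact: sqrt_continuous. Qed.

Lemma D1_scale F f t : 0 < t -> D1 F f -> D1 (fun r => F (t * r)) (fun r => t * f (t * r)).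
Proof.
move=> t0 dF r r0.
have h : is_derive r 1 (fun r => t * r) t.
  have := is_deriveZ t (@is_derive_id R R r 1); rewrite /GRing.scale /= mulr1; exact.
have := @is_derive1_comp R F (fun r => t * r) r (f (t * r)) t (dF _ (mulr_gt0 t0 r0)) h.
by rewrite mulrC.
Qed.

Lemma D1Z F f k : D1 F f -> D1 (fun r => k * F r) (fun r => k * f r).
Proof. by move=> dF r r0; exact: (is_deriveZ _ (dF r r0)). Qed.
Lemma D1D F f G g : D1 F f -> D1 G g -> D1 (fun r => F r + G r) (fun r => f r + g r).
Proof. by move=> dF dG r r0; exact: (is_deriveD (dF r r0) (dG r r0)). Qed.
Lemma D1B F f G g : D1 F f -> D1 G g -> D1 (fun r => F r - G r) (fun r => f r - g r).
Proof. by move=> dF dG r r0; exact: (is_deriveB (dF r r0) (dG r r0)). Qed.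
Lemma D1N F f : D1 F f -> D1 (fun r => - F r) (fun r => - f r).
Proof. by move=> dF r r0; exact: (is_deriveN (dF r r0)). Qed.
Lemma D1M F f G g : D1 F f -> D1 G g ->
  D1 (fun r => F r * G r) (fun r => f r * G r + F r * g r).
Proof.
move=> dF dG r r0; have := is_deriveM (dF r r0) (dG r r0).
by rewrite /GRing.scale /= => h; apply: is_derive_eq h _; ring.
Qed.
Lemma D1_cst k : D1 (fun=> k) (fun=> 0).
Proof. by move=> r r0; exact: is_derive_cst. Qed.
Lemma D1_id : D1 id (fun=> 1).
Proof. by move=> r r0; exact: is_derive_id. Qed.
Lemma D1_ext F G f g : (forall r, 0 < r -> F r = G r) -> (forall r, 0 < r -> f r = g r) ->
  D1 F f -> D1 G g.
Proof.
move=> FG fg dF r r0; rewrite -fg//.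
apply: (near_eq_is_derive _ (dF r r0)).
by near=> x; rewrite FG//; near: x; exact: lt_nbhsr.
Unshelve. all: by end_near. Qed.
Lemma D1X F f n : D1 F f -> D1 (fun r => F r ^+ n.+1) (fun r => n.+1%:R * F r ^+ n * f r).
Proof.
move=> dF; elim: n => [|n IH].
  by apply: D1_ext dF => r _; [rewrite expr1|rewrite expr0 !mul1r].
apply: D1_ext (D1M dF IH) => r _; first by rewrite -exprS.
by rewrite -[n.+2%:R]natr1 exprS; ring.
Qed.
Lemma D1V F f : (forall r, 0 < r -> F r != 0) -> D1 F f ->
  D1 (fun r => (F r)^-1) (fun r => - f r / F r ^+ 2).
Proof.
move=> F0 dF r r0; have := is_deriveV (F0 r r0) (dF r r0).
have -> : - F r ^- 2 *: f r = - f r / F r ^+ 2 by rewrite /GRing.scale /= !mulNr mulrC.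
exact.
Qed.
Lemma D1_comp (h h' : R -> R) F f : (forall r, 0 < r -> is_derive (F r) 1 h (h' (F r))) ->
  D1 F f -> D1 (fun r => h (F r)) (fun r => h' (F r) * f r).
Proof.
move=> dh dF r r0.
by have := @is_derive1_comp R h F r (h' (F r)) (f r) (dh r r0) (dF r r0).
Qed.
Lemma D1_ln : D1 (@ln R) (fun r => r^-1).
Proof. by move=> r r0; exact: is_derive1_ln. Qed.
Lemma D1_sqrt F f : (forall r, 0 < r -> 0 < F r) -> D1 F f ->
  D1 (fun r => Num.sqrt (F r)) (fun r => f r / (2 * Num.sqrt (F r))).
Proof.
move=> F0 dF.
have := @D1_comp Num.sqrt (fun r => (2 * Num.sqrt r)^-1) F f _ dF.
move=> H; apply: D1_ext (H _) => // [r _|r r0]; first by rewrite mulrC.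
exact: is_derive1_sqrt (F0 r r0).
Qed.
Lemma D1_powR a : D1 (fun r => r `^ a) (fun r => a * r `^ (a - 1)).
Proof. by move=> r r0; exact: is_derive1_powR. Qed.

(** Change of variables through primitives: [t^-1 * prim g (t * r)] is a primitive of [g (t * r)].
    Its boundedness, for [g = |f|], gives integrability, and its limits at both ends give the
    value. *)
Lemma ip_scale f t : cpos f -> ip f -> 0 < t ->
  ip (fun r => f (t * r)) /\ Ip (fun r => f (t * r)) = t^-1 * Ip f.
Proof.
move=> cf fi t0.
have cft := cpos_scale t0 cf.
have dp g : cpos g -> ip g ->
    D1 (fun r => t^-1 * prim g (t * r)) (fun r => g (t * r)).
  move=> cg gi; apply: D1_ext (D1Z t^-1 (D1_scale t0 (prim_D1 cg gi))) => // r r0.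
  by rewrite mulrA mulVf ?mul1r// gt_eqF.
have afi := igabs mpos fi; have caf := cpos_abs cf.
have fti : ip (fun r => f (t * r)).
  apply: (ig_dom mpos (g := fun r => `|f (t * r)|)) => //; first exact: cpos_meas.
  apply: (ip_bounded_prim (M := t^-1 * Ip (fun x => `|f x|)) (dp _ caf afi)) => //.
    exact: (cpos_scale t0 caf).
  move=> r r0; rewrite normrM gtr0_norm ?invr_gt0// ler_pM2l ?invr_gt0//.
  rewrite ger0_norm; first by apply: prim_le_Ip.
  by apply: prim_ge0.
split => //.
pose u n : R := n.+1%:R^-1; pose w n : R := n.+1%:R.
have wy : w n @[n --> \oo] --> +oo by apply/cvgryPge => A; near=> n; rewrite /w;
  apply: le_trans (_ : n%:R <= _); [near: n; exact: nbhs_infty_ger|rewrite ler_nat].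
have uu : u n @[n --> \oo] --> 0 by exact: cvg_harmonic.
rewrite (FTC_lim (u := u) (w := w) (l0 := t^-1 * 0) (l1 := t^-1 * Ip f) (dp _ cf fi) cft fti) //.
- by rewrite mulr0 subr0.
- by move=> n; rewrite invr_gt0 ltr0n.
- apply: cvgM; first exact: cvg_cst.
  move/cvg_at_rightP : (prim_cvg0 fi); apply; split.
    by move=> n; rewrite mulr_gt0// invr_gt0 ltr0n.
  by rewrite -[X in _ --> X](mulr0 t); apply: cvgM => //; exact: cvg_cst.
- apply: cvgM; first exact: cvg_cst.
  move/cvg_pinftyP : (prim_cvgy fi); apply.
  apply/cvgryPge => A; near=> n; rewrite mulrC -ler_pdivrMr//.
  by near: n; move/cvgryPge : wy; exact.
Unshelve. all: by end_near. Qed.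

(** Otherwise [f r >= e / r] beyond [N], which contradicts integrability by the divergence of the
    logarithm. *)
Lemma ip_small_y f e N : cpos f -> ip f -> (forall r, 0 < r -> 0 <= f r) -> 0 < e -> 0 < N ->
  exists2 r, N < r & r * f r < e.
Proof.
move=> cf fi f0 e0 N0; apply: contrapT => /forall2NP h.
have {}h r : N < r -> e / r <= f r.
  move=> Nr; have r0 := lt_trans N0 Nr.
  by have [//|/negP] := h r; rewrite -leNgt ler_pdivrMr// mulrC.
(* Chosen so that [e * (ln b - ln N)] equals [Ip f + 1]. *)
pose b := N * expR ((Ip f + 1) / e).
have Ipf0 : 0 <= Ip f by apply: Rintegral_ge0 => x; rewrite posE; exact: f0.
have Nb : N <= b.
  rewrite /b ler_peMr ?(ltW N0)// -[leLHS]expR0 ler_expR divr_ge0 ?(ltW e0)// addr_ge0//.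
have cg : cpos (fun r => e / r).
  by apply: cposM; [exact: cpos_cst|apply: cposV; [move=> r /gt_eqF ->|exact: cpos_id]].
have : e * ln b - e * ln N <= Ip f.
  rewrite -(FTC2 (D1Z e D1_ln) cg N0 Nb).
  apply: le_trans (_ : _ <= \int[leb]_(x in `]N, b]) f x) _.
    rewrite -Rintegral_itv_obnd_cbnd; last first.
      by apply: (cpos_igS cg N0) => //; exact: subset_itv_oc_cc.
    apply: le_Rint => //.
    + by apply: (cpos_igS cg N0) => //; exact: subset_itv_oc_cc.
    + by apply: (cpos_igS cf N0) => //; exact: subset_itv_oc_cc.
    + by move=> x /=; rewrite in_itv /= => /andP[Nx _]; exact: h.
  rewrite Rintegral_itv_obnd_cbnd; last first.
    by apply: (cpos_igS cf N0) => //; exact: subset_itv_oc_cc.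
  rewrite prim_seg//; apply: le_trans (prim_le_Ip b fi f0).
  by rewrite lerBlDr lerDl prim_ge0.
rewrite /b lnM ?posrE ?expR_gt0// expRK mulrDr addrAC subrr add0r mulrCA mulfV ?gt_eqF// mulr1.
by rewrite -subr_ge0 opprD addrA subrr add0r oppr_ge0 ler10.
Qed.

Lemma ip_small_0 f e N : cpos f -> ip f -> (forall r, 0 < r -> 0 <= f r) -> 0 < e -> 0 < N ->
  exists2 r, 0 < r < N & r * f r < e.
Proof.
move=> cf fi f0 e0 N0; apply: contrapT => /forall2NP h.
have {}h r : 0 < r -> r < N -> e / r <= f r.
  move=> r0 rN.
  have [/negP|/negP] := h r; first by rewrite r0 rN.
  by rewrite -leNgt ler_pdivrMr// mulrC.
pose a := N * expR (- ((Ip f + 1) / e)).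
have Ipf0 : 0 <= Ip f by apply: Rintegral_ge0 => x; rewrite posE; exact: f0.
have aN : a <= N.
  by rewrite /a ler_piMr ?(ltW N0)// -[leRHS]expR0 ler_expR oppr_le0 divr_ge0 ?(ltW e0)// addr_ge0.
have a0 : 0 < a by rewrite mulr_gt0// expR_gt0.
have cg : cpos (fun r => e / r).
  by apply: cposM; [exact: cpos_cst|apply: cposV; [move=> r /gt_eqF ->|exact: cpos_id]].
have : e * ln N - e * ln a <= Ip f.
  rewrite -(FTC2 (D1Z e D1_ln) cg a0 aN).
  apply: le_trans (_ : _ <= \int[leb]_(x in `[a, N[) f x) _.
    rewrite -Rintegral_itv_bndo_bndc; last first.
      by apply: (cpos_igS cg a0) => //; exact: subset_itv_co_cc.
    apply: le_Rint => //.
    + by apply: (cpos_igS cg a0) => //; exact: subset_itv_co_cc.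
    + by apply: (cpos_igS cf a0) => //; exact: subset_itv_co_cc.
    + by move=> x /=; rewrite in_itv /= => /andP[ax xN]; apply: h => //; exact: lt_le_trans ax.
  rewrite Rintegral_itv_bndo_bndc; last first.
    by apply: (cpos_igS cf a0) => //; exact: subset_itv_co_cc.
  rewrite prim_seg//; apply: le_trans (prim_le_Ip N fi f0).
  by rewrite lerBlDr lerDl prim_ge0.
rewrite /a lnM ?posrE ?expR_gt0// expRK mulrDr opprD addrA subrr add0r mulrN opprK mulrCA mulfV ?gt_eqF// mulr1.
by rewrite -subr_ge0 opprD addrA subrr add0r oppr_ge0 ler10.
Qed.

Lemma ip_seq_y f : cpos f -> ip f -> (forall r, 0 < r -> 0 <= f r) ->
  exists w : nat -> R, [/\ (forall n, 0 < w n), w n @[n --> \oo] --> +oo &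
    w n * f (w n) @[n --> \oo] --> 0].
Proof.
move=> cf fi f0.
have /choice[w hw] : forall n : nat, exists r, n.+1%:R < r /\ r * f r < n.+1%:R^-1.
  move=> n; have [||r h1 h2] := @ip_small_y f n.+1%:R^-1 n.+1%:R cf fi f0.
  - by rewrite invr_gt0 ltr0n.
  - by rewrite ltr0n.
  by exists r.
have w0 n : 0 < w n by apply: lt_trans (hw n).1; rewrite ltr0n.
exists w; split => //.
  apply/cvgryPge => A; near=> n; apply: le_trans (ltW (hw n).1).
  by apply: le_trans (_ : n%:R <= _); [near: n; exact: nbhs_infty_ger|rewrite ler_nat].
apply: (@squeeze_cvgr _ _ _ _ (fun=> 0) (fun n => n.+1%:R^-1)).
- by apply: nearW => n; rewrite mulr_ge0 ?f0 ?ltW//= (hw n).2.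
- exact: cvg_cst.
- exact: cvg_harmonic.
Unshelve. all: by end_near. Qed.

(* Integrable with total mass [1/e]: behaves like [r^(e-1)] at 0 and [r^(-1-e)] at infinity. *)
Definition wgt (e r : R) : R := r `^ (e - 1) / (1 + r `^ e) ^+ 2.

Lemma wgt_ge0 e r : 0 <= wgt e r.
Proof. by rewrite /wgt divr_ge0 ?powR_ge0 ?sqr_ge0. Qed.

Lemma cpos_powR a : cpos (fun r => r `^ a).
Proof. exact: D1_cpos (D1_powR a). Qed.

Lemma powR1D_gt0 e r : 0 < 1 + r `^ e.
Proof. by rewrite ltr_wpDr ?powR_ge0. Qed.

Lemma wgt_cpos e : cpos (wgt e).
Proof.
apply: cposM; first exact: cpos_powR.
apply: cposV; first by move=> r _; rewrite expf_neq0// gt_eqF// powR1D_gt0.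
by apply: cposX; apply: cposD; [exact: cpos_cst|exact: cpos_powR].
Qed.

Lemma ip_wgt e : 0 < e -> ip (wgt e).
Proof.
move=> e0; apply: (ip_bounded_prim (F := fun r => - e^-1 * (1 + r `^ e)^-1) (M := e^-1)).
- apply: D1_ext (D1Z (- e^-1) (D1V _ (D1D (D1_cst 1) (D1_powR e)))) => //; last first.
    by move=> r _; rewrite gt_eqF// powR1D_gt0.
  move=> r r0; rewrite /wgt add0r mulNr mulNr mulrN opprK mulrA mulrA mulVf ?mul1r// gt_eqF//.
- exact: wgt_cpos.
- by move=> r _; exact: wgt_ge0.
- move=> r r0; rewrite normrM normrN !ger0_norm ?invr_ge0 ?(ltW e0) ?(ltW (powR1D_gt0 _ _))//.
  by rewrite ler_piMr ?invr_ge0 ?(ltW e0)// invf_le1 ?powR1D_gt0// lerDl powR_ge0.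
Qed.

Lemma wgt_lb0 e r : 0 < e -> 0 < r -> r <= 1 -> r `^ (e - 1) <= 4 * wgt e r.
Proof.
move=> e0 r0 r1; rewrite /wgt mulrCA ler_peMr ?powR_ge0//.
rewrite ler_pdivlMr ?exprn_gt0 ?powR1D_gt0// mul1r.
have h : r `^ e <= 1.
  have <- : 1 `^ e = 1 :> R by rewrite powR1.
  by apply: ge0_ler_powR; rewrite ?nnegrE ?(ltW e0) ?(ltW r0).
have : 0 <= r `^ e by exact: powR_ge0.
by nra.
Qed.

Lemma wgt_lby e r : 0 < e -> 1 <= r -> r `^ (- e - 1) <= 4 * wgt e r.
Proof.
move=> e0 r1; have r0 : 0 < r by exact: lt_le_trans r1.
rewrite /wgt mulrCA mulrA ler_pdivlMr ?exprn_gt0 ?powR1D_gt0//.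
have -> : e - 1 = (- e - 1) + (e + e) by ring.
rewrite [X in _ <= X * _]powRD; last by rewrite (gt_eqF r0) implybT.
rewrite [r `^ (e + e)]powRD; last by rewrite (gt_eqF r0) implybT.
rewrite -mulrA ler_pM2l ?powR_gt0//.
have h : 1 <= r `^ e by rewrite -(powRr0 r); apply: ler_powR => //; exact: ltW.
by nra.
Qed.

End Half.
#[local] Hint Resolve mpos : core.

(** * Supporting lines of the scalar functions in the reduced energy *)

Section Concave.
Implicit Types (a b m r s t x y : R).

Lemma cuberoot3 y : 0 <= y -> (y `^ 3^-1) ^+ 3 = y.
Proof.
by move=> y0; rewrite -powR_mulrn ?powR_ge0// -powRrM mulVf ?pnatr_eq0// powRr1.
Qed.

(** With [z] and [w] the cube roots of [x] and [b], the gap below the tangent line is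
    [(z - w)^2 (z + 2 w) / (3 w^2)], positive unless [x = b]. *)
Lemma cuberoot_tangent b x : 0 < b -> 0 < x ->
  x `^ 3^-1 + (b `^ 3^-1 / (3 * b)) * (b - x) <= b `^ 3^-1 /\
  (x != b -> x `^ 3^-1 + (b `^ 3^-1 / (3 * b)) * (b - x) < b `^ 3^-1).
Proof.
move=> b0 x0.
have hx := cuberoot3 (ltW x0); have hb := cuberoot3 (ltW b0).
have zx : 0 < x `^ 3^-1 by exact: powR_gt0.
have zb : 0 < b `^ 3^-1 by exact: powR_gt0.
move: hx hb zx zb; set z := x `^ _; set w := b `^ _ => hx hb zx zb.
have E : w - (z + w / (3 * b) * (b - x)) = (z - w) ^+ 2 * (z + 2 * w) / (3 * w ^+ 2).
  rewrite -hx -hb; field.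
  by rewrite gt_eqF.
have P0 : 0 < (z + 2 * w) / (3 * w ^+ 2) by rewrite divr_gt0 ?mulr_gt0 ?addr_gt0 ?exprn_gt0 ?mulr_gt0.
split.
  by rewrite -subr_ge0 E -mulrA mulr_ge0 ?sqr_ge0 ?ltW.
move=> xb; rewrite -subr_gt0 E -mulrA mulr_gt0// exprn_even_gt0//= subr_eq0.
by apply: contra_neq xb => zw; rewrite -hx -hb zw.
Qed.

(** Young's inequality for the product of [y] and 1, with the exponent [q] and its conjugate. *)
Lemma bernoulli q y : 1 < q -> 0 <= y -> 1 + q * (y - 1) <= y `^ q.
Proof.
move=> q1 y0.
have q0 : 0 < q by exact: lt_trans q1.
have q'0 : 0 < 1 - q^-1 by rewrite subr_gt0 invf_lt1.
have := @conjugate_powR R y 1 q (1 - q^-1)^-1 y0 ler01 q0.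
rewrite invr_gt0 invrK => /(_ q'0); rewrite addrCA subrr addr0 => /(_ erefl).
have -> : 1 `^ (1 - q^-1)^-1 = 1 :> R by rewrite powR1.
rewrite mulr1 mul1r => h.
have : q * y <= q * (y `^ q / q + (1 - q^-1)) by rewrite ler_pM2l.
rewrite mulrDr mulrCA mulfV ?gt_eqF// mulr1 mulrBr mulr1 mulfV ?gt_eqF//.
by lra.
Qed.

Lemma powabs_continuous (e : R) : 0 < e -> continuous (fun x : R => `|x| `^ e).
Proof.
move=> e0 x; have [->|x0] := eqVneq x 0.
  rewrite /continuous_at normr0 powR0 ?gt_eqF//; apply/cvgrPdist_lt => d d0.
  have d1 : 0 < d `^ e^-1 by exact: powR_gt0.
  have dE : d = (d `^ e^-1) `^ e by rewrite -powRrM mulVf ?gt_eqF// powRr1 ?ltW.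
  have : \forall y \near (0 : R), `|y| < d `^ e^-1 by exact: nbhs0_lt.
  apply: filterS => y yd; rewrite sub0r normrN ger0_norm ?powR_ge0// [ltRHS]dE.
  by rewrite gt0_ltr_powR ?nnegrE ?powR_ge0.
apply: (@cvg_comp _ _ _ (fun x : R => `|x|) (fun y => y `^ e) _ (nbhs `|x|)).
  exact: norm_continuous.
by have := @is_derive1_powR R e `|x|; rewrite normr_gt0 => /(_ x0) /@ex_derive /derivable1_diffP /differentiable_continuous.
Qed.

Lemma powR_tangent q b x : 1 < q -> 0 < b -> 0 < x ->
  b `^ q + q * (b `^ q / b) * (x - b) <= x `^ q.
Proof.
move=> q1 b0 x0.
have := @bernoulli q (x / b) q1 (divr_ge0 (ltW x0) (ltW b0)).
have -> : x `^ q = b `^ q * (x / b) `^ q.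
  by rewrite -powRM ?divr_ge0 ?ltW// mulrCA mulfV ?gt_eqF// mulr1.
rewrite -(ler_pM2l (powR_gt0 q b0)) => /(le_trans _); apply.
by rewrite le_eqVlt; apply/orP; left; apply/eqP; field; rewrite gt_eqF.
Qed.

Definition nlin (p x : R) : R := `|x| `^ (p - 1) * x.

Lemma nlin_continuous (p : R) : 1 < p -> continuous (nlin p).
Proof. by move=> p1 x; apply: cvgM; [apply: powabs_continuous; rewrite subr_gt0|exact: cvg_id]. Qed.

Lemma nlin_norm (p x : R) : 1 < p -> `|nlin p x| = `|x| `^ p.
Proof.
move=> p1; rewrite /nlin normrM ger0_norm ?powR_ge0// mulrC mulr_powRB1//.
exact: lt_trans p1.
Qed.

(** The tangent inequality for positive arguments, applied to [|x|] and [|y|], leaves only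
    [x * y <= |x| * |y|]. Zero arguments are treated apart because the power tangent is available at
    positive points. *)
Lemma powabs_tangent (p x y : R) : 1 < p ->
  `|x| `^ (p + 1) + (p + 1) * nlin p x * (y - x) <= `|y| `^ (p + 1).
Proof.
move=> p1; have p0 : 0 < p + 1 by lra.
have [->|x0] := eqVneq x 0.
  by rewrite normr0 /nlin !mulr0 mul0r addr0 powR0 ?powR_ge0// gt_eqF.
have ax : 0 < `|x| by rewrite normr_gt0.
have [->|y0] := eqVneq y 0.
  rewrite normr0 sub0r powR0 ?gt_eqF// mulrN -mulrA /nlin -mulrA -expr2 -real_normK ?num_real//.
  have -> : `|x| `^ (p - 1) * `|x| ^+ 2 = `|x| `^ (p + 1).
    by rewrite -powR_mulrn// -powRD; [congr (_ `^ _); ring|rewrite (gt_eqF ax) implybT].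
  have : 0 <= `|x| `^ (p + 1) by exact: powR_ge0.
  by nra.
have ay : 0 < `|y| by rewrite normr_gt0.
have p1' : 1 < p + 1 by lra.
apply: le_trans (powR_tangent p1' ax ay); rewrite lerD2l -!mulrA ler_pM2l// [leRHS]mulrA.
have -> : `|x| `^ (p + 1) / `|x| = `|x| `^ (p - 1) * `|x|.
  apply: (mulIf (lt0r_neq0 ax)); rewrite mulfVK ?lt0r_neq0// -mulrA -expr2 -powR_mulrn//.
  by rewrite -powRD; [congr (_ `^ _); ring|rewrite (gt_eqF ax) implybT].
rewrite -mulrA ler_wpM2l ?powR_ge0//.
rewrite !mulrBr -!expr2 real_normK ?num_real// lerD2r.
by rewrite -normrM ler_norm.
Qed.

(** With [a = r^2] this is [r^2 (sqrt (1 + (m / r^2)^2) - 1)]: the Legendre transform of the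
    Born-Infeld integrand at the electric displacement [m / r^2], times the volume weight. *)
Definition bif a m : R := Num.sqrt (a ^+ 2 + m ^+ 2) - a.

Lemma bif_ge0 a m : 0 <= a -> 0 <= bif a m.
Proof.
move=> a0; rewrite /bif subr_ge0 -[leLHS](ger0_norm a0) -sqrtr_sqr ler_wsqrtr// lerDl sqr_ge0//.
Qed.

Lemma sqr_sqrtD a m : Num.sqrt (a ^+ 2 + m ^+ 2) ^+ 2 = a ^+ 2 + m ^+ 2.
Proof. by rewrite sqr_sqrtr// addr_ge0 ?sqr_ge0. Qed.

Lemma bif_le1 a m : 0 <= a -> 0 <= m -> bif a m <= m.
Proof.
move=> a0 m0; rewrite /bif lerBlDl -[leRHS]ger0_norm ?addr_ge0// -sqrtr_sqr ler_wsqrtr//.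
by rewrite sqrrD -addrA lerD2l lerDr mulrn_wge0// mulr_ge0.
Qed.

Lemma bif_le2 a m : 0 < a -> bif a m <= m ^+ 2 / (2 * a).
Proof.
move=> a0; rewrite ler_pdivlMr ?mulr_gt0//.
have := sqr_sqrtD a m; rewrite /bif; set S := Num.sqrt _ => h.
have : a <= S by rewrite -subr_ge0; exact: bif_ge0 (ltW a0).
by nra.
Qed.

Lemma young_le (u x l : R) : 0 < x -> 0 < l ->
  `|u| <= 2^-1 * (l * (u ^+ 2 * x ^+ 2) + l^-1 * x ^- 2).
Proof.
move=> x0 l0.
have h1 : 0 <= l * (u * x - l^-1 * x^-1) ^+ 2 by rewrite mulr_ge0 ?sqr_ge0 ?ltW.
have h2 : 0 <= l * (u * x + l^-1 * x^-1) ^+ 2 by rewrite mulr_ge0 ?sqr_ge0 ?ltW.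
have e1 : l * (u * x - l^-1 * x^-1) ^+ 2 = (l * (u ^+ 2 * x ^+ 2) + l^-1 * x ^- 2) - 2 * u.
  by field; rewrite !gt_eqF.
have e2 : l * (u * x + l^-1 * x^-1) ^+ 2 = (l * (u ^+ 2 * x ^+ 2) + l^-1 * x ^- 2) + 2 * u.
  by field; rewrite !gt_eqF.
by rewrite ler_norml; apply/andP; split; lra.
Qed.

Lemma abs2uv_le (u v : R) : `|2 * u * v| <= v ^+ 2 + u ^+ 2.
Proof.
have := sqr_ge0 (u - v); have := sqr_ge0 (u + v).
by rewrite ler_norml => h1 h2; apply/andP; split; nra.
Qed.

(** Concavity of [x |-> bif a (x m) / x]. The slope is its derivative at [b]; the tangent line [h]
    has a nonnegative intercept, so [a + h x] may be squared, and the difference of the squares is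
    [x (x - b)^2] times a nonnegative factor. *)
Lemma bif_tangent a m b x (S : R) : 0 < a -> 0 < b -> 0 < x ->
  S = Num.sqrt (a ^+ 2 + (b * m) ^+ 2) ->
  bif a (x * m) / x <= bif a (b * m) / b + a * (S - a) / (S * b ^+ 2) * (x - b).
Proof.
move=> a0 b0 x0 SE.
have S2 : S ^+ 2 = a ^+ 2 + (b * m) ^+ 2 by rewrite SE; exact: sqr_sqrtD.
have aS : a <= S by rewrite SE -subr_ge0; exact: bif_ge0 (ltW a0).
have S0 : 0 < S by exact: lt_le_trans aS.
pose g0 := (S - a) / b; pose sg := a * (S - a) / (S * b ^+ 2).
have -> : bif a (b * m) / b = g0 by rewrite /bif -SE.
rewrite -/sg.
have sg0 : 0 <= sg by rewrite divr_ge0// mulr_ge0 ?subr_ge0 ?sqr_ge0 ?(ltW a0) ?(ltW S0).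
have h0 : 0 <= g0 - sg * b.
  have -> : g0 - sg * b = (S - a) ^+ 2 / (S * b) by rewrite /g0 /sg; field; rewrite !gt_eqF.
  by rewrite divr_ge0 ?sqr_ge0 ?mulr_ge0 ?ltW.
pose h := g0 + sg * (x - b).
have hh : 0 <= h by rewrite /h; nra.
have Q0 : 0 <= a + h * x by rewrite addr_ge0 ?(ltW a0)// mulr_ge0// ltW.
rewrite -/h ler_pdivrMr// /bif lerBlDl -(ger0_norm Q0) -sqrtr_sqr ler_wsqrtr//.
have m2 : m ^+ 2 = (S ^+ 2 - a ^+ 2) / b ^+ 2.
  by rewrite S2 addrAC subrr add0r exprMn mulrAC mulfV ?mul1r// sqrf_eq0 gt_eqF.
have key : (a + h * x) ^+ 2 - (a ^+ 2 + (x * m) ^+ 2) =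
   x * ((x - b) ^+ 2 * (sg ^+ 2 * x + 2 * a * (g0 - sg * b) / b ^+ 2)).
  rewrite exprMn m2 /h /g0 /sg; field; rewrite !gt_eqF//.
rewrite -subr_ge0 key; apply: mulr_ge0; first exact: ltW.
apply: mulr_ge0; first exact: sqr_ge0.
apply: addr_ge0; first by apply: mulr_ge0; [exact: sqr_ge0|exact: ltW].
by apply: divr_ge0; [apply: mulr_ge0 => //; apply: mulr_ge0 => //; exact: ltW|exact: sqr_ge0].
Qed.

End Concave.

(** * The reduced functional of a radial profile *)

Section Functionals.
Variable p : R.
Hypothesis p2 : 2 < p.
Hypothesis p5 : p < 5.
Implicit Types (U V : R -> R) (a b r s t A C E M : R).

Definition fA U' r : R := U' r ^+ 2 * r ^+ 2.
Definition fC U r : R := U r ^+ 2 * r ^+ 2.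
Definition fD U r : R := `|U r| `^ (p + 1) * r ^+ 2.
Definition mass U : R -> R := prim (fC U).
Definition fB U s r : R := bif (r ^+ 2) (s * mass U r).
Definition EB U s : R := s^-1 * Ip (fB U s).
(** Under [t^2 U(t r)] the nonlinear integral scales like [t^(2 p - 1)]; in the variable [s = t^3]
    this is the power [qexp]. It exceeds 1 for [2 < p], which makes the nonlinear term convex in
    [s]. *)
Definition qexp : R := (2 * p - 1) / 3.
(** The quadratic integrals [A] and [C] are arguments separate from [U]: along a minimizing sequence
    they converge to numbers that may exceed the corresponding integrals of the limit profile. *)
Definition Pf A C U s : R :=
  2^-1 * (s * A) + 2^-1 * (s `^ 3^-1 * C) + 2^-1 * EB U s - s `^ qexp * Ip (fD U) / (p + 1).

Lemma q_gt1 : 1 < qexp.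
Proof.
rewrite /qexp ltr_pdivlMr ?ltr0n// mul1r.
by have := p2; lra.
Qed.

Definition bnd E U := forall r, 0 < r -> U r ^+ 2 <= E / r /\ U r ^+ 2 <= E / r ^+ 2.
Definition Kp U U' := [/\ D1 U U', cpos U', ip (fA U') & ip (fC U)].
Definition EE U U' := Ip (fA U') + Ip (fC U).

Lemma fA_ge0 U r : 0 <= fA U r. Proof. by rewrite mulr_ge0 ?sqr_ge0. Qed.
Lemma fC_ge0 U r : 0 <= fC U r. Proof. exact: fA_ge0. Qed.
Lemma fD_ge0 U r : 0 <= fD U r. Proof. by rewrite mulr_ge0 ?sqr_ge0 ?powR_ge0. Qed.
Lemma IpA_ge0 U : 0 <= Ip (fA U). Proof. by apply: Rintegral_ge0 => r _; exact: fA_ge0. Qed.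
Lemma IpC_ge0 U : 0 <= Ip (fC U). Proof. by apply: Rintegral_ge0 => r _; exact: fC_ge0. Qed.
Lemma IpD_ge0 U : 0 <= Ip (fD U). Proof. by apply: Rintegral_ge0 => r _; exact: fD_ge0. Qed.
Lemma mass_ge0 U r : 0 <= mass U r.
Proof. by apply: prim_ge0 => t _; exact: fC_ge0. Qed.
Lemma mass_le U r : ip (fC U) -> mass U r <= Ip (fC U).
Proof. by move=> h; apply: prim_le_Ip => // t _; exact: fC_ge0. Qed.
Lemma cpos_fC U : cpos U -> cpos (fC U).
Proof. by move=> cU; apply: cposM; [exact: cposX|apply: cposX; exact: cpos_id]. Qed.
Lemma mass_D1 U : cpos U -> ip (fC U) -> D1 (mass U) (fC U).
Proof. by move=> cU; apply: prim_D1; exact: cpos_fC. Qed.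
Lemma cpos_mass U : cpos U -> ip (fC U) -> cpos (mass U).
Proof. by move=> cU iU; apply: D1_cpos (mass_D1 cU iU). Qed.
Lemma cpos_bif (f g : R -> R) : cpos f -> cpos g -> cpos (fun r => bif (f r) (g r)).
Proof.
by move=> cf cg; apply: cposB => //; apply: cpos_sqrt; apply: cposD; exact: cposX.
Qed.
Lemma cpos_fB U s : cpos U -> ip (fC U) -> cpos (fB U s).
Proof.
move=> cU iU; apply: cpos_bif; first by apply: cposX; exact: cpos_id.
by apply: cposM; [exact: cpos_cst|exact: cpos_mass].
Qed.
(** Young's inequality applied to [U' = (U' r) / r], with a free weight [l]. A small [l] gives
    equicontinuity, and the optimal [l] gives the radial bound near the origin. *)
Lemma osc U U' (l a b : R) : Kp U U' -> 0 < l -> 0 < a -> a <= b ->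
  `|U b - U a| <= 2^-1 * (l * Ip (fA U') + l^-1 * (a^-1 - b^-1)).
Proof.
move=> [dU cU' iA iC] l0 a0 ab; rewrite -(FTC2 dU cU' a0 ab).
have cA : cpos (fA U') by apply: cposM; [exact: cposX|apply: cposX; exact: cpos_id].
pose g r : R := r ^- 2.
have r2 : forall r, 0 < r -> r ^+ 2 != 0 by move=> r r0; rewrite expf_neq0 ?gt_eqF.
have cg : cpos g by apply: cposV => //; apply: cposX; exact: cpos_id.
have dg : D1 (fun r : R => - r^-1) g.
  apply: D1_ext (D1N (D1V _ (@D1_id))) => // r r0; last by rewrite gt_eqF.
  by rewrite /g mulNr opprK mul1r.
have iA' := cpos_ig_seg b cA a0; have ig := cpos_ig_seg b cg a0.
have mab : @measurable _ mR `[a, b] by exact: measurable_itv.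
pose gg (x : R) : R := 2^-1 * (l * fA U' x + l^-1 * g x).
apply: le_trans (abs_Rint mab (g := gg) _ _ _) _.
- exact: cpos_ig_seg.
- by apply: igZ => //; apply: igD => //; apply: igZ.
- move=> x /= /(seg_pos a0)/pos_gt0 x0; rewrite /gg /fA /g.
  exact: young_le.
rewrite /gg RintZ//; last by apply: igD => //; apply: igZ.
rewrite RintegralD//; [|exact: igZ|exact: igZ].
rewrite !RintZ// (FTC2 dg cg a0 ab) ler_pM2l ?invr_gt0// lerD//.
  by rewrite ler_pM2l//; apply: seg_le_Ip => // t _; exact: fA_ge0.
by rewrite ler_pM2l ?invr_gt0// opprK addrC.
Qed.

Lemma Kp_small U U' (e N : R) : Kp U U' -> 0 < e -> 0 < N -> exists2 r, N < r & U r ^+ 2 < e.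
Proof.
move=> [dU cU' iA iC] e0 N0.
have cU := D1_cpos dU.
have N1 : 0 < Num.max N 1 by rewrite lt_max N0.
have [r] := ip_small_y (cpos_fC cU) iC (fun r _ => fC_ge0 U r) e0 N1.
rewrite gt_max => /andP[Nr r1] h; exists r => //; apply: le_lt_trans h.
by rewrite /fC mulrCA -exprS ler_peMr ?sqr_ge0// exprn_ege1// ltW.
Qed.

(** Strauss' radial estimates. The bound in [1/r^2] integrates [(U^2)' = 2 U U'] from [r] to a far
    point where [U] is small; the bound in [1/r] applies [osc] on the same interval. *)
Lemma Kp_bnd U U' : Kp U U' -> bnd (EE U U') U.
Proof.
move=> KU; have [dU cU' iA iC] := KU; have cU := D1_cpos dU.
have cA : cpos (fA U') by apply: cposM; [exact: cposX|apply: cposX; exact: cpos_id].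
have cC := cpos_fC cU.
have E0 : 0 <= EE U U' by rewrite addr_ge0 ?IpA_ge0 ?IpC_ge0.
have R2 r : 0 < r -> U r ^+ 2 <= EE U U' / r ^+ 2.
  move=> r0; apply/ler_addgt0Pr => e e0.
  have [b rb Ub] := Kp_small KU e0 r0.
  have dU2 := D1X 1 dU; rewrite /= in dU2.
  have cdU2 : cpos (fun r => 2 * U r ^+ 1 * U' r).
    by apply: cposM => //; apply: cposM; [exact: cpos_cst|exact: cposX].
  have := FTC2 dU2 cdU2 r0 (ltW rb).
  have mab : @measurable _ mR `[r, b] by exact: measurable_itv.
  have ia := cpos_ig_seg b cA r0; have ic := cpos_ig_seg b cC r0.
  have h1 : `|\int[leb]_(x in `[r, b]) (2 * U x ^+ 1 * U' x)| <= EE U U' / r ^+ 2.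
    apply: le_trans (abs_Rint mab (g := fun x => r ^- 2 * (fA U' x + fC U x)) _ _ _) _.
    - exact: cpos_ig_seg.
    - by apply: igZ => //; apply: igD.
    - move=> x; rewrite /= in_itv /= => /andP[rx _].
      have x0 : 0 < x by exact: lt_le_trans rx.
      apply: le_trans (_ : _ <= U' x ^+ 2 + U x ^+ 2) _.
        by rewrite expr1; exact: abs2uv_le.
      rewrite /fA /fC -mulrDl mulrCA ler_peMr ?addr_ge0 ?sqr_ge0//.
      by rewrite mulrC ler_pdivlMr ?exprn_gt0// mul1r lerXn2r ?nnegrE ?(ltW r0) ?(ltW x0).
    rewrite RintZ//; last exact: igD.
    rewrite mulrC ler_pM2r ?invr_gt0 ?exprn_gt0// RintegralD// lerD//.
    - by apply: seg_le_Ip => // t _; exact: fA_ge0.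
    - by apply: seg_le_Ip => // t _; exact: fC_ge0.
  move=> h2; move: h1; rewrite h2 ler_norml => /andP[h3 _].
  by lra.
move=> r r0; split; last exact: R2.
have [E00|En] := eqVneq (EE U U') 0.
  by have := R2 r r0; rewrite E00 !mul0r.
have {En}E1 : 0 < EE U U' by rewrite lt_def En.
pose E := EE U U'; rewrite -/E in E1 *.
have h l : 0 < l -> `|U r| <= 2^-1 * (l * E + l^-1 * r^-1).
  move=> l0; apply/ler_addgt0Pr => e e0.
  have e2 : 0 < e ^+ 2 by rewrite exprn_gt0.
  have [b rb Ub] := Kp_small KU e2 r0.
  have h1 := osc KU l0 r0 (ltW rb).
  have h2 : `|U b| <= e.
    by rewrite -(@ler_pXn2r _ 2) ?nnegrE ?normr_ge0 ?(ltW e0)// real_normK ?num_real// ltW.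
  have h3 : `|U r| <= `|U b| + `|U b - U r|.
    by rewrite -{1}(subKr (U b) (U r)); exact: ler_normB.
  apply: le_trans h3 _; rewrite addrC lerD//; apply: le_trans h1 _.
  rewrite ler_pM2l ?invr_gt0// lerD// ler_pM2l ?invr_gt0//.
    by rewrite /E /EE lerDl IpC_ge0.
  by rewrite lerBlDr lerDl invr_ge0 ltW// (lt_trans r0).
have w0 : 0 < Num.sqrt (r * E) by rewrite sqrtr_gt0 mulr_gt0.
(* The optimal weight [1 / sqrt (r E)] balances the two terms of [h], and gives
   [|U r| <= sqrt (E / r)]. *)
have := h (Num.sqrt (r * E))^-1; rewrite invr_gt0 invrK => /(_ w0).
have w2 : Num.sqrt (r * E) ^+ 2 = r * E by rewrite sqr_sqrtr// mulr_ge0 ?ltW.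
move: w0 w2; set w := Num.sqrt _ => w0 w2.
have -> : 2^-1 * (w^-1 * E + w / r) = w / r.
  have -> : E = w ^+ 2 / r by rewrite w2 mulrAC mulfV ?mul1r ?gt_eqF.
  by field; rewrite !gt_eqF.
move=> h1; rewrite -[U r ^+ 2]real_normK ?num_real//.
apply: le_trans (_ : (w / r) ^+ 2 <= _).
  by apply: lerXn2r => //; rewrite nnegrE divr_ge0 ?(ltW w0) ?(ltW r0).
by rewrite expr_div_n w2 expr2 invfM mulrACA mulfV ?mul1r ?gt_eqF.
Qed.

Lemma cpos_fD U : cpos U -> cpos (fD U).
Proof.
move=> cU; apply: cposM; last by apply: cposX; exact: cpos_id.
have p10 : 0 < p + 1 by have := p2; lra.
exact: (cpos_comp (powabs_continuous p10)).
Qed.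

(** The radial bounds turn [fD U] into at most [r^((3 - p) / 2)] near 0 and [r^(1 - p)] at infinity,
    up to constants. [wgt ew] dominates both: the two entries of the minimum are the margins of
    integrability at the two ends. *)
Definition ew : R := Num.min ((5 - p) / 2) (p - 2).
Lemma ew_gt0 : 0 < ew.
Proof. by rewrite lt_min divr_gt0 ?subr_gt0. Qed.

Lemma fD_bnd E U r : 0 <= E -> bnd E U -> 0 < r ->
  fD U r <= 4 * E `^ ((p + 1) / 2) * wgt ew r.
Proof.
move=> E0 bU r0; have [b1 b2] := bU r r0; rewrite /fD.
have p10 : 0 <= (p + 1) / 2 by have := p2; lra.
have -> : `|U r| `^ (p + 1) = (U r ^+ 2) `^ ((p + 1) / 2).
  rewrite -[U r ^+ 2]real_normK ?num_real// -powR_mulrn// -powRrM; congr (_ `^ _); by field.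
have Ei0 : 0 <= E `^ ((p + 1) / 2) by exact: powR_ge0.
have rr : r ^+ 2 = r `^ 2 by rewrite powR_mulrn// ltW.
have [r1|r1] := leP r 1.
  apply: (@le_trans _ _ ((E / r) `^ ((p + 1) / 2) * r ^+ 2)).
    by rewrite ler_wpM2r ?sqr_ge0//; apply: ge0_ler_powR => //; rewrite nnegrE ?sqr_ge0// divr_ge0// ltW.
  rewrite powRM ?invr_ge0 ?(ltW r0)// -mulrA (mulrC 4) -mulrA ler_wpM2l//.
  apply: le_trans (wgt_lb0 ew_gt0 r0 r1).
  rewrite -powR_inv1 ?(ltW r0)// -powRrM rr -powRD; last by rewrite (gt_eqF r0) implybT.
  rewrite ger_powR ?r0//.
  have : ew <= (5 - p) / 2 by rewrite ge_min lexx.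
  by lra.
apply: (@le_trans _ _ ((E / r ^+ 2) `^ ((p + 1) / 2) * r ^+ 2)).
  by rewrite ler_wpM2r ?sqr_ge0//; apply: ge0_ler_powR => //; rewrite nnegrE ?sqr_ge0// divr_ge0// sqr_ge0.
rewrite powRM ?invr_ge0 ?sqr_ge0// -mulrA (mulrC 4) -mulrA ler_wpM2l//.
apply: le_trans (wgt_lby ew_gt0 (ltW r1)).
rewrite -powR_inv1 ?sqr_ge0// -powRrM rr -powRrM -powRD; last by rewrite (gt_eqF r0) implybT.
rewrite ler_powR ?(ltW r1)//.
have : ew <= p - 2 by rewrite ge_min lexx orbT.
by have := p2; lra.
Qed.

Lemma ip_fD E U : 0 <= E -> bnd E U -> cpos U -> ip (fD U).
Proof.
move=> E0 bU cU; apply: (ig_dom mpos (g := fun r => 4 * E `^ ((p + 1) / 2) * wgt ew r)).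
- exact: cpos_meas (cpos_fD cU).
- by apply: igZ => //; exact: ip_wgt ew_gt0.
- by move=> r /pos_gt0 r0; rewrite ger0_norm ?fD_ge0//; exact: fD_bnd.
Qed.

Lemma IpD_le E U : 0 <= E -> bnd E U -> cpos U ->
  Ip (fD U) <= 4 * Ip (wgt ew) * E `^ ((p + 1) / 2).
Proof.
move=> E0 bU cU; apply: le_trans (_ : Ip (fun r => 4 * E `^ ((p + 1) / 2) * wgt ew r) <= _).
  apply: le_Rint => //; [exact: ip_fD bU cU| |].
    by apply: igZ => //; exact: ip_wgt ew_gt0.
  by move=> r /pos_gt0 r0; exact: fD_bnd.
by rewrite RintZ//; [lra|exact: ip_wgt ew_gt0].
Qed.

(** Near the origin [bif a m <= m] is used, far away [bif a m <= m^2 / (2 a)]; together they give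
    decay like [wgt 1]. *)
Lemma fB_bnd U s r M : 0 <= s -> mass U r <= M -> 0 < r ->
  0 <= fB U s r <= 4 * (s * M + (s * M) ^+ 2) * wgt 1 r.
Proof.
move=> s0 mM r0; have m0 := mass_ge0 U r.
have M0 : 0 <= M by exact: le_trans mM.
have sm : s * mass U r <= s * M by rewrite ler_wpM2l.
have sm0 : 0 <= s * mass U r by exact: mulr_ge0.
rewrite /fB bif_ge0 ?sqr_ge0//= [leRHS]mulrAC.
have w0 := wgt_ge0 1 r.
have [r1|r1] := leP r 1.
  have := wgt_lb0 ltr01 r0 r1; rewrite subrr powRr0 => w1.
  apply: le_trans (bif_le1 (sqr_ge0 _) sm0) _; apply: le_trans sm _.
  have : 0 <= s * M by exact: mulr_ge0.
  have : 0 <= (s * M) ^+ 2 by exact: sqr_ge0.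
  by nra.
have := wgt_lby ltr01 (ltW r1).
have -> : - (1) - 1 = (-1) * 2 :> R by ring.
rewrite powRrM powR_inv1 ?(ltW r0)// powR_mulrn ?invr_ge0 ?(ltW r0)// => w1.
apply: le_trans (bif_le2 _ (exprn_gt0 2 r0)) _.
apply: le_trans (_ : (s * M) ^+ 2 * r^-1 ^+ 2 <= _).
  rewrite exprVn invfM mulrA ler_wpM2r ?invr_ge0 ?sqr_ge0//.
  apply: le_trans (_ : (s * mass U r) ^+ 2 <= _).
    by rewrite ler_piMr ?sqr_ge0// invf_le1// ler1n.
  by apply: lerXn2r; rewrite ?nnegrE// (le_trans sm0).
have : (s * M) ^+ 2 * r^-1 ^+ 2 <= (s * M) ^+ 2 * (4 * wgt 1 r) by rewrite ler_wpM2l ?sqr_ge0.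
have : 0 <= (s * M) * (4 * wgt 1 r) by rewrite mulr_ge0// mulr_ge0.
by lra.
Qed.

Lemma ip_fB U s : cpos U -> ip (fC U) -> 0 <= s -> ip (fB U s).
Proof.
move=> cU iU s0.
apply: (ig_dom mpos (g := fun r => 4 * (s * Ip (fC U) + (s * Ip (fC U)) ^+ 2) * wgt 1 r)).
- exact: cpos_meas (cpos_fB cU iU).
- by apply: igZ => //; exact: ip_wgt.
- move=> r /pos_gt0 r0; have /andP[h1 h2] := fB_bnd s0 (mass_le r iU) r0.
  by rewrite ger0_norm.
Qed.

(** * Passage to the limit along bounded pointwise convergent profiles *)

Section Sequences.
Variables (W : nat -> R -> R) (u : R -> R) (E : R).
Hypothesis E0 : 0 <= E.
Hypothesis cW : forall n, cpos (W n).
Hypothesis bW : forall n, bnd E (W n).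
Hypothesis iW : forall n, ip (fC (W n)).
Hypothesis CW : forall n, Ip (fC (W n)) <= E.
Hypothesis Wu : forall r, 0 < r -> W n r @[n --> \oo] --> u r.
Hypothesis cu : cpos u.

Lemma seq_fC : ip (fC u) /\ Ip (fC u) <= E.
Proof.
apply: (Rfatou mpos (f := fun n => fC (W n))) => // [n x _|x /pos_gt0 x0]; first exact: fC_ge0.
by apply: cvgM; [under eq_fun do rewrite expr2; rewrite expr2; apply: cvgM; exact: Wu|exact: cvg_cst].
Qed.

Lemma seq_bnd : bnd E u.
Proof.
move=> r r0; have h : W n r ^+ 2 @[n --> \oo] --> u r ^+ 2.
  by under eq_fun do rewrite expr2; rewrite expr2; apply: cvgM; exact: Wu.
split; rewrite -(cvg_lim _ h)//.
- apply: limr_le; first by apply/cvg_ex; exists (u r ^+ 2).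
  by apply: nearW => n; have [] := bW n r0.
- apply: limr_le; first by apply/cvg_ex; exists (u r ^+ 2).
  by apply: nearW => n; have [] := bW n r0.
Qed.

Lemma seq_mass r : 0 < r -> mass (W n) r @[n --> \oo] --> mass u r.
Proof.
move=> r0; have mr : @measurable _ mR `]0, r] by exact: measurable_itv.
suff [] : leb.-integrable `]0, r] (EFin \o fC u) /\
  (\int[leb]_(x in `]0, r]) fC (W n) x @[n --> \oo] --> \int[leb]_(x in `]0, r]) fC u x) by [].
apply: (@DCT _ _ _ leb `]0, r]%classic mr (fun n => fC (W n)) (fC u) (fun=> E * r)).
- move=> n; apply: measurable_funS (ig_meas (iW n)) => //; exact: oseg_pos.
- exact: ig_oseg_cst.
- move=> n x /= /[1!in_itv] /= /andP[x0 xr]; rewrite ger0_norm ?fC_ge0// /fC.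
  apply: le_trans (_ : E / x * x ^+ 2 <= _).
    by rewrite ler_wpM2r ?sqr_ge0//; have [] := bW n x0.
  by rewrite -mulrA ler_wpM2l// expr2 mulrA mulVf ?gt_eqF// mul1r.
- move=> x /= /[1!in_itv] /= /andP[x0 xr].
  by apply: cvgM; [under eq_fun do rewrite expr2; rewrite expr2; apply: cvgM; exact: Wu|exact: cvg_cst].
Qed.

(** Radial compactness: the bounds at 0 and at infinity provide one integrable majorant for all [n],
    so the nonlinear integral loses nothing in the limit. *)
Lemma seq_fD : Ip (fD (W n)) @[n --> \oo] --> Ip (fD u).
Proof.
suff [] : ip (fD u) /\ (Ip (fD (W n)) @[n --> \oo] --> Ip (fD u)) by [].
apply: (@DCT _ _ _ leb pos mpos (fun n => fD (W n)) (fD u) (fun r => 4 * E `^ ((p + 1) / 2) * wgt ew r)).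
- by move=> n; exact: cpos_meas (cpos_fD (@cW n)).
- by apply: igZ => //; exact: ip_wgt ew_gt0.
- by move=> n r /pos_gt0 r0; rewrite ger0_norm ?fD_ge0//; exact: fD_bnd.
- move=> x /pos_gt0 x0; apply: cvgM; last exact: cvg_cst.
  apply: (@cvg_comp _ _ _ (fun n => W n x) (fun y => `|y| `^ (p + 1)) _ (nbhs (u x))); first exact: Wu.
  by apply: powabs_continuous; have := p2; lra.
Qed.

Lemma seq_fB s : 0 <= s -> Ip (fB (W n) s) @[n --> \oo] --> Ip (fB u s).
Proof.
move=> s0.
suff [] : ip (fB u s) /\ (Ip (fB (W n) s) @[n --> \oo] --> Ip (fB u s)) by [].
apply: (@DCT _ _ _ leb pos mpos (fun n => fB (W n) s) (fB u s) (fun r => 4 * (s * E + (s * E) ^+ 2) * wgt 1 r)).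
- by move=> n; exact: cpos_meas (cpos_fB (@cW n) (iW n)).
- by apply: igZ => //; exact: ip_wgt.
- move=> n r /pos_gt0 r0.
  have /andP[h1 h2] := fB_bnd s0 (le_trans (mass_le r (iW n)) (CW n)) r0.
  by rewrite ger0_norm.
- move=> x /pos_gt0 x0; apply: cvgB; last exact: cvg_cst.
  apply: (@cvg_comp _ _ _ _ Num.sqrt _ (nbhs ((x ^+ 2) ^+ 2 + (s * mass u x) ^+ 2))); last exact: sqrt_continuous.
  apply: cvgD; first exact: cvg_cst.
  have h : s * mass (W n) x @[n --> \oo] --> s * mass u x by apply: cvgM; [exact: cvg_cst|exact: seq_mass].
  by under eq_fun do rewrite expr2; rewrite expr2; exact: cvgM.
Qed.

Lemma seq_Pf (A C : nat -> R) (a c s : R) : 0 < s ->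
  A n @[n --> \oo] --> a -> C n @[n --> \oo] --> c ->
  Pf (A n) (C n) (W n) s @[n --> \oo] --> Pf a c u s.
Proof.
move=> s0 Aa Cc; apply: cvgB; [apply: cvgD; [apply: cvgD|]|].
- by apply: cvgM; [exact: cvg_cst|apply: cvgM => //; exact: cvg_cst].
- by apply: cvgM; [exact: cvg_cst|apply: cvgM => //; exact: cvg_cst].
- by apply: cvgM; [exact: cvg_cst|apply: cvgM; [exact: cvg_cst|apply: seq_fB; exact: ltW]].
- by apply: cvgM; [apply: cvgM; [exact: cvg_cst|exact: seq_fD]|exact: cvg_cst].
Qed.

End Sequences.

(** The derivative at [x = b] of [bif (r^2) (x m) / x] with [m = mass U r]; its integral is a slope
    of [EB U] at [b]. *)
Definition kB U b r : R := let S := Num.sqrt ((r ^+ 2) ^+ 2 + (b * mass U r) ^+ 2) in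
  r ^+ 2 * (S - r ^+ 2) / (S * b ^+ 2).

Lemma EB_tangent U b : cpos U -> ip (fC U) -> 0 < b ->
  [/\ cpos (kB U b), ip (kB U b) &
    forall s, 0 < s -> EB U s <= EB U b + Ip (kB U b) * (s - b)].
Proof.
move=> cU iU b0.
pose S r := Num.sqrt ((r ^+ 2) ^+ 2 + (b * mass U r) ^+ 2).
pose k r := r ^+ 2 * (S r - r ^+ 2) / (S r * b ^+ 2).
rewrite (_ : kB U b = k)//.
have ifb := ip_fB cU iU (ltW b0).
have S0 r : 0 < r -> 0 < S r.
  by move=> r0; rewrite sqrtr_gt0 ltr_wpDr ?sqr_ge0// !exprn_gt0.
have cS : cpos S.
  apply: cpos_sqrt; apply: cposD; first by apply: cposX; apply: cposX; exact: cpos_id.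
  by apply: cposX; apply: cposM; [exact: cpos_cst|exact: cpos_mass].
have ck : cpos k.
  apply: cposM.
    apply: cposM; first by apply: cposX; exact: cpos_id.
    by apply: cposB => //; apply: cposX; exact: cpos_id.
  apply: cposV; last by apply: cposM => //; exact: cpos_cst.
  by move=> r r0; rewrite mulf_neq0// gt_eqF// ?S0// exprn_gt0.
have ik : ip k.
  apply: (ig_dom mpos (g := fun r => (b ^+ 2)^-1 * fB U b r)).
  - exact: cpos_meas.
  - exact: igZ.
  - move=> r /pos_gt0 r0; have S1 := S0 r r0.
    have h0 : 0 <= S r - r ^+ 2 by exact: (bif_ge0 _ (sqr_ge0 r)).
    rewrite /k /fB /bif -/(S r) ger0_norm; last first.
      by apply: divr_ge0; apply: mulr_ge0; rewrite ?sqr_ge0 ?(ltW S1).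
    rewrite invfM mulrA [_ * (b ^+ 2)^-1]mulrC ler_wpM2l ?invr_ge0 ?sqr_ge0//.
    rewrite mulrAC ler_piMl// ler_pdivrMr// mul1r -subr_ge0//.
split => // s s0; have ifs := ip_fB cU iU (ltW s0).
rewrite /EB [_ * (s - b)]mulrC -!RintZ// -RintegralD//; [|exact: igZ|exact: igZ].
apply: le_Rint => //; [exact: igZ|by apply: igD => //; exact: igZ|].
move=> r /pos_gt0 r0; rewrite /k /fB.
have := bif_tangent (exprn_gt0 2 r0) b0 s0 (erefl (S r)).
by rewrite -/(S r) [_^-1 * _]mulrC [b^-1 * _]mulrC [(s - b) * _]mulrC.
Qed.

(* Concavity of [s |-> Pf A C U s], in the form of a supporting line at [b]. *)
Definition slope A C U b : R := 2^-1 * A + 2^-1 * (C * (b `^ 3^-1 / (3 * b))) + 2^-1 * Ip (kB U b)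
  - qexp * (b `^ qexp / b) * Ip (fD U) / (p + 1).

(** A sum of supporting lines: linear term, cube root, field term, and minus a power with exponent
    above 1. Strictness is taken from the cube root, whence the condition [0 < C]. *)
Lemma Pf_tangent_slope A C U b : 0 <= A -> 0 <= C -> cpos U -> ip (fC U) -> 0 < b ->
  forall s, 0 < s ->
    Pf A C U s <= Pf A C U b + slope A C U b * (s - b) /\
    (0 < C -> s != b -> Pf A C U s < Pf A C U b + slope A C U b * (s - b)).
Proof.
move=> A0 C0 cU iU b0; rewrite /slope.
have [_ _ EBt] := EB_tangent cU iU b0; move: (Ip (kB U b)) EBt => sgB EBt.
have q1 := q_gt1; have D0 := IpD_ge0 U.
have p10 : 0 < p + 1 by have := p2; lra.
move=> s s0.
have h1 := EBt s s0.
have [h2 h2'] := cuberoot_tangent b0 s0.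
have h3 : b `^ qexp * (Ip (fD U) / (p + 1)) + qexp * (b `^ qexp / b) * (Ip (fD U) / (p + 1)) * (s - b)
    <= s `^ qexp * (Ip (fD U) / (p + 1)).
  have := powR_tangent q1 b0 s0.
  have D1 : 0 <= Ip (fD U) / (p + 1) by rewrite divr_ge0 ?(ltW p10).
  move=> /(ler_wpM2r D1) h; apply: le_trans h; rewrite le_eqVlt; apply/orP; left; apply/eqP; ring.
have h4 : C * (s `^ 3^-1) <= C * (b `^ 3^-1) + C * (b `^ 3^-1 / (3 * b)) * (s - b).
  by move: h2 => /(ler_wpM2l C0) h; lra.
split.
  rewrite /Pf.
  by lra.
move=> C1 sb; have h5 : C * (s `^ 3^-1) < C * (b `^ 3^-1) + C * (b `^ 3^-1 / (3 * b)) * (s - b).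
  by move: (h2' sb); rewrite -(ltr_pM2l C1) => h; lra.
rewrite /Pf.
by lra.
Qed.

Lemma Pf_tangent A C U b : 0 <= A -> 0 <= C -> cpos U -> ip (fC U) -> 0 < b ->
  exists sg : R, forall s, 0 < s ->
    Pf A C U s <= Pf A C U b + sg * (s - b) /\
    (0 < C -> s != b -> Pf A C U s < Pf A C U b + sg * (s - b)).
Proof. by move=> A0 C0 cU iU b0; exists (slope A C U b) => s; exact: Pf_tangent_slope. Qed.

End Functionals.

(** * Further criteria of integrability and uniqueness of primitives *)

Section HalfMore.
Implicit Types (f g F : R -> R) (a b r s t e k N : R).

Lemma prim_uniq F f r : D1 F f -> cpos f -> ip f -> F x @[x --> 0^'+] --> 0 -> 0 < r ->
  F r = prim f r.
Proof.
move=> dF cf fi F0 r0; apply/eqP; rewrite -subr_eq0; apply/eqP.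
pose u n : R := n.+1%:R^-1.
have u0 n : 0 < u n by rewrite invr_gt0 ltr0n.
have uu : u n @[n --> \oo] --> 0 by exact: cvg_harmonic.
have h : F (u n) - prim f (u n) @[n --> \oo] --> 0 - 0.
  apply: cvgB; first by move/cvg_at_rightP : F0; apply; split.
  by move/cvg_at_rightP : (prim_cvg0 fi); apply; split.
have E : (fun n => F (u n) - prim f (u n)) = (fun=> F r - prim f r).
  by apply/funext => n; have := FTC_prim dF cf fi (u0 n) r0; lra.
rewrite E subr0 in h.
by rewrite -(cvg_lim (@Rhausdorff R) h) lim_cst//; exact: Rhausdorff.
Qed.

Lemma D1_uniq F f g r : D1 F f -> D1 F g -> 0 < r -> f r = g r.
Proof.
move=> dF dG r0; have <- := @derive_val _ _ _ _ _ _ _ (dF r r0).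
by have <- := @derive_val _ _ _ _ _ _ _ (dG r r0).
Qed.

(** If the integral were 0, the primitive of the nonnegative [f] would vanish identically, and so
    would its derivative [f]. *)
Lemma Ip_gt0 f r : cpos f -> ip f -> (forall t, 0 < t -> 0 <= f t) -> 0 < r -> f r != 0 ->
  0 < Ip f.
Proof.
move=> cf fi f0 r0 fr; rewrite lt_def; apply/andP; split; last first.
  by apply: Rintegral_ge0 => x /pos_gt0; exact: f0.
apply: contra_neq fr => I0.
have p0 t : 0 < t -> prim f t = 0.
  move=> t0; apply/eqP; rewrite eq_le prim_ge0// andbT.
  by rewrite -I0; exact: prim_le_Ip.
have d := prim_D1 cf fi.
have d' : D1 (prim f) (fun=> 0).
  by apply: D1_ext (D1_cst 0) => // t t0; rewrite p0.
exact: D1_uniq d d' r0.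
Qed.

Lemma sum_small_seg f a b M : cpos f -> (forall r, 0 < r -> 0 <= f r) ->
  (forall a b, 0 < a -> a <= b -> \int[leb]_(x in `[a, b]) f x <= M) ->
  ip f /\ Ip f <= M.
Proof.
move=> cf f0 fM.
pose E n : set R := `[n.+1%:R^-1, n.+1%:R]%classic.
have Ep n : E n `<=` pos by apply: seg_pos.
have h : (forall x, pos x -> (f \_ (E n)) x @[n --> \oo] --> f x).
  move=> x /pos_gt0 x0; apply: cvg_near_cst.
  near=> n; rewrite patchE mem_set// /E /= in_itv /=; apply/andP; split.
    rewrite -[leRHS]invrK lef_pV2 ?posrE ?invr_gt0 ?ltr0n//.
    by apply: le_trans (_ : n%:R <= _); [near: n; exact: nbhs_infty_ger|rewrite ler_nat].
  by apply: le_trans (_ : n%:R <= _); [near: n; exact: nbhs_infty_ger|rewrite ler_nat].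
apply: (@Rfatou _ _ _ leb pos mpos (fun n => f \_ (E n)) f M _ _ h _).
- move=> n; apply: ig_restr => //; first exact: measurable_itv.
  exact: cpos_ig_seg.
- move=> n x /pos_gt0 x0; rewrite /patch; case: ifP => // _; exact: f0.
- move=> n; rewrite -Rint_restr//; last exact: measurable_itv.
  apply: fM => //; apply: (@le_trans _ _ 1); last by rewrite ler1n.
  by rewrite invf_le1 ?ltr0n// ler1n.
Unshelve. all: by end_near. Qed.

Lemma cpos_seg_bounded f a b : cpos f -> 0 < a ->
  exists2 M : R, 0 <= M & forall x, x \in `[a, b] -> `|f x| <= M.
Proof.
move=> cf a0; have [ab|ba] := leP a b; last first.
  by exists 0 => // x; rewrite in_itv /= => /andP[ax xb]; have := lt_le_trans ba (le_trans ax xb); rewrite ltxx.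
have [c _ hc] := EVT_max ab (cpos_within (b := b) (cpos_abs cf) a0).
by exists `|f c|.
Qed.

Lemma inv2_le_wgt a r : 0 < a -> a <= r -> r ^- 2 <= (1 + a^-1) ^+ 2 * wgt 1 r.
Proof.
move=> a0 ar; have r0 := lt_le_trans a0 ar.
rewrite /wgt subrr powRr0 mul1r powRr1 ?(ltW r0)// -expr_div_n -exprVn.
have h : r^-1 <= (1 + a^-1) / (1 + r).
  rewrite ler_pdivlMr ?addr_gt0// mulrDr mulr1 mulVf ?gt_eqF// [leLHS]addrC lerD2l lef_pV2//.
by apply: lerXn2r; rewrite // nnegrE ?invr_ge0 ?divr_ge0 ?addr_ge0 ?invr_ge0 ?(ltW r0) ?(ltW a0).
Qed.

Lemma ip_tail f a M : cpos f -> 0 < a -> (forall r, 0 < r -> r < a -> f r = 0) ->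
  (forall r, a <= r -> `|f r| <= M * r ^- 2) -> ip f.
Proof.
move=> cf a0 f0 fM.
have M0 : 0 <= M.
  have := le_trans (normr_ge0 _) (fM a (lexx a)).
  by rewrite pmulr_lge0// invr_gt0 exprn_gt0.
apply: (ig_dom mpos (g := fun r => M * (1 + a^-1) ^+ 2 * wgt 1 r)).
- exact: cpos_meas.
- by apply: igZ => //; exact: ip_wgt.
- move=> r /pos_gt0 r0; have [ra|ar] := ltP r a.
    by rewrite f0// normr0 mulr_ge0 ?wgt_ge0// mulr_ge0 ?sqr_ge0.
  by rewrite -mulrA (le_trans (fM r ar))// ler_wpM2l//; exact: inv2_le_wgt.
Qed.

Lemma ip_csupp f a b : cpos f -> 0 < a -> (forall r, 0 < r -> (r < a) || (b < r) -> f r = 0) -> ip f.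
Proof.
move=> cf a0 f0; have [M M0 hM] := cpos_seg_bounded b cf a0.
apply: (@ip_tail f a (M * b ^+ 2)) => // [r r0 ra|r ar]; first by rewrite f0// ra.
have r0 := lt_le_trans a0 ar.
have [br|rb] := ltP b r.
  by rewrite f0 ?br ?orbT// normr0 mulr_ge0 ?invr_ge0 ?sqr_ge0// mulr_ge0 ?sqr_ge0.
rewrite -mulrA; apply: le_trans (hM r _) _; [by rewrite in_itv /= ar|rewrite ler_peMr//].
rewrite ler_pdivlMr ?exprn_gt0// mul1r lerXn2r ?nnegrE ?(ltW r0)//.
exact: ltW (lt_le_trans r0 rb).
Qed.

Lemma powR_le1 e s : 0 <= s -> s <= 1 -> 0 <= e -> s `^ e <= 1.
Proof.
move=> s0 s1 e0; have -> : 1 = 1 `^ e :> R by rewrite powR1.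
by apply: ge0_ler_powR; rewrite ?nnegrE.
Qed.

End HalfMore.

(** * Smooth test functions and fundamental lemmas on the half-line *)

Section SmoothHalf.
Implicit Types (F f g : R -> R) (a b r x y k : R) (n : nat).

Fixpoint Sm n f : Prop := if n is m.+1 then exists2 f', D1 f f' & Sm m f' else cpos f.
Definition smooth f := forall n, Sm n f.

Lemma cpos_ext f g : (forall r, 0 < r -> f r = g r) -> cpos f -> cpos g.
Proof.
move=> fg cf r r0; rewrite -fg//; apply: cvg_trans (cf r r0); apply: near_eq_cvg.
by near=> x; rewrite fg//; near: x; exact: lt_nbhsr.
Unshelve. all: by end_near. Qed.

Lemma Sm_ext n f g : (forall r, 0 < r -> f r = g r) -> Sm n f -> Sm n g.
Proof.
case: n => [|n] fg; first exact: cpos_ext.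
by move=> [f' df h]; exists f' => //; exact: D1_ext df.
Qed.

Lemma SmS n f : Sm n.+1 f -> Sm n f.
Proof.
elim: n f => [|n IH] f; first by move=> [f' df _]; exact: D1_cpos df.
by move=> [f' df h]; exists f' => //; exact: IH.
Qed.

Lemma SmD n f g : Sm n f -> Sm n g -> Sm n (fun r => f r + g r).
Proof.
elim: n f g => [|n IH] f g; first exact: cposD.
move=> [f' df hf] [g' dg hg]; exists (fun r => f' r + g' r); [exact: D1D|exact: IH].
Qed.

Lemma SmM n f g : Sm n f -> Sm n g -> Sm n (fun r => f r * g r).
Proof.
elim: n f g => [|n IH] f g; first exact: cposM.
move=> hf hg; have [f' df hf'] := hf; have [g' dg hg'] := hg.
exists (fun r => f' r * g r + f r * g' r); first exact: D1M.
by apply: SmD; apply: IH => //; exact: SmS.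
Qed.

Lemma Sm_cst n k : Sm n (fun=> k).
Proof. by elim: n k => [|n IH] k; [exact: cpos_cst|exists (fun=> 0); [exact: D1_cst|exact: IH]]. Qed.

Lemma Sm_id n : Sm n id.
Proof. by case: n => [|n]; [exact: cpos_id|exists (fun=> 1); [exact: D1_id|exact: Sm_cst]]. Qed.

Lemma SmV n f : (forall r, 0 < r -> f r != 0) -> Sm n f -> Sm n (fun r => (f r)^-1).
Proof.
move=> f0; elim: n f f0 => [|n IH] f f0; first exact: cposV.
move=> hf; have [f' df hf'] := hf; exists (fun r => - f' r / f r ^+ 2); first exact: D1V.
have h := IH f f0 (SmS hf).
apply: (@Sm_ext _ (fun r => (-1) * f' r * ((f r)^-1 * (f r)^-1))).
  by move=> r r0; rewrite mulN1r expr2 invfM.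
by apply: SmM; [apply: SmM => //; exact: Sm_cst|exact: SmM].
Qed.

Lemma smoothD f g : smooth f -> smooth g -> smooth (fun r => f r + g r).
Proof. by move=> hf hg n; exact: SmD. Qed.
Lemma smoothM f g : smooth f -> smooth g -> smooth (fun r => f r * g r).
Proof. by move=> hf hg n; exact: SmM. Qed.
Lemma smooth_cst k : smooth (fun=> k).
Proof. by move=> n; exact: Sm_cst. Qed.
Lemma smooth_id : smooth id.
Proof. by move=> n; exact: Sm_id. Qed.
Lemma smoothV f : (forall r, 0 < r -> f r != 0) -> smooth f -> smooth (fun r => (f r)^-1).
Proof. by move=> f0 hf n; exact: SmV. Qed.
Lemma smooth_ext f g : (forall r, 0 < r -> f r = g r) -> smooth f -> smooth g.
Proof. by move=> fg hf n; exact: Sm_ext (hf n). Qed.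
Lemma smooth_cpos f : smooth f -> cpos f.
Proof. by move=> /(_ 0%N). Qed.
Lemma smoothX f n : smooth f -> smooth (fun r => f r ^+ n).
Proof.
move=> hf; elim: n => [|n IH]; first exact: smooth_cst.
by apply: smooth_ext (smoothM hf IH) => r _; rewrite exprS.
Qed.

Lemma smooth_D1 f f' : smooth f -> D1 f f' -> smooth f'.
Proof.
move=> hf df n; have [g dg hg] := hf n.+1.
by apply: Sm_ext hg => r r0; exact: (D1_uniq dg df).
Qed.

Lemma smooth_deriv f : smooth f -> exists2 f', D1 f f' & smooth f'.
Proof. by move=> hf; have [f' df _] := hf 1%N; exists f' => //; exact: smooth_D1 df. Qed.

Lemma D1_smooth f f' : D1 f f' -> smooth f' -> smooth f.
Proof. by move=> df h [|n]; [exact: D1_cpos df|exists f']. Qed.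

Lemma smooth_prim f : smooth f -> ip f -> smooth (prim f).
Proof. by move=> hf fi; exact: D1_smooth (prim_D1 (smooth_cpos hf) fi) hf. Qed.

Definition supp a b f := forall r, 0 < r -> (r < a) || (b < r) -> f r = 0.
(** Tests are supported away from the origin, so that weights such as [1 / r^2] may be absorbed in
    them and no boundary term appears at 0. *)
Definition T1 a b f := [/\ 0 < a, smooth f & supp a b f].

Lemma supp_D1 a b f f' : D1 f f' -> supp a b f -> supp a b f'.
Proof.
move=> df sf r r0 h; have d0 : is_derive r 1 f 0.
  apply: (near_eq_is_derive _ (is_derive_cst (0 : R) r 1)).
  have [ra|ar] := ltP r a.
    near=> x; rewrite /= sf//; first by near: x; exact: lt_nbhsr.
    by apply/orP; left; near: x; exact: lt_nbhsl.
  have br : b < r by move: h; rewrite ltNge ar.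
  near=> x; rewrite /= sf//; first by near: x; exact: lt_nbhsr.
  by apply/orP; right; near: x; exact: lt_nbhsr.
have <- := @derive_val _ _ _ _ _ _ _ (df r r0).
by have <- := @derive_val _ _ _ _ _ _ _ d0.
Unshelve. all: by end_near. Qed.

Lemma supp_W a b a' b' f : a' <= a -> b <= b' -> supp a b f -> supp a' b' f.
Proof.
move=> aa bb sf r r0 /orP[h|h]; apply: sf => //; apply/orP; [left|right].
  exact: lt_le_trans aa.
exact: le_lt_trans bb _.
Qed.

Lemma ip_supp a b f g : 0 < a -> cpos f -> cpos g -> supp a b g -> ip (fun r => f r * g r).
Proof.
move=> a0 cf cg sg; apply: (@ip_csupp _ a b) => //; first exact: cposM.
by move=> r r0 h; rewrite sg// mulr0.
Qed.

Lemma IBP0 a b F f : 0 < a -> D1 F f -> cpos f -> supp a b F -> Ip f = 0.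
Proof.
move=> a0 dF cf sF; have sf := supp_D1 dF sF.
have fi : ip f by exact: (ip_csupp (a := a) (b := b)).
rewrite -(subrr (0 : R)).
apply: (@FTC_lim F f 0 0 (fun n => a / n.+2%:R) (fun n => `|b| + n.+1%:R)) => //.
- by move=> n; rewrite divr_gt0// ltr0n.
- rewrite -[X in _ --> X](mulr0 a); apply: cvgM; first exact: cvg_cst.
  by move: (@cvg_harmonic R); rewrite -(cvg_shiftn 1); apply: cvg_trans; apply: near_eq_cvg;
     apply: nearW => n /=; rewrite /harmonic addn1.
- apply: cvg_near_cst; apply: nearW => n; apply: sF; first by rewrite divr_gt0// ltr0n.
  by rewrite ltr_pdivrMr ?ltr0n// ltr_pMr// ltr1n.
- apply/cvgryPge => A; near=> n; rewrite ler_wpDl//.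
  by apply: (@le_trans _ _ n%:R); [near: n; exact: nbhs_infty_ger|rewrite ler_nat].
- apply: cvg_near_cst; apply: nearW => n; apply: sF; first by rewrite ltr_wpDl// ltr0n.
  by rewrite (le_lt_trans (ler_norm b)) ?orbT// ltrDl ltr0n.
Unshelve. all: by end_near. Qed.

(** The flat functions [x^(-n) exp (-1/x)], extended by 0. The family is closed under
    differentiation, the derivative being a combination of the members [n + 1] and [n + 2];
    smoothness follows by induction. *)
Definition ef n x : R := if 0 < x then x^-1 ^+ n * expR (- x^-1) else 0.

Lemma ef_ge0 n x : 0 <= ef n x.
Proof. by rewrite /ef; case: ifP => // x0; rewrite mulr_ge0 ?expR_ge0// exprn_ge0// invr_ge0 ltW. Qed.

(** From [exp y >= (y / m)^m] with [m = n + 2]: two powers of [x] are left over, which makes the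
    derivative at 0 vanish. *)
Lemma ef_le n x : ef n x <= (n.+2%:R ^+ n.+2) * x ^+ 2.
Proof.
rewrite /ef; case: ifPn => [x0|_]; last by rewrite mulr_ge0 ?sqr_ge0// exprn_ge0.
pose m : R := n.+2%:R; have m0 : 0 < m by rewrite ltr0n.
have h : (x^-1 / m) ^+ n.+2 <= expR x^-1.
  have e : x^-1 = n.+2%:R * (x^-1 / m) by rewrite mulrC divfK// gt_eqF.
  have y0 : 0 <= x^-1 / m by rewrite divr_ge0 ?invr_ge0 ?ltW.
  rewrite [leRHS](_ : _ = expR (x^-1 / m) ^+ n.+2); last by rewrite -expRM_natl -e.
  rewrite ler_pXn2r ?nnegrE ?expR_ge0//.
  by apply: le_trans (expR_ge1Dx _); rewrite lerDr.
rewrite expRN ler_pdivrMr ?expR_gt0//.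
apply: (@le_trans _ _ (m ^+ n.+2 * x ^+ 2 * (x^-1 / m) ^+ n.+2)).
  rewrite le_eqVlt; apply/orP; left; apply/eqP; rewrite !exprS exprMn !exprVn; field.
  by rewrite !expf_neq0 ?gt_eqF.
by rewrite ler_wpM2l// mulr_ge0 ?sqr_ge0// exprn_ge0// ltW.
Qed.

Lemma is_derive_flat (f : R -> R) (C : R) : f 0 = 0 -> (forall x, `|f x| <= C * x ^+ 2) -> is_derive (0 : R) (1 : R) f (0 : R).
Proof.
move=> f0 fC.
have h : (fun h : R => h^-1 *: (f (h *: 1 + 0) - f 0)) @ 0^' --> (0 : R).
  apply/norm_cvg0P; apply: (@squeeze_cvgr _ _ _ _ (fun=> 0) (fun h => C * `|h|)).
  - near=> x; have x0 : x != 0 by near: x; exact: nbhs_dnbhs_neq.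
    rewrite normr_ge0 /= f0 subr0 addr0 /GRing.scale /= mulr1 normrM normfV mulrC ler_pdivrMr ?normr_gt0//.
    by rewrite -mulrA -expr2 real_normK ?num_real.
  - exact: cvg_cst.
  - rewrite -[X in _ --> X](mulr0 C); apply: cvgM; first exact: cvg_cst.
    by rewrite -[X in _ --> X](@normr0 _ R); apply: (@cvg_norm _ _ _ _ _ id); apply: cvg_within_filter; exact: cvg_id.
by apply: DeriveDef; [apply/cvg_ex; exists 0|exact: cvg_lim h].
Unshelve. all: by end_near. Qed.

Lemma ef_derive n x : is_derive x 1 (ef n) (- n%:R * ef n.+1 x + ef n.+2 x).
Proof.
have [x0|x0|->] := ltgtP x 0.
- rewrite {2 3}/ef ltNge (ltW x0)/= mulr0 addr0.
  apply: (near_eq_is_derive _ (is_derive_cst (0 : R) x 1)).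
  near=> y; rewrite /ef ltNge ltW//; near: y; exact: lt_nbhsl.
- rewrite {2 3}/ef x0.
  have hn : forall y, 0 < y -> is_derive y 1 (fun r : R => r^-1 ^+ n * expR (- r^-1))
      (- n%:R * (y^-1 ^+ n.+1 * expR (- y^-1)) + y^-1 ^+ n.+2 * expR (- y^-1)).
    have dV : D1 (fun r : R => r^-1) (fun r => - 1 / r ^+ 2).
      by apply: D1V (@D1_id) => r r0; rewrite gt_eqF.
    have dE : D1 (fun r : R => expR (- r^-1)) (fun r => expR (- r^-1) * (- (- 1 / r ^+ 2))).
      by apply: (D1_comp (h := expR) (h' := expR)); exact: D1N.
    have dX : D1 (fun r : R => r^-1 ^+ n) (fun r => - n%:R * r^-1 ^+ n.+1).
      case: (n) => [|m]; first by apply: D1_ext (@D1_cst 1) => r _; rewrite ?expr0 ?oppr0 ?mul0r.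
      apply: D1_ext (D1X m dV) => // r r0; rewrite !exprS; field; rewrite !gt_eqF// ?exprn_gt0//.
    suff h : D1 (fun r : R => r^-1 ^+ n * expR (- r^-1))
      (fun y => - n%:R * (y^-1 ^+ n.+1 * expR (- y^-1)) + y^-1 ^+ n.+2 * expR (- y^-1)) by [].
    apply: D1_ext (D1M dX dE) => // r r0; move: (expR _) => E.
    by rewrite !exprS; move: (r^-1 ^+ n) => X; field; rewrite gt_eqF.
  apply: (near_eq_is_derive _ (hn x x0)).
  by near=> y; rewrite /ef ifT//; near: y; exact: lt_nbhsr.
- rewrite {2 3}/ef ltxx mulr0 addr0; apply: (@is_derive_flat _ (n.+2%:R ^+ n.+2)).
    by rewrite /ef ltxx.
  by move=> y; rewrite ger0_norm ?ef_ge0// ef_le.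
Unshelve. all: by end_near. Qed.

Lemma ef_smooth n (c d : R) : smooth (fun r => ef n (c * r + d)).
Proof.
move=> m; elim: m n => [|m IH] n; have dn : D1 (fun r => ef n (c * r + d))
  (fun r => (- n%:R * ef n.+1 (c * r + d) + ef n.+2 (c * r + d)) * c).
- apply: (D1_comp (h := ef n) (h' := fun x => - n%:R * ef n.+1 x + ef n.+2 x)); first by move=> r _; exact: ef_derive.
  by apply: D1_ext (D1D (D1Z c (@D1_id)) (@D1_cst d)) => // r _; rewrite mulr1 addr0.
- exact: D1_cpos dn.
- apply: (D1_comp (h := ef n) (h' := fun x => - n%:R * ef n.+1 x + ef n.+2 x)); first by move=> r _; exact: ef_derive.
  by apply: D1_ext (D1D (D1Z c (@D1_id)) (@D1_cst d)) => // r _; rewrite mulr1 addr0.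
- exists (fun r => (- n%:R * ef n.+1 (c * r + d) + ef n.+2 (c * r + d)) * c) => //.
  by apply: SmM; [apply: SmD; [apply: SmM; [exact: Sm_cst|exact: IH]|exact: IH]|exact: Sm_cst].
Qed.

(** A smooth bump on []a, b[] whose parameter [k] sharpens it: [exp (-1/(k y))] tends to 1 for
    [y > 0], so the bumps converge to the indicator function of the open interval. *)
Definition bp k a b r : R := ef 0 (k * r + - (k * a)) * ef 0 (- k * r + k * b).

Lemma bp_ge0 k a b r : 0 <= bp k a b r.
Proof. by rewrite mulr_ge0 ?ef_ge0. Qed.

Lemma ef0E x : 0 < x -> ef 0 x = expR (- x^-1).
Proof. by move=> x0; rewrite /ef x0 expr0 mul1r. Qed.

Lemma ef0_le1 x : ef 0 x <= 1.
Proof.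
have [x0|x0] := ltP 0 x; last by rewrite /ef ltNge x0.
by rewrite ef0E// -expR0 ler_expR oppr_le0 invr_ge0 ltW.
Qed.

Lemma bp_le1 k a b r : bp k a b r <= 1.
Proof. by rewrite -(mulr1 1); apply: ler_pM; rewrite ?ef_ge0 ?ef0_le1. Qed.

Lemma bpE k a b r : bp k a b r = ef 0 (k * (r - a)) * ef 0 (k * (b - r)).
Proof. by rewrite /bp; congr (ef _ _ * ef _ _); ring. Qed.

Lemma bp_gt0 k a b r : 0 < k -> a < r -> r < b -> 0 < bp k a b r.
Proof. by move=> k0 ar rb; rewrite bpE !ef0E ?mulr_gt0 ?subr_gt0 ?expR_gt0. Qed.

Lemma bp_out k a b r : 0 < k -> (r <= a) || (b <= r) -> bp k a b r = 0.
Proof.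
move=> k0 h; rewrite bpE /ef !pmulr_rgt0// !subr_gt0 !ltNge.
by case/orP: h => -> /=; rewrite ?mul0r ?mulr0.
Qed.

Lemma bp_supp k a b : 0 < k -> supp a b (bp k a b).
Proof. by move=> k0 r r0 h; apply: bp_out => //; case/orP: h => /ltW ->; rewrite ?orbT. Qed.

Lemma bp_smooth k a b : smooth (bp k a b).
Proof. by apply: smoothM; exact: ef_smooth. Qed.

Lemma bp_T1 k a b : 0 < k -> 0 < a -> T1 a b (bp k a b).
Proof. by move=> k0 a0; split => //; [exact: bp_smooth|exact: bp_supp]. Qed.

Lemma bp_cvg a b r : bp n.+1%:R a b r @[n --> \oo] --> (((a < r) && (r < b))%:R : R).
Proof.
have [/andP[ar rb]|h] := boolP ((a < r) && (r < b)); last first.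
  apply: cvg_near_cst; apply: nearW => n; apply: bp_out; first by rewrite ltr0n.
  by move: h; rewrite negb_and -!leNgt.
have key (y : R) : 0 < y -> ef 0 (n.+1%:R * y) @[n --> \oo] --> (1 : R).
  move=> y0; rewrite -[X in _ --> X](@expR0 R).
  rewrite (_ : (fun n => ef 0 (n.+1%:R * y)) = (fun n => expR (- (n.+1%:R^-1 * y^-1)))); last first.
    by apply/funext => n; rewrite ef0E ?mulr_gt0 ?ltr0n// invfM.
  apply: (@cvg_comp _ _ _ (fun n => - (n.+1%:R^-1 * y^-1)) expR _ (nbhs (0 : R))); last exact: continuous_expR.
  rewrite -oppr0 -[X in - X](mul0r y^-1); apply: cvgN; apply: cvgM; [exact: cvg_harmonic|exact: cvg_cst].
rewrite -[X in _ --> X](mulr1 (1 : R)).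
under eq_fun do rewrite bpE.
by apply: cvgM; apply: key; rewrite subr_gt0.
Qed.

Lemma T1_W a b a' b' f : 0 < a' -> a' <= a -> b <= b' -> T1 a b f -> T1 a' b' f.
Proof. by move=> a0 aa bb [_ h1 h2]; split => //; exact: supp_W h2. Qed.

Lemma T1_lin a b f g k (l : R) : T1 a b f -> T1 a b g -> T1 a b (fun r => k * f r + l * g r).
Proof.
move=> [a0 f1 f2] [_ g1 g2]; split => //.
  by apply: smoothD; apply: smoothM => //; exact: smooth_cst.
by move=> r r0 h; rewrite f2// g2// !mulr0 addr0.
Qed.

Lemma fund1_le f : cpos f -> (forall a b e, T1 a b e -> Ip (fun r => f r * e r) = 0) ->
  forall r, 0 < r -> f r <= 0.
Proof.
move=> cf h r r0; rewrite leNgt; apply/negP => fr.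
have [d /= d0 hd] : \forall x \near r, 0 < f x by exact: (cvgr_gt _ (cf r r0)).
pose e : R := Num.min d (r / 2).
have e0 : 0 < e by rewrite lt_min; apply/andP; split => //; rewrite divr_gt0.
have ed : e <= d by rewrite ge_min lexx.
have er : e <= r / 2 by rewrite ge_min lexx orbT.
have a0 : 0 < r - e by lra.
have tb := bp_T1 (r + e) (@ltr01 R) a0; have [_ sb ub] := tb.
have cb := smooth_cpos sb.
have : 0 < Ip (fun x => f x * bp 1 (r - e) (r + e) x).
  apply: (@Ip_gt0 _ r) => //; first exact: cposM.
  - exact: ip_supp ub.
  - move=> t t0; have [ht|ht] := ltP `|r - t| e.
      by rewrite mulr_ge0 ?bp_ge0// ltW// hd//= (lt_le_trans ht).
    rewrite bp_out ?mulr0//; move: ht; rewrite ler_normr => /orP[] ht; apply/orP; [left|right]; lra.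
  - by rewrite gt_eqF// mulr_gt0// bp_gt0//; lra.
by rewrite (h _ _ _ tb) ltxx.
Qed.

Lemma fund1 f : cpos f -> (forall a b e, T1 a b e -> Ip (fun r => f r * e r) = 0) ->
  forall r, 0 < r -> f r = 0.
Proof.
move=> cf h r r0; apply/eqP; rewrite eq_le fund1_le//= -oppr_le0.
apply: (@fund1_le (fun r => - f r)) => //; first exact: cposN.
move=> a b e te; rewrite -[RHS]oppr0 -(h _ _ _ te) -RintN_all.
by apply: eq_RintD => x _; rewrite mulNr.
Qed.

Lemma exists_bump a b : 0 < a -> a < b ->
  exists e, [/\ T1 a b e, (forall t, 0 <= e t) & 0 < Ip e].
Proof.
move=> a0 ab; have te := bp_T1 b (@ltr01 R) a0; have [_ se ue] := te; have ce := smooth_cpos se.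
exists (bp 1 a b); split => //; first by move=> t; exact: bp_ge0.
have m0 : a < (a + b) / 2 by lra.
apply: (@Ip_gt0 _ ((a + b) / 2)) => //.
- exact: (ip_csupp ce a0 ue).
- by move=> t _; exact: bp_ge0.
- exact: lt_trans a0 m0.
- by rewrite gt_eqF// bp_gt0//; lra.
Qed.

Lemma in_pos (r : R) : pos r <-> 0 < r.
Proof.
split; first exact: pos_gt0.
by move=> r0; change (is_true (r \in `]0, +oo[)); rewrite in_itv /= r0.
Qed.

Lemma ip_T1 a b e : T1 a b e -> ip e.
Proof. by move=> [a0 se ue]; apply: (ip_csupp (smooth_cpos se) a0 ue). Qed.

Lemma T1M a b e g : T1 a b e -> smooth g -> T1 a b (fun r => e r * g r).
Proof.
by move=> [a0 se ue] sg; split => //; [exact: smoothM|move=> r r0 h; rewrite ue// mul0r].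
Qed.

Lemma prim_const0 f r : (forall t, 0 < t -> t <= r -> f t = 0) -> prim f r = 0.
Proof.
move=> h; rewrite prim_restr -[RHS](Rint_cst0 leb mpos); apply: eq_RintD => t /in_pos t0.
by rewrite /patch; case: ifPn => //; rewrite inE /= in_itv /= => /andP[_ tr]; exact: h.
Qed.

Lemma prim_full f r : (forall t, 0 < t -> r < t -> f t = 0) -> prim f r = Ip f.
Proof.
move=> h; rewrite prim_restr; apply: eq_RintD => t /in_pos t0; rewrite /patch; case: ifPn => // tr.
rewrite h// ltNge; apply: contra tr => tr; by rewrite inE /= in_itv /= t0.
Qed.

(** The product of the two primitives is bounded, vanishes at the origin and tends to [Ip f * Ip g]
    at infinity. *)
Lemma prim_ibp f g : cpos f -> ip f -> cpos g -> ip g ->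
  [/\ ip (fun r => f r * prim g r), ip (fun r => prim f r * g r) &
      Ip (fun r => f r * prim g r) + Ip (fun r => prim f r * g r) = Ip f * Ip g].
Proof.
move=> cf fi cg gi; have df := prim_D1 cf fi; have dg := prim_D1 cg gi.
have pb (k : R -> R) r : ip k -> 0 < r -> `|prim k r| <= Ip (fun x => `|k x|).
  move=> ki r0; have mr : @measurable _ mR `]0, r] by exact: measurable_itv.
  have ka := igabs mpos ki; apply: (@le_trans _ _ (prim (fun x => `|k x|) r)); last exact: prim_le_Ip.
  by apply: abs_Rint => //; exact: ip_oseg.
have c1 : cpos (fun r => f r * prim g r) by apply: cposM => //; exact: D1_cpos dg.
have c2 : cpos (fun r => prim f r * g r) by apply: cposM => //; exact: D1_cpos df.
have i1 : ip (fun r => f r * prim g r).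
  apply: (ig_dom mpos (cpos_meas c1) (igZ mpos (Ip (fun x => `|g x|)) (igabs mpos fi))) => r /in_pos r0.
  by rewrite normrM mulrC ler_wpM2r// pb.
have i2 : ip (fun r => prim f r * g r).
  apply: (ig_dom mpos (cpos_meas c2) (igZ mpos (Ip (fun x => `|f x|)) (igabs mpos gi))) => r /in_pos r0.
  by rewrite normrM ler_wpM2r// pb.
split => //; rewrite -RintegralD//; have i3 := igD mpos i1 i2.
have lim : prim f x * prim g x @[x --> 0^'+] --> (0 : R).
  by rewrite -[X in _ --> X](mul0r 0); apply: cvgM; exact: prim_cvg0.
have lim2 : prim f r * prim g r @[r --> +oo] --> Ip f * Ip g by apply: cvgM; exact: prim_cvgy.
have lim3 : prim (fun r => f r * prim g r + prim f r * g r) r @[r --> +oo] --> Ip f * Ip g.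
  apply: cvg_trans lim2; apply: near_eq_cvg; near=> r.
  apply: (prim_uniq (D1M df dg) (cposD c1 c2) i3 lim).
  by near: r; exact: nbhs_pinfty_gt.
exact: (cvg_unique _ (prim_cvgy i3) lim3).
Unshelve. all: by end_near. Qed.

Lemma T1_prim a b e : T1 a b e -> Ip e = 0 -> T1 a b (prim e).
Proof.
move=> te e0; have [a0 se ue] := te; have ie := ip_T1 te; split => //; first exact: smooth_prim.
move=> r r0 /orP[ra|br].
  by apply: prim_const0 => t t0 tr; rewrite ue// (le_lt_trans tr ra).
by rewrite prim_full// => t t0 rt; rewrite ue// (lt_trans br rt) orbT.
Qed.

Lemma ibp_T1 a b F f z z' : D1 F f -> cpos f -> T1 a b z -> D1 z z' ->
  Ip (fun r => F r * z' r) = - Ip (fun r => f r * z r).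
Proof.
move=> dF cf [a0 sz uz] dz; have cz := smooth_cpos sz; have cz' := smooth_cpos (smooth_D1 sz dz).
have cF := D1_cpos dF; have i1 : ip (fun r => f r * z r) by exact: ip_supp uz.
have i2 : ip (fun r => F r * z' r) by apply: ip_supp (supp_D1 dz uz).
have : Ip (fun r => f r * z r + F r * z' r) = 0.
  apply: (@IBP0 a b (fun r => F r * z r)) => //; first exact: D1M.
    by apply: cposD; exact: cposM.
  by move=> r r0 h; rewrite uz// mulr0.
by rewrite RintegralD// => /eqP; rewrite addr_eq0 => /eqP ->; rewrite opprK.
Qed.

(** A linear form that vanishes on the kernel of integration against [g] is a multiple of that
    integration. A fixed bump [e] determines the factor, and [w - k e] lies in the kernel for the
    right [k]. *)
Lemma form_multiple (L : (R -> R) -> R) g : smooth g -> (forall r, 0 < r -> 0 < g r) ->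
  (forall a b w z k l, a < b -> T1 a b w -> T1 a b z -> L (fun r => k * w r + l * z r) = k * L w + l * L z) ->
  (forall a b w, a < b -> T1 a b w -> Ip (fun r => w r * g r) = 0 -> L w = 0) ->
  exists c, forall a b w, T1 a b w -> L w = c * Ip (fun r => w r * g r).
Proof.
move=> sg g0 lin ker; have te := bp_T1 2 (@ltr01 R) (@ltr01 R); set e := bp 1 1 2 in te.
have cg := smooth_cpos sg; have [_ se _] := te.
have E0 : 0 < Ip (fun r => e r * g r).
  apply: (@Ip_gt0 _ (3 / 2)) => //.
  - by apply: cposM => //; exact: smooth_cpos.
  - exact: ip_T1 (T1M te sg).
  - by move=> t t0; rewrite mulr_ge0 ?bp_ge0// ltW// g0.
  - by rewrite gt_eqF// mulr_gt0 ?g0//; apply: bp_gt0; lra.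
exists (L e / Ip (fun r => e r * g r)) => a b w tw; have a0 : 0 < a by case: tw.
(* Linearity is assumed for tests with a common support interval, so the intervals of [w] and of [e]
   are merged. *)
have m0 : 0 < Num.min a 1 by rewrite lt_min a0 ltr01.
have mm : Num.min a 1 < Num.max b 2 by rewrite gt_min !lt_max ltr1n !orbT.
have t1 : T1 (Num.min a 1) (Num.max b 2) w by apply: T1_W tw; rewrite ?ge_min ?le_max ?lexx.
have t2 : T1 (Num.min a 1) (Num.max b 2) e by apply: T1_W te; rewrite ?ge_min ?le_max ?lexx ?orbT.
pose k := Ip (fun r => w r * g r) / Ip (fun r => e r * g r).
have := ker _ _ _ mm (T1_lin 1 (- k) t1 t2); rewrite (lin _ _ _ _ _ _ mm t1 t2) => h.
have [_ Iz] := ig2 mpos 1 (- k) (ip_T1 (T1M t1 sg)) (ip_T1 (T1M t2 sg)).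
have /h/eqP : Ip (fun r => (1 * w r + - k * e r) * g r) = 0.
  transitivity (Ip (fun r => 1 * (w r * g r) + - k * (e r * g r))); first by apply: eq_RintD => r _; ring.
  by rewrite Iz /k; field; rewrite gt_eqF.
by rewrite mul1r mulNr subr_eq0 => /eqP ->; rewrite /k; field; rewrite gt_eqF.
Qed.

(** The lemma of du Bois-Reymond: a test with zero integral is the derivative of the test given by
    its primitive. *)
Lemma orth_deriv f : (forall a b w, a < b -> T1 a b w -> ip (fun r => f r * w r)) ->
  (forall a b w w', a < b -> T1 a b w -> D1 w w' -> Ip (fun r => f r * w' r) = 0) ->
  exists c, forall a b w, a < b -> T1 a b w -> Ip (fun r => (f r - c) * w r) = 0.
Proof.
move=> fi h; have one (w : R -> R) : Ip (fun r => w r * 1) = Ip w by apply: eq_RintD => r _; rewrite mulr1.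
have [||||c hc] := @form_multiple (fun w => Ip (fun r => f r * w r)) (fun=> 1).
- exact: smooth_cst.
- by [].
- move=> a b w z k l ab tw tz; have [_ <-] := ig2 mpos k l (fi _ _ _ ab tw) (fi _ _ _ ab tz).
  by apply: eq_RintD => r _; ring.
- move=> a b w ab tw; rewrite one => w0; have [_ sw _] := tw.
  exact: h ab (T1_prim tw w0) (prim_D1 (smooth_cpos sw) (ip_T1 tw)).
exists c => a b w ab tw; have [_ E] := ig2 mpos 1 (- c) (fi _ _ _ ab tw) (ip_T1 tw).
transitivity (Ip (fun r => 1 * (f r * w r) + - c * w r)); first by apply: eq_RintD => r _; ring.
by rewrite E (hc _ _ _ tw) one; ring.
Qed.

(** No integrability near 0 is available, so the primitive is based at the point 1. *)
Lemma exists_prim f : cpos f -> exists F, D1 F f.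
Proof.
move=> cf; pose P (c r : R) := \int[leb]_(x in `[c, r]) f x.
have dP (c r : R) : 0 < c -> c < r -> is_derive r 1 (P c) (f r).
  move=> c0 cr; have rr : r < r + 1 by rewrite ltrDl.
  have [d e] := @continuous_FTC1_closed R f c r (r + 1) rr (cpos_ig_seg _ cf c0) cr (cf r (lt_trans c0 cr)).
  by apply: (@DeriveDef _ _ _ _ _ _ _ d); rewrite -derive1E.
have ad (c d r : R) : 0 < c -> c <= d -> d <= r -> P c r - P c d = P d r.
  move=> c0 cd dr; rewrite /P (@Rintegral_itvB _ f (BLeft c) (BRight r) d).
  - rewrite Rintegral_itv_obnd_cbnd//.
    apply: (@cpos_igS f d r _ cf (lt_le_trans c0 cd)); first exact: measurable_itv.
    by move=> x /=; rewrite !in_itv/= => /andP[/ltW -> ->].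
  - exact: cpos_ig_seg.
  - by rewrite bnd_simp.
  - by rewrite bnd_simp.
exists (fun r => if 1 <= r then P 1 r else - P r 1) => r r0.
(* A base point below both [r] and 1: near [r] both branches of the definition equal
   [P c x - P c 1]. *)
pose c : R := Num.min r 1 / 2.
have m0 : 0 < Num.min r 1 by rewrite lt_min; apply/andP.
have c0 : 0 < c by rewrite divr_gt0.
have mr : Num.min r 1 <= r by rewrite ge_min lexx.
have m1 : Num.min r 1 <= 1 by rewrite ge_min lexx orbT.
have cm : c < Num.min r 1 by rewrite /c; lra.
have cr : c < r by exact: lt_le_trans mr.
have c1 : c <= 1 by rewrite ltW// (lt_le_trans cm).
have h : is_derive r 1 (fun x => P c x - P c 1) (f r).
  by rewrite -[f r]subr0; apply: is_deriveB; exact: dP.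
apply: (near_eq_is_derive _ h); near=> x.
have cx : c <= x by rewrite ltW//; near: x; exact: lt_nbhsr.
have [x1|x1] := leP 1 x; first by rewrite ad.
by rewrite -(@ad c x 1) ?opprB// ltW.
Unshelve. all: by end_near. Qed.

(* The equation is tested with [v] such that [r^2 v'] is an arbitrary test function [z] with
   [\int z / r^2 = 0]; hence [u] minus a double primitive of the right-hand side is [A + B / r]. *)
Lemma weak_ode u h : cpos u -> cpos h ->
  (forall a b v v1 v2, T1 a b v -> D1 v v1 -> D1 v1 v2 ->
     Ip (fun r => u r * (2 * r * v1 r + r ^+ 2 * v2 r)) = Ip (fun r => h r * v r)) ->
  exists u' u'', [/\ D1 u u', D1 u' u'', cpos u'' & D1 (fun r => r ^+ 2 * u' r) h].
Proof.
move=> cu ch hu.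
have dr2 : D1 (fun r : R => r ^+ 2) (fun r => 2 * r).
  by apply: D1_ext (D1X 1 (@D1_id)) => // r _; rewrite expr1 mulr1.
have sV2 : smooth (fun r : R => (r ^+ 2)^-1).
  by apply: smoothV; [move=> r r0; rewrite gt_eqF// exprn_gt0|exact: smoothX smooth_id].
have dV : D1 (fun r : R => - r^-1) (fun r => (r ^+ 2)^-1).
  apply: D1_ext (D1N (D1V _ (@D1_id))) => // [r r0|r r0]; last by rewrite gt_eqF.
  by rewrite mulNr opprK mul1r.
have [H dH] := exists_prim ch; have cH := D1_cpos dH.
have [K dK] := exists_prim (cposM cH (smooth_cpos sV2)); have cK := D1_cpos dK.
pose f r := u r - K r; have cf : cpos f by exact: cposB.
have iT g a b w : cpos g -> T1 a b w -> ip (fun r => g r * w r).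
  by move=> cg [a0 sw uw]; apply: ip_supp uw => //; exact: smooth_cpos.
have T1d a b w w' : T1 a b w -> D1 w w' -> T1 a b w'.
  by move=> [a0 sw uw] dw; split => //; [exact: smooth_D1 dw|exact: supp_D1 uw].
have key a b z z' : T1 a b z -> D1 z z' -> Ip (fun r => z r * (r ^+ 2)^-1) = 0 -> Ip (fun r => f r * z' r) = 0.
  move=> tz dz z0; have tw := T1M tz sV2; have tv := T1_prim tw z0.
  have [_ sw _] := tw; have dv := prim_D1 (smooth_cpos sw) (ip_T1 tw).
  have dV2 : D1 (fun r : R => (r ^+ 2)^-1) (fun r => - 2 / r ^+ 3).
    apply: D1_ext (D1V _ dr2) => // [r r0|r r0]; last by rewrite gt_eqF// exprn_gt0.
    by field; rewrite gt_eqF.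
  have dw := D1M dz dV2; have tz' := T1d _ _ _ _ tz dz.
  have := hu _ _ _ _ _ tv dv dw; rewrite -[RHS]opprK -(ibp_T1 dH ch tv dv).
  rewrite (@eq_RintD _ _ _ leb pos _ (fun r => u r * z' r)); last first.
    by move=> r /pos_gt0 r0; field; rewrite gt_eqF.
  have := ibp_T1 dK (cposM cH (smooth_cpos sV2)) tz dz.
  rewrite (@eq_RintD _ _ _ leb pos (fun r => _ * z r) (fun r => H r * (z r * (r ^+ 2)^-1))); last by move=> r _; ring.
  move=> <- e4; have [_ eg] := ig2 mpos 1 (-1) (iT _ _ _ _ cu tz') (iT _ _ _ _ cK tz').
  transitivity (Ip (fun r => 1 * (u r * z' r) + -1 * (K r * z' r))).
    by apply: eq_RintD => r _; rewrite /f; ring.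
  by rewrite eg e4 mul1r mulN1r subrr.
have der w w' : D1 w w' -> Ip (fun r => f r * derive1 w r) = Ip (fun r => f r * w' r).
  move=> dw; apply: eq_RintD => r /pos_gt0 r0; rewrite derive1E.
  by have /@derive_val -> := dw r r0.
(* The form [w |-> Ip (f w')] vanishes when [w / r^2] has zero integral, hence equals
   [B * Ip (w / r^2)]: weakly, [f' = - B / r^2]. *)
have [|||B hB] := @form_multiple (fun w => Ip (fun r => f r * derive1 w r)) _ sV2.
- by move=> r r0; rewrite invr_gt0 exprn_gt0.
- move=> a b w z k l _ tw tz; have [_ sw _] := tw; have [_ sz _] := tz.
  have [w' dw _] := smooth_deriv sw; have [z' dz _] := smooth_deriv sz.
  rewrite (der _ _ dw) (der _ _ dz) (der _ _ (D1D (D1Z k dw) (D1Z l dz))).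
  have [_ <-] := ig2 mpos k l (iT _ _ _ _ cf (T1d _ _ _ _ tw dw)) (iT _ _ _ _ cf (T1d _ _ _ _ tz dz)).
  by apply: eq_RintD => r _; ring.
- move=> a b w _ tw w0; have [_ sw _] := tw; have [w' dw _] := smooth_deriv sw.
  by rewrite (der _ _ dw); exact: key tw dw w0.
have cg : cpos (fun r => f r + B * - r^-1).
  by apply: cposD => //; apply: cposM; [exact: cpos_cst|exact: D1_cpos dV].
(* After subtracting [B / r] the weak derivative is 0, and what remains is the constant [A]. *)
have [||A hA] := @orth_deriv (fun r => f r + B * - r^-1).
- by move=> a b w _; exact: iT.
- move=> a b w w' _ tw dw; have tw' := T1d _ _ _ _ tw dw.
  have [_ E] := ig2 mpos 1 B (iT _ _ _ _ cf tw') (iT _ _ _ _ (D1_cpos dV) tw').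
  transitivity (Ip (fun r => 1 * (f r * w' r) + B * (- r^-1 * w' r))); first by apply: eq_RintD => r _; ring.
  rewrite E (ibp_T1 dV (smooth_cpos sV2) tw dw) -(der _ _ dw) (hB _ _ _ tw).
  rewrite (@eq_RintD _ _ _ leb pos (fun r => (r ^+ 2)^-1 * _) (fun r => w r * (r ^+ 2)^-1)); last by move=> r _; ring.
  by rewrite mul1r mulrN subrr.
have hAB r : 0 < r -> u r - K r = A + B * r^-1.
  move=> r0; have : f r + B * - r^-1 - A = 0.
    apply: (fund1 (cposB cg (@cpos_cst A)) _ r0) => a b e te; have [a0 _ _] := te.
    have te' : T1 a (Num.max b (a + 1)) e by apply: T1_W te; rewrite ?le_max ?lexx.
    by apply: hA te'; rewrite lt_max ltrDl ltr01 orbT.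
  by rewrite /f mulrN; move: (B * r^-1) => t; lra.
pose u' r := H r * (r ^+ 2)^-1 - B * (r ^+ 2)^-1.
have du : D1 u u'.
  apply: D1_ext (D1D dK (D1D (@D1_cst A) (D1Z (- B) dV))) => // r r0.
    by rewrite mulrNN -hAB// addrC subrK.
  by rewrite add0r mulNr.
have [V2 dV2 sV2'] := smooth_deriv sV2.
pose u'' r := (h r * (r ^+ 2)^-1 + H r * V2 r) - B * V2 r.
exists u', u''; split => //.
- by apply: D1B; [exact: D1M|exact: D1Z].
- by apply: cposB; [apply: cposD; apply: cposM => //; exact: smooth_cpos|apply: cposM; [exact: cpos_cst|exact: smooth_cpos]].
- apply: D1_ext (D1B dH (@D1_cst B)) => r r0; last by rewrite subr0.
  by rewrite /u' mulrBr mulrCA (mulrCA _ B) mulfV ?mulr1// gt_eqF// exprn_gt0.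
Qed.

End SmoothHalf.

(** * Dilations and the minimax level *)

Section Level.
Variable p : R.
Hypothesis p2 : 2 < p.
Hypothesis p5 : p < 5.
Implicit Types (U V : R -> R) (a b r s t A C E M : R).
Local Notation Pf := (Pf p).
Local Notation fD := (fD p).

Definition PP U U' s := Pf (Ip (fA U')) (Ip (fC U)) U s.

Lemma q_gt1' : 1 < qexp p.
Proof. exact: q_gt1. Qed.

Lemma p10 : 0 < p + 1.
Proof. by have := p2; lra. Qed.

Section Scale.
Variables (U U' : R -> R) (t : R).
Hypothesis KU : Kp U U'.
Hypothesis t0 : 0 < t.
Let V r := t ^+ 2 * U (t * r).
Let V' r := t ^+ 3 * U' (t * r).

Let t3_gt0 : 0 < t ^+ 3. Proof. exact: exprn_gt0. Qed.

Lemma scale_fA r : fA V' r = t ^+ 4 * fA U' (t * r).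
Proof. by rewrite /fA /V'; ring. Qed.
Lemma scale_fC r : fC V r = t ^+ 2 * fC U (t * r).
Proof. by rewrite /fC /V; ring. Qed.

Lemma scale_q s : 0 < s -> (t ^+ 3 * s) `^ qexp p = t `^ (2 * p) * t^-1 * s `^ qexp p.
Proof.
move=> s0; rewrite powRM ?(ltW t3_gt0) ?(ltW s0)// -powR_mulrn ?(ltW t0)// -powRrM.
have -> : 3%:R * qexp p = 2 * p + (- 1) by rewrite /qexp mulrCA mulfV ?mulr1.
by rewrite powRD ?(gt_eqF t0) ?implybT// powR_inv1 ?(ltW t0).
Qed.

Lemma scale_fD r : fD V r = t `^ (2 * p) * fD U (t * r).
Proof.
rewrite /fD /V normrM ger0_norm ?sqr_ge0//; move: `|U _| (normr_ge0 (U (t * r))) => y y0.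
rewrite powRM ?sqr_ge0// exprMn -powR_mulrn ?(ltW t0)// -powRrM.
have -> : 2 * (p + 1) = 2 * p + 2 :> R by ring.
have -> : t `^ (2 * p + 2) = t `^ (2 * p) * t `^ 2 by rewrite powRD// (gt_eqF t0) implybT.
by ring.
Qed.

Lemma Kp_scale : Kp V V' /\ (Ip (fA V') = t ^+ 3 * Ip (fA U') /\ Ip (fC V) = t * Ip (fC U)).
Proof.
have [dU cU' iA iC] := KU; have cU := D1_cpos dU.
have cA : cpos (fA U') by exact: cpos_fC.
have cC : cpos (fC U) by exact: cpos_fC.
have [iA1 iA2] := ip_scale cA iA t0; have [iC1 iC2] := ip_scale cC iC t0.
have eA : fA V' = fun r => t ^+ 4 * fA U' (t * r) by apply/funext => r; exact: scale_fA.
have eC : fC V = fun r => t ^+ 2 * fC U (t * r) by apply/funext => r; exact: scale_fC.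
split.
  split.
  - apply: D1_ext (D1Z (t ^+ 2) (D1_scale t0 dU)) => // r r0.
    by rewrite /V' mulrA -exprSr.
  - by apply: cposM; [exact: cpos_cst|exact: cpos_scale].
  - by rewrite eA; apply: igZ.
  - by rewrite eC; apply: igZ.
rewrite eA eC !RintZ// iA2 iC2 !mulrA; split; congr (_ * _).
- by rewrite exprSr -mulrA mulfV ?mulr1// gt_eqF.
- by rewrite expr2 -mulrA mulfV ?mulr1// gt_eqF.
Qed.

Lemma scale_mass r : 0 < r -> mass V r = t * mass U (t * r).
Proof.
move=> r0; have [dU cU' iA iC] := KU; have cU := D1_cpos dU.
have [[dV _ _ iCV] _] := Kp_scale; have cV := D1_cpos dV.
rewrite /mass; symmetry; apply: (@prim_uniq (fun x => t * mass U (t * x))) => //.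
- apply: D1_ext (D1Z t (D1_scale t0 (mass_D1 cU iC))) => // x x0.
  by rewrite scale_fC mulrA -expr2.
- exact: cpos_fC.
- rewrite -[X in _ --> X](mulr0 t); apply: cvgM; first exact: cvg_cst.
  apply/cvg_at_rightP => u [u0 uu]; move/cvg_at_rightP : (prim_cvg0 iC); apply; split.
    by move=> n; rewrite mulr_gt0.
  by rewrite -[X in _ --> X](mulr0 t); apply: cvgM => //; exact: cvg_cst.
Qed.

(** The dilation multiplies the gradient, mass and nonlinear integrals by [t^3], [t] and
    [t^(2 p - 1)], while the field energy becomes [t^-3] times that of [t^3] times the mass. These
    are exactly the powers of [s] in [Pf]. *)
Lemma scale_PP s : 0 < s -> PP V V' s = PP U U' (t ^+ 3 * s).
Proof.
move=> s0; have [dU cU' iA iC] := KU; have cU := D1_cpos dU.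
have [[dV _ _ iCV] [eA eC]] := Kp_scale; have cV := D1_cpos dV.
have h1 : s * (t ^+ 3 * Ip (fA U')) = t ^+ 3 * s * Ip (fA U') by rewrite mulrCA mulrA.
have h2 : s `^ 3^-1 * (t * Ip (fC U)) = (t ^+ 3 * s) `^ 3^-1 * Ip (fC U).
  rewrite powRM ?(ltW t3_gt0) ?(ltW s0)// -powR_mulrn ?(ltW t0)// -powRrM mulfV ?pnatr_eq0//.
  by rewrite powRr1 ?(ltW t0)// mulrCA mulrA.
have h3 : EB V s = EB U (t ^+ 3 * s).
  rewrite /EB (_ : Ip (fB V s) = Ip (fun r => t ^- 2 * fB U (t ^+ 3 * s) (t * r))); last first.
    apply: eq_RintD => r /pos_gt0 r0; rewrite /fB /bif scale_mass// mulrBr.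
    congr (_ - _); last by rewrite exprMn mulrA mulVf ?mul1r// expf_neq0// gt_eqF.
    rewrite -[t ^- 2]ger0_norm ?invr_ge0 ?sqr_ge0// -sqrtr_sqr -sqrtrM ?sqr_ge0//.
    move: (mass U _) => mm.
    by congr Num.sqrt; field; rewrite gt_eqF.
  have cB : cpos (fB U (t ^+ 3 * s)) by exact: cpos_fB.
  have iB : ip (fB U (t ^+ 3 * s)) by apply: ip_fB => //; rewrite mulr_ge0 ?ltW.
  have [iB1 iB2] := ip_scale cB iB t0.
  rewrite RintZ// iB2; move: (Ip _) => I; field; by rewrite !gt_eqF.
have h4 : s `^ qexp p * Ip (fD V) = (t ^+ 3 * s) `^ qexp p * Ip (fD U).
  have -> : Ip (fD V) = Ip (fun r => t `^ (2 * p) * fD U (t * r)).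
    by apply: eq_RintD => r _; exact: scale_fD.
  have E0 : 0 <= EE U U' by rewrite addr_ge0 ?IpA_ge0 ?IpC_ge0.
  have iD : ip (fD U) by apply: ip_fD E0 (Kp_bnd KU) cU.
  have [iD1 iD2] := ip_scale (cpos_fD p2 cU) iD t0.
  by rewrite (RintZ mpos _ iD1) iD2 scale_q// mulrCA (mulrCA (s `^ _)) !mulrA.
by rewrite /PP /Pf eA eC h1 h2 h3 h4.
Qed.

End Scale.

Lemma EB_ge0 U s : 0 <= s -> 0 <= EB U s.
Proof.
move=> s0; rewrite mulr_ge0 ?invr_ge0//; apply: Rintegral_ge0 => r _.
by rewrite bif_ge0 ?sqr_ge0.
Qed.

(** Mountain-pass geometry. A dilation brings the quadratic energy to a fixed small value [e], for
    which the nonlinear term is at most [e / 4]; the field energy is nonnegative, and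
    [e / 2 - e / 4] remains. *)
Lemma PP_lower : exists2 c0 : R, 0 < c0 & forall U U', Kp U U' -> 0 < Ip (fC U) ->
  exists2 s, 0 < s & c0 <= PP U U' s.
Proof.
pose k := 4 * Ip (wgt (ew p)) / (p + 1) + 1.
have k0 : 0 < k.
  rewrite ltr_wpDl// divr_ge0 ?(ltW p10)// mulr_ge0//.
  by apply: Rintegral_ge0 => x _; exact: wgt_ge0.
have pm : 0 < (p - 1) / 2 by have := p2; lra.
(* The solution of [k e^((p - 1) / 2) = 1 / 4]. *)
pose e := (4 * k)^-1 `^ ((p - 1) / 2)^-1.
have e0 : 0 < e by rewrite powR_gt0// invr_gt0 mulr_gt0.
have ek : k * e `^ ((p + 1) / 2) <= e / 4.
  have -> : (p + 1) / 2 = (p - 1) / 2 + 1 by field.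
  rewrite powRD ?(gt_eqF e0) ?implybT// powRr1 ?(ltW e0)//.
  rewrite /e -powRrM mulVf ?gt_eqF// powRr1 ?invr_ge0 ?mulr_ge0 ?(ltW k0)//.
  by rewrite le_eqVlt; apply/orP; left; apply/eqP; rewrite -/e; field; rewrite gt_eqF.
exists (e / 4); first by rewrite divr_gt0.
move=> U U' KU C0; set A := Ip (fA U'); set C := Ip (fC U).
have A0 : 0 <= A by exact: IpA_ge0.
pose f (t : R) := t ^+ 3 * A + t * C.
(* Since [T >= 1], one has [f T >= T (A + C) >= e]; the intermediate value theorem then finds a
   dilation of energy exactly [e]. *)
pose T := Num.max 1 (e / (A + C)).
have AC : 0 < A + C by rewrite ltr_wpDl.
have T1 : 1 <= T by rewrite le_max lexx.
have T0 : 0 <= T by exact: le_trans T1.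
have fT : e <= f T.
  apply: (@le_trans _ _ (T * (A + C))).
    by rewrite -ler_pdivrMr// le_max lexx orbT.
  rewrite /f mulrDr lerD2r ler_wpM2r// exprS ler_peMr// exprn_ege1//.
have [t tT ft] : exists2 t, t \in `[0, T] & f t = e.
  apply: IVT => //.
    apply: continuous_subspaceT => x; apply: cvgD; apply: cvgM; try exact: cvg_cst; last exact: cvg_id.
    exact: exprn_continuous.
  have f0 : f 0 = 0 by rewrite /f expr0n /= !mul0r addr0.
  rewrite f0 minEle maxEle (le_trans _ fT) ?(ltW e0)//= ltW//=.
have t0 : 0 < t.
  move: tT; rewrite in_itv /= => /andP[t0 _]; rewrite lt_def t0 andbT; apply/eqP => t00.
  by move: ft e0; rewrite t00 /f expr0n /= !mul0r addr0 => <-; rewrite ltxx.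
have [KV [eA eC]] := Kp_scale KU t0.
exists (t ^+ 3 * 1); first by rewrite mulr1 exprn_gt0.
rewrite -(scale_PP KU t0)//.
set V := (fun r => t ^+ 2 * U (t * r)) in KV eC *; set V' := (fun r => _) in KV eA *.
have EV : EE V V' = e by rewrite /EE eA eC -ft.
have bV := Kp_bnd KV; rewrite EV in bV.
have [dV _ _ _] := KV; have cV := D1_cpos dV.
have hD := IpD_le p2 p5 (ltW e0) bV cV.
rewrite /PP /Pf !powR1 !mul1r.
have hB : 0 <= 2^-1 * EB V 1 by rewrite mulr_ge0// EB_ge0.
have hD2 : Ip (fD V) / (p + 1) <= k * e `^ ((p + 1) / 2).
  apply: (@le_trans _ _ (4 * Ip (wgt (ew p)) * e `^ ((p + 1) / 2) / (p + 1))).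
    by rewrite ler_pM2r ?invr_gt0 ?p10.
  rewrite [leLHS]mulrAC ler_wpM2r ?powR_ge0// /k lerDl//.
move: EV; rewrite /EE => EV.
lra.
Qed.

(** Upper bounds along the dilation curve are collected instead of suprema, so that curves on which
    the functional is unbounded need no separate treatment; the infimum is the same. *)
Definition Lv : set R := [set l | exists U U', [/\ Kp U U', 0 < Ip (fC U) &
   forall s, 0 < s -> PP U U' s <= l]].

Lemma PPb_alg (s A C sg nb x1 x2 be b d B1 Bs : R) :
  Bs <= B1 + sg * (s - 1) -> (nb + 1) * (s - b) <= d * x2 -> be * s <= nb * s ->
  C * x1 <= C * (1 + s) -> be * s = 2^-1 * A * s + 2^-1 * C * s + 2^-1 * sg * s -> 0 <= s ->
  2^-1 * (s * A) + 2^-1 * (x1 * C) + 2^-1 * Bs - d * x2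
    <= 2^-1 * C + 2^-1 * (B1 - sg) + (nb + 1) * b.
Proof. by move=> h1 h2 h3 h4 h5 h6; lra. Qed.

(** The first three terms grow at most linearly in [s], with slope [be] up to constants, whereas the
    nonlinear term has a power above 1 and a positive coefficient. *)
Lemma PP_bounded U U' : Kp U U' -> 0 < Ip (fD U) -> exists l, forall s, 0 < s -> PP U U' s <= l.
Proof.
move=> KU D0; have [dU cU' iA iC] := KU; have cU := D1_cpos dU.
have A0 := IpA_ge0 U'; have C0 := IpC_ge0 U.
have q1 := q_gt1'; have q0 : 0 < qexp p by exact: lt_trans q1.
pose d := Ip (fD U) / (p + 1); have d0 : 0 < d by rewrite divr_gt0 ?p10.
have [sg hsg] : exists sg : R, forall s, 0 < s -> EB U s <= EB U 1 + sg * (s - 1).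
  by have [_ _ h] := EB_tangent cU iC (ltr01 : 0 < (1:R)); eexists; exact: h.
pose be := 2^-1 * Ip (fA U') + 2^-1 * Ip (fC U) + 2^-1 * sg.
(* The point where the tangent to [d * s^qexp] has slope [|be| + 1]. *)
pose b := ((`|be| + 1) / (d * qexp p)) `^ (qexp p - 1)^-1.
have bb0 : 0 < (`|be| + 1) / (d * qexp p) by rewrite divr_gt0// mulr_gt0.
have b0 : 0 < b by rewrite powR_gt0.
have bq : b `^ qexp p / b = (`|be| + 1) / (d * qexp p).
  rewrite -powR_inv1 ?(ltW b0)// -powRD ?(gt_eqF b0) ?implybT// -powRrM mulVf ?powRr1 ?(ltW bb0)//.
  by rewrite subr_eq0 gt_eqF.
exists (2^-1 * Ip (fC U) + 2^-1 * (EB U 1 - sg) + (`|be| + 1) * b) => s s0.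
have h1 := hsg s s0.
have h2 := powR_tangent q1 b0 s0; rewrite bq in h2.
have h3 : s `^ 3^-1 <= 1 + s.
  have [s1|s1] := leP s 1.
    apply: (@le_trans _ _ 1); last by rewrite lerDl ltW.
    by apply: powR_le1; rewrite ?(ltW s0)// invr_ge0.
  apply: (@le_trans _ _ s); last by rewrite lerDr.
  by apply: ler1_powR; [exact: ltW|rewrite invf_le1// ler1n].
have h4 : (`|be| + 1) * (s - b) <= d * s `^ qexp p.
  apply: (@le_trans _ _ (d * (b `^ qexp p + qexp p * ((`|be| + 1) / (d * qexp p)) * (s - b)))).
    have : 0 <= d * b `^ qexp p by rewrite mulr_ge0 ?powR_ge0 ?ltW.
    have -> : d * (b `^ qexp p + qexp p * ((`|be| + 1) / (d * qexp p)) * (s - b)) =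
      d * b `^ qexp p + (`|be| + 1) * (s - b) by field; rewrite !gt_eqF.
    by rewrite lerDr.
  by rewrite ler_pM2l.
have h5 : be * s <= `|be| * s by rewrite ler_wpM2r ?ler_norm// ltW.
have h6 : Ip (fC U) * s `^ 3^-1 <= Ip (fC U) * (1 + s) by rewrite ler_wpM2l.
rewrite /PP /Pf.
have -> : s `^ qexp p * Ip (fD U) / (p + 1) = d * s `^ qexp p by rewrite -mulrA mulrC.
have h7 : be * s = 2^-1 * Ip (fA U') * s + 2^-1 * Ip (fC U) * s + 2^-1 * sg * s.
  by rewrite /be !mulrDl.
exact: PPb_alg h1 h4 h5 h6 h7 (ltW s0).
Qed.

Lemma Lv_nonempty : Lv !=set0.
Proof.
have [_ sU uU] := bp_T1 3 (@ltr01 R) (@ltr01 R); set U := bp 1 1 3 in sU uU.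
have [U' dU sU'] := smooth_deriv sU; have uU' := supp_D1 dU uU.
have cU := smooth_cpos sU; have cU' := smooth_cpos sU'.
have KU : Kp U U'.
  split => //; [apply: (ip_csupp (cpos_fC cU') ltr01 (b := 3))|apply: (ip_csupp (cpos_fC cU) ltr01 (b := 3))].
    by move=> r r0 h; rewrite /fC uU'// expr0n mul0r.
  by move=> r r0 h; rewrite /fC uU// expr0n mul0r.
have U2 : 0 < U 2 by apply: bp_gt0; lra.
have C0 : 0 < Ip (fC U).
  apply: (@Ip_gt0 _ 2) => //; [exact: cpos_fC|by have [] := KU|by move=> t _; exact: fC_ge0|].
  by rewrite /fC mulf_neq0// expf_neq0// gt_eqF.
have E0 : 0 <= EE U U' by rewrite addr_ge0 ?IpA_ge0 ?IpC_ge0.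
have D0 : 0 < Ip (fD U).
  apply: (@Ip_gt0 _ 2) => //; first exact: cpos_fD.
  - exact: ip_fD E0 (Kp_bnd KU) cU.
  - by move=> t _; exact: fD_ge0.
  - by rewrite /fD mulf_neq0// ?expf_neq0// gt_eqF// powR_gt0// normr_gt0 gt_eqF.
have [l hl] := PP_bounded KU D0.
by exists l, U, U'.
Qed.

Definition clev : R := inf Lv.

Lemma Lv_lb : exists2 c0 : R, 0 < c0 & lbound Lv c0.
Proof.
have [c0 c00 hc] := PP_lower; exists c0 => // l [U [U' [KU C0 hl]]].
have [s s0 hs] := hc _ _ KU C0; exact: le_trans hs (hl s s0).
Qed.

Lemma clev_le l : Lv l -> clev <= l.
Proof. by move=> h; apply: ge_inf => //; have [c0 _ hc] := Lv_lb; exists c0. Qed.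

Lemma clev_gt0 : 0 < clev.
Proof.
have [c0 c00 hc] := Lv_lb; apply: lt_le_trans c00 _; apply: lb_le_inf => //; exact: Lv_nonempty.
Qed.

(** Some point [s] of a nearly optimal curve has value at least [clev - e], otherwise [clev - e]
    would belong to [Lv]. Dilating by the cube root of [s] moves this point to 1. *)
Lemma minimizing (e : R) : 0 < e -> exists U U', [/\ Kp U U', 0 < Ip (fC U),
  (forall s, 0 < s -> PP U U' s <= clev + e) & clev - e <= PP U U' 1].
Proof.
move=> e0.
have hinf : has_inf Lv by split; [exact: Lv_nonempty|have [c0 _ hc] := Lv_lb; exists c0].
have [l [U [U' [KU C0 hl]]] hle] := inf_adherent e0 hinf.
have [s s0 hs] : exists2 s, 0 < s & clev - e <= PP U U' s.
  apply: contrapT => /forall2NP h.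
  have : Lv (clev - e).
    exists U, U'; split => // s s0; have [//|/negP] := h s.
    by rewrite -ltNge => /ltW.
  by move/clev_le; rewrite lerBrDr gerDl leNgt e0.
pose t := s `^ 3^-1; have t0 : 0 < t by exact: powR_gt0.
have t3 : t ^+ 3 = s by apply: cuberoot3; exact: ltW.
have [KV [_ eC]] := Kp_scale KU t0.
exists (fun r => t ^+ 2 * U (t * r)), (fun r => t ^+ 3 * U' (t * r)); split.
- exact: KV.
- by rewrite eC mulr_gt0.
- move=> x x0; rewrite scale_PP// t3; apply: le_trans (hl _ _) _; first by rewrite mulr_gt0.
  exact: ltW.
- by rewrite scale_PP// t3 mulr1.
Qed.

End Level.

(** * Compactness of minimizing sequences *)

Section Selection.
Import ArrowAsProduct.

(* Tychonoff provides a cluster point of the sequence for pointwise convergence. *)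
Lemma pointwise_cluster (g : nat -> R -> R) (M : R -> R) : (forall n x, `|g n x| <= M x) ->
  exists f : R -> R, forall (l : seq R) (e : R) (N : nat), 0 < e ->
    exists2 n, (N <= n)%N & forall x, x \in l -> `|g n x - f x| < e.
Proof.
move=> gM.
have cA : compact [set f : forall i : R, R | forall i, `[- M i, M i]%classic (f i)].
  by apply: (@tychonoff R (fun=> R) (fun i => `[- M i, M i]%classic)) => i; exact: segment_compact.
have [|f [_ fcl]] := cA (g n @[n --> \oo]) _.
  by exists 0%N => // n _ i /=; rewrite in_itv /= -ler_norml.
exists f => l e N e0.
have nf : nbhs f [set h | forall x, x \in l -> `|h x - f x| < e].
  elim: l => [|a l IH]; first by apply: filterS filterT => h _ x; rewrite in_nil.
  have h1 : nbhs f [set h | `|h a - f a| < e].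
    have := @proj_continuous R (fun=> R) a f.
    by move/cvgrPdist_lt => /(_ e e0); apply: filterS => h /=; rewrite distrC.
  apply: filterS2 h1 IH => h h1 h2 x; rewrite in_cons => /orP[/eqP ->//|]; exact: h2.
have nt : (g n @[n --> \oo]) [set h | exists2 n, (N <= n)%N & h = g n].
  by exists N => // n Nn; exists n.
have [h [[n Nn ->] hl]] := fcl _ _ nt nf.
by exists n.
Qed.

(** Pointwise this is [S1 + 3 a <= 4 S2] for the square roots at [m] and [m / 2]; after squaring it
    reduces to [(S1 - a)^2 >= 0]. *)
Lemma EB_half (U : R -> R) : cpos U -> leb.-integrable pos (EFin \o fC U) ->
  2^-1 * EB U 1 <= EB U 2^-1.
Proof.
move=> cU iU; rewrite /EB invr1 mul1r invrK.
have i1 := ip_fB cU iU (ler01 : 0 <= (1 : R)).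
have h0 : 0 <= 2^-1 :> R by rewrite invr_ge0.
have i2 := ip_fB cU iU h0; have mp := @mpos.
rewrite -RintZ// -[leRHS]RintZ//.
apply: le_Rint => //; [exact: igZ|exact: igZ|].
move=> r _; rewrite /fB mul1r; move: (mass U r) => m.
have : forall a m : R, 0 <= a -> 2^-1 * bif a m <= 2 * bif a (2^-1 * m).
  move=> {}a {}m a0; rewrite /bif.
  have h1 := sqr_sqrtD a m; have h2 := sqr_sqrtD a (2^-1 * m).
  set S1 := Num.sqrt (a ^+ 2 + m ^+ 2) in h1 *.
  set S2 := Num.sqrt (a ^+ 2 + (2^-1 * m) ^+ 2) in h2 *.
  have p1 : 0 <= S1 by exact: sqrtr_ge0.
  have p2 : 0 <= S2 by exact: sqrtr_ge0.
  have key : S1 + 3 * a <= 4 * S2.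
    rewrite -(@ler_pXn2r _ 2) ?nnegrE ?addr_ge0 ?mulr_ge0//.
    have := sqr_ge0 (S1 - a); nra.
  by lra.
by apply; exact: sqr_ge0.
Qed.

End Selection.

Section Compactness.
Variable p : R.
Hypothesis p2 : 2 < p.
Hypothesis p5 : p < 5.
Local Notation PP := (PP p).
Local Notation c := (clev p).

Lemma three_quarters (e k : R) : 0 < e -> k < e / 4 -> e / 4 + (k + e / 4) < e.
Proof. by move=> e0 h; lra. Qed.

Definition Ebd : R := 4 * c / (2^-1 - 2^-1 `^ qexp p).

Lemma half_q : 0 < 2^-1 - 2^-1 `^ qexp p :> R.
Proof.
rewrite subr_gt0; have h : 0 < 2^-1 :> R by rewrite invr_gt0.
have := q_gt1' p2 => q1.
have -> : qexp p = 1 + (qexp p - 1) by rewrite addrCA subrr addr0.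
rewrite powRD; last by rewrite (gt_eqF h) implybT.
rewrite powRr1 ?(ltW h)// gtr_pMr//.
rewrite /powR gt_eqF// -[ltRHS]expR0 ltr_expR.
by rewrite pmulr_rlt0 ?subr_gt0// lnV ?posrE// oppr_lt0 ln_gt0// ltr1n.
Qed.

(** The values at [s = 1] and [s = 1/2] are compared. Nonnegativity at 1 bounds the nonlinear term
    by half the energy; inserting this at [1/2], where the value is at most [2 c], leaves
    [(1/2 - 2^(-qexp)) / 2] times the energy, which explains the constant [Ebd]. *)
Lemma energy_bound U U' e : Kp U U' -> e <= c -> (forall s, 0 < s -> PP U U' s <= c + e) ->
  c - e <= PP U U' 1 -> EE U U' <= Ebd.
Proof.
move=> KU ec h1 h2; have [dU cU' iA iC] := KU; have cU := D1_cpos dU.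
have A0 := IpA_ge0 U'; have C0 := IpC_ge0 U.
have hh : 0 < 2^-1 :> R by rewrite invr_gt0.
have hB := EB_half cU iC.
have hB1 : 0 <= EB U 1 by exact: EB_ge0.
have hq := half_q.
rewrite /Ebd ler_pdivlMr// /EE.
have := h1 _ hh; move: h2; rewrite /PP /Pf !powR1 !mul1r.
have h3 : 2^-1 <= 2^-1 `^ 3^-1 :> R.
  by apply: ger1_powR; rewrite ?hh ?invf_le1// ler1n.
have q0 : 0 <= 2^-1 `^ qexp p :> R by exact: powR_ge0.
move: hq q0 h3 hB; set hq := 2^-1 `^ qexp p; set x3 := 2^-1 `^ 3^-1.
set A := Ip (fA U') in A0 *; set C := Ip (fC U) in C0 *.
rewrite -[hq * _ / _]mulrA; set D' := _ / (p + 1).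
move: (EB U 1) (EB U 2^-1) hB1 => B1 Bh hB1 hq0 q0 h3 hB g1 g2.
have k1 : 2^-1 * C <= x3 * C by rewrite ler_wpM2r.
have k2 : hq * D' <= hq * (2^-1 * (A + C + B1)).
  by rewrite ler_wpM2l//; lra.
have k3 : 0 <= (2^-1 - hq) * B1 by rewrite mulr_ge0// ltW.
have : 4^-1 * (A + C + B1) - hq * (2^-1 * (A + C + B1)) <= 2 * c by lra.
move: k3; clear; set X := c.
have -> : 4^-1 * (A + C + B1) - hq * (2^-1 * (A + C + B1)) =
  2^-1 * ((2^-1 - hq) * (A + C)) + 2^-1 * ((2^-1 - hq) * B1) by field.
by move=> h1 h2; rewrite [_ * (2^-1 - hq)]mulrC; lra.
Qed.

(** The modulus comes from [osc] with [l = e / (E + 1)] and does not depend on the profile, only on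
    its energy bound. *)
Lemma equicont (E x e : R) : 0 <= E -> 0 < x -> 0 < e -> exists2 d, 0 < d &
  forall U U' y, Kp U U' -> EE U U' <= E -> `|y - x| < d -> 0 < y /\ `|U y - U x| <= e.
Proof.
move=> E0 x0 e0.
pose l := e / (E + 1); have l0 : 0 < l by rewrite divr_gt0// ltr_wpDl.
have [d d0 hd] : exists2 d, 0 < d & forall y, `|y - x| < d -> 0 < y /\ `|y^-1 - x^-1| < l * e.
  have h1 : \forall y \near x, 0 < y by exact: lt_nbhsr.
  have h2 : \forall y \near x, `|y^-1 - x^-1| < l * e.
    have : y^-1 @[y --> x] --> x^-1 by apply: cvgV; rewrite ?gt_eqF//; exact: cvg_id.
    by move/cvgrPdist_lt => /(_ (l * e)); rewrite mulr_gt0// => /(_ isT); apply: filterS => y; rewrite distrC.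
  have [d /= d0 hd] := filterI h1 h2.
  exists d => // y yx; have [] := hd y; first by rewrite /= distrC.
  by [].
exists d => // U U' y KU EU yx; have [y0 hy] := hd y yx; split => //.
have AE : Ip (fA U') <= E by apply: le_trans EU; rewrite lerDl IpC_ge0.
have key a b : 0 < a -> a <= b -> a^-1 - b^-1 <= l * e -> `|U b - U a| <= e.
  move=> a0 ab h; apply: le_trans (osc KU l0 a0 ab) _.
  have h1 : l * Ip (fA U') <= e.
    rewrite /l mulrAC ler_pdivrMr ?ltr_wpDl// ler_pM2l//.
    by apply: le_trans AE _; rewrite lerDl.
  have h2 : l^-1 * (a^-1 - b^-1) <= e by rewrite mulrC ler_pdivrMr// mulrC.
  by lra.
have [xy|/ltW yx'] := leP x y.
  by apply: key => //; rewrite ltW// (le_lt_trans _ hy)// distrC ler_norm.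
by rewrite distrC; apply: key => //; rewrite ltW// (le_lt_trans _ hy)// ler_norm.
Qed.

(** Quadratic in the step [1/(n+1)] with which the sequence is later perturbed, so that lack of
    minimality is an error of second order; the factor [c] gives the bound [eps n <= c] asked by
    [energy_bound]. *)
Definition eps n : R := c / n.+1%:R ^+ 2.

Lemma eps_gt0 n : 0 < eps n.
Proof. by rewrite divr_gt0 ?clev_gt0// exprn_gt0// ltr0n. Qed.

Lemma eps_le n : eps n <= c.
Proof.
by rewrite /eps ler_piMr ?(ltW (clev_gt0 p2 p5))// invf_le1 ?exprn_ege1 ?ler1n.
Qed.

Lemma eps_mono k n : (k <= n)%N -> eps n <= eps k.
Proof.
move=> kn; rewrite /eps ler_wpM2l ?(ltW (clev_gt0 p2 p5))//.
by rewrite lef_pV2 ?posrE ?exprn_gt0 ?ltr0n// lerXn2r ?nnegrE// ler_nat.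
Qed.

Lemma Ebd_ge0 : 0 <= Ebd.
Proof. by rewrite divr_ge0 ?(ltW half_q)// mulr_ge0// ltW// clev_gt0. Qed.

(** A cluster point for pointwise convergence approximates finitely many points at a time. Taking
    ever more rationals gives convergence on a dense set, and equicontinuity extends it to all
    positive points and makes the limit continuous. *)
Lemma selection : exists (W W' : nat -> R -> R) (u : R -> R) (a0 c0 : R),
  [/\ (forall n, Kp (W n) (W' n)) /\ (forall n, EE (W n) (W' n) <= Ebd),
      (forall n s, 0 < s -> PP (W n) (W' n) s <= c + eps n) /\
      (forall n, c - eps n <= PP (W n) (W' n) 1),
      (forall r, 0 < r -> W n r @[n --> \oo] --> u r) /\ cpos u,
      Ip (fA (W' n)) @[n --> \oo] --> a0 &
      Ip (fC (W n)) @[n --> \oo] --> c0].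
Proof.
have /choice[U /choice[U' hU]] : forall n, exists U U', [/\ Kp U U', 0 < Ip (fC U),
  (forall s, 0 < s -> PP U U' s <= c + eps n) & c - eps n <= PP U U' 1].
  by move=> n; apply: minimizing => //; exact: eps_gt0.
have KU n : Kp (U n) (U' n) by have [] := hU n.
have EU n : EE (U n) (U' n) <= Ebd.
  by have [h1 _ h2 h3] := hU n; apply: energy_bound h1 (eps_le n) h2 h3.
pose g n (x : R) := if 0 < x then U n x else if x == 0 then Ip (fA (U' n)) else Ip (fC (U n)).
pose M (x : R) := if 0 < x then 1 + Ebd / x else Ebd.
have AE n : Ip (fA (U' n)) <= Ebd by apply: le_trans (EU n); rewrite lerDl IpC_ge0.
have CE n : Ip (fC (U n)) <= Ebd by apply: le_trans (EU n); rewrite lerDr IpA_ge0.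
have gM n x : `|g n x| <= M x.
  rewrite /g /M; case: ifPn => [x0|_]; last first.
    by case: ifP => _; rewrite ger0_norm ?IpA_ge0 ?IpC_ge0.
  have [h _] := Kp_bnd (KU n) x0.
  apply: (@le_trans _ _ (1 + U n x ^+ 2)).
    rewrite -[U n x ^+ 2]real_normK ?num_real//; move: `|U n x| (normr_ge0 (U n x)) => y y0.
    by have := sqr_ge0 (y - 1); nra.
  by rewrite lerD2l; apply: le_trans h _; rewrite ler_pM2r ?invr_gt0.
have [f hf] := pointwise_cluster gM.
pose L k : seq R := 0 :: -1 :: [seq ratr q | q <- pmap (@unpickle rat) (iota 0 k)].
(* The indices [nk k] need not increase; [k <= nk k] suffices because [eps] is nonincreasing. *)
have /choice[nk hnk] : forall k : nat, exists n, (k <= n)%N /\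
    forall x, x \in L k -> `|g n x - f x| < k.+1%:R^-1.
  move=> k; have k0 : 0 < k.+1%:R^-1 :> R by rewrite invr_gt0 ltr0n.
  by have [n kn hn] := hf (L k) _ k k0; exists n.
have harm (h : nat -> R) (l : R) : (\forall k \near \oo, `|h k - l| < k.+1%:R^-1) -> h k @[k --> \oo] --> l.
  move=> hk; apply/cvgrPdist_lt => e e0.
  have : \forall k \near \oo, k.+1%:R^-1 < e.
    have := @cvg_harmonic R; move/cvgrPdist_lt => /(_ e e0).
    by apply: filterS => k; rewrite sub0r normrN ger0_norm ?invr_ge0.
  move: hk; apply: filterS2 => k h1 h2; rewrite distrC; exact: lt_trans h2.
have eqf x e : 0 < x -> 0 < e -> exists2 d, 0 < d &
    forall y, `|y - x| < d -> [/\ 0 < y, (forall n, `|U n y - U n x| <= e) & `|f y - f x| <= e].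
  move=> x0 e0; have [d d0 hd] := equicont Ebd_ge0 x0 e0; exists d => // y yx.
  have y0 : 0 < y by have [] := hd _ _ y (KU 0) (EU 0) yx.
  have hn n : `|U n y - U n x| <= e by have [] := hd _ _ y (KU n) (EU n) yx.
  split => //; apply/ler_addgt0Pr => z z0.
  have z2 : 0 < z / 2 by rewrite divr_gt0.
  have [n _ hz] := hf [:: x; y] (z / 2) 0%N z2.
  have := hz x; rewrite /g x0 !inE eqxx /= => /(_ isT) h1.
  have := hz y; rewrite /g y0 !inE eqxx orbT /= => /(_ isT) h2.
  have -> : f y - f x = (f y - U n y) + ((U n y - U n x) + (U n x - f x)) by ring.
  apply: le_trans (ler_normD _ _) _; rewrite distrC.
  apply: le_trans (lerD (lexx _) (ler_normD _ _)) _.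
  have := hn n; lra.
exists (fun k => U (nk k)), (fun k => U' (nk k)), f, (f 0), (f (-1)).
have pw (r : R) : 0 < r -> U (nk k) r @[k --> \oo] --> f r.
  move=> r0; apply/cvgrPdist_lt => e e0.
  have e4 : 0 < e / 4 by rewrite divr_gt0.
  have [d d0 hd] := eqf r (e / 4) r0 e4.
  have rdd : r - d < r + d by lra.
  have [q] := @rat_in_itvoo R (r - d) (r + d) rdd; rewrite in_itv /= => /andP[q1 q2].
  have qr : `|ratr q - r| < d by rewrite ltr_norml; apply/andP; split; lra.
  have [y0 hU2 hf2] := hd _ qr.
  have : \forall k \near \oo, k.+1%:R^-1 < e / 4.
    have := @cvg_harmonic R; move/cvgrPdist_lt => /(_ _ e4).
    by apply: filterS => k; rewrite sub0r normrN ger0_norm ?invr_ge0.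
  have : \forall k \near \oo, (pickle q < k)%N by exact: nbhs_infty_gt.
  apply: filterS2 => k k1 k2.
  have qL : ratr q \in L k.
    rewrite !inE; apply/orP; right; apply/orP; right; apply/mapP; exists q => //.
    by rewrite mem_pmap; apply/mapP; exists (pickle q); rewrite ?mem_iota ?pickleK.
  have := (hnk k).2 _ qL; rewrite /g y0 => h1.
  have := hU2 (nk k); move: hf2; rewrite distrC => h2 h3.
  have -> : f r - U (nk k) r = - (f (ratr q) - f r) + (- (U (nk k) (ratr q) - f (ratr q)) + (U (nk k) (ratr q) - U (nk k) r)) by ring.
  apply: le_lt_trans (ler_normD _ _) _.
  apply: le_lt_trans (lerD (lexx _) (ler_normD _ _)) _.
  rewrite !normrN; rewrite distrC in h2.
  exact: le_lt_trans (lerD h2 (lerD (ltW h1) h3)) (three_quarters e0 k2).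
split.
- by split.
- split=> [k s s0|k].
    have [_ _ h _] := hU (nk k); apply: le_trans (h s s0) _.
    by rewrite lerD2l; apply: eps_mono; exact: (hnk k).1.
  have [_ _ _ h] := hU (nk k); apply: le_trans h.
  by rewrite lerD2l lerN2; apply: eps_mono; exact: (hnk k).1.
- split => // x x0; apply/cvgrPdist_le => e e0.
  have [d d0 hd] := eqf x e x0 e0.
  have : \forall y \near x, `|y - x| < d by exists d => //= y /=; rewrite distrC.
  by apply: filterS => y yx; rewrite distrC; have [] := hd y yx.
- apply: harm; apply: nearW => k.
  by have := (hnk k).2 0; rewrite /g ltxx eqxx; apply; rewrite !inE eqxx.
- apply: harm; apply: nearW => k.
  have := (hnk k).2 (-1); rewrite /g ltr0N1 oppr_eq0 oner_eq0; apply.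
  by rewrite !inE eqxx orbT.
Qed.

End Compactness.

(** * Elementary inequalities for the first variation *)

Section StepAlgebra.
Implicit Types (a b s t x y r p E : R).

Lemma sq_addt_le (f g : R -> R) t r : 0 < t -> t <= 1 ->
  (f r + t * g r) ^+ 2 * r ^+ 2 <= 2 * (f r ^+ 2 * r ^+ 2) + 2 * (g r ^+ 2 * r ^+ 2).
Proof.
move=> t0 t1; rewrite (mulrA 2) (mulrA 2) -mulrDl; apply: ler_wpM2r; first exact: sqr_ge0.
move: (f r) (g r) => x y; have h1 := sqr_ge0 (x - t * y).
have h2 : 0 <= (1 - t ^+ 2) * y ^+ 2 by rewrite mulr_ge0 ?sqr_ge0// subr_ge0 expr_le1// ltW.
by nra.
Qed.

Lemma powabs_tangent_step p t x y r : 1 < p -> 0 < t ->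
  `|x| `^ (p + 1) * r ^+ 2 + (p + 1) * t * (nlin p x * y * r ^+ 2) <=
  `|x + t * y| `^ (p + 1) * r ^+ 2.
Proof.
move=> p1 t0; have -> : `|x| `^ (p + 1) * r ^+ 2 + (p + 1) * t * (nlin p x * y * r ^+ 2) =
  (`|x| `^ (p + 1) + (p + 1) * nlin p x * (x + t * y - x)) * r ^+ 2 by ring.
by rewrite ler_wpM2r ?sqr_ge0//; exact: powabs_tangent.
Qed.

Lemma fC_add (f v : R -> R) t x : fC (fun r => f r + t * v r) x =
  fC f x + (2 * t) * (f x * v x * x ^+ 2) + t ^+ 2 * fC v x.
Proof. by rewrite /fC; ring. Qed.

(** The right-hand side squared exceeds the radicand by a square: the bound
    [sqrt (1 + x) <= 1 + x / 2] rescaled by [S]. *)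
Lemma sqrt_step (A m d S : R) : 0 < S -> S ^+ 2 = A ^+ 2 + m ^+ 2 ->
  Num.sqrt (A ^+ 2 + (m + d) ^+ 2) <= S + (m * d + d ^+ 2 / 2) / S.
Proof.
move=> S0 S2.
have e : S + (m * d + d ^+ 2 / 2) / S = (S ^+ 2 + (m * d + d ^+ 2 / 2)) / S by field; rewrite gt_eqF.
have h0 : 0 <= S ^+ 2 + (m * d + d ^+ 2 / 2).
  by rewrite S2; have := sqr_ge0 (m + d); have := sqr_ge0 A; have := sqr_ge0 m; nra.
have h1 : 0 <= S + (m * d + d ^+ 2 / 2) / S by rewrite e divr_ge0// ltW.
rewrite -(ger0_norm h1) -sqrtr_sqr ler_wsqrtr//.
have -> : A ^+ 2 + (m + d) ^+ 2 = S ^+ 2 + 2 * (m * d + d ^+ 2 / 2) by rewrite S2; field.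
have -> : (S + (m * d + d ^+ 2 / 2) / S) ^+ 2 =
  S ^+ 2 + 2 * (m * d + d ^+ 2 / 2) + ((m * d + d ^+ 2 / 2) / S) ^+ 2 by field; rewrite gt_eqF.
by rewrite lerDl sqr_ge0.
Qed.

(** One-sided expansion of the field density when the mass changes by [2 t u + t^2 v]. The remainder
    is [t^2] times constants depending only on the bounds [E], [K], [N], hence uniform along the
    sequence. *)
Lemma bif_step r s t m u v E K N w : 0 < r -> 0 < s -> 0 < t -> t <= 1 ->
  0 <= m -> m <= E -> `|u| <= K -> 0 <= v -> v <= N -> r ^- 2 <= w ->
  bif (r ^+ 2) (s * (m + 2 * t * u + t ^+ 2 * v)) <=
  bif (r ^+ 2) (s * m) + ((s ^+ 2 * (2 * t)) * (m * u / Num.sqrt ((r ^+ 2) ^+ 2 + (s * m) ^+ 2))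
    + (s ^+ 2 * (t ^+ 2 * (E * N + 4 * K ^+ 2 + N ^+ 2))) * w).
Proof.
move=> r0 s0 t0 t1 m0 mE uK v0 vN rw; rewrite /bif.
set S := Num.sqrt (_ + (s * m) ^+ 2).
have r2 : 0 < r ^+ 2 by rewrite exprn_gt0.
have S2 : S ^+ 2 = (r ^+ 2) ^+ 2 + (s * m) ^+ 2 by exact: sqr_sqrtD.
have rS : r ^+ 2 <= S by rewrite -subr_ge0; exact: bif_ge0 (ltW r2).
have S0 : 0 < S by exact: lt_le_trans rS.
rewrite [leRHS]addrAC lerD2r.
have -> : s * (m + 2 * t * u + t ^+ 2 * v) = s * m + s * (2 * t * u + t ^+ 2 * v) by ring.
apply: le_trans (sqrt_step _ S0 S2) _; rewrite lerD2l.
set X := m * v + (2 * u + t * v) ^+ 2 / 2.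
have -> : (s * m * (s * (2 * t * u + t ^+ 2 * v)) + (s * (2 * t * u + t ^+ 2 * v)) ^+ 2 / 2) / S =
  s ^+ 2 * (2 * t) * (m * u / S) + s ^+ 2 * t ^+ 2 * (X * S^-1) by rewrite /X; field; rewrite gt_eqF.
rewrite lerD2l [leRHS](_ : _ = s ^+ 2 * t ^+ 2 * ((E * N + 4 * K ^+ 2 + N ^+ 2) * w)); last by ring.
apply: ler_wpM2l; first by apply: mulr_ge0; exact: sqr_ge0.
have u2 : u ^+ 2 <= K ^+ 2 by rewrite -real_normK ?num_real// ler_pXn2r ?nnegrE// (le_trans _ uK).
have tv0 : 0 <= t * v by apply: mulr_ge0 => //; exact: ltW.
have tv : (t * v) ^+ 2 <= v ^+ 2 by rewrite !expr2; apply: ler_pM => //; exact: ler_piMl.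
have X0 : 0 <= X by apply: addr_ge0; [exact: mulr_ge0|apply: divr_ge0 => //; exact: sqr_ge0].
apply: ler_pM => //; first by rewrite invr_ge0 ltW.
  by rewrite /X; have := sqr_ge0 (2 * u - t * v); nra.
by apply: le_trans _ rw; rewrite lef_pV2 ?posrE.
Qed.

Lemma PP_step (s A C B BV d DV D c1 q k t a1 c2 G Q Av Cv : R) : 0 <= q -> 0 < k ->
  BV <= B + s * (2 * t * G + t ^+ 2 * Q) ->
  D + k * t * d <= DV ->
  2^-1 * (s * (A + 2 * t * a1 + t ^+ 2 * Av)) + 2^-1 * (c1 * (C + 2 * t * c2 + t ^+ 2 * Cv))
    + 2^-1 * BV - q * DV / k <=
  2^-1 * (s * A) + 2^-1 * (c1 * C) + 2^-1 * B - q * D / k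
   + t * (s * a1 + c1 * c2 + s * G - q * d) + t ^+ 2 * (2^-1 * (s * Av + c1 * Cv + s * Q)).
Proof.
move=> q0 k0 hB hD.
have h : q * (D / k + t * d) <= q * (DV / k).
  rewrite ler_wpM2l// ler_pdivlMr// mulrDl mulfVK ?gt_eqF//.
  by rewrite [t * d * k](_ : _ = k * t * d) //; ring.
rewrite -!mulrA; move: h; move: (D / k) (DV / k) => x y h.
move: h hB; rewrite !mulrDr; nra.
Qed.

Lemma sq_lower (x y r : R) : 2 * (x * (y * r ^+ 2)) + -1 * (y ^+ 2 * r ^+ 2) <= x ^+ 2 * r ^+ 2.
Proof.
rewrite -subr_ge0 [leRHS](_ : _ = (x - y) ^+ 2 * r ^+ 2); last by ring.
by rewrite mulr_ge0 ?sqr_ge0.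
Qed.

Lemma far_alg (c P x y e g : R) : g = (c - P) / 2 -> `|P - x| < g -> `|c - y| < g -> `|0 - e| < g ->
  x < y /\ x < c - e.
Proof.
by move=> -> h1 h2 h3; move: h1 h2 h3; rewrite !ltr_distl => /andP[h1 h1'] /andP[h2 h2'] /andP[h3 h3']; split; lra.
Qed.

(* A concave function exceeding its values at [1 - e] and [1 + e] both at [1] and at [s] forces [s] in between. *)
Lemma sn_alg (P1 Ps Pm Pp sm sp e s : R) :
  P1 <= Pm + sm * (1 - (1 - e)) -> Ps <= Pm + sm * (s - (1 - e)) ->
  P1 <= Pp + sp * (1 - (1 + e)) -> Ps <= Pp + sp * (s - (1 + e)) ->
  0 < e -> Pm < P1 -> Pm < Ps -> Pp < P1 -> Pp < Ps -> `|1 - s| < e.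
Proof.
move=> a1 a2 a3 a4 e0 b1 b2 b3 b4.
have h1 : 1 - e < s by nra.
have h2 : s < 1 + e by nra.
by rewrite ltr_distl; apply/andP; split; lra.
Qed.

Lemma Lfun_alg (c e t T Q Pv Pw : R) : 0 < t -> e = c * t ^+ 2 ->
  c - e < Pv -> Pv <= Pw + t * T + t ^+ 2 * Q -> Pw <= c + e ->
  - (2 * c) * t - t * Q <= T.
Proof.
move=> t0 -> h1 h2 h3; rewrite -(ler_pM2l t0).
have : - (2 * c * t ^+ 2) <= t * T + t ^+ 2 * Q by lra.
by rewrite mulrBr; nra.
Qed.

End StepAlgebra.

(** * Euler-Lagrange equation for the limit of a minimizing sequence *)

Section EulerLagrange.
Variable p : R.
Hypothesis p2 : 2 < p.
Hypothesis p5 : p < 5.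
Local Notation PP := (PP p).
Local Notation c := (clev p).
Local Notation E := (Ebd p).
Local Notation eps := (eps p).
Local Notation Pf := (Pf p).
Local Notation fD := (fD p).

Variables (W W' : nat -> R -> R) (u : R -> R) (a0 c0 : R).
Hypothesis KW : forall n, Kp (W n) (W' n).
Hypothesis EW : forall n, EE (W n) (W' n) <= E.
Hypothesis PW : forall n s, 0 < s -> PP (W n) (W' n) s <= c + eps n.
Hypothesis PW1 : forall n, c - eps n <= PP (W n) (W' n) 1.
Hypothesis Wu : forall r, 0 < r -> W n r @[n --> \oo] --> u r.
Hypothesis cu : cpos u.
Hypothesis Aa : Ip (fA (W' n)) @[n --> \oo] --> a0.
Hypothesis Cc : Ip (fC (W n)) @[n --> \oo] --> c0.

Let E0 : 0 <= E := Ebd_ge0 p2 p5.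
Let c_gt0 : 0 < c := clev_gt0 p2 p5.

Lemma bnd_mono (e1 e2 : R) U : e1 <= e2 -> bnd e1 U -> bnd e2 U.
Proof.
move=> h b r r0; have [b1 b2] := b r r0; split.
  by apply: le_trans b1 _; rewrite ler_pM2r ?invr_gt0.
by apply: le_trans b2 _; rewrite ler_pM2r ?invr_gt0 ?exprn_gt0.
Qed.

Lemma bW n : bnd E (W n).
Proof. exact: bnd_mono (EW n) (Kp_bnd (KW n)). Qed.
Lemma cW n : cpos (W n).
Proof. by have [dU _ _ _] := KW n; exact: D1_cpos dU. Qed.
Lemma cW' n : cpos (W' n).
Proof. by have [_ ? _ _] := KW n. Qed.
Lemma iA n : ip (fA (W' n)).
Proof. by have [_ _ ? _] := KW n. Qed.
Lemma iC n : ip (fC (W n)).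
Proof. by have [_ _ _ ?] := KW n. Qed.
Lemma CE n : Ip (fC (W n)) <= E.
Proof. by apply: le_trans (EW n); rewrite lerDr IpA_ge0. Qed.
Lemma AE n : Ip (fA (W' n)) <= E.
Proof. by apply: le_trans (EW n); rewrite lerDl IpC_ge0. Qed.

Let iu : ip (fC u) := (seq_fC iC CE Wu).1.
Lemma u_bnd : bnd E u.
Proof. exact: seq_bnd bW Wu. Qed.

Lemma eps_cvg : eps n @[n --> \oo] --> 0.
Proof.
apply: (@squeeze_cvgr _ _ _ _ (fun=> 0) (fun n => c * n.+1%:R^-1)).
- apply: nearW => n; rewrite ltW ?eps_gt0//= /eps.
  rewrite ler_wpM2l ?(ltW c_gt0)// lef_pV2 ?posrE ?exprn_gt0 ?ltr0n//; first by rewrite ler_eXnr// ler1n.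
- exact: cvg_cst.
- by rewrite -[X in _ --> X](mulr0 c); apply: cvgM; [exact: cvg_cst|exact: cvg_harmonic].
Qed.

Lemma PWlim s : 0 < s -> PP (W n) (W' n) s @[n --> \oo] --> Pf a0 c0 u s.
Proof. by move=> s0; apply: (seq_Pf p2 p5 E0 cW bW iC CE Wu s0 Aa Cc). Qed.

Lemma Pinf_le s : 0 < s -> Pf a0 c0 u s <= c.
Proof.
move=> s0; rewrite -[leRHS]addr0.
apply: (ler_cvg_to (PWlim s0) (cvgD (cvg_cst c) eps_cvg)).
by apply: nearW => n; exact: PW.
Qed.

Lemma Pinf_1 : Pf a0 c0 u 1 = c.
Proof.
apply/eqP; rewrite eq_le Pinf_le//= -[leLHS]subr0.
apply: (ler_cvg_to (cvgB (cvg_cst c) eps_cvg) (PWlim ltr01)).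
by apply: nearW => n; exact: PW1.
Qed.

Lemma a0_ge0 : 0 <= a0.
Proof.
apply: (ler_cvg_to (cvg_cst 0) Aa); apply: nearW => n; exact: IpA_ge0.
Qed.
Lemma c0_ge0 : 0 <= c0.
Proof.
apply: (ler_cvg_to (cvg_cst 0) Cc); apply: nearW => n; exact: IpC_ge0.
Qed.

(** Fatou along a tail of the sequence. Only an inequality is obtained, since part of the mass may
    escape to infinity. *)
Lemma Ipu_le_c0 : Ip (fC u) <= c0.
Proof.
apply/ler_addgt0Pr => e e0.
have [N _ hN] : \forall n \near \oo, Ip (fC (W n)) <= c0 + e.
  by move/cvgrPdist_le : Cc => /(_ e e0); apply: filterS => n; rewrite ler_distlC => /andP[].
have Wu' r : 0 < r -> W (n + N)%N r @[n --> \oo] --> u r.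
  by move=> r0; move: (Wu r0); rewrite -(cvg_shiftn N).
apply: (@Rfatou _ _ _ leb pos mpos (fun n => fC (W (n + N)%N)) (fC u) (c0 + e) _ _ _ _).2.
- by move=> n; exact: iC.
- by move=> n x _; exact: fC_ge0.
- move=> x /pos_gt0 x0; apply: cvgM; last exact: cvg_cst.
  by under eq_fun do rewrite expr2; rewrite expr2; apply: cvgM; exact: Wu'.
- by move=> n; apply: hN => /=; rewrite leq_addl.
Qed.

(** For [u = 0] the limit functional is [(s a0 + s^(1/3) c0) / 2], increasing in [s]; its value at
    [s = 2] would exceed the maximum [c > 0] attained at 1. *)
Lemma u_neq0 : exists2 r, 0 < r & u r != 0.
Proof.
apply: contrapT => /forall2NP h.
have {}h r : 0 < r -> u r = 0.
  by move=> r0; have [//|/negP] := h r; rewrite negbK => /eqP.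
have eD : Ip (fD u) = 0.
  rewrite -(Rint_cst0 leb mpos); apply: eq_RintD => r /pos_gt0 r0.
  by rewrite /fD h// normr0 powR0 ?mul0r// gt_eqF// p10.
have m0 r : mass u r = 0.
  have mr : @measurable _ mR `]0, r] by exact: measurable_itv.
  rewrite /mass /prim -[RHS](Rint_cst0 leb mr).
  apply: eq_RintD => x /= /[!in_itv] /= /andP[x0 _].
  by rewrite /fC h// expr0n mul0r.
have eB s : EB u s = 0.
  rewrite /EB (_ : Ip _ = 0) ?mulr0// -(Rint_cst0 leb mpos); apply: eq_RintD => r _.
  by rewrite /fB m0 mulr0 /bif expr0n addr0 sqrtr_sqr ger0_norm ?sqr_ge0 ?subrr.
have h1 := Pinf_1; have h2 := Pinf_le (ltr0n R 2).
move: h1 h2; rewrite /Pf eD !eB !mulr0 !mul0r !subr0 !addr0 !powR1 !mul1r => h1 h2.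
have h3 : 1 < 2 `^ 3^-1 :> R.
  have e1 : 1 `^ 3^-1 = 1 :> R by rewrite powR1.
  by rewrite -[ltLHS]e1 gt0_ltr_powR ?nnegrE ?invr_gt0 ?ltr1n.
have ca := a0_ge0; have cc := c_gt0.
have [c00|] := leP c0 0.
  have e0 : c0 = 0 by apply/eqP; rewrite eq_le c00 c0_ge0.
  by move: h1 h2; rewrite e0 !mulr0; lra.
move=> c0p; have h4 : c0 < 2 `^ 3^-1 * c0 by rewrite ltr_pMl.
by move: h1 h2 h4; move: (2 `^ _ * c0) => x; lra.
Qed.

Lemma Ipu_gt0 : 0 < Ip (fC u).
Proof.
have [r r0 ur] := u_neq0; apply: (Ip_gt0 (r := r)) => //.
- exact: cpos_fC.
- by move=> t _; exact: fC_ge0.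
- by rewrite /fC mulf_neq0// expf_neq0// gt_eqF.
Qed.

Lemma c0_gt0 : 0 < c0.
Proof. exact: lt_le_trans Ipu_gt0 Ipu_le_c0. Qed.

(** Strict concavity, available because [c0 > 0]: a second maximizer would push the value at the
    midpoint above [c]. *)
Lemma Pinf_lt s : 0 < s -> s != 1 -> Pf a0 c0 u s < c.
Proof.
move=> s0 s1; pose x := (1 + s) / 2.
have x0 : 0 < x by rewrite divr_gt0// addr_gt0.
have [sg hsg] := Pf_tangent p2 a0_ge0 c0_ge0 cu iu x0.
have xs : s != x by apply: contra_neq s1 => sx; move: sx; rewrite /x; lra.
have x1 : 1 != x by apply: contra_neq s1 => sx; move: sx; rewrite /x; lra.
have h1 := (hsg 1 ltr01).2 c0_gt0 x1; have h2 := (hsg s s0).2 c0_gt0 xs.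
have h3 := Pinf_le x0; rewrite Pinf_1 in h1.
have h4 : sg * (1 - x) + sg * (s - x) = 0 by rewrite -mulrDr /x; field.
by lra.
Qed.

Section Variation.
Variables (v v1 v2 : R -> R) (a b : R).
Hypothesis dv : D1 v v1.
Hypothesis dv1 : D1 v1 v2.
Hypothesis cv2 : cpos v2.
Hypothesis a_gt0 : 0 < a.
Hypothesis vsupp : forall r, 0 < r -> (r < a) || (b < r) -> [/\ v r = 0, v1 r = 0 & v2 r = 0].

Let cv : cpos v := D1_cpos dv.
Let cv1 : cpos v1 := D1_cpos dv1.

Let cX (n : nat) : cpos (fun r : R => r ^+ n).
Proof. by apply: cposX; exact: cpos_id. Qed.

Definition lap r : R := 2 * r * v1 r + r ^+ 2 * v2 r.
Definition mu (f : R -> R) : R -> R := prim (fun r => f r * v r * r ^+ 2).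
(** Density of the derivative of the field energy: a variation [t v] changes the mass by [2 t mu] to
    first order, and [m / sqrt (r^4 + (s m)^2)] is the corresponding slope. *)
Definition Gf (f : R -> R) (s r : R) : R :=
  mass f r * mu f r / Num.sqrt ((r ^+ 2) ^+ 2 + (s * mass f r) ^+ 2).
(** The first variation of the limit functional at [s = 1]. The gradient term is integrated by
    parts, [lap] being [(r^2 v')'], because [u] is not yet known to have a derivative. *)
Definition ELfun : R :=
  - Ip (fun r => u r * lap r) + Ip (fun r => u r * v r * r ^+ 2)
  + Ip (Gf u 1) - Ip (fun r => nlin p (u r) * v r * r ^+ 2).

Let clap : cpos lap.
Proof. by apply: cposD; apply: cposM => //; apply: cposM; [exact: cpos_cst|exact: cpos_id]. Qed.
Let cfv (f : R -> R) : cpos f -> cpos (fun r => f r * v r * r ^+ 2).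
Proof. by move=> cf; apply: cposM => //; apply: cposM. Qed.
Let ipv (f g : R -> R) : cpos f -> cpos g -> (forall r, 0 < r -> (r < a) || (b < r) -> g r = 0) ->
  ip (fun r => f r * g r).
Proof.
move=> cf cg g0; apply: (@ip_csupp _ a b) => //; first exact: cposM.
by move=> r r0 h; rewrite g0// mulr0.
Qed.
Let vr2 r : 0 < r -> (r < a) || (b < r) -> v r * r ^+ 2 = 0.
Proof. by move=> r0 h; have [-> _ _] := vsupp r0 h; rewrite mul0r. Qed.

Let ifv (f : R -> R) : cpos f -> ip (fun r => f r * v r * r ^+ 2).
Proof.
move=> cf; have h := ipv cf (cposM cv (cX (n:=2))) vr2.
by apply: (ig_eq mpos _ h) => r _ /=; rewrite mulrA.
Qed.

Lemma aq_ibp n : Ip (fun r => W' n r * v1 r * r ^+ 2) = - Ip (fun r => W n r * lap r).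
Proof.
have [dW cWn' _ _] := KW n.
have i1 : ip (fun r => W' n r * v1 r * r ^+ 2).
  have h : ip (fun r => W' n r * (v1 r * r ^+ 2)).
    apply: ipv => //; first exact: cposM.
    by move=> r r0 h; have [_ -> _] := vsupp r0 h; rewrite mul0r.
  by apply: (ig_eq mpos _ h) => r _; rewrite mulrA.
have i2 : ip (fun r => W n r * lap r).
  apply: ipv => //; first exact: cW.
  by move=> r r0 h; rewrite /lap; have [_ -> ->] := vsupp r0 h; rewrite !mulr0 addr0.
have dF : D1 (fun r => W n r * (v1 r * r ^+ 2)) (fun r => W' n r * v1 r * r ^+ 2 + W n r * lap r).
  by apply: D1_ext (D1M dW (D1M dv1 (D1X 1 (@D1_id)))) => // r r0; rewrite /lap expr1; ring.
have : Ip (fun r => W' n r * v1 r * r ^+ 2 + W n r * lap r) = 0.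
  apply: (IBP0 a_gt0 dF _ (b := b)).
    by apply: cposD; apply: cposM => //; [exact: cposM|exact: cW].
  by move=> r r0 h; have [_ -> _] := vsupp r0 h; rewrite mul0r mulr0.
by rewrite RintegralD// => /eqP; rewrite addr_eq0 => /eqP.
Qed.

Let gdom (r : R) : R := 1 + E / r.
Let cgdom : cpos gdom.
Proof.
apply: cposD; first exact: cpos_cst.
apply: cposM; first exact: cpos_cst.
by apply: cposV; [move=> r r0; rewrite gt_eqF|exact: cpos_id].
Qed.
Let gdom_ge1 r : 0 < r -> 1 <= gdom r.
Proof. by move=> r0; rewrite lerDl divr_ge0// ltW. Qed.

Lemma bnd_gdom U r : bnd E U -> 0 < r -> `|U r| <= gdom r.
Proof.
move=> bU r0; have [h _] := bU r r0.
apply: (@le_trans _ _ (1 + U r ^+ 2)); last by rewrite lerD2l.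
rewrite -[U r ^+ 2]real_normK ?num_real//; move: `|U r| (normr_ge0 (U r)) => y y0.
by have := sqr_ge0 (y - 1); nra.
Qed.

Lemma seq_lin (g : R -> R) : cpos g -> (forall r, 0 < r -> (r < a) || (b < r) -> g r = 0) ->
  Ip (fun r => W n r * g r) @[n --> \oo] --> Ip (fun r => u r * g r).
Proof.
move=> cg g0.
suff [] : ip (fun r => u r * g r) /\ (Ip (fun r => W n r * g r) @[n --> \oo] --> Ip (fun r => u r * g r)) by [].
apply: (@DCT _ _ _ leb pos mpos (fun n r => W n r * g r) (fun r => u r * g r) (fun r => gdom r * `|g r|)).
- by move=> n; apply: cpos_meas; apply: cposM => //; exact: cW.
- apply: ipv => //; first exact: cpos_abs.
  by move=> r r0 h; rewrite g0// normr0.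
- by move=> n r /pos_gt0 r0; rewrite normrM ler_wpM2r// bnd_gdom//; exact: bW.
- by move=> r /pos_gt0 r0; apply: cvgM; [exact: Wu|exact: cvg_cst].
Qed.

Lemma seq_nlin : Ip (fun r => nlin p (W n r) * v r * r ^+ 2) @[n --> \oo] -->
  Ip (fun r => nlin p (u r) * v r * r ^+ 2).
Proof.
have p1 : 1 < p by have := p2; lra.
have cnl f : cpos f -> cpos (fun r => nlin p (f r)) by move=> cf; apply: cpos_comp cf; exact: nlin_continuous.
suff [] : ip (fun r => nlin p (u r) * v r * r ^+ 2) /\ (Ip (fun r => nlin p (W n r) * v r * r ^+ 2) @[n --> \oo] -->
  Ip (fun r => nlin p (u r) * v r * r ^+ 2)) by [].
apply: (@DCT _ _ _ leb pos mpos (fun n r => nlin p (W n r) * v r * r ^+ 2)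
   (fun r => nlin p (u r) * v r * r ^+ 2) (fun r => (`|gdom r| `^ p) * `|v r * r ^+ 2|)).
- by move=> n; apply: cpos_meas; apply: cfv; apply: cnl; exact: cW.
- apply: ipv.
  + by apply: (cpos_comp (powabs_continuous _)) => //; have := p2; lra.
  + by apply: cpos_abs; exact: cposM.
  + by move=> r r0 h; rewrite vr2// normr0.
- move=> n r /pos_gt0 r0; rewrite -mulrA normrM ler_wpM2r// nlin_norm//.
  apply: ge0_ler_powR; rewrite ?nnegrE ?normr_ge0//; first by have := p2; lra.
  by rewrite [leRHS]ger0_norm ?(le_trans ler01 (gdom_ge1 r0))// bnd_gdom//; exact: bW.
- move=> r /pos_gt0 r0; apply: cvgM; last exact: cvg_cst.
  apply: cvgM; last exact: cvg_cst.
  apply: (@cvg_comp _ _ _ (fun n => W n r) (nlin p) _ (nbhs (u r))); first exact: Wu.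
  exact: nlin_continuous.
Qed.

Lemma seq_mu r : 0 < r -> mu (W n) r @[n --> \oo] --> mu u r.
Proof.
move=> r0; have mr : @measurable _ mR `]0, r] by exact: measurable_itv.
suff [] : leb.-integrable `]0, r] (EFin \o (fun r => u r * v r * r ^+ 2)) /\ (mu (W n) r @[n --> \oo] --> mu u r) by [].
apply: (@DCT _ _ _ leb `]0, r]%classic mr (fun n r => W n r * v r * r ^+ 2) (fun r => u r * v r * r ^+ 2)
   (fun r => gdom r * `|v r * r ^+ 2|)).
- move=> n; apply: measurable_funS (ig_meas (ifv (@cW n))) => //; exact: oseg_pos.
- apply: ip_oseg; apply: ipv => //; first by apply: cpos_abs; exact: cposM.
  by move=> x x0 h; rewrite vr2// normr0.
- move=> n x /oseg_pos/pos_gt0 x0; rewrite -mulrA normrM ler_wpM2r// bnd_gdom//; exact: bW.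
- move=> x /oseg_pos/pos_gt0 x0; apply: cvgM; last exact: cvg_cst.
  by apply: cvgM; [exact: Wu|exact: cvg_cst].
Qed.

Definition Kmu : R := Ip (fun r => gdom r * `|v r * r ^+ 2|).
Lemma Kmu_ge0 : 0 <= Kmu.
Proof.
by apply: Rintegral_ge0 => r /pos_gt0 r0; rewrite mulr_ge0// (le_trans ler01)// gdom_ge1.
Qed.

Lemma mu_bound U r : cpos U -> bnd E U -> 0 < r -> `|mu U r| <= Kmu.
Proof.
move=> cU bU r0.
have ig : ip (fun r => gdom r * `|v r * r ^+ 2|).
  apply: ipv => //; first by apply: cpos_abs; exact: cposM.
  by move=> x x0 h; rewrite vr2// normr0.
apply: (@le_trans _ _ (prim (fun r => gdom r * `|v r * r ^+ 2|) r)).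
  apply: abs_Rint => //; [exact: ip_oseg (ifv cU)|exact: ip_oseg ig|].
  by move=> x /oseg_pos/pos_gt0 x0; rewrite -mulrA normrM ler_wpM2r// bnd_gdom.
apply: (prim_le_Ip r ig) => t t0; by rewrite mulr_ge0// (le_trans ler01)// gdom_ge1.
Qed.

Lemma mu_lt_a f r : r < a -> mu f r = 0.
Proof.
move=> ra; have mr : @measurable _ mR `]0, r] by exact: measurable_itv.
rewrite /mu /prim -[RHS](Rint_cst0 leb mr).
apply: eq_RintD => x /= /[!in_itv] /= /andP[x0 xr].
by rewrite -mulrA vr2 ?mulr0// (le_lt_trans xr).
Qed.

Lemma massv_lt_a r : r < a -> mass v r = 0.
Proof.
move=> ra; have mr : @measurable _ mR `]0, r] by exact: measurable_itv.
rewrite /mass /prim -[RHS](Rint_cst0 leb mr).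
apply: eq_RintD => x /= /[!in_itv] /= /andP[x0 xr].
by rewrite /fC; have [-> _ _] := vsupp x0 (introT orP (or_introl (le_lt_trans xr ra))); rewrite expr0n mul0r.
Qed.

Lemma cpos_mu f : cpos f -> cpos (mu f).
Proof. by move=> cf; apply: D1_cpos (prim_D1 (cfv cf) (ifv cf)). Qed.

Lemma S_ge (r s m : R) : r ^+ 2 <= Num.sqrt ((r ^+ 2) ^+ 2 + (s * m) ^+ 2).
Proof. by rewrite -subr_ge0; exact: bif_ge0 (sqr_ge0 r). Qed.

Lemma S_gt0 (r s m : R) : 0 < r -> 0 < Num.sqrt ((r ^+ 2) ^+ 2 + (s * m) ^+ 2).
Proof. by move=> r0; apply: lt_le_trans (S_ge r s m); rewrite exprn_gt0. Qed.

Lemma cpos_S (f : R -> R) s : cpos f -> cpos (fun r => Num.sqrt ((r ^+ 2) ^+ 2 + (s * f r) ^+ 2)).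
Proof.
move=> cf; apply: cpos_sqrt; apply: cposD; first by apply: cposX.
by apply: cposX; apply: cposM => //; exact: cpos_cst.
Qed.

Lemma cpos_Gf f s : cpos f -> ip (fC f) -> cpos (Gf f s).
Proof.
move=> cf fi; apply: cposM; first by apply: cposM; [exact: cpos_mass|exact: cpos_mu].
apply: cposV; first by move=> r r0; rewrite gt_eqF// S_gt0.
by apply: cpos_S; exact: cpos_mass.
Qed.

Let wdom (r : R) : R := (1 + a^-1) ^+ 2 * wgt 1 r.
Let iw : ip wdom.
Proof. by apply: igZ => //; exact: ip_wgt. Qed.
Let wdom_ge0 r : 0 <= wdom r.
Proof. by rewrite mulr_ge0 ?sqr_ge0 ?wgt_ge0. Qed.

(** Below the support of [v] the factor [mu] vanishes, and above it the square root is at least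
    [r^2]; the majorant does not depend on [s] or on the profile. *)
Lemma Gf_bound U s r : cpos U -> bnd E U -> ip (fC U) -> Ip (fC U) <= E -> 0 < r ->
  `|Gf U s r| <= E * Kmu * wdom r.
Proof.
move=> cU bU iU IU r0; have [ra|ar] := ltP r a.
  by rewrite /Gf mu_lt_a// mulr0 mul0r normr0 mulr_ge0// mulr_ge0// Kmu_ge0.
rewrite /Gf !normrM normfV [`|Num.sqrt _|]ger0_norm ?sqrtr_ge0//.
apply: (@le_trans _ _ (E * Kmu * r ^- 2)).
  apply: ler_pM; rewrite ?mulr_ge0 ?invr_ge0 ?sqrtr_ge0//.
    apply: ler_pM => //; last exact: mu_bound.
    by rewrite ger0_norm ?mass_ge0// (le_trans (mass_le r iU)).
  by rewrite lef_pV2 ?posrE ?S_gt0 ?exprn_gt0// S_ge.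
by apply: ler_wpM2l; [rewrite mulr_ge0 ?Kmu_ge0|rewrite /wdom; exact: inv2_le_wgt].
Qed.

Lemma seq_Gf (s : nat -> R) : s n @[n --> \oo] --> (1 : R) ->
  Ip (Gf (W n) (s n)) @[n --> \oo] --> Ip (Gf u 1).
Proof.
move=> s1.
suff [] : ip (Gf u 1) /\ (Ip (Gf (W n) (s n)) @[n --> \oo] --> Ip (Gf u 1)) by [].
apply: (@DCT _ _ _ leb pos mpos (fun n => Gf (W n) (s n)) (Gf u 1) (fun r => E * Kmu * wdom r)).
- by move=> n; apply: cpos_meas; apply: cpos_Gf; [exact: cW|exact: iC].
- exact: igZ.
- by move=> n r /pos_gt0 r0; apply: Gf_bound => //; [exact: cW|exact: bW|exact: iC|exact: CE].
- move=> r /pos_gt0 r0.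
  have hm := seq_mass E0 bW iC Wu r0.
  apply: cvgM; first by apply: cvgM => //; exact: seq_mu.
  apply: cvgV; first by rewrite gt_eqF// S_gt0.
  apply: (@cvg_comp _ _ _ _ Num.sqrt _ (nbhs ((r ^+ 2) ^+ 2 + (1 * mass u r) ^+ 2))); last exact: sqrt_continuous.
  apply: cvgD; first exact: cvg_cst.
  have h : s n * mass (W n) r @[n --> \oo] --> 1 * mass u r by exact: cvgM.
  by under eq_fun do rewrite expr2; rewrite expr2; exact: cvgM.
Qed.

Let KW' n := KW n.
Definition Kv : R := Ip (fC v).
Let iCv : ip (fC v).
Proof. by apply: (ig_eq mpos _ (ifv cv)) => r _; rewrite /fC expr2. Qed.
Let iAv : ip (fA v1).
Proof.
have h : ip (fun r => v1 r * (v1 r * r ^+ 2)).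
  apply: ipv => //; first exact: cposM.
  by move=> r r0 hr; have [_ -> _] := vsupp r0 hr; rewrite mul0r.
by apply: (ig_eq mpos _ h) => r _; rewrite /fA expr2 mulrA.
Qed.

Section Step.
Variables (n : nat) (t : R).
Hypothesis t0 : 0 < t.
Hypothesis t1 : t <= 1.
Definition VV r : R := W n r + t * v r.
Definition VV' r : R := W' n r + t * v1 r.

Let i1 : ip (fun r => W' n r * v1 r * r ^+ 2).
Proof.
have h : ip (fun r => W' n r * (v1 r * r ^+ 2)).
  apply: ipv; [exact: (@cW' n)|exact: cposM|].
  by move=> r r0 hr; have [_ -> _] := vsupp r0 hr; rewrite mul0r.
by apply: (ig_eq mpos _ h) => r _; rewrite mulrA.
Qed.
Let i2 : ip (fun r => W n r * v r * r ^+ 2) := ifv (@cW n).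

Lemma VV_A : ip (fA VV') /\ Ip (fA VV') =
  Ip (fA (W' n)) + 2 * t * Ip (fun r => W' n r * v1 r * r ^+ 2) + t ^+ 2 * Ip (fA v1).
Proof.
pose g r := fA (W' n) r + (2 * t) * (W' n r * v1 r * r ^+ 2) + t ^+ 2 * fA v1 r.
have e r : fA VV' r = g r by rewrite /g /fA /VV'; ring.
have [ig' eg] := ig3 mpos (2 * t) (t ^+ 2) (@iA n) i1 iAv.
split; first by apply: (ig_eq mpos _ ig') => r _; rewrite e.
by rewrite -eg; apply: eq_RintD => r _; exact: e.
Qed.

Lemma VV_C : ip (fC VV) /\ Ip (fC VV) =
  Ip (fC (W n)) + 2 * t * Ip (fun r => W n r * v r * r ^+ 2) + t ^+ 2 * Ip (fC v).
Proof.
pose g r := fC (W n) r + (2 * t) * (W n r * v r * r ^+ 2) + t ^+ 2 * fC v r.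
have e r : fC VV r = g r by rewrite /g /fC /VV; ring.
have [ig' eg] := ig3 mpos (2 * t) (t ^+ 2) (@iC n) i2 iCv.
split; first by apply: (ig_eq mpos _ ig') => r _; rewrite e.
by rewrite -eg; apply: eq_RintD => r _; exact: e.
Qed.

Lemma VV_Kp : Kp VV VV'.
Proof.
have [dW cWn' _ _] := KW n; split; last exact: VV_C.1.
- by apply: D1D => //; exact: D1Z.
- by apply: cposD => //; apply: cposM => //; exact: cpos_cst.
- exact: VV_A.1.
Qed.

Lemma VV_EE : EE VV VV' <= 2 * E + 2 * EE v v1.
Proof.
have hA : Ip (fA VV') <= 2 * Ip (fA (W' n)) + 2 * Ip (fA v1).
  have [ig' eg] := ig2 mpos 2 2 (@iA n) iAv.
  by rewrite -eg; apply: le_Rint => //; [exact: VV_A.1|move=> r _; exact: sq_addt_le].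
have hC : Ip (fC VV) <= 2 * Ip (fC (W n)) + 2 * Ip (fC v).
  have [ig' eg] := ig2 mpos 2 2 (@iC n) iCv.
  by rewrite -eg; apply: le_Rint => //; [exact: VV_C.1|move=> r _; exact: sq_addt_le].
have := EW n; rewrite /EE; move: hA hC; lra.
Qed.

Let ibv : bnd (2 * E + 2 * EE v v1) VV.
Proof. exact: bnd_mono VV_EE (Kp_bnd VV_Kp). Qed.
Lemma EE_ge0 (U U' : R -> R) : 0 <= EE U U'.
Proof. by rewrite addr_ge0 ?IpA_ge0 ?IpC_ge0. Qed.
Lemma EV0 : 0 <= 2 * E + 2 * EE v v1.
Proof. by rewrite addr_ge0// mulr_ge0// EE_ge0. Qed.

Let iDV : ip (fD VV).
Proof. by apply: (ip_fD p2 p5 EV0 ibv); have [d _ _ _] := VV_Kp; exact: D1_cpos d. Qed.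
Let iDW : ip (fD (W n)).
Proof. by apply: (ip_fD p2 p5 E0 (@bW n)); exact: cW. Qed.
Let iN : ip (fun r => nlin p (W n r) * v r * r ^+ 2).
Proof. by apply: ifv; apply: cpos_comp (@cW n); apply: nlin_continuous; have := p2; lra. Qed.

Lemma VV_D : Ip (fD (W n)) + (p + 1) * t * Ip (fun r => nlin p (W n r) * v r * r ^+ 2) <= Ip (fD VV).
Proof.
rewrite -RintZ// -RintegralD//; last exact: igZ.
apply: le_Rint => //; first by apply: igD => //; exact: igZ.
move=> r _; rewrite /fD /VV; move: (W n r) (v r) => x y.
by apply: powabs_tangent_step => //; have := p2; lra.
Qed.

Lemma VV_mass r : mass VV r = mass (W n) r + 2 * t * mu (W n) r + t ^+ 2 * mass v r.
Proof.
have mr : @measurable _ mR `]0, r] by exact: measurable_itv.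
rewrite /mass /mu /prim; transitivity (\int[leb]_(x in `]0, r])
   (fC (W n) x + (2 * t) * (W n x * v x * x ^+ 2) + t ^+ 2 * fC v x)).
  by apply: eq_RintD => x _; exact: fC_add.
have j1 := ip_oseg r (@iC n); have j2 := ip_oseg r i2; have j3 := ip_oseg r iCv.
by have [_ ->] := ig3 mr (2 * t) (t ^+ 2) j1 j2 j3.
Qed.

Definition Qv : R := (E * Kv + 4 * Kmu ^+ 2 + Kv ^+ 2) * Ip wdom.

Lemma VV_fB s : 0 < s -> Ip (fB VV s) <=
  Ip (fB (W n) s) + s ^+ 2 * (2 * t * Ip (Gf (W n) s) + t ^+ 2 * Qv).
Proof.
move=> s0; have Kv0 : 0 <= Kv by exact: IpC_ge0.
have iG : ip (Gf (W n) s).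
  apply: (@ig_dom _ _ _ leb pos mpos _ (fun r => E * Kmu * wdom r)); last first.
  - by move=> r /pos_gt0 r0; apply: Gf_bound => //; [exact: cW|exact: bW|exact: iC|exact: CE].
  - exact: igZ.
  - by apply: cpos_meas; apply: cpos_Gf; [exact: cW|exact: iC].
have iB1 : ip (fB VV s).
  by have [d _ _ i] := VV_Kp; apply: ip_fB => //; [exact: D1_cpos d|exact: ltW].
have iB2 : ip (fB (W n) s) by apply: ip_fB; [exact: cW|exact: iC|exact: ltW].
have [ig' eg] := ig3 mpos (s ^+ 2 * (2 * t)) (s ^+ 2 * (t ^+ 2 * (E * Kv + 4 * Kmu ^+ 2 + Kv ^+ 2))) iB2 iG iw.
rewrite [leRHS](_ : _ = Ip (fB (W n) s) + s ^+ 2 * (2 * t) * Ip (Gf (W n) s) +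
  s ^+ 2 * (t ^+ 2 * (E * Kv + 4 * Kmu ^+ 2 + Kv ^+ 2)) * Ip wdom); last by rewrite /Qv; ring.
rewrite -eg; apply: le_Rint => //.
move=> r /pos_gt0 r0; rewrite /fB VV_mass /Gf.
have [ra|ar] := ltP r a.
  rewrite mu_lt_a// massv_lt_a// !mulr0 mul0r !addr0 mulr0 addr0 lerDl mulr_ge0 ?wdom_ge0//.
  apply: mulr_ge0; first exact: sqr_ge0.
  apply: mulr_ge0; first exact: sqr_ge0.
  by apply: addr_ge0; [apply: addr_ge0; [exact: mulr_ge0|apply: mulr_ge0 => //; exact: sqr_ge0]|exact: sqr_ge0].
have hm : mass (W n) r <= E by apply: le_trans (mass_le r (@iC n)) (CE n).
have hv : mass v r <= Kv by exact: mass_le.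
have hmu := mu_bound (@cW n) (@bW n) r0.
have hw : r ^- 2 <= wdom r by exact: inv2_le_wgt.
have hm0 := mass_ge0 (W n) r; have hv0 := mass_ge0 v r.
rewrite -[leRHS]addrA; move: (mass (W n) r) (mass v r) (mu (W n) r) (wdom r) hm hv hmu hw hm0 hv0.
by move=> m1 m2 m3 m4 hm hv hmu hw hm0 hv0; exact: (bif_step r0 s0 t0 t1).
Qed.

Definition TT s : R := s * Ip (fun r => W' n r * v1 r * r ^+ 2) + s `^ 3^-1 * Ip (fun r => W n r * v r * r ^+ 2)
  + s * Ip (Gf (W n) s) - s `^ qexp p * Ip (fun r => nlin p (W n r) * v r * r ^+ 2).
Definition RR s : R := 2^-1 * (s * Ip (fA v1) + s `^ 3^-1 * Ip (fC v) + s * Qv).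

(** An upper expansion suffices. The quadratic terms are expanded exactly, the nonlinear term is
    bounded below by convexity, and the field term above by [bif_step]. *)
Lemma VV_PP s : 0 < s -> PP VV VV' s <= PP (W n) (W' n) s + t * TT s + t ^+ 2 * RR s.
Proof.
move=> s0; rewrite /PP /Pf VV_A.2 VV_C.2 /TT /RR.
have hB : EB VV s <= EB (W n) s + s * (2 * t * Ip (Gf (W n) s) + t ^+ 2 * Qv).
  rewrite /EB; apply: (@le_trans _ _ (s^-1 * (Ip (fB (W n) s) + s ^+ 2 * (2 * t * Ip (Gf (W n) s) + t ^+ 2 * Qv)))).
    by rewrite ler_wpM2l ?invr_ge0 ?VV_fB// ltW.
  by rewrite mulrDr lerD2l expr2 -mulrA mulKf ?gt_eqF.
have hD := VV_D; have q0 := powR_ge0 s (qexp p).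
have P0 := p10 p2.
apply: PP_step => //.
Qed.

End Step.
Let ts n : R := n.+1%:R^-1.
Let ts0 n : 0 < ts n. Proof. by rewrite invr_gt0 ltr0n. Qed.
Let ts1 n : ts n <= 1. Proof. by rewrite invf_le1 ?ler1n ?ltr0n. Qed.
Let tsc : ts n @[n --> \oo] --> (0 : R). Proof. exact: cvg_harmonic. Qed.
Let V n := VV n (ts n).
Let V' n := VV' n (ts n).
Let EV : R := 2 * E + 2 * EE v v1.
Let KV n : Kp (V n) (V' n). Proof. exact: VV_Kp. Qed.

Let vr2' : cpos (fun r => v r * r ^+ 2).
Proof. exact: cposM. Qed.

Let aqc : Ip (fun r => W' n r * v1 r * r ^+ 2) @[n --> \oo] --> - Ip (fun r => u r * lap r).
Proof.
under eq_fun do rewrite aq_ibp; apply: cvgN; apply: seq_lin => // r r0 hr.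
by rewrite /lap; have [_ -> ->] := vsupp r0 hr; rewrite !mulr0 addr0.
Qed.

Let bqc : Ip (fun r => W n r * v r * r ^+ 2) @[n --> \oo] --> Ip (fun r => u r * v r * r ^+ 2).
Proof.
have h := seq_lin vr2' vr2.
rewrite (_ : Ip (fun r => u r * v r * r ^+ 2) = Ip (fun r => u r * (v r * r ^+ 2))); last first.
  by apply: eq_RintD => r _; rewrite mulrA.
apply: cvg_trans h; apply: near_eq_cvg; apply: nearW => n.
by apply: eq_RintD => r _; rewrite mulrA.
Qed.

Lemma cvg_quad (f g : nat -> R) (l m k : R) : f n @[n --> \oo] --> l -> g n @[n --> \oo] --> m ->
  f n + 2 * ts n * g n + ts n ^+ 2 * k @[n --> \oo] --> l.
Proof.
move=> fl gm; rewrite -[X in _ --> X](_ : l + 2 * 0 * m + 0 ^+ 2 * k = l); last by ring.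
apply: cvgD; first (apply: cvgD => //; apply: cvgM => //; apply: cvgM => //; exact: cvg_cst).
by apply: cvgM; [under eq_fun do rewrite expr2; rewrite expr2; exact: cvgM|exact: cvg_cst].
Qed.

Let Ac' : Ip (fA (V' n)) @[n --> \oo] --> a0.
Proof. by under eq_fun do rewrite (VV_A _ _).2; exact: cvg_quad aqc. Qed.
Let Cc' : Ip (fC (V n)) @[n --> \oo] --> c0.
Proof. by under eq_fun do rewrite (VV_C _ _).2; exact: cvg_quad bqc. Qed.

Let PVlim s : 0 < s -> PP (V n) (V' n) s @[n --> \oo] --> Pf a0 c0 u s.
Proof.
move=> s0; apply: (@seq_Pf _ p2 p5 V u EV) => //.
- exact: (EV0).
- by move=> n; have [d _ _ _] := KV n; exact: D1_cpos d.
- by move=> n; apply: bnd_mono (Kp_bnd (KV n)); exact: VV_EE.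
- by move=> n; have [_ _ _ ?] := KV n.
- by move=> n; apply: le_trans (VV_EE n (ts0 n) (ts1 n)); rewrite lerDr IpA_ge0.
- move=> r r0; rewrite -[X in _ --> X](_ : u r + 0 * v r = u r); last by ring.
  by apply: cvgD; [exact: Wu|apply: cvgM => //; exact: cvg_cst].
Qed.

(** Otherwise [c - eps n] would be an admissible level below the infimum. For a perturbed profile of
    zero mass the value [s = 1] is only a placeholder. *)
Lemma exists_sn : exists s : nat -> R, (forall n, 0 < s n) /\
  (forall n, 0 < Ip (fC (V n)) -> c - eps n < PP (V n) (V' n) (s n)).
Proof.
suff /choice [s hs] : forall n, exists s : R, 0 < s /\ (0 < Ip (fC (V n)) -> c - eps n < PP (V n) (V' n) s).
  by exists s; split => n; have [] := hs n.
move=> n; have [C0|C0] := ltP 0 (Ip (fC (V n))); last by exists 1.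
apply: contrapT => h; have : clev p <= c - eps n.
  apply: (clev_le p2 p5); exists (V n), (V' n); split => // s s0.
  by rewrite leNgt; apply/negP => hs; apply: h; exists s.
by apply/negP; rewrite -ltNge ltrBlDr ltrDl; exact: eps_gt0.
Qed.

(** The limit functional has its strict maximum at 1. Eventually the values at [1 - e] and [1 + e]
    lie below those at 1 and at [s n], and concavity traps [s n] between them. *)
Lemma sn_cvg (s : nat -> R) : (forall n, 0 < s n) ->
  (\forall n \near \oo, c - eps n < PP (V n) (V' n) (s n)) -> s n @[n --> \oo] --> (1 : R).
Proof.
move=> s0 hs; apply/cvgrPdist_lt => d d0.
pose e : R := Num.min d 2^-1.
have e0 : 0 < e by rewrite lt_min; apply/andP; split => //; rewrite invr_gt0.
have ed : e <= d by rewrite ge_min lexx.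
have e1 : e <= 2^-1 by rewrite ge_min lexx orbT.
(* Away from 1 the limit lies below [c] by [2 g]; once the three sequences are within [g] of their
   limits, the value at [y] is below both the value at 1 and [c - eps n]. *)
have far (y : R) : 0 < y -> y != 1 -> \forall n \near \oo,
    PP (V n) (V' n) y < PP (V n) (V' n) 1 /\ PP (V n) (V' n) y < c - eps n.
  move=> y0 y1; have h := Pinf_lt y0 y1.
  pose g := (c - Pf a0 c0 u y) / 2.
  have g0 : 0 < g by rewrite divr_gt0// subr_gt0.
  have c1 := PVlim y0; have c2 := PVlim (@ltr01 R); have c3 := eps_cvg.
  move/cvgrPdist_lt : c1 => /(_ g g0) c1.
  move/cvgrPdist_lt : c2 => /(_ g g0) c2; rewrite Pinf_1 in c2.
  move/cvgrPdist_lt : c3 => /(_ g g0) c3.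
  near=> n.
  have h1 : `|Pf a0 c0 u y - PP (V n) (V' n) y| < g by near: n.
  have h2 : `|c - PP (V n) (V' n) 1| < g by near: n.
  have h3 : `|0 - eps n| < g by near: n.
  exact: far_alg h1 h2 h3.
have bm : 0 < 1 - e by lra.
have bm1 : 1 - e != 1 by apply/eqP => h; lra.
have bp : 0 < 1 + e by lra.
have bp1 : 1 + e != 1 by apply/eqP => h; lra.
have fm := far _ bm bm1; have fp := far _ bp bp1.
near=> n.
have [m1 m2] : PP (V n) (V' n) (1 - e) < PP (V n) (V' n) 1 /\ PP (V n) (V' n) (1 - e) < c - eps n by near: n.
have [p1 p2'] : PP (V n) (V' n) (1 + e) < PP (V n) (V' n) 1 /\ PP (V n) (V' n) (1 + e) < c - eps n by near: n.
have hn : c - eps n < PP (V n) (V' n) (s n) by near: n.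
have tan (y : R) : 0 < y -> exists sg : R, forall s, 0 < s -> PP (V n) (V' n) s <= PP (V n) (V' n) y + sg * (s - y).
  move=> y0; have [dV _ iAV iCV] := KV n.
  have [sg hsg] := Pf_tangent p2 (IpA_ge0 (V' n)) (IpC_ge0 (V n)) (D1_cpos dV) iCV y0.
  by exists sg => x x0; have [] := hsg x x0.
apply: (lt_le_trans _ ed).
have [sgm hm] := tan _ bm; have [sgp hp] := tan _ bp.
apply: (sn_alg (hm 1 ltr01) (hm _ (s0 n)) (hp 1 ltr01) (hp _ (s0 n)) e0 m1 _ p1) => //.
  exact: lt_trans hn.
exact: lt_trans hn.
Unshelve. all: by end_near. Qed.

(** At the near maximizer [s n] of the perturbed profile, [c - eps < PP V <= PP W + t TT + t^2 RR <=
    c + eps + t TT + t^2 RR]. Dividing by [t], with [eps = c t^2], leaves a nonnegative limit of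
    [TT]. *)
Lemma ELfun_ge0 : 0 <= ELfun.
Proof.
have [s [s0 hs]] := exists_sn.
have hC : \forall n \near \oo, c - eps n < PP (V n) (V' n) (s n).
  have : \forall n \near \oo, 0 < Ip (fC (V n)) by exact: (cvgr_gt _ Cc' _ c0_gt0).
  by apply: filterS => n; exact: hs.
have s1 := sn_cvg s0 hC.
have pw (e : R) : s n `^ e @[n --> \oo] --> (1 : R).
  have -> : 1 = 1 `^ e :> R by rewrite powR1.
  exact: (cvg_comp _ _ s1 (@cpos_powR e 1 ltr01)).
have Tc : TT n (s n) @[n --> \oo] --> ELfun.
  rewrite (_ : ELfun = 1 * (- Ip (fun r => u r * lap r)) + 1 * Ip (fun r => u r * v r * r ^+ 2)
    + 1 * Ip (Gf u 1) - 1 * Ip (fun r => nlin p (u r) * v r * r ^+ 2)); last by rewrite !mul1r.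
  apply: cvgB; last (apply: cvgM; [exact: pw|exact: seq_nlin]).
  apply: cvgD; last (apply: cvgM => //; exact: seq_Gf).
  by apply: cvgD; apply: cvgM => //; exact: pw.
have Rc : ts n * RR (s n) @[n --> \oo] --> (0 : R).
  rewrite -[X in _ --> X](mul0r (2^-1 * (1 * Ip (fA v1) + 1 * Ip (fC v) + 1 * Qv))).
  apply: cvgM => //; apply: cvgM; first exact: cvg_cst.
  apply: cvgD; last (apply: cvgM => //; exact: cvg_cst).
  by apply: cvgD; apply: cvgM => //; try exact: cvg_cst; exact: pw.
have ec : (- (2 * c) * ts n) - ts n * RR (s n) @[n --> \oo] --> (0 : R).
  rewrite -[X in _ --> X](_ : - (2 * c) * 0 - 0 = 0 :> R); last by ring.
  by apply: cvgB => //; apply: cvgM => //; exact: cvg_cst.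
apply: (ler_cvg_to ec Tc); near=> n.
have h1 : c - eps n < PP (V n) (V' n) (s n) by near: n.
have h2 := VV_PP n (ts0 n) (ts1 n) (s0 n).
have h3 := PW n (s0 n).
apply: (Lfun_alg (ts0 n) _ h1 h2 h3).
by rewrite /eps /ts exprVn.
Unshelve. all: by end_near. Qed.

End Variation.

(** The form is odd in the test function, so the one-sided inequality for [v] and [- v] gives
    equality. *)
Lemma ELfun_eq0 v v1 v2 a b : D1 v v1 -> D1 v1 v2 -> cpos v2 -> 0 < a ->
  (forall r, 0 < r -> (r < a) || (b < r) -> [/\ v r = 0, v1 r = 0 & v2 r = 0]) ->
  ELfun v v1 v2 = 0.
Proof.
move=> d1 d2 c2 a_gt0 hs; apply/eqP; rewrite eq_le (ELfun_ge0 d1 d2 c2 a_gt0 hs) andbT -oppr_ge0.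
pose N (f : R -> R) r : R := - f r.
have hs' r : 0 < r -> (r < a) || (b < r) -> [/\ N v r = 0, N v1 r = 0 & N v2 r = 0].
  by move=> r0 hr; have [e1 e2 e3] := hs r r0 hr; rewrite /N e1 e2 e3 oppr0.
have := ELfun_ge0 (D1N d1) (D1N d2) (cposN c2) a_gt0 hs'.
suff -> : ELfun (N v) (N v1) (N v2) = - ELfun v v1 v2 by [].
have RN (f g : R -> R) : (forall r, g r = - f r) -> Ip g = - Ip f.
  by move=> e; rewrite -RintN_all; apply: eq_RintD => r _; rewrite e.
have muN f r : mu (N v) f r = - mu v f r.
  rewrite /mu /prim -RintN_all; apply: eq_RintD => x _.
  by rewrite /N mulrN mulNr.
rewrite /ELfun.
rewrite (RN (fun r => u r * lap v1 v2 r) (fun r => u r * lap (N v1) (N v2) r)); last first.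
  by move=> r; rewrite /lap /N !mulrN -opprD mulrN.
rewrite (RN (fun r => u r * v r * r ^+ 2) (fun r => u r * N v r * r ^+ 2)); last first.
  by move=> r; rewrite /N mulrN mulNr.
rewrite (RN (Gf v u 1) (Gf (N v) u 1)); last first.
  by move=> r; rewrite /Gf muN mulrN mulNr.
rewrite (RN (fun r => nlin p (u r) * v r * r ^+ 2) (fun r => nlin p (u r) * N v r * r ^+ 2)); last first.
  by move=> r; rewrite /N mulrN mulNr.
by ring.
Qed.

(** On each segment [2 W' u' - u'^2 <= W'^2]. The linear term converges because an integration by
    parts moves the derivative from [W] onto [r^2 u'], which is why a second derivative of [u] is
    assumed. *)
Lemma lsc u' u'' : D1 u u' -> D1 u' u'' -> cpos u'' -> ip (fA u') /\ Ip (fA u') <= a0.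
Proof.
move=> du du' cu''; have cu' := D1_cpos du'.
have c2 : cpos (fun r : R => r ^+ 2) by apply: cposX; exact: cpos_id.
have cfA : cpos (fA u') by apply: cposM => //; exact: cposX.
apply: sum_small_seg => //.
  by move=> r _; exact: fC_ge0.
move=> al be al0 ab.
have ms : @measurable _ mR `[al, be] by exact: measurable_itv.
pose g r := u' r * r ^+ 2.
pose g' r := u'' r * r ^+ 2 + u' r * (2 * r).
have dg : D1 g g'.
  apply: D1_ext (D1M du' (D1X 1 (@D1_id))) => // r r0.
  by rewrite /g' expr1; ring.
have cg : cpos g by exact: cposM.
have cg' : cpos g'.
  apply: cposD; first exact: cposM.
  by apply: cposM => //; apply: cposM; [exact: cpos_cst|exact: cpos_id].
have ibp (U U' : R -> R) : D1 U U' -> cpos U' ->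
    \int[leb]_(x in `[al, be]) (U' x * g x) =
    (U be * g be - U al * g al) - \int[leb]_(x in `[al, be]) (U x * g' x).
  move=> dU cU'; have cU := D1_cpos dU.
  have cc1 : cpos (fun x => U' x * g x) by exact: cposM.
  have cc2 : cpos (fun x => U x * g' x) by exact: cposM.
  rewrite -(FTC2 (D1M dU dg) (cposD cc1 cc2) al0 ab) RintegralD//; last 2 first.
  - exact: cpos_ig_seg cc1 al0.
  - exact: cpos_ig_seg cc2 al0.
  by rewrite addrK.
pose X := \int[leb]_(x in `[al, be]) fA u' x.
have eX : X = \int[leb]_(x in `[al, be]) (u' x * g x).
  by apply: eq_RintD => x _; rewrite /fA /g expr2 mulrA.
have lim : \int[leb]_(x in `[al, be]) (W' n x * g x) @[n --> \oo] --> X.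
  rewrite eX (ibp _ _ du cu').
  under eq_fun => n do rewrite (ibp _ _ (let: And4 d _ _ _ := KW n in d) (@cW' n)).
  apply: cvgB.
    by apply: cvgB; apply: cvgM; [apply: Wu; exact: lt_le_trans ab|exact: cvg_cst|exact: Wu|exact: cvg_cst].
  suff [] : leb.-integrable `[al, be] (EFin \o (fun r => u r * g' r)) /\
    (\int[leb]_(x in `[al, be]) (W n x * g' x) @[n --> \oo] --> \int[leb]_(x in `[al, be]) (u x * g' x)) by [].
  have cgd : cpos (fun r : R => 1 + E / r).
    apply: cposD; first exact: cpos_cst.
    apply: cposM; first exact: cpos_cst.
    by apply: cposV; [move=> r r0; rewrite gt_eqF|exact: cpos_id].
  apply: (@DCT _ _ _ leb `[al, be]%classic ms (fun n r => W n r * g' r) (fun r => u r * g' r)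
     (fun r => (1 + E / r) * `|g' r|)).
  - by move=> n; apply: ig_meas; exact: cpos_ig_seg (cposM (@cW n) cg') al0.
  - exact: cpos_ig_seg (cposM cgd (cpos_abs cg')) al0.
  - move=> n x /(seg_pos al0)/pos_gt0 x0; rewrite normrM ler_wpM2r//.
    exact: bnd_gdom (@bW n) x0.
  - by move=> x /(seg_pos al0)/pos_gt0 x0; apply: cvgM; [exact: Wu|exact: cvg_cst].
suff : 2 * X - X <= a0 by rewrite mulr_natl mulr2n addrK.
apply: (ler_cvg_to (cvgB (cvgM (cvg_cst (2 : R)) lim) (cvg_cst X)) Aa).
apply: nearW => n.
have iA1 : leb.-integrable `[al, be] (EFin \o (fun x => W' n x * g x)).
  exact: cpos_ig_seg (cposM (@cW' n) cg) al0.
have iA2 : leb.-integrable `[al, be] (EFin \o fA u').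
  exact: cpos_ig_seg cfA al0.
have cA : cpos (fA (W' n)) by apply: cposM => //; apply: cposX; exact: cW'.
apply: (le_trans _ (seg_le_Ip be cA (@iA n) _ al0)); last by move=> t _; exact: fA_ge0.
have [i3 e3] := ig2 ms 2 (-1) iA1 iA2.
rewrite [leLHS](_ : _ = \int[leb]_(r in `[al, be]) (2 * (W' n r * g r) + -1 * fA u' r)); last by rewrite e3 mulN1r.
apply: le_Rint => //; first exact: cpos_ig_seg cA al0.
by move=> r _; rewrite /fA /g; exact: sq_lower.
Qed.

End EulerLagrange.

(** The last clause is conditional on derivatives of [u]: these are produced by the equation in the
    clause before it, after which the energy bound becomes available. *)
Theorem minimizer (p : R) : 2 < p -> p < 5 ->
  exists u : R -> R, [/\ cpos u, (exists2 r, 0 < r & u r != 0),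
   leb.-integrable pos (EFin \o fC u) /\ bnd (Ebd p) u,
   (forall v v1 v2 a b, D1 v v1 -> D1 v1 v2 -> cpos v2 -> 0 < a ->
     (forall r, 0 < r -> (r < a) || (b < r) -> [/\ v r = 0, v1 r = 0 & v2 r = 0]) ->
     ELfun p u v v1 v2 = 0) &
   forall u' u'', D1 u u' -> D1 u' u'' -> cpos u'' ->
     leb.-integrable pos (EFin \o fA u') /\ PP p u u' 1 <= clev p].
Proof.
move=> p2 p5.
have [W [W' [u [a0 [c0 [[KW EW] [PW PW1] [Wu cu] Aa Cc]]]]]] := selection p2 p5.
exists u; split => //.
- by eapply u_neq0; eassumption.
- split; first by apply: (@seq_fC W u (Ebd p) (iC KW) _ Wu).1 => n; eapply CE; eassumption.
  by eapply u_bnd; eassumption.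
- by move=> v v1 v2 a b d1 d2 c2 a_gt0 hs; eapply ELfun_eq0; eassumption.
- move=> u' u'' d1 d2 c2.
  have [i1 h1] : leb.-integrable pos (EFin \o fA u') /\ Rintegral leb pos (fA u') <= a0.
    by eapply lsc; eassumption.
  have h2 : Rintegral leb pos (fC u) <= c0 by eapply Ipu_le_c0; eassumption.
  have h3 : Pf p a0 c0 u 1 = clev p by eapply Pinf_1; eassumption.
  by split => //; move: h3; rewrite /PP /Pf powR1; lra.
Qed.

(** * The potential generated by a radial charge *)

Section Potential.
Implicit Types (U V : R -> R) (r s t : R).

Definition SS U r : R := Num.sqrt ((r ^+ 2) ^+ 2 + mass U r ^+ 2).
Definition fS U r : R := mass U r / SS U r.
(** The integral of [fS U] from [r] to infinity, written as a difference so that the derivative is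
    [- fS U] and the limit at infinity is 0. *)
Definition pot U r : R := Ip (fS U) - prim (fS U) r.

Lemma SS_ge U r : r ^+ 2 <= SS U r.
Proof. by rewrite -subr_ge0; exact: bif_ge0 (sqr_ge0 r). Qed.
Lemma SS_gt0 U r : 0 < r -> 0 < SS U r.
Proof. by move=> r0; apply: lt_le_trans (SS_ge U r); rewrite exprn_gt0. Qed.
Lemma SS_sqr U r : SS U r ^+ 2 = (r ^+ 2) ^+ 2 + mass U r ^+ 2.
Proof. exact: sqr_sqrtD. Qed.
Lemma SS_gem U r : mass U r <= SS U r.
Proof. by apply: le_trans (ler_norm _) _; rewrite -sqrtr_sqr ler_wsqrtr// lerDr sqr_ge0. Qed.

Lemma fS_ge0 U r : 0 <= fS U r.
Proof. by rewrite divr_ge0 ?mass_ge0 ?sqrtr_ge0. Qed.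
Lemma fS_le1 U r : fS U r <= 1.
Proof.
have [s0|s0] := ltP 0 (SS U r); first by rewrite ler_pdivrMr// mul1r SS_gem.
have e : SS U r = 0 by apply/eqP; rewrite eq_le s0 sqrtr_ge0.
by rewrite /fS e invr0 mulr0.
Qed.
Lemma fS_le2 U r : ip (fC U) -> 0 < r -> fS U r <= Ip (fC U) * r ^- 2.
Proof.
move=> iU r0; apply: ler_pM; rewrite ?mass_ge0 ?invr_ge0 ?sqrtr_ge0 ?mass_le//.
by rewrite lef_pV2 ?posrE ?SS_gt0 ?exprn_gt0// SS_ge.
Qed.

Section WithU.
Variable U : R -> R.
Hypothesis cU : cpos U.
Hypothesis iU : ip (fC U).

Lemma cpos_SS : cpos (SS U).
Proof.
apply: cpos_sqrt; apply: cposD; first by apply: cposX; apply: cposX; exact: cpos_id.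
by apply: cposX; exact: cpos_mass.
Qed.

Lemma cpos_fS : cpos (fS U).
Proof.
apply: cposM; first exact: cpos_mass.
by apply: cposV; [move=> r r0; rewrite gt_eqF// SS_gt0|exact: cpos_SS].
Qed.

Lemma ip_fS : ip (fS U).
Proof.
apply: (@ig_dom _ _ _ leb pos mpos _ (fun r => 4 * (1 + Ip (fC U)) * wgt 1 r)).
- by apply: cpos_meas; exact: cpos_fS.
- by apply: igZ => //; exact: ip_wgt.
- move=> r /pos_gt0 r0; rewrite ger0_norm ?fS_ge0//.
  have C0 := IpC_ge0 U; have w0 := wgt_ge0 1 r.
  have [r1|r1] := leP r 1.
    have := @wgt_lb0 1 r ltr01 r0 r1; rewrite subrr powRr0 => h.
    by apply: le_trans (fS_le1 U r) _; nra.
  have h := @inv2_le_wgt 1 r ltr01 (ltW r1); rewrite invr1 in h.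
  apply: le_trans (fS_le2 iU r0) _.
  have : Ip (fC U) * r ^- 2 <= Ip (fC U) * ((1 + 1) ^+ 2 * wgt 1 r) by rewrite ler_wpM2l.
  by move: (Ip (fC U)) (r ^- 2) C0 => M x; nra.
Qed.

Lemma pot_D1 : D1 (pot U) (fun r => - fS U r).
Proof.
apply: D1_ext (D1B (@D1_cst (Ip (fS U))) (prim_D1 cpos_fS ip_fS)) => // r _.
by rewrite sub0r.
Qed.
Lemma cpos_pot : cpos (pot U).
Proof. exact: D1_cpos pot_D1. Qed.
Lemma pot_ge0 r : 0 <= pot U r.
Proof. by rewrite subr_ge0; apply: prim_le_Ip ip_fS _ => t _; exact: fS_ge0. Qed.
Lemma pot_le r : pot U r <= Ip (fS U).
Proof. by rewrite lerBlDr lerDl; apply: prim_ge0 => t _; exact: fS_ge0. Qed.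
Lemma pot_cvgy : pot U r @[r --> +oo] --> (0 : R).
Proof.
rewrite -[X in _ --> X](subrr (Ip (fS U))); apply: cvgB; first exact: cvg_cst.
exact: prim_cvgy ip_fS.
Qed.
Lemma pot_cvg0 : pot U r @[r --> 0^'+] --> Ip (fS U).
Proof.
rewrite -[X in _ --> X](subr0 (Ip (fS U))); apply: cvgB; first exact: cvg_cst.
exact: prim_cvg0 ip_fS.
Qed.

Lemma SS_D1 : D1 (SS U) (fun r => (2 * r ^+ 3 + mass U r * fC U r) / SS U r).
Proof.
have dm := mass_D1 cU iU.
have d2 : D1 (fun r : R => (r ^+ 2) ^+ 2 + mass U r ^+ 2) (fun r => 4 * r ^+ 3 + 2 * mass U r * fC U r).
  apply: D1_ext (D1D (D1X 1 (D1X 1 (@D1_id))) (D1X 1 dm)) => // r _.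
  by rewrite !expr1; ring.
apply: D1_ext (D1_sqrt _ d2) => // [r r0|r r0]; last first.
  by rewrite ltr_pwDl ?sqr_ge0// !exprn_gt0.
have S0 := SS_gt0 U r0; rewrite /SS in S0 *; move: (Num.sqrt _) S0 => S S0.
by field; rewrite gt_eqF.
Qed.

(** Integration by parts moves the primitive from the charge [U v r^2] to [fS U]: the variation of
    the field energy is multiplication by the potential. *)
Lemma pot_Gf (v : R -> R) a b : cpos v -> 0 < a -> supp a b v ->
  Ip (Gf v U 1) = Ip (fun r => pot U r * U r * r ^+ 2 * v r).
Proof.
move=> cv a0 sv.
pose g r := U r * v r * r ^+ 2.
have cg : cpos g by apply: cposM => //; exact: cposM.
have sg : supp a b g by move=> r r0 h; rewrite /g sv// mulr0 mul0r.
have ig' : ip g := ip_csupp cg a0 sg.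
have [i1 i2 E] := prim_ibp cpos_fS ip_fS cg ig'; have [_ E3] := ig2 mpos (Ip (fS U)) (-1) ig' i2.
transitivity (Ip (fun r => fS U r * prim g r)).
  by apply: eq_RintD => r _; rewrite /Gf /fS /SS mul1r mulrAC.
transitivity (Ip (fun r => Ip (fS U) * g r + -1 * (prim (fS U) r * g r))).
  by rewrite E3 -E mulN1r addrK.
by apply: eq_RintD => r _; rewrite /pot /g; ring.
Qed.

End WithU.
End Potential.

(** * The radial Schrödinger equation for the minimizer *)

Section MinimizerODE.
Variable p : R.
Hypothesis p2 : 2 < p.
Hypothesis p5 : p < 5.

Definition rhs (w U : R -> R) r : R := r ^+ 2 * ((1 + w r) * U r - nlin p (U r)).

Lemma rhs_alg (w U : R -> R) (v r : R) : rhs w U r * v =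
  U r * r ^+ 2 * v + w r * U r * r ^+ 2 * v - nlin p (U r) * r ^+ 2 * v.
Proof. by rewrite /rhs; ring. Qed.

Lemma cpos_nlin (U : R -> R) : cpos U -> cpos (fun r => nlin p (U r)).
Proof. by move=> cU; apply: cpos_comp cU; apply: nlin_continuous; have := p2; lra. Qed.

Lemma cpos_rhs (w U : R -> R) : cpos w -> cpos U -> cpos (rhs w U).
Proof.
move=> cw cU; apply: cposM; first by apply: cposX; exact: cpos_id.
apply: cposB; last exact: cpos_nlin.
by apply: cposM => //; apply: cposD => //; exact: cpos_cst.
Qed.

Lemma Lfun_ode (u : R -> R) : cpos u -> ip (fC u) ->
  (forall v v1 v2 a b, D1 v v1 -> D1 v1 v2 -> cpos v2 -> 0 < a ->
     (forall r, 0 < r -> (r < a) || (b < r) -> [/\ v r = 0, v1 r = 0 & v2 r = 0]) ->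
     ELfun p u v v1 v2 = 0) ->
  exists u' u'', [/\ D1 u u', D1 u' u'', cpos u'' & D1 (fun r => r ^+ 2 * u' r) (rhs (pot u) u)].
Proof.
move=> cu iu hL; have cp := cpos_pot cu iu.
apply: weak_ode => //; first exact: cpos_rhs.
move=> a b v v1 v2 [a0 sv uv] d1 d2.
have sv1 := smooth_D1 sv d1; have sv2 := smooth_D1 sv1 d2.
have uv1 := supp_D1 d1 uv; have uv2 := supp_D1 d2 uv1.
have cv := smooth_cpos sv.
have := hL v v1 v2 a b d1 d2 (smooth_cpos sv2) a0 (fun r r0 h => And3 (uv r r0 h) (uv1 r r0 h) (uv2 r r0 h)).
rewrite /ELfun (pot_Gf cu iu cv a0 uv).
have c2 : cpos (fun r : R => r ^+ 2) by apply: cposX; exact: cpos_id.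
have i1 : ip (fun r => u r * r ^+ 2 * v r) by apply: ip_supp uv => //; exact: cposM.
have i2 : ip (fun r => pot u r * u r * r ^+ 2 * v r) by apply: ip_supp uv => //; apply: cposM => //; exact: cposM.
have i3 : ip (fun r => nlin p (u r) * r ^+ 2 * v r) by apply: ip_supp uv => //; apply: cposM => //; exact: cpos_nlin.
have -> : Ip (fun r => u r * v r * r ^+ 2) = Ip (fun r => u r * r ^+ 2 * v r).
  by apply: eq_RintD => r _; rewrite mulrAC.
have -> : Ip (fun r => nlin p (u r) * v r * r ^+ 2) = Ip (fun r => nlin p (u r) * r ^+ 2 * v r).
  by apply: eq_RintD => r _; rewrite mulrAC.
have i4 := igD mpos i1 i2.
have -> : Ip (fun r => rhs (pot u) u r * v r) = Ip (fun r => u r * r ^+ 2 * v r) +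
   Ip (fun r => pot u r * u r * r ^+ 2 * v r) - Ip (fun r => nlin p (u r) * r ^+ 2 * v r).
  rewrite -RintegralD// -RintegralB//; apply: eq_RintD => r _; exact: rhs_alg.
rewrite /lap; lra.
Qed.

End MinimizerODE.

(** * Regularity at the origin *)

Section BootstrapAlgebra.
Implicit Types (a r x y z e L K : R).

Lemma max_sub (x y x' d : R) : 0 <= d -> x' = x - d -> Num.max x y - d <= Num.max x' y.
Proof.
move=> d0 ->; rewrite lerBlDr ge_max -!lerBlDr !le_max lexx /=.
by apply/orP; right; rewrite gerBl.
Qed.

Lemma ratio_alg x t L e : 0 < t -> `|L - x / t ^+ 2| <= e -> `|x - L * t ^+ 2| <= e * t ^+ 2.
Proof.
move=> t0 h; have t2 : 0 < t ^+ 2 by rewrite exprn_gt0.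
have -> : x - L * t ^+ 2 = - ((L - x / t ^+ 2) * t ^+ 2) by field; rewrite gt_eqF.
by rewrite normrN normrM [`|t ^+ 2|]gtr0_norm// ler_pM2r.
Qed.

Lemma cubic_alg x y L e a r z K : 0 < a -> a < r -> 0 < e -> 0 < z -> K = `|L| + 1 -> a < 1 -> a < z / (2 * K) ->
  `|y| < z / 2 ->
  `|x - L / 3 * r ^+ 3 - (y - L / 3 * a ^+ 3)| <= e / 3 * r ^+ 3 - e / 3 * a ^+ 3 ->
  `|x - L / 3 * r ^+ 3| <= e * r ^+ 3 + z.
Proof.
move=> a0 ar e0 z0 KE a1 az hy h.
have r0 : 0 < r by exact: lt_trans ar.
have K0 : 0 < K by rewrite KE ltr_wpDl.
have h1 : 0 < a ^+ 3 by rewrite exprn_gt0.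
have h2 : 0 < r ^+ 3 by rewrite exprn_gt0.
have h3 : `|L / 3 * a ^+ 3| <= z / 2.
  rewrite normrM [`|a ^+ 3|]gtr0_norm// normrM normfV [`|3|]gtr0_norm//.
  have hK : K * a <= z / 2.
    move: az; rewrite ltr_pdivlMr ?mulr_gt0// => /ltW; lra.
  have ha3 : a ^+ 3 <= a by rewrite exprS ler_piMr ?(ltW a0)// exprn_ile1// ltW.
  apply: le_trans _ hK; rewrite KE; have := normr_ge0 L; move: `|L| => l l0.
  apply: (@le_trans _ _ (l * a)); last by rewrite ler_wpM2r ?(ltW a0)// lerDl.
  rewrite -mulrA ler_wpM2l//; lra.
have h4 := ler_normD (x - L / 3 * r ^+ 3 - (y - L / 3 * a ^+ 3)) (y - L / 3 * a ^+ 3).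
rewrite subrK in h4; have h5 := ler_normB y (L / 3 * a ^+ 3).
have h6 : e / 3 * r ^+ 3 - e / 3 * a ^+ 3 <= e * r ^+ 3.
  have := mulr_gt0 e0 h1; have := mulr_gt0 e0 h2.
  by move: (r ^+ 3) (a ^+ 3) => A B; rewrite -!(mulrAC _ _ 3^-1); lra.
by lra.
Qed.

Lemma cubic_alg2 (v L e r : R) : 0 < r -> `|v - L / 3 * r ^+ 3| <= e * r ^+ 3 -> `|L / 3 - v / r ^+ 3| <= e.
Proof.
move=> r0; have r3 : 0 < r ^+ 3 by rewrite exprn_gt0.
have -> : v - L / 3 * r ^+ 3 = - ((L / 3 - v / r ^+ 3) * r ^+ 3) by field; rewrite gt_eqF.
by rewrite normrN normrM [`|r ^+ 3|]gtr0_norm// ler_pM2r.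
Qed.

Lemma cauchy_alg K x y e : 0 <= K -> 0 < e -> x < e / (2 * (K + 1)) -> y < e / (2 * (K + 1)) -> K * x + K * y < e.
Proof.
move=> K0 e0; rewrite !ltr_pdivlMr ?mulr_gt0 ?ltr_wpDl// => h1 h2.
have [->|kn] := eqVneq K 0; first by rewrite !mul0r addr0.
by have [x0|x0] := ltP 0 x; have [y0|y0] := ltP 0 y; nra.
Qed.

End BootstrapAlgebra.

Section Bootstrap.
Implicit Types (F f G g : R -> R) (a b r t e al x y C K N : R).

Lemma D1_cmp F f G g a b : D1 F f -> cpos f -> D1 G g -> cpos g -> 0 < a -> a <= b ->
  (forall t, a <= t -> t <= b -> `|f t| <= g t) -> `|F b - F a| <= G b - G a.
Proof.
move=> dF cf dG cg a0 ab fg; rewrite -(FTC2 dF cf a0 ab) -(FTC2 dG cg a0 ab).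
apply: abs_Rint => //; [exact: cpos_ig_seg|exact: cpos_ig_seg|].
by move=> x /=; rewrite in_itv /= => /andP[]; exact: fg.
Qed.

Lemma powR_anti r x y : 0 < r -> r <= 1 -> x <= y -> r `^ y <= r `^ x.
Proof.
move=> r0 r1 xy; have -> : r `^ x = r `^ y * r `^ (x - y).
  by rewrite -powRD ?(gt_eqF r0) ?implybT//; congr (_ `^ _); ring.
rewrite ler_peMr ?powR_ge0//.
have -> : x - y = - (y - x) by ring.
rewrite powRN invf_ge1 ?powR_gt0//.
by apply: powR_le1 => //; [exact: ltW|rewrite subr_ge0].
Qed.

(** L'Hospital's rule for [F / r^3], where smallness of [F] is known only at points arbitrarily
    close to 0. On [[a, r]] the derivative of [F - L r^3 / 3] is compared with [e r^2], and [a] is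
    then sent to 0. *)
Lemma cubic_limit_gen F h (L : R) : D1 F h -> cpos h ->
  (forall e N, 0 < e -> 0 < N -> exists a, [/\ 0 < a, a < N & `|F a| < e]) ->
  h r / r ^+ 2 @[r --> 0^'+] --> L -> F r / r ^+ 3 @[r --> 0^'+] --> L / 3.
Proof.
move=> dH ch flux_small hL; apply/cvgrPdist_le => e e0.
move/cvgrPdist_le : hL => /(_ e e0) [d /= d0 hd].
near=> r.
have rd : r < d by near: r; exact: nbhs_right_lt.
have key : `|(F r - L / 3 * r ^+ 3)| <= e * r ^+ 3.
  apply/ler_addgt0Pr => z z0; pose K := `|L| + 1.
  have K0 : 0 < K by rewrite ltr_wpDl.
  have N0 : 0 < Num.min r (Num.min 1 (z / (2 * K))).
    by rewrite !lt_min; apply/and3P; split => //; rewrite divr_gt0// mulr_gt0.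
  have [a [a0]] := flux_small _ _ (divr_gt0 z0 (ltr0n R 2)) N0.
  rewrite !lt_min => /and3P[ar a1 az] ha.
  have dF : D1 (fun r => F r - L / 3 * r ^+ 3) (fun r => h r - L * r ^+ 2).
    apply: D1_ext (D1B dH (D1Z (L / 3) (D1X 2 (@D1_id)))) => // x _.
    by rewrite mulr1 mulrA divfK.
  have cF : cpos (fun r => h r - L * r ^+ 2).
    by apply: cposB => //; apply: cposM; [exact: cpos_cst|apply: cposX; exact: cpos_id].
  have dG : D1 (fun r => e / 3 * r ^+ 3) (fun r => e * r ^+ 2).
    apply: D1_ext (D1Z (e / 3) (D1X 2 (@D1_id))) => // x _.
    by rewrite mulr1 mulrA divfK.
  have cG : cpos (fun r : R => e * r ^+ 2).
    by apply: cposM; [exact: cpos_cst|apply: cposX; exact: cpos_id].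
  have hb t : a <= t -> t <= r -> `|h t - L * t ^+ 2| <= e * t ^+ 2.
    move=> t1 t2; have t0 := lt_le_trans a0 t1.
    have := hd t; rewrite /= sub0r normrN gtr0_norm// (le_lt_trans t2 rd) t0 => /(_ isT isT).
    exact: ratio_alg.
  have := D1_cmp dF cF dG cG a0 (ltW ar) hb.
  by apply: (cubic_alg a0 ar e0 z0 (K := K)).
exact: cubic_alg2 key.
Unshelve. all: by end_near. Qed.

Section Flux.
Variables V V' h : R -> R.
Hypothesis dV : D1 V V'.
Hypothesis cV' : cpos V'.
Hypothesis dH : D1 (fun r => r ^+ 2 * V' r) h.
Hypothesis ch : cpos h.
Hypothesis iA : ip (fA V').

(** Finite Dirichlet energy makes [r^2 V'] small at points arbitrarily close to 0; this excludes the
    singular behaviour [1 / r]. *)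
Lemma flux_small e N : 0 < e -> 0 < N -> exists a, [/\ 0 < a, a < N & `|a ^+ 2 * V' a| < e].
Proof.
move=> e0 N0; have cA : cpos (fA V') by exact: cpos_fC.
have M0 : 0 < Num.min N 1 by rewrite lt_min; apply/andP.
have [a /andP[a0 aN] h1] := ip_small_0 cA iA (fun t _ => fA_ge0 V' t) (exprn_gt0 2 e0) M0.
exists a; split => //; first by rewrite (lt_le_trans aN)// ge_min lexx.
have a1 : a < 1 by rewrite (lt_le_trans aN)// ge_min lexx orbT.
rewrite -(@ltr_pXn2r _ 2)// ?nnegrE ?ltW// real_normK ?num_real//.
apply: le_lt_trans h1; rewrite /fA.
have -> : (a ^+ 2 * V' a) ^+ 2 = a * (a * (V' a ^+ 2 * a ^+ 2)) by ring.
by apply: ler_piMl; [apply: mulr_ge0; [exact: ltW|exact: fA_ge0]|exact: ltW].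
Qed.

Lemma flux_bound be C : -1 < be -> 0 <= C -> (forall t : R, 0 < t -> t <= 1 -> `|h t| <= C * t `^ be) ->
  forall r, 0 < r -> r <= 1 -> `|r ^+ 2 * V' r| <= C / (be + 1) * r `^ (be + 1).
Proof.
move=> b1 C0 hC r r0 r1; apply/ler_addgt0Pr => e e0.
have b10 : 0 < be + 1 by lra.
have [a [a0 ar ha]] := flux_small e0 r0.
have dG : D1 (fun r => C / (be + 1) * r `^ (be + 1)) (fun r => C * r `^ be).
  apply: D1_ext (D1Z (C / (be + 1)) (@D1_powR (be + 1))) => // x _.
  by rewrite addrK mulrA divfK// gt_eqF.
have cG : cpos (fun r => C * r `^ be) by apply: cposM; [exact: cpos_cst|exact: cpos_powR].
have hb t : a <= t -> t <= r -> `|h t| <= C * t `^ be.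
  by move=> t1 t2; apply: hC; [exact: lt_le_trans t1|exact: le_trans r1].
have hab := D1_cmp dH ch dG cG a0 (ltW ar) hb.
have : 0 <= C / (be + 1) * a `^ (be + 1) by rewrite mulr_ge0 ?powR_ge0// divr_ge0// ltW.
move: hab ha; rewrite /= => hab ha h3.
have := ler_normD (r ^+ 2 * V' r - a ^+ 2 * V' a) (a ^+ 2 * V' a).
rewrite subrK => h4; apply: le_trans h4 _; apply: lerD; last exact: ltW.
by apply: le_trans hab _; rewrite gerBl.
Qed.

Lemma cubic_limit (L : R) : h r / r ^+ 2 @[r --> 0^'+] --> L ->
  V' r / r @[r --> 0^'+] --> L / 3.
Proof.
move=> hL; have := cubic_limit_gen dH ch flux_small hL.
apply: cvg_trans; apply: near_eq_cvg; near=> r.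
by field; rewrite gt_eqF.
Unshelve. all: by end_near. Qed.

Section Power.
Variable p E Cw : R.
Hypothesis p2 : 2 < p.
Hypothesis p5 : p < 5.
Hypothesis E0 : 0 <= E.
Hypothesis bV : bnd E V.
Hypothesis Cw0 : 0 <= Cw.
Hypothesis hb : forall r, 0 < r -> r <= 1 -> `|h r| <= r ^+ 2 * ((1 + Cw) * `|V r| + `|V r| `^ p).

Definition Bd al := exists2 K, 0 <= K & forall r, 0 < r -> r <= 1 -> `|V r| <= K * r `^ (- al).

Let p0 : 0 < p. Proof. exact: lt_trans p2. Qed.

Lemma Bd_deriv al : Bd al -> 0 <= al -> al <= 2^-1 ->
  exists2 C, 0 <= C & forall r, 0 < r -> r <= 1 -> `|V' r| <= C * r `^ (1 - p * al).
Proof.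
move=> [K K0 hK] a0 a1; pose C := (1 + Cw) * K + K `^ p.
have C0 : 0 <= C by rewrite addr_ge0 ?powR_ge0// mulr_ge0// addr_ge0.
have pa : p * al < 5 / 2.
  apply: (@le_lt_trans _ _ (p * 2^-1)); first by rewrite ler_pM2l.
  by rewrite ltr_pM2r.
have hC t : 0 < t -> t <= 1 -> `|h t| <= C * t `^ (2 - p * al).
  move=> t0 t1; apply: le_trans (hb t0 t1) _.
  have -> : C * t `^ (2 - p * al) = t ^+ 2 * (C * t `^ (- (p * al))).
    rewrite mulrCA; congr (_ * _); rewrite -powR_mulrn ?(ltW t0)//.
    by rewrite powRD ?(gt_eqF t0) ?implybT.
  apply: ler_wpM2l; first exact: sqr_ge0.
  rewrite /C [leRHS]mulrDl; apply: lerD.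
    rewrite -mulrA ler_wpM2l ?addr_ge0//; apply: le_trans (hK t t0 t1) _.
    rewrite ler_wpM2l//; apply: powR_anti => //; rewrite lerN2.
    by rewrite ler_peMl//; have := p2; lra.
  apply: (@le_trans _ _ ((K * t `^ (- al)) `^ p)).
    by apply: ge0_ler_powR; rewrite ?nnegrE ?mulr_ge0 ?powR_ge0 ?hK// ltW.
  by rewrite powRM ?powR_ge0// -powRrM mulNr [al * p]mulrC.
have b1 : -1 < 2 - p * al by lra.
exists (C / (2 - p * al + 1)); first by rewrite divr_ge0//; lra.
move=> r r0 r1; have := flux_bound b1 C0 hC r0 r1.
rewrite normrM [`|r ^+ 2|]ger0_norm ?sqr_ge0//.
have -> : r `^ (2 - p * al + 1) = r ^+ 2 * r `^ (1 - p * al).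
  rewrite -powR_mulrn ?(ltW r0)// -powRD ?(gt_eqF r0) ?implybT//.
  by congr (_ `^ _); ring.
by rewrite mulrCA ler_pM2l ?exprn_gt0.
Qed.

(** Growth [r^(-al)] gives [V' = O(r^(1 - p al))] through the flux, and integration gives
    [V = O(r^(2 - p al))] up to constants. For [al <= 1/2] this gains at least [(5 - p) / 2] on the
    exponent. *)
Lemma Bd_step al be : Bd al -> 0 <= al -> al <= 2^-1 -> 0 < be -> al - (5 - p) / 2 <= be -> Bd be.
Proof.
move=> hB a0 a1 b0 ab; have [C C0 hC] := Bd_deriv hB a0 a1.
exists (`|V 1| + C / be); first by rewrite addr_ge0// divr_ge0// ltW.
move=> r r0 r1.
have dG : D1 (fun r => - (C / be) * r `^ (- be)) (fun r => C * r `^ (- be - 1)).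
  apply: D1_ext (D1Z (- (C / be)) (@D1_powR (- be))) => // x _.
  by rewrite mulrA mulrNN divfK// gt_eqF.
have cG : cpos (fun r => C * r `^ (- be - 1)) by apply: cposM; [exact: cpos_cst|exact: cpos_powR].
have hb' t : r <= t -> t <= 1 -> `|V' t| <= C * t `^ (- be - 1).
  move=> t1 t2; have t0 := lt_le_trans r0 t1.
  apply: le_trans (hC t t0 t2) _; rewrite ler_wpM2l//; apply: powR_anti => //.
  have : (p - 1) * al <= (p - 1) * 2^-1 by rewrite ler_wpM2l//; have := p2; lra.
  by move: ab; rewrite mulrBl; lra.
have := D1_cmp dV cV' dG cG r0 r1 hb'.
have e1 : 1 `^ (- be) = 1 :> R by rewrite powR1.
have r1' : 1 <= r `^ (- be).
  by rewrite -[leLHS](@powRr0 _ r); apply: powR_anti => //; rewrite oppr_le0 ltW.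
rewrite e1 => h1.
have h2 : `|V r| <= `|V 1| + `|V 1 - V r|.
  by have := ler_normB (V 1) (V 1 - V r); rewrite opprB addrC subrK.
have h3 : `|V 1| <= `|V 1| * r `^ (- be) by rewrite ler_peMr.
have h4 : 0 <= C / be by rewrite divr_ge0// ltW.
by apply: le_trans h2 _; rewrite mulrDl; apply: lerD => //; apply: le_trans h1 _; lra.
Qed.

Lemma Bd_half : Bd 2^-1.
Proof.
exists (Num.sqrt E); first exact: sqrtr_ge0.
move=> r r0 r1; have [h1 _] := bV r0.
rewrite powRN powR12_sqrt ?(ltW r0)// -sqrtrV ?(ltW r0)// -sqrtrM// -sqrtr_sqr.
by rewrite ler_wsqrtr.
Qed.

(** The bootstrap starts from the exponent [1/2] of the radial bound and stops at [1/p], for which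
    [1 - p al = 0] and [V'] is bounded. *)
Lemma deriv_bounded : exists2 K, 0 <= K & forall r, 0 < r -> r <= 1 -> `|V' r| <= K.
Proof.
(* The maximum keeps the exponents positive and makes the iteration end exactly at [1/p]. *)
pose s n := Num.max (2^-1 - n%:R * ((5 - p) / 2)) p^-1.
have p1 : p^-1 <= 2^-1 by rewrite lef_pV2 ?posrE// ltW.
have d0 : 0 < (5 - p) / 2 by rewrite divr_gt0// subr_gt0.
have s0 n : 0 < s n by rewrite lt_max invr_gt0 p0 orbT.
have s1 n : s n <= 2^-1.
  by rewrite ge_max p1 andbT gerBl mulr_ge0// ltW.
have hs n : Bd (s n).
  elim: n => [|n IH].
    have -> : s 0%N = 2^-1 by rewrite /s mul0r subr0; apply/max_idPl.
    exact: Bd_half.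
  apply: (Bd_step IH) => //; first exact: ltW.
  by apply: max_sub; [exact: ltW|rewrite -natr1; ring].
have [n hn] : exists n, s n = p^-1.
  have [n hn] : exists n : nat, 2^-1 / ((5 - p) / 2) < n%:R.
    by exists (Num.truncn (2^-1 / ((5 - p) / 2))).+1; exact: truncnS_gt.
  exists n; apply/max_idPr; move: hn; rewrite ltr_pdivrMr// => hn.
  have h0 : 0 < p^-1 by rewrite invr_gt0.
  by move: hn; move: (n%:R * _) => x; lra.
have := hs n; rewrite hn => hB.
have pV0 : 0 <= p^-1 by rewrite invr_ge0 ltW.
have [C C0 hC] := Bd_deriv hB pV0 p1.
exists C => // r r0 r1; have := hC r r0 r1.
by rewrite mulfV ?gt_eqF// subrr powRr0 mulr1.
Qed.

End Power.
End Flux.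

Lemma lip_limit V V' K : D1 V V' -> cpos V' -> 0 <= K -> (forall r, 0 < r -> r <= 1 -> `|V' r| <= K) ->
  exists V0, forall r, 0 < r -> r <= 1 -> `|V r - V0| <= K * r.
Proof.
move=> dV cV' K0 hK.
have lip a b : 0 < a -> a <= b -> b <= 1 -> `|V b - V a| <= K * b - K * a.
  move=> a0 ab b1; apply: (D1_cmp dV cV' (g := fun=> K)) => //.
  - by apply: D1_ext (D1Z K (@D1_id)) => // r _; rewrite mulr1.
  - exact: cpos_cst.
  - by move=> t t1 t2; apply: hK; [exact: lt_le_trans t1|exact: le_trans b1].
pose u n : R := n.+1%:R^-1.
have u0 n : 0 < u n by rewrite invr_gt0 ltr0n.
have u1 n : u n <= 1 by rewrite invf_le1 ?ler1n ?ltr0n.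
have uc : u n @[n --> \oo] --> (0 : R) by exact: cvg_harmonic.
have lip2 n m : `|V (u n) - V (u m)| <= K * u n + K * u m.
  have [h|/ltW h] := leP (u m) (u n).
    by apply: le_trans (lip _ _ (u0 m) h (u1 n)) _; rewrite lerD2l; apply: (@le_trans _ _ 0); rewrite ?oppr_le0 mulr_ge0// ltW.
  rewrite distrC [leRHS]addrC; apply: le_trans (lip _ _ (u0 n) h (u1 m)) _; rewrite lerD2l; apply: (@le_trans _ _ 0); by rewrite ?oppr_le0 mulr_ge0// ltW.
have : cvg (V (u n) @[n --> \oo]).
  apply: cauchy_cvg; apply/cauchy_exP => e e0.
  have e3 : 0 < e / (2 * (K + 1)) by rewrite divr_gt0// mulr_gt0// ltr_wpDl.
  move/cvgrPdist_lt : uc => /(_ _ e3) [N _ hN].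
  exists (V (u N)); exists N => // n nN; rewrite /ball /= .
  have h1 := hN N (leqnn N); have h2 := hN n nN.
  rewrite sub0r normrN gtr0_norm// in h1; rewrite sub0r normrN gtr0_norm// in h2.
  by apply: le_lt_trans (lip2 N n) _; exact: cauchy_alg h1 h2.
move=> /cvg_ex[V0 hV0]; exists V0 => r r0 r1.
have c1 : `|V r - V (u n)| @[n --> \oo] --> `|V r - V0|.
  by apply: cvg_norm; apply: cvgB => //; exact: cvg_cst.
apply: (ler_cvg_to c1 (cvg_cst (K * r))).
move/cvgrPdist_lt : uc => /(_ _ r0) uc'.
near=> n; have un : u n <= r.
  have : `|0 - u n| < r by near: n; exact: uc'.
  by rewrite sub0r normrN gtr0_norm// => /ltW.
by apply: le_trans (lip _ _ (u0 n) un r1) _; rewrite gerBl mulr_ge0// ltW.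
Unshelve. all: by end_near. Qed.

End Bootstrap.

(** * Pohozaev's identity *)

Section PohozaevAlgebra.
Implicit Types (a c d h x y r : R).

Lemma slope_squeeze a c d h : h != 0 -> c * h <= a -> a <= d * h -> `|h^-1 * a - c| <= `|d - c|.
Proof.
move=> h0 h1 h2; have -> : h^-1 * a - c = h^-1 * (a - c * h) by field.
have e : h * (d - c) = d * h - c * h by ring.
rewrite normrM normfV ler_pdivrMl ?normr_gt0// -normrM e.
by rewrite !ger0_norm ?subr_ge0 ?(le_trans h1)// lerD2r.
Qed.

(** By convexity the difference quotient lies between the slopes at [x] and at [x + h], and the
    slope is continuous; no case distinction at [x = 0] is needed. *)
Lemma powabs_derive (p x : R) : 1 < p ->
  is_derive x 1 (fun y : R => `|y| `^ (p + 1)) ((p + 1) * nlin p x).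
Proof.
move=> p1; pose f (y : R) := `|y| `^ (p + 1).
have h : (fun h : R => h^-1 *: (f (h *: 1 + x) - f x)) @ 0^' --> (p + 1) * nlin p x.
  apply/subr_cvg0/norm_cvg0P.
  apply: (@squeeze_cvgr _ _ _ _ (fun=> 0) (fun h => `|(p + 1) * nlin p (h + x) - (p + 1) * nlin p x|)).
  - near=> h; have h0 : h != 0 by near: h; exact: nbhs_dnbhs_neq.
    rewrite normr_ge0 /=; rewrite [h *: 1]mulr1; apply: slope_squeeze => //.
      by have := powabs_tangent x (h + x) p1; rewrite addrK -lerBrDl.
    have := powabs_tangent (h + x) x p1; have -> : x - (h + x) = - h by ring.
    by rewrite -/(f x) -/(f (h + x)) mulrN; lra.
  - exact: cvg_cst.
  - rewrite -[X in _ --> X](_ : `|(p + 1) * nlin p x - (p + 1) * nlin p x| = 0); last by rewrite subrr normr0.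
    apply: cvg_norm; apply: cvgB; last exact: cvg_cst.
    apply: cvgM; first exact: cvg_cst.
    apply: (@cvg_comp _ _ _ (fun h : R => h + x) (nlin p) _ (nbhs x)); last exact: nlin_continuous.
    suff hx : (h + x) @[h --> 0^'] --> 0 + x by rewrite add0r in hx.
    by apply: cvgD; [apply: cvg_within_filter; exact: cvg_id|exact: cvg_cst].
by apply: DeriveDef; [apply/cvg_ex; exists ((p + 1) * nlin p x)|exact: cvg_lim h].
Unshelve. all: by end_near. Qed.

(* Pohozaev's identity in integrated form, with [H = r^2 V'] and [K = r^2((1 + f)V - n)]. *)
Lemma poho_alg (r V V' H K f n P m S p : R) : 0 < r -> 0 < S -> 0 < p + 1 ->
  S ^+ 2 = (r ^+ 2) ^+ 2 + m ^+ 2 -> H = r ^+ 2 * V' -> K = r ^+ 2 * ((1 + f) * V - n) ->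
  n * V = P ->
  (2 * H * K * (2 * r)^-1 - H ^+ 2 * 2 / (2 * r) ^+ 2) + 2 * (V' * H + V * K)
  - 2^-1 * ((- (m / S)) * (r ^+ 3 * V ^+ 2) + (1 + f) * (3 * r ^+ 2 * V ^+ 2 + r ^+ 3 * (2 * V * V')))
  + (3 * r ^+ 2 * P + r ^+ 3 * ((p + 1) * n * V')) / (p + 1)
  - 2^-1 * (- (m / S) * m + f * (V ^+ 2 * r ^+ 2))
  - 2^-1 * (1 * (S - r ^+ 2) + r * ((2 * r ^+ 3 + m * (V ^+ 2 * r ^+ 2)) / S - 2 * r))
  = 3 / 2 * (V' ^+ 2 * r ^+ 2) + 2^-1 * (V ^+ 2 * r ^+ 2) - (2 * p - 1) / (p + 1) * (P * r ^+ 2)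
   + 3 / 2 * (r ^+ 2 * (S - r ^+ 2) / (S * 1 ^+ 2)).
Proof.
move=> r0 S0 p0 S2 -> -> <-.
have m2 : m ^+ 2 = S ^+ 2 - (r ^+ 2) ^+ 2 by rewrite S2 addrAC subrr add0r.
have e : - (m / S) * m = - (S ^+ 2 - (r ^+ 2) ^+ 2) / S by rewrite -m2; field; rewrite gt_eqF.
rewrite e; field; rewrite !gt_eqF//.
Qed.

(** Near the origin each boundary term carries a power of [r] or the mass, all other factors being
    bounded. *)
Lemma poho_small (r V V' f P m Sd Kv K F0 : R) q : 0 < r -> r <= 1 -> `|V| <= Kv -> `|V'| <= K ->
  0 <= f -> f <= F0 -> 0 <= P -> P <= q -> 0 <= m -> 0 <= Sd -> Sd <= m ->
  `|(r ^+ 2 * V') ^+ 2 * (2 * r)^-1 + 2 * (V * (r ^+ 2 * V')) - 2^-1 * ((1 + f) * (r ^+ 3 * V ^+ 2))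
    + r ^+ 3 * P - 2^-1 * (f * m) - 2^-1 * (r * Sd)| <=
  r * (K ^+ 2 + 2 * Kv * K + (1 + F0) * Kv ^+ 2 + q) + (F0 + 1) * m.
Proof.
move=> r0 r1 hV hV' f0 fF P0 Pq m0 s0 sm.
have Kv0 : 0 <= Kv by exact: le_trans hV.
have K0 : 0 <= K by exact: le_trans hV'.
have V2 : V ^+ 2 <= Kv ^+ 2 by rewrite -real_normK ?num_real// ler_pXn2r ?nnegrE.
have V2' : V' ^+ 2 <= K ^+ 2 by rewrite -real_normK ?num_real// ler_pXn2r ?nnegrE.
have VV : `|V * V'| <= Kv * K by rewrite normrM ler_pM.
have r3 : r ^+ 3 <= r by rewrite exprS ler_piMr ?(ltW r0)// exprn_ile1// ltW.
have r2 : r ^+ 2 <= r by rewrite expr2; apply: ler_piMl => //; exact: ltW.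
have r30 : 0 <= r ^+ 3 by rewrite exprn_ge0// ltW.
have r20 : 0 <= r ^+ 2 by exact: sqr_ge0.
have -> : (r ^+ 2 * V') ^+ 2 * (2 * r)^-1 = 2^-1 * (r ^+ 3 * V' ^+ 2) by field; rewrite gt_eqF.
have t1 : r ^+ 3 * V' ^+ 2 <= r * K ^+ 2 by apply: ler_pM => //; exact: sqr_ge0.
have t10 : 0 <= r ^+ 3 * V' ^+ 2 by rewrite mulr_ge0 ?sqr_ge0.
have t2 : `|V * (r ^+ 2 * V')| <= r * (Kv * K).
  by rewrite mulrCA normrM ger0_norm// ler_pM.
have t3 : (1 + f) * (r ^+ 3 * V ^+ 2) <= r * ((1 + F0) * Kv ^+ 2).
  rewrite [leRHS]mulrCA; apply: ler_pM; [exact: addr_ge0|by apply: mulr_ge0 => //; exact: sqr_ge0|by rewrite lerD2l|].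
  by apply: ler_pM => //; exact: sqr_ge0.
have t30 : 0 <= (1 + f) * (r ^+ 3 * V ^+ 2) by rewrite mulr_ge0 ?addr_ge0// mulr_ge0 ?sqr_ge0.
have t4 : r ^+ 3 * P <= r * q by exact: ler_pM.
have t40 : 0 <= r ^+ 3 * P by exact: mulr_ge0.
have t5 : f * m <= F0 * m by exact: ler_wpM2r.
have t50 : 0 <= f * m by exact: mulr_ge0.
have t6 : r * Sd <= m by apply: le_trans sm; rewrite ler_piMl.
have t60 : 0 <= r * Sd by rewrite mulr_ge0// ltW.
move: t2; rewrite ler_norml => /andP[t2 t2'].
by rewrite ler_norml; apply/andP; split; lra.
Qed.

(** Far away each boundary term is controlled by [r] times the energy density, by the potential, or
    by [1 / r], all of which can be made small along a sequence. *)
Lemma poho_large (r V V' f P m Sd M F0 q x : R) : 1 <= r -> x = r * (V' ^+ 2 * r ^+ 2 + V ^+ 2 * r ^+ 2) ->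
  0 <= f -> f <= F0 -> 0 <= P -> P <= q * V ^+ 2 -> 0 <= q -> 0 <= m -> m <= M -> 0 <= Sd -> Sd <= m ^+ 2 / (2 * r ^+ 2) ->
  `|(r ^+ 2 * V') ^+ 2 * (2 * r)^-1 + 2 * (V * (r ^+ 2 * V')) - 2^-1 * ((1 + f) * (r ^+ 3 * V ^+ 2))
    + r ^+ 3 * P - 2^-1 * (f * m) - 2^-1 * (r * Sd)| <=
  (3 + F0 + q) * x + M * f + M ^+ 2 / r.
Proof.
move=> r1 xE f0 fF P0 Pq q0 m0 mM s0 sm.
have r0 : 0 < r by exact: lt_le_trans r1.
have -> : (r ^+ 2 * V') ^+ 2 * (2 * r)^-1 = 2^-1 * (r ^+ 3 * V' ^+ 2) by field; rewrite gt_eqF.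
have r30 : 0 <= r ^+ 3 by rewrite exprn_ge0// ltW.
have e : x = r ^+ 3 * V' ^+ 2 + r ^+ 3 * V ^+ 2 by rewrite xE; ring.
have a0 : 0 <= r ^+ 3 * V' ^+ 2 by rewrite mulr_ge0 ?sqr_ge0.
have b0 : 0 <= r ^+ 3 * V ^+ 2 by rewrite mulr_ge0 ?sqr_ge0.
have t2 : `|2 * (V * (r ^+ 2 * V'))| <= x.
  have -> : 2 * (V * (r ^+ 2 * V')) = r ^+ 2 * (2 * V * V') by ring.
  rewrite normrM ger0_norm ?sqr_ge0//.
  apply: (@le_trans _ _ (r ^+ 2 * (V' ^+ 2 + V ^+ 2))); first by rewrite ler_wpM2l ?sqr_ge0 ?abs2uv_le.
  rewrite e -mulrDr ler_wpM2r ?addr_ge0 ?sqr_ge0//.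
  by rewrite [leRHS]exprS ler_peMl ?sqr_ge0.
have t3 : (1 + f) * (r ^+ 3 * V ^+ 2) <= (1 + F0) * x.
  apply: ler_pM => //; [by rewrite addr_ge0|by rewrite lerD2l|by rewrite e lerDr].
have t30 : 0 <= (1 + f) * (r ^+ 3 * V ^+ 2) by rewrite mulr_ge0 ?addr_ge0.
have t4 : r ^+ 3 * P <= q * x.
  apply: (@le_trans _ _ (q * (r ^+ 3 * V ^+ 2))); last by rewrite ler_wpM2l// e lerDr.
  by rewrite mulrCA ler_wpM2l.
have t40 : 0 <= r ^+ 3 * P by exact: mulr_ge0.
have t5 : f * m <= M * f by rewrite mulrC ler_wpM2r.
have t50 : 0 <= f * m by exact: mulr_ge0.
have t6 : r * Sd <= M ^+ 2 / r.
  apply: (@le_trans _ _ (r * (m ^+ 2 / (2 * r ^+ 2)))); first by rewrite ler_wpM2l// ltW.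
  have -> : r * (m ^+ 2 / (2 * r ^+ 2)) = 2^-1 * m ^+ 2 / r by field; rewrite gt_eqF.
  rewrite ler_wpM2r ?invr_ge0 ?(ltW r0)//.
  have : m ^+ 2 <= M ^+ 2 by rewrite ler_pXn2r ?nnegrE// (le_trans m0).
  by have := sqr_ge0 m; lra.
have t60 : 0 <= r * Sd by rewrite mulr_ge0// ltW.
have x0 : 0 <= x by rewrite e addr_ge0.
move: t2; rewrite ler_norml => /andP[t2 t2'].
have F00 : 0 <= F0 by exact: le_trans fF.
have e3 : (3 + F0 + q) * x = 2 * x + (1 + F0) * x + q * x by ring.
have : 0 <= (1 + F0) * x by rewrite mulr_ge0// addr_ge0.
have : 0 <= q * x by rewrite mulr_ge0.
have : 0 <= M * f by rewrite mulr_ge0// (le_trans m0).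
have : 0 <= M ^+ 2 / r by rewrite divr_ge0 ?sqr_ge0 ?ltW.
by rewrite ler_norml e3 => *; apply/andP; split; lra.
Qed.

Lemma bi_alg (r S m : R) : 0 < S -> S ^+ 2 = (r ^+ 2) ^+ 2 + m ^+ 2 ->
  r ^+ 2 * (1 - r ^+ 2 / S) = m ^+ 2 / S - (S - r ^+ 2).
Proof.
move=> S0 S2; have -> : m ^+ 2 = S ^+ 2 - (r ^+ 2) ^+ 2 by rewrite S2 addrAC subrr add0r.
by field; rewrite gt_eqF.
Qed.

End PohozaevAlgebra.

Section Pohozaev.
Variable p : R.
Hypothesis p2 : 2 < p.
Hypothesis p5 : p < 5.
Variables V V' : R -> R.
Hypothesis KV : Kp V V'.
Hypothesis dH : D1 (fun r => r ^+ 2 * V' r) (rhs p (pot V) V).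

Let E : R := EE V V'.
Let E0 : 0 <= E. Proof. by rewrite addr_ge0 ?IpA_ge0 ?IpC_ge0. Qed.
Let dV : D1 V V'. Proof. by have [] := KV. Qed.
Let cV : cpos V := D1_cpos dV.
Let cV' : cpos V'. Proof. by have [] := KV. Qed.
Let iA : ip (fA V'). Proof. by have [] := KV. Qed.
Let iC : ip (fC V). Proof. by have [] := KV. Qed.
Let bV : bnd E V := Kp_bnd KV.
Let iD : ip (fD p V) := ip_fD p2 p5 E0 bV cV.
Let F0 : R := Ip (fS V).
Let F00 : 0 <= F0. Proof. by apply: Rintegral_ge0 => r _; exact: fS_ge0. Qed.
Let p10 : 0 < p + 1. Proof. by have := p2; lra. Qed.

Lemma sol_deriv_bounded : exists2 K, 0 <= K & forall r, 0 < r -> r <= 1 -> `|V' r| <= K.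
Proof.
apply: (deriv_bounded dV cV' dH _ iA p2 p5 E0 bV F00).
  by apply: cpos_rhs => //; exact: cpos_pot.
move=> r r0 r1; rewrite /rhs normrM ger0_norm ?sqr_ge0//; apply: ler_wpM2l; first exact: sqr_ge0.
apply: le_trans (ler_normB _ _) _; rewrite nlin_norm; last by have := p2; lra.
rewrite lerD2r normrM ler_wpM2r// ger0_norm ?lerD2l ?pot_le// addr_ge0// pot_ge0//.
Qed.

(** The boundary expression obtained from multiplying the equation by [2 V + r V'], the generator at
    [t = 1] of the dilation [t^2 V(t r)]. Its derivative [zf] is the integrand of three times the
    slope of the reduced functional. *)
Definition Zf r : R := (r ^+ 2 * V' r) ^+ 2 * (2 * r)^-1 + 2 * (V r * (r ^+ 2 * V' r))
  - 2^-1 * ((1 + pot V r) * (r ^+ 3 * V r ^+ 2)) + r ^+ 3 * (`|V r| `^ (p + 1) / (p + 1))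
  - 2^-1 * (pot V r * mass V r) - 2^-1 * (r * (SS V r - r ^+ 2)).
Definition zf r : R := 3 / 2 * fA V' r + 2^-1 * fC V r - (2 * p - 1) / (p + 1) * fD p V r + 3 / 2 * kB V 1 r.

Lemma Zf_D1 : D1 Zf zf.
Proof.
have dX (n : nat) : D1 (fun r : R => r ^+ n.+1) (fun r => n.+1%:R * r ^+ n).
  by apply: D1_ext (D1X n (@D1_id)) => // r _; rewrite mulr1.
have dm := mass_D1 cV iC; have dp := pot_D1 cV iC; have dS := SS_D1 cV iC.
have dP : D1 (fun r => `|V r| `^ (p + 1)) (fun r => (p + 1) * nlin p (V r) * V' r).
  apply: (D1_comp (h := fun y : R => `|y| `^ (p + 1)) (h' := fun y => (p + 1) * nlin p y)) => // r r0.
  by apply: powabs_derive; have := p2; lra.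
have d2 : D1 (fun r : R => (2 * r)^-1) (fun r => - 2 / (2 * r) ^+ 2).
  have h : D1 (fun r : R => 2 * r) (fun=> 2).
    by apply: D1_ext (D1Z 2 (@D1_id)) => // r _; rewrite mulr1.
  by apply: D1V h => r r0; rewrite gt_eqF// mulr_gt0.
have D := D1B (D1B (D1D (D1B (D1D (D1M (D1X 1 dH) d2) (D1Z 2 (D1M dV dH)))
   (D1Z 2^-1 (D1M (D1D (@D1_cst 1) dp) (D1M (dX 2%N) (D1X 1 dV)))))
   (D1M (dX 2%N) (D1Z (p + 1)^-1 dP)))
   (D1Z 2^-1 (D1M dp dm))) (D1Z 2^-1 (D1M (@D1_id) (D1B dS (dX 1%N)))).
apply: D1_ext D => r r0; first by rewrite /Zf /= [_ / (p + 1)]mulrC.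
have nP : nlin p (V r) * V r = `|V r| `^ (p + 1).
  rewrite /nlin -mulrA -expr2 -real_normK ?num_real// -powR_mulrn//.
  have [->|v0] := eqVneq (V r) 0; first by rewrite normr0 !powR0 ?mul0r ?gt_eqF//; have := p2; lra.
  by rewrite -powRD; [congr (_ `^ _); ring|rewrite normr_eq0 (negbTE v0) implybT].
have := poho_alg r0 (SS_gt0 V r0) p10 (SS_sqr V r) (erefl (r ^+ 2 * V' r)) (erefl (rhs p (pot V) V r)) nP.
have ek : kB V 1 r = r ^+ 2 * (SS V r - r ^+ 2) / (SS V r * 1 ^+ 2) by rewrite /kB mul1r.
rewrite /zf ek /fA /fC /fD => <-.
rewrite !expr1 -/(mass V r) /fS /fC -/(SS V r).
by move: (SS V r) (mass V r) (pot V r) (nlin p (V r)) (rhs _ _ _ _) (`|V r| `^ _) => S m f n K P; ring.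
Qed.

Lemma ip_zf : [/\ cpos zf, ip zf & Ip zf = 3 * slope p (Ip (fA V')) (Ip (fC V)) V 1].
Proof.
have [ck ik _] := EB_tangent cV iC (@ltr01 R).
have cA : cpos (fA V') by exact: cpos_fC.
have cC : cpos (fC V) by exact: cpos_fC.
have cD : cpos (fD p V) by apply: cpos_fD => //; have := p2; lra.
have [i1 e1] := ig2 mpos (3 / 2) 2^-1 iA iC.
have [i2 e2] := ig3 mpos (- ((2 * p - 1) / (p + 1))) (3 / 2) i1 iD ik.
have ez r : zf r = 3 / 2 * fA V' r + 2^-1 * fC V r + - ((2 * p - 1) / (p + 1)) * fD p V r + 3 / 2 * kB V 1 r.
  by rewrite /zf mulNr.
have iz : ip zf by apply: (ig_eq mpos _ i2) => r _; rewrite ez.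
split => //.
  apply: cposD; last by apply: cposM => //; exact: cpos_cst.
  apply: cposB; last by apply: cposM => //; exact: cpos_cst.
  by apply: cposD; apply: cposM => //; exact: cpos_cst.
transitivity (Ip (fun r => 3 / 2 * fA V' r + 2^-1 * fC V r + - ((2 * p - 1) / (p + 1)) * fD p V r + 3 / 2 * kB V 1 r)).
  by apply: eq_RintD => r _; exact: ez.
rewrite e2 e1 /slope !powR1 /qexp; field; rewrite gt_eqF//.
Qed.

(** The integral of [zf] is the difference of the limits of [Zf], both 0: at the origin because [V]
    and [V'] are bounded there, at infinity along a sequence on which [r] times the energy density
    tends to 0. *)
Lemma pohozaev : slope p (Ip (fA V')) (Ip (fC V)) V 1 = 0.
Proof.
have [cz iz ez] := ip_zf; have [K K0 hK] := sol_deriv_bounded.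
have [V0 hV0] := lip_limit dV cV' K0 hK.
pose Kv := `|V0| + K.
have hKv r : 0 < r -> r <= 1 -> `|V r| <= Kv.
  move=> r0 r1; have := ler_normD V0 (V r - V0); rewrite addrC subrK => h; apply: le_trans h _.
  by rewrite lerD2l (le_trans (hV0 r r0 r1))// ler_piMr.
have P0 r : 0 <= `|V r| `^ (p + 1) / (p + 1) by rewrite divr_ge0 ?powR_ge0// ltW.
have Kv0 : 0 <= Kv by rewrite addr_ge0.
have SS0 r : 0 <= SS V r - r ^+ 2 by rewrite subr_ge0 SS_ge.
have SSm r : SS V r - r ^+ 2 <= mass V r by exact: bif_le1 (sqr_ge0 r) (mass_ge0 V r).
pose M := Ip (fC V).
have iAC : ip (fun r => fA V' r + fC V r) by exact: igD.
have cAC : cpos (fun r => fA V' r + fC V r) by apply: cposD; exact: cpos_fC.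
have [w [w0 wy wl]] := ip_seq_y cAC iAC (fun r _ => addr_ge0 (fA_ge0 V' r) (fC_ge0 V r)).
have h : Ip zf = 0.
  rewrite -(subrr (0 : R)).
  apply: (@FTC_lim Zf zf 0 0 (fun n => n.+1%:R^-1) w Zf_D1 cz iz) => //.
  - exact: cvg_harmonic.
  - pose C0 := K ^+ 2 + 2 * Kv * K + (1 + F0) * Kv ^+ 2 + Kv `^ (p + 1) / (p + 1).
    apply/norm_cvg0P; apply: (@squeeze_cvgr _ _ _ _ (fun=> 0) (fun n => n.+1%:R^-1 * C0 + (F0 + 1) * mass V n.+1%:R^-1)).
    + apply: nearW => n; rewrite normr_ge0 /=; set r := n.+1%:R^-1.
      have r0 : 0 < r by rewrite invr_gt0 ltr0n.
      have r1 : r <= 1 by rewrite invf_le1 ?ler1n ?ltr0n.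
      apply: poho_small => //; [exact: hKv|exact: hK|exact: pot_ge0|exact: pot_le| |exact: mass_ge0].
      rewrite ler_pM2r ?invr_gt0//; by apply: ge0_ler_powR; [exact: ltW|rewrite nnegrE|rewrite nnegrE|exact: hKv].
    + exact: cvg_cst.
    + rewrite -[X in _ --> X](_ : 0 * C0 + (F0 + 1) * 0 = 0); last by ring.
      apply: cvgD; first by apply: cvgM; [exact: cvg_harmonic|exact: cvg_cst].
      apply: cvgM; first exact: cvg_cst.
      have /cvg_at_rightP := prim_cvg0 iC; apply; split; last exact: cvg_harmonic.
      by move=> n; rewrite invr_gt0 ltr0n.
  - pose q := Num.sqrt E `^ (p - 1) / (p + 1).
    have q0 : 0 <= q by rewrite divr_ge0 ?powR_ge0// ltW.
    apply/norm_cvg0P; apply: (@squeeze_cvgr _ _ _ _ (fun=> 0) (fun n => (3 + F0 + q) * (w n * (fA V' (w n) + fC V (w n))) + M * pot V (w n) + M ^+ 2 / w n)).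
    + near=> n; rewrite normr_ge0 /=; have r1 : 1 <= w n by near: n; exact: (cvgry_ge wy).
      have r0 := w0 n; move: (w n) r0 r1 => r r0 r1.
      apply: poho_large => //; [exact: pot_ge0|exact: pot_le| |exact: mass_ge0|exact: mass_le|].
        have [_ h2] := bV r0; rewrite /q mulrAC ler_pM2r ?invr_gt0//.
        have hE : `|V r| <= Num.sqrt E.
          rewrite -sqrtr_sqr ler_wsqrtr// (le_trans h2)// ler_pdivrMr ?exprn_gt0// ler_peMr// exprn_ege1//.
        rewrite -[V r ^+ 2]real_normK ?num_real//; move: hE; move: `|V r| (normr_ge0 (V r)) => y y0 hE.
        have -> : y `^ (p + 1) = y `^ (p - 1) * y ^+ 2.
          have [->|yn] := eqVneq y 0; first by rewrite expr0n mulr0 powR0 ?gt_eqF.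
          by rewrite -powR_mulrn// -powRD; [congr (_ `^ _); ring|rewrite (negbTE yn) implybT].
        rewrite ler_wpM2r ?sqr_ge0//; apply: ge0_ler_powR; rewrite ?nnegrE ?sqrtr_ge0//.
        by have := p2; lra.
      exact: bif_le2 (exprn_gt0 2 r0).
    + exact: cvg_cst.
    + rewrite -[X in _ --> X](_ : (3 + F0 + q) * 0 + M * 0 + M ^+ 2 * 0 = 0); last by ring.
      apply: cvgD; last by apply: cvgM; [exact: cvg_cst|apply/gtr0_cvgV0 => //; apply: nearW => n; exact: w0].
      apply: cvgD; apply: cvgM; [exact: cvg_cst|exact: wl|exact: cvg_cst|].
      exact: (cvg_comp _ _ wy (pot_cvgy cV iC)).
by move: h; rewrite ez => /eqP; rewrite mulf_eq0 pnatr_eq0 /= => /eqP.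
Unshelve. all: by end_near. Qed.

Lemma PP_max s : 0 < s -> PP p V V' s <= PP p V V' 1.
Proof.
move=> s0; have [h _] := Pf_tangent_slope p2 (IpA_ge0 V') (IpC_ge0 V) cV iC (@ltr01 R) s0.
by move: h; rewrite pohozaev mul0r addr0.
Qed.

Lemma clev_le_sol : 0 < Ip (fC V) -> clev p <= PP p V V' 1.
Proof. by move=> C0; apply: (clev_le p2 p5); exists V, V'; split => // s; exact: PP_max. Qed.

(** Integration by parts with [pot' = - fS] and [mass' = fC]. *)
Lemma pot_energy : ip (fun r => pot V r * fC V r) /\
  Ip (fun r => pot V r * fC V r) = Ip (fun r => mass V r ^+ 2 / SS V r).
Proof.
have [i1 i2 Eq] := prim_ibp (cpos_fS cV iC) (ip_fS cV iC) (cpos_fC cV) iC.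
have [i3 E3] := ig2 mpos (Ip (fS V)) (-1) iC i2.
have e r : Ip (fS V) * fC V r + -1 * (prim (fS V) r * fC V r) = pot V r * fC V r by rewrite /pot; ring.
split; first by apply: (ig_eq mpos _ i3) => r _; exact: e.
transitivity (Ip (fun r => Ip (fS V) * fC V r + -1 * (prim (fS V) r * fC V r))).
  by apply: eq_RintD => r _; rewrite e.
rewrite E3 -Eq mulN1r addrK; apply: eq_RintD => r _.
by rewrite -[prim (fC V) r]/(mass V r) /fS expr2 mulrAC.
Qed.

(* The radial form of the action [F] of the pair (V, pot V) is [PP p V V' 1]. *)
Lemma action_PP : ip (fun r => r ^+ 2 * (1 - r ^+ 2 / SS V r)) /\
  2^-1 * (Ip (fA V') + Ip (fC V)) + 2^-1 * Ip (fun r => pot V r * fC V r)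
  - (p + 1)^-1 * Ip (fD p V) - 2^-1 * Ip (fun r => r ^+ 2 * (1 - r ^+ 2 / SS V r)) = PP p V V' 1.
Proof.
have cp := cpos_pot cV iC; have cm := cpos_mass cV iC; have cS := cpos_SS cV iC.
have iB := ip_fB cV iC (@ler01 R); have [i2 e2] := pot_energy.
have [i3 e3] := ig2 mpos 1 (-1) i2 iB.
have key r : 0 < r -> r ^+ 2 * (1 - r ^+ 2 / SS V r) = mass V r ^+ 2 / SS V r - fB V 1 r.
  move=> r0; rewrite /fB /bif mul1r -/(SS V r); exact: (bi_alg (SS_gt0 V r0) (SS_sqr V r)).
have i4 : ip (fun r => mass V r ^+ 2 / SS V r).
  have cc : cpos (fun r => mass V r ^+ 2 / SS V r).
    apply: cposM; first exact: cposX.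
    by apply: cposV => // r r0; rewrite gt_eqF// SS_gt0.
  apply: (@ig_dom _ _ _ leb pos mpos _ (fun r => Ip (fC V) * fS V r)).
  - exact: cpos_meas.
  - by apply: igZ => //; exact: ip_fS.
  - move=> r _; rewrite ger0_norm ?divr_ge0 ?sqr_ge0 ?sqrtr_ge0// expr2 -mulrA ler_wpM2r ?fS_ge0// mass_le//.
have i5 := igB mpos i4 iB.
have i6 : ip (fun r => r ^+ 2 * (1 - r ^+ 2 / SS V r)).
  by apply: (ig_eq mpos _ i5) => r /pos_gt0 r0; rewrite key.
split => //.
have -> : Ip (fun r => r ^+ 2 * (1 - r ^+ 2 / SS V r)) = Ip (fun r => mass V r ^+ 2 / SS V r) - Ip (fB V 1).
  by rewrite -RintegralB//; apply: eq_RintD => r /pos_gt0 r0; rewrite key.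
by rewrite e2 /PP /Pf /EB !powR1 invr1; ring.
Qed.

End Pohozaev.

Lemma S_ratio_alg (r S m : R) : 0 < r -> r ^+ 2 <= S -> 0 <= m -> S - r ^+ 2 <= m ->
  1 - r * (m / r ^+ 3) <= r ^+ 2 / S <= 1.
Proof.
move=> r0 rS m0 hm; have r2 : 0 < r ^+ 2 by rewrite exprn_gt0.
have S0 : 0 < S by exact: lt_le_trans rS.
rewrite ler_pdivrMr// mul1r rS andbT ler_pdivlMr//.
have -> : (1 - r * (m / r ^+ 3)) * S = S - m * (S / r ^+ 2) by field; rewrite gt_eqF.
have : 1 <= S / r ^+ 2 by rewrite ler_pdivlMr// mul1r.
by move=> h; have := ler_wpM2l m0 h; rewrite mulr1; lra.
Qed.

(** * The ground state profile and its behaviour at 0 *)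

Section GroundProfile.
Variable p : R.
Hypothesis p2 : 2 < p.
Hypothesis p5 : p < 5.

(** The conditions under which [f(|x|)] is of class C^2 across the origin: [f' / r] and [f''] must
    have the same limit, the Hessian there being [k] times the identity. *)
Definition reg2 (f f' f'' : R -> R) (f0 k : R) : Prop :=
  [/\ D1 f f', D1 f' f'', cpos f'', f r @[r --> 0^'+] --> f0 &
    (f' r / r @[r --> 0^'+] --> k) /\ (f'' r @[r --> 0^'+] --> k)].

Lemma near_right_ext (f g : R -> R) (l : R) : (forall r, 0 < r -> f r = g r) ->
  f r @[r --> 0^'+] --> l -> g r @[r --> 0^'+] --> l.
Proof.
move=> fg; apply: cvg_trans; apply: near_eq_cvg; near=> r; apply: fg.
by near: r; exact: nbhs_right_gt.
Unshelve. all: by end_near. Qed.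

Lemma cvg_id0 : (r : R) @[r --> 0^'+] --> (0 : R).
Proof. by apply: cvg_within_filter; exact: cvg_id. Qed.

Lemma lip_cvg0 (V : R -> R) (V0 K : R) : (forall r, 0 < r -> r <= 1 -> `|V r - V0| <= K * r) ->
  V r @[r --> 0^'+] --> V0.
Proof.
move=> hV; apply/subr_cvg0/norm_cvg0P.
apply: (@squeeze_cvgr _ _ _ _ (fun=> 0) (fun r => K * r)).
- near=> r; rewrite normr_ge0 /=.
  by apply: hV => //; near: r; exact: nbhs_right_le.
- exact: cvg_cst.
- by rewrite -[X in _ --> X](mulr0 K); apply: cvgM; [exact: cvg_cst|exact: cvg_id0].
Unshelve. all: by end_near. Qed.

Section Solution.
Variables U U' U'' : R -> R.
Hypothesis KU : Kp U U'.
Hypothesis dU' : D1 U' U''.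
Hypothesis cU'' : cpos U''.
Hypothesis dH : D1 (fun r => r ^+ 2 * U' r) (rhs p (pot U) U).

Let dU : D1 U U'. Proof. by have [] := KU. Qed.
Let cU : cpos U := D1_cpos dU.
Let iU : ip (fC U). Proof. by have [] := KU. Qed.
Let iA : ip (fA U'). Proof. by have [] := KU. Qed.

Lemma sol_cvg0 : exists U0 : R, U r @[r --> 0^'+] --> U0.
Proof.
have [K K0 hK] := sol_deriv_bounded p2 p5 KU dH.
have cU' : cpos U' by have [] := KU.
by have [U0 hU] := lip_limit dU cU' K0 hK; exists U0; exact: lip_cvg0 hU.
Qed.

Lemma sol_laplace r : 0 < r -> U'' r = rhs p (pot U) U r / r ^+ 2 - 2 * (U' r / r).
Proof.
move=> r0; have dd : D1 (fun r => r ^+ 2 * U' r) (fun r => 2 * r * U' r + r ^+ 2 * U'' r).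
  have h : D1 (fun r : R => r ^+ 2) (fun r => 2 * r).
    by apply: D1_ext (D1X 1 (@D1_id)) => // x _; rewrite expr1 mulr1.
  exact: D1M.
rewrite (D1_uniq dH dd r0); field; rewrite gt_eqF//.
Qed.

(** The radial Laplacian [U'' + 2 U' / r] tends to [L] by the equation, and the flux gives
    [U' / r -> L / 3]; what remains for [U''] is again [L / 3]. *)
Lemma sol_reg2 : exists U0 k, reg2 U U' U'' U0 k.
Proof.
have [U0 hU0] := sol_cvg0.
have p1 : 1 < p by have := p2; lra.
pose L := (1 + Ip (fS U)) * U0 - nlin p U0.
have hL : rhs p (pot U) U r / r ^+ 2 @[r --> 0^'+] --> L.
  apply: (near_right_ext (f := fun r => (1 + pot U r) * U r - nlin p (U r))).
    by move=> r r0; rewrite /rhs mulrAC mulfV ?mul1r// gt_eqF// exprn_gt0.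
  rewrite /L; apply: cvgB.
    2: by apply: (@cvg_comp _ _ _ U (nlin p) _ (nbhs U0)) => //; exact: nlin_continuous.

  apply: cvgM => //; apply: cvgD; [exact: cvg_cst|exact: pot_cvg0].
have h1 : U' r / r @[r --> 0^'+] --> L / 3.
  by apply: (cubic_limit _ dH _ iA hL); [exact: D1_cpos dU'|exact: (cpos_rhs p2 (cpos_pot cU iU) cU)].
exists U0, (L / 3); split => //; split => //.
apply: (near_right_ext (f := fun r => rhs p (pot U) U r / r ^+ 2 - 2 * (U' r / r))).
  by move=> r r0; rewrite sol_laplace.
have -> : L / 3 = L - 2 * (L / 3) by field.
by apply: cvgB => //; apply: cvgM => //; exact: cvg_cst.
Qed.

Definition potd2 r : R := - (fC U r / SS U r - fS U r * ((2 * r ^+ 3 + mass U r * fC U r) / SS U r ^+ 2)).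

Lemma mass_cubic (U0 : R) : U r @[r --> 0^'+] --> U0 -> mass U r / r ^+ 3 @[r --> 0^'+] --> U0 ^+ 2 / 3.
Proof.
move=> hU0; apply: (cubic_limit_gen (mass_D1 cU iU)); first exact: cpos_fC.
  move=> e N e0 N0; have := prim_cvg0 iU.
  move/cvgrPdist_lt => /(_ e e0) [d /= d0 hd].
  pose a := Num.min N d / 2.
  have m0 : 0 < Num.min N d by rewrite lt_min; apply/andP.
  have a0 : 0 < a by rewrite divr_gt0.
  have am : a < Num.min N d by rewrite /a; lra.
  exists a; split => //; first by rewrite (lt_le_trans am)// ge_min lexx.
  have ad : a < d by rewrite (lt_le_trans am)// ge_min lexx orbT.
  have h := hd a; rewrite /= sub0r normrN gtr0_norm// in h.
  by have := h ad a0; rewrite sub0r normrN.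
apply: (near_right_ext (f := fun r => U r * U r)).
  by move=> r r0; rewrite /fC expr2 mulfK// gt_eqF// exprn_gt0.
by rewrite expr2; exact: cvgM.
Qed.

(** Since [S - r^2 <= m] and [m] is of order [r^3], the ratio differs from 1 by at most [m / r^2],
    of order [r]. *)
Lemma S_ratio (U0 : R) : U r @[r --> 0^'+] --> U0 -> r ^+ 2 / SS U r @[r --> 0^'+] --> (1 : R).
Proof.
move=> hU0; have hm := mass_cubic hU0.
apply: (@squeeze_cvgr _ _ _ _ (fun r => 1 - r * (mass U r / r ^+ 3)) (fun=> 1)).
- near=> r; have r0 : 0 < r by near: r; exact: nbhs_right_gt.
  apply: S_ratio_alg => //; [exact: SS_ge|exact: mass_ge0|exact: (bif_le1 (sqr_ge0 r) (mass_ge0 U r))].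
- rewrite -[X in _ --> X](_ : 1 - 0 * (U0 ^+ 2 / 3) = 1); last by ring.
  by apply: cvgB; [exact: cvg_cst|apply: cvgM => //; exact: cvg_id0].
- exact: cvg_cst.
Unshelve. all: by end_near. Qed.

Lemma pot_reg2 : exists f0 k, reg2 (pot U) (fun r => - fS U r) potd2 f0 k.
Proof.
have [U0 hU0] := sol_cvg0; have hm := mass_cubic hU0; have hS := S_ratio hU0.
have dm := mass_D1 cU iU; have dS := SS_D1 cU iU.
have S0 r : 0 < r -> SS U r != 0 by move=> r0; rewrite gt_eqF// SS_gt0.
have cS : cpos (SS U) by exact: cpos_SS.
have cC : cpos (fC U) by exact: cpos_fC.
have cm : cpos (mass U) by exact: cpos_mass.
have cr3 : cpos (fun r : R => 2 * r ^+ 3).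
  by apply: cposM; [exact: cpos_cst|apply: cposX; exact: cpos_id].
exists (Ip (fS U)), (- (U0 ^+ 2 / 3)); split; last split.
- exact: pot_D1.
- apply: D1_ext (D1N (D1M dm (D1V S0 dS))) => // r r0.
  rewrite /potd2 /fS; have := S0 r r0; move: (SS U r) (mass U r) (fC U r) => S m f s0.
  by field.
- apply: cposN; apply: cposB; first by apply: cposM => //; exact: cposV.
  apply: cposM; first exact: cpos_fS.
  apply: cposM; first by apply: cposD => //; exact: cposM.
  by apply: cposV; [move=> r r0; rewrite expf_neq0// S0|exact: cposX].
- exact: pot_cvg0.
- apply: (near_right_ext (f := fun r => - (mass U r / r ^+ 3 * (r ^+ 2 / SS U r)))).
    by move=> r r0; rewrite /fS; field; rewrite S0// gt_eqF.
  by rewrite -[X in - X]mulr1; apply: cvgN; apply: cvgM.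
(* The second derivative is rewritten through [m / r^3] and [r^2 / S], whose limits are known. *)
- apply: (near_right_ext (f := fun r => - (U r * U r * (r ^+ 2 / SS U r)
     - 2 * (mass U r / r ^+ 3) * (r ^+ 2 / SS U r) ^+ 3
     - (mass U r / r ^+ 3) ^+ 2 * (U r * U r) * (r * r) * (r ^+ 2 / SS U r) ^+ 3))).
    by move=> r r0; rewrite /potd2 /fS /fC; have := S0 r r0; move: (SS U r) => S s0; field; rewrite s0 gt_eqF.
  have -> : - (U0 ^+ 2 / 3) = - (U0 * U0 * 1 - 2 * (U0 ^+ 2 / 3) * 1 ^+ 3 -
      (U0 ^+ 2 / 3) ^+ 2 * (U0 * U0) * (0 * 0) * 1 ^+ 3) by field.
  have hX (n : nat) : (r ^+ 2 / SS U r) ^+ n @[r --> 0^'+] --> (1 ^+ n : R).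
    elim: n => [|n IH]; first exact: cvg_cst.
    apply: (near_right_ext (f := fun r => (r ^+ 2 / SS U r) * (r ^+ 2 / SS U r) ^+ n)).
      by move=> r _; rewrite -exprS.
    by rewrite exprS; exact: cvgM.
  have hU2 : U r * U r @[r --> 0^'+] --> U0 * U0 by exact: cvgM.
  apply: cvgN; apply: cvgB; [apply: cvgB|].
  + exact: cvgM.
  + by apply: cvgM => //; apply: cvgM => //; exact: cvg_cst.
  + apply: cvgM => //; apply: cvgM; last by apply: cvgM; exact: cvg_id0.
    apply: cvgM => //; rewrite [X in _ --> X]expr2; under eq_fun do rewrite expr2.
    exact: cvgM.
Qed.

End Solution.

Theorem ground_profile : exists U U' U'' : R -> R,
  [/\ Kp U U', 0 < Ip (fC U), PP p U U' 1 <= clev p, D1 (fun r => r ^+ 2 * U' r) (rhs p (pot U) U) &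
   (exists U0 k, reg2 U U' U'' U0 k) /\
   (exists f0 k, reg2 (pot U) (fun r => - fS U r) (potd2 U) f0 k)].
Proof.
have [u [cu [r0 r00 ur0] [iu bu] hL lsc]] := minimizer p2 p5.
have [u' [u'' [du du' cu'' dH]]] := Lfun_ode p2 cu iu hL.
have [iA hP] := lsc u' u'' du du' cu''.
have Ku : Kp u u' by split => //; exact: D1_cpos du'.
exists u, u', u''; split => //.
- apply: (Ip_gt0 (r := r0)) => //; first exact: cpos_fC.
    by move=> t _; exact: fC_ge0.
  by rewrite /fC mulf_neq0// expf_neq0// gt_eqF.
- by split; [eapply sol_reg2; eassumption|eapply pot_reg2; eassumption].
Qed.

End GroundProfile.

(** * Calculus and integration in three variables *)

Lemma pair_continuous (T U W : topologicalType) (f : T -> U) (g : T -> W) :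
  continuous f -> continuous g -> continuous (fun t => (f t, g t)).
Proof. by move=> cf cg t; apply: cvg_pair; [exact: cf|exact: cg]. Qed.

Lemma triple_continuous (f g h : R -> R) : continuous f -> continuous g -> continuous h ->
  continuous (fun t => (f t, g t, h t) : pt).
Proof. by move=> cf cg ch; exact: (pair_continuous (pair_continuous cf cg) ch). Qed.

(** The measurable structure is that of a product, not the Borel one by definition. An open set is
    the countable union of the boxes with rational centre and radius [1/(k+1)] that it contains;
    other boxes are replaced by the empty set. *)
Lemma open_measurable3 (O : set pt) : open O -> measurable O.
Proof.
move=> oO.
pose Bx (q : rat * rat * rat * nat) : set pt :=
  (ball (ratr q.1.1.1 : R) q.2.+1%:R^-1 `*` ball (ratr q.1.1.2 : R) q.2.+1%:R^-1) `*` ball (ratr q.1.2 : R) q.2.+1%:R^-1.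
pose F q := if `[< Bx q `<=` O >] then Bx q else set0.
have mF q : measurable (F q).
  rewrite /F; case: ifP => _; last exact: measurable0.
  by apply: measurableX; [apply: measurableX|]; exact: measurable_ball.
suff -> : O = \bigcup_q F q by apply: countable_bigcupT_measurable => //; exact: countableP.
apply/seteqP; split => [x Ox|x [q _]]; last first.
  by rewrite /F; case: ifP => // /asboolP h /h.
have /= [e /= e0 he] := (nbhs_ballP x O).1 (open_nbhs_nbhs (conj oO Ox)).
have [k hk] : exists k : nat, k.+1%:R^-1 < e / 2.
  have e2 : 0 < e / 2 by rewrite divr_gt0.
  have := @cvg_harmonic R; move/cvgrPdist_lt => /(_ _ e2) [N _ hN].
  exists N; have := hN N (leqnn N); rewrite /= sub0r normrN gtr0_norm// invr_gt0 ltr0n//.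
pose d : R := k.+1%:R^-1.
have d0 : 0 < d by rewrite invr_gt0 ltr0n.
have rt (t : R) : exists q : rat, `|ratr q - t| < d.
  have [|q] := @rat_in_itvoo R (t - d) (t + d); first by rewrite ltrD2l gtrN.
  by rewrite in_itv /= => /andP[h1 h2]; exists q; rewrite ltr_distl h1 h2.
have [q1 h1] := rt x.1.1; have [q2 h2] := rt x.1.2; have [q3 h3] := rt x.2.
exists (q1, q2, q3, k) => //; rewrite /F.
have hd : d + d < e by move: hk; rewrite -/d; lra.
have tri (q t s : R) : `|q - t| < d -> `|q - s| < d -> `|t - s| < e.
  move=> a b; apply: lt_trans hd.
  by have := ler_distD q t s; rewrite (distrC t q) => /le_lt_trans; apply; exact: ltrD.
have sub : Bx (q1, q2, q3, k) `<=` O.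
  move=> y /= [[y1 y2] y3]; apply: he; split => /=; [split => /=|].
  - exact: (tri _ _ _ h1 y1).
  - exact: (tri _ _ _ h2 y2).
  - exact: (tri _ _ _ h3 y3).
by rewrite asboolT.
Qed.

Lemma cont_measurable3 (f : pt -> R) : continuous f -> measurable_fun setT f.
Proof.
move=> cf; apply: (measurability _ (RGenOpens.measurableE R)) => _ [_ [a [b ->] <-]].
rewrite setTI; apply: open_measurable3; apply: open_comp; last exact: interval_open.
by move=> x _; exact: cf.
Qed.

Lemma coord_cont : [/\ continuous (fun x : pt => x.1.1), continuous (fun x : pt => x.1.2)
  & continuous (fun x : pt => x.2)].
Proof.
have f1 (T U : topologicalType) : continuous (@fst T U) by move=> x; exact: cvg_fst.
have f2 (T U : topologicalType) : continuous (@snd T U) by move=> x; exact: cvg_snd.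
split => x; last exact: f2.
- by apply: (@continuous_comp _ _ _ fst fst); exact: f1.
- by apply: (@continuous_comp _ _ _ fst snd); [exact: f1|exact: f2].
Qed.

Lemma continuous_coord (i : 'I_3) : continuous (@coord3 R i).
Proof.
have [c1 c2 c3] := coord_cont.
by case: i => [[|[|[|//]]] i3]; rewrite /coord3 /=.
Qed.

Lemma dot3E (x : pt) : dot3 x x = x.1.1 ^+ 2 + x.1.2 ^+ 2 + x.2 ^+ 2.
Proof. by rewrite /dot3 !expr2. Qed.

Lemma dot3_ge0 (x : pt) : 0 <= dot3 x x.
Proof. by rewrite dot3E !addr_ge0 ?sqr_ge0. Qed.

Lemma enorm_ge0 (x : pt) : 0 <= enorm x.
Proof. exact: sqrtr_ge0. Qed.

Lemma enorm_sqr (x : pt) : enorm x ^+ 2 = dot3 x x.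
Proof. by rewrite sqr_sqrtr// dot3_ge0. Qed.

Lemma continuous_dot3 : continuous (fun x : pt => dot3 x x).
Proof.
have [c1 c2 c3] := coord_cont; move=> x.
by apply: cvgD; [apply: cvgD|]; apply: cvgM; [exact: c1|exact: c1|exact: c2|exact: c2|exact: c3|exact: c3].
Qed.

Lemma continuous_enorm : continuous (@enorm R).
Proof.
move=> x; apply: (@continuous_comp _ _ _ (fun x : pt => dot3 x x) Num.sqrt); first exact: continuous_dot3.
exact: sqrt_continuous.
Qed.

Lemma coord_le_enorm (i : 'I_3) (x : pt) : `|coord3 i x| <= enorm x.
Proof.
rewrite -sqrtr_sqr ler_wsqrtr// dot3E /coord3.
have := sqr_ge0 x.1.1; have := sqr_ge0 x.1.2; have := sqr_ge0 x.2.
by case: ifP => _; [|case: ifP => _]; lra.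
Qed.

Lemma coords_le_enorm (x : pt) : [/\ `|x.1.1| <= enorm x, `|x.1.2| <= enorm x & `|x.2| <= enorm x].
Proof.
split; [exact: (coord_le_enorm (@Ordinal 3 0 isT))|exact: (coord_le_enorm (@Ordinal 3 1 isT))|
  exact: (coord_le_enorm (@Ordinal 3 2 isT))].
Qed.

Definition bsupp (f : pt -> R) := exists M : R, forall x, M < enorm x -> f x = 0.

Lemma box_bounded (f : pt -> R) (M : R) : continuous f ->
  exists2 C : R, 0 <= C & forall x, enorm x <= M -> `|f x| <= C.
Proof.
move=> cf; pose B : set pt := (`[- M, M] `*` `[- M, M]) `*` `[- M, M].
have cB : compact B by apply: compact_setX; [apply: compact_setX|]; exact: segment_compact.
have : compact (f @` B) by apply: continuous_compact => //; exact: continuous_subspaceT.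
move=> /compact_bounded [N [Nr hN]].
exists (`|N| + 1); first by rewrite addr_ge0.
move=> x xM; apply: (hN (`|N| + 1)).
  by rewrite (le_lt_trans (ler_norm N))// ltrDl.
exists x => //; have [h1 h2 h3] := coords_le_enorm x.
by split; [split|]; rewrite /= in_itv /= -ler_norml; [exact: le_trans h1 xM|exact: le_trans h2 xM|exact: le_trans h3 xM].
Qed.

Lemma mu3_ball (M : R) : measurable [set x : pt | enorm x <= M] /\ (mu3 [set x : pt | (enorm x <= M)%R] < +oo)%E.
Proof.
have mB : measurable [set x : pt | enorm x <= M].
  rewrite (_ : [set x : pt | enorm x <= M] = (@enorm R) @^-1` `]-oo, M]); last first.
    by apply/seteqP; split => x /=; rewrite in_itv.
  rewrite -[X in measurable X]setTI; apply: cont_measurable3 => //; exact: continuous_enorm.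
split => //.
pose I : set R := `[- M, M]%classic.
have mI : measurable I by exact: measurable_itv.
have sub : [set x : pt | enorm x <= M] `<=` (I `*` I) `*` I.
  move=> x /= xM; have [h1 h2 h3] := coords_le_enorm x.
  rewrite /I /= !in_itv /= -!ler_norml; split; [split|]; [exact: le_trans h1 xM|exact: le_trans h2 xM|exact: le_trans h3 xM].
have mIII : measurable ((I `*` I) `*` I : set pt) by apply: measurableX => //; exact: measurableX.
apply: (@le_lt_trans _ _ (mu3 ((I `*` I) `*` I))).
  by apply: le_measure => //; rewrite inE.
have -> : mu3 ((I `*` I) `*` I) = (leb I * leb I * leb I)%E.
  rewrite /Defs.mu3 product_measure1E//; last exact: measurableX.
  by congr (_ * _)%E; exact: product_measure1E.
have fI : (leb I < +oo)%E.
  by rewrite lebesgue_measure_itv /=; case: ifP => _; rewrite ?ltry// -EFinB ltry.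
have f2 : (leb I * leb I < +oo)%E by apply: lte_mul_pinfty => //; rewrite ge0_fin_numE.
by apply: lte_mul_pinfty => //; [apply: mule_ge0|rewrite ge0_fin_numE ?mule_ge0].
Qed.

Lemma csupp_integrable (f : pt -> R) : continuous f -> bsupp f ->
  int3 f.
Proof.
move=> cf [M hM]; have [C C0 hC] := box_bounded M cf.
have [mB fB] := mu3_ball M.
have i1 : mu3.-integrable [set x : pt | enorm x <= M] (EFin \o cst C).
  by apply: measurable_bounded_integrable => //; exists C; split; rewrite ?num_real// => x Cx y _; rewrite /= ger0_norm// ltW.
apply: (@ig_dom _ _ _ mu3 setT _ f ((cst C) \_ [set x : pt | enorm x <= M])) => //.
- exact: cont_measurable3.
- by apply: ig_restr.
- move=> x _; rewrite /patch; case: ifPn => hx; first by apply: hC; rewrite inE in hx.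
  by rewrite hM ?normr0// ltNge; apply: contra hx; rewrite inE.
Qed.

Lemma is_derive_line (f : pt -> R) (x v : pt) (df : R) (k : R -> R) (t : R) :
  (forall h, k (h + t) = f (h *: v + x)) -> is_derive x v f df -> is_derive t 1 k df.
Proof.
move=> hk [dv Dv].
have E : (fun h : R => h^-1 *: ((k \o shift t) (h *: 1) - k t)) =
         (fun h : R => h^-1 *: ((f \o shift x) (h *: v) - f x)).
  apply/funext => h; rewrite /= [h *: 1]mulr1 hk; congr (_ *: (_ - _)).
  by have := hk 0; rewrite add0r scale0r add0r.
apply: DeriveDef; first by rewrite /derivable E.
by rewrite -Dv /derive E.
Qed.

Lemma line_is_derive (f : pt -> R) (x v : pt) (df : R) (k : R -> R) (t : R) :
  (forall h, k (h + t) = f (h *: v + x)) -> is_derive t 1 k df -> is_derive x v f df.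
Proof.
move=> hk [dv Dv].
have E : (fun h : R => h^-1 *: ((k \o shift t) (h *: 1) - k t)) =
         (fun h : R => h^-1 *: ((f \o shift x) (h *: v) - f x)).
  apply/funext => h; rewrite /= [h *: 1]mulr1 hk; congr (_ *: (_ - _)).
  by have := hk 0; rewrite add0r scale0r add0r.
apply: DeriveDef; first by rewrite /derivable -E.
by rewrite -Dv /derive E.
Qed.

Lemma line_int (h g : R -> R) (M : R) : (forall t : R, is_derive t 1 h (g t)) -> continuous g ->
  (forall t, M < `|t| -> h t = 0) -> (\int[leb]_t (g t)%:E = 0)%E.
Proof.
move=> dh cg hM; pose N := `|M| + 1.
have MN : M < N by rewrite (le_lt_trans (ler_norm M))// ltrDl.
have N0 : 0 < N by rewrite ltr_wpDl.
have g0 t : N < `|t| -> g t = 0.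
  move=> Nt; have d0 : is_derive t 1 h 0.
    apply: (near_eq_is_derive _ (is_derive_cst (0 : R) t 1)).
    have : \forall y \near t, M < `|y|.
      by apply: (cvgr_gt _ (@norm_continuous _ _ t)); exact: lt_trans Nt.
    by apply: filterS => y hy; rewrite hM.
  have <- := @derive_val _ _ _ _ _ _ _ (dh t).
  by have <- := @derive_val _ _ _ _ _ _ _ d0.
transitivity (\int[leb]_(t in `[(- N)%R, N]) (g t)%:E)%E.
  rewrite [RHS]integral_mkcond; apply: eq_integral => t _.
  rewrite /patch; case: ifPn => // hx; rewrite g0// ltNge; apply: contra hx => hx.
  by rewrite inE /= in_itv /= -ler_norml.
rewrite (@continuous_FTC2 _ _ h)//.
- have -> : h N = 0 by apply: hM; rewrite ger0_norm// ltW.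
  have -> : h (- N) = 0 by apply: hM; rewrite normrN ger0_norm// ltW.
  by rewrite subee.
- by rewrite gtrN.
- exact: continuous_subspaceT.
- have ch : continuous h by move=> t; have := dh t => /@ex_derive; move/derivable1_diffP/differentiable_continuous; exact.
  split.
  + by move=> x _; have := dh x => /@ex_derive.
  + by apply: cvg_at_right_filter; exact: ch.
  + by apply: cvg_at_left_filter; exact: ch.
- by move=> x _; rewrite derive1E; have := dh x => /@derive_val.
Qed.

Lemma slice_integrable (f : pt -> R) (z : R) : continuous f -> bsupp f ->
  (leb \x leb)%E.-integrable setT (fun xy : R * R => (f (xy, z))%:E).
Proof.
move=> cf [M hM]; have [C C0 hC] := box_bounded M cf.
pose I : set R := `[- M, M]%classic.
have mI : measurable I by exact: measurable_itv.
have mII : measurable (I `*` I : set (R * R)) by exact: measurableX.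
have fI : (leb I < +oo)%E.
  by rewrite lebesgue_measure_itv /=; case: ifP => _; rewrite ?ltry// -EFinB ltry.
have fII : ((leb \x leb) (I `*` I : set (R * R)) < +oo)%E.
  by rewrite product_measure1E// lte_mul_pinfty// ge0_fin_numE.
have i1 : (leb \x leb)%E.-integrable (I `*` I : set (R * R)) (EFin \o cst C).
  by apply: measurable_bounded_integrable => //; exists C; split; rewrite ?num_real// => x Cx y _; rewrite /= ger0_norm// ltW.
apply: (@ig_dom _ _ _ (leb \x leb)%E setT _ (fun xy => f (xy, z)) ((cst C) \_ (I `*` I))) => //.
- apply: (measurableT_comp (cont_measurable3 cf)); exact: measurable_pair2.
- by apply: ig_restr.
- move=> x _; have [h1 h2 h3] := coords_le_enorm (x, z).
  rewrite /patch; case: ifPn => hx.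
    have [h|h] := leP (enorm (x, z)) M; first exact: hC.
    by rewrite hM// normr0.
  rewrite hM ?normr0// ltNge; apply: contra hx => hx; rewrite inE /I /= !in_itv /= -!ler_norml.
  by split; [exact: le_trans h1 hx|exact: le_trans h2 hx].
Qed.

Lemma bsupp_derive (f d : pt -> R) (v : pt) : (forall x, is_derive x v f (d x)) -> bsupp f -> bsupp d.
Proof.
move=> df [M hM]; exists M => x Mx.
have d0 : is_derive x v f 0.
  apply: (near_eq_is_derive _ (is_derive_cst (0 : R) x v)).
  have : \forall y \near x, M < enorm y by exact: (cvgr_gt _ (@continuous_enorm x)).
  by apply: filterS => y hy; rewrite hM.
have <- := @derive_val _ _ _ _ _ _ _ (df x).
by have <- := @derive_val _ _ _ _ _ _ _ d0.
Qed.

Definition leb2 : {sigma_finite_measure set (measurableTypeR R * measurableTypeR R)%type -> \bar R} :=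
  prod_sf leb leb.

Lemma Rint0 (d : pt -> R) : (\int[leb2 \x leb]_z (d z)%:E = 0)%E -> Int3 d = 0.
Proof.
by move=> h; rewrite /Rintegral; transitivity (fine (\int[leb2 \x leb]_z (d z)%:E)%E) => //; rewrite h.
Qed.

(** Fubini with the i-th variable integrated innermost; on each line the integral of the derivative
    of a compactly supported function vanishes. *)
Lemma int_partial (i : 'I_3) (f d : pt -> R) : (forall x, is_derive x (ebasis i) f (d x)) ->
  continuous d -> bsupp f -> Int3 d = 0.
Proof.
move=> df cd bf; have bd := bsupp_derive df bf.
have id3 : (leb2 \x leb)%E.-integrable setT (fun z => (d z)%:E) by exact: csupp_integrable.
have [M hM] := bf; apply: Rint0.
have bnd1 (x : pt) : M < `|x.1.1| -> f x = 0.
  by have [h1 _ _] := coords_le_enorm x; move=> h; apply: hM; exact: lt_le_trans h1.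
have bnd2 (x : pt) : M < `|x.1.2| -> f x = 0.
  by have [_ h1 _] := coords_le_enorm x; move=> h; apply: hM; exact: lt_le_trans h1.
have bnd3 (x : pt) : M < `|x.2| -> f x = 0.
  by have [_ _ h1] := coords_le_enorm x; move=> h; apply: hM; exact: lt_le_trans h1.
have cl1 (y z : R) : continuous (fun t : R => d (t, y, z)).
  move=> t; apply: (@continuous_comp _ _ _ (fun t : R => ((t, y), z) : pt) d); last exact: cd.
  by apply: (triple_continuous (f := id)) => ?; first [exact: cvg_id|exact: cvg_cst].
have cl2 (y z : R) : continuous (fun t : R => d (y, t, z)).
  move=> t; apply: (@continuous_comp _ _ _ (fun t : R => ((y, t), z) : pt) d); last exact: cd.
  by apply: (triple_continuous (g := id)) => ?; first [exact: cvg_id|exact: cvg_cst].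
have cl3 (y z : R) : continuous (fun t : R => d (y, z, t)).
  move=> t; apply: (@continuous_comp _ _ _ (fun t : R => ((y, z), t) : pt) d); last exact: cd.
  by apply: (triple_continuous (h := id)) => ?; first [exact: cvg_id|exact: cvg_cst].
have sl z := @slice_integrable d z cd bd.
case: i df => [[|[|[|//]]] i3] df.
- apply: (@fubini0_21 _ _ _ _ R leb2 leb d) => // z.
  apply: (@fubini0_21 _ _ _ _ R leb leb (fun xy => d (xy, z))) => // y.
  apply: (@line_int (fun t => f (t, y, z)) (fun t => d (t, y, z)) M).
  + move=> t; apply: is_derive_line (df (t, y, z)) => h.
    by rewrite /ebasis /=; congr f; congr ((_, _), _); rewrite /= /GRing.scale /= ?mulr1 ?mulr0 ?add0r.
  + exact: cl1.
  + by move=> t; exact: (bnd1 (t, y, z)).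
- apply: (@fubini0_21 _ _ _ _ R leb2 leb d) => // z.
  apply: (@fubini0_12 _ _ _ _ R leb leb (fun xy => d (xy, z))) => // y.
  apply: (@line_int (fun t => f (y, t, z)) (fun t => d (y, t, z)) M).
  + move=> t; apply: is_derive_line (df (y, t, z)) => h.
    by rewrite /ebasis /=; congr f; congr ((_, _), _); rewrite /= /GRing.scale /= ?mulr1 ?mulr0 ?add0r.
  + exact: cl2.
  + by move=> t; exact: (bnd2 (y, t, z)).
- apply: (@fubini0_12 _ _ _ _ R leb2 leb d) => // -[y1 y2].
  apply: (@line_int (fun t => f (y1, y2, t)) (fun t => d (y1, y2, t)) M).
  + move=> t; apply: is_derive_line (df (y1, y2, t)) => h.
    by rewrite /ebasis /=; congr f; congr ((_, _), _); rewrite /= /GRing.scale /= ?mulr1 ?mulr0 ?add0r.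
  + exact: cl3.
  + by move=> t; exact: (bnd3 (y1, y2, t)).
Qed.

(** * Radial functions and a supply of test functions *)

Section Radial.
Implicit Types (F w : R -> R) (x v : pt) (i j : 'I_3).

Lemma chain_dir (g : pt -> R) (h : R -> R) x v (dg dh : R) :
  is_derive x v g dg -> is_derive (g x) (1 : R) h dh -> is_derive x v (fun y => h (g y)) (dh * dg).
Proof.
move=> Dg Dh; pose k t := g (t *: v + x).
have kE t : k (t + 0) = g (t *: v + x) by rewrite addr0.
have Dk : is_derive (0 : R) (1 : R) k dg by apply: is_derive_line Dg.
have k0 : k 0 = g x by rewrite /k scale0r add0r.
have Dhk : is_derive (0 : R) (1 : R) (h \o k) (dg *: dh).
  have Dh' : is_derive (k 0) (1 : R) h dh by rewrite k0.
  have -> : dg *: dh = dh * dg by rewrite mulrC.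
  exact: is_derive1_comp.
have -> : dh * dg = dg *: dh by rewrite mulrC.
apply: (@line_is_derive _ _ _ _ (h \o k) 0) => // t; rewrite /= kE//.
Qed.

Lemma coord_derive i j x : is_derive x (ebasis j) (@coord3 R i) ((i == j)%:R : R).
Proof.
apply: (@line_is_derive _ _ _ _ (fun t => t * (i == j)%:R + coord3 i x) 0).
  move=> h; rewrite addr0; case: i => [[|[|[|//]]] i3]; case: j => [[|[|[|//]]] j3];
   by rewrite /coord3 /ebasis /= ?mulr1 ?mulr0 /GRing.scale /= ?mulr1 ?mulr0.
have : is_derive (0 : R) (1 : R) (fun t => t * (i == j)%:R + coord3 i x) ((0 : R) *: 0 + (i == j)%:R *: 1 + 0).
  apply: is_deriveD; apply: (@is_deriveM _ _ id (fun=> (i == j)%:R)).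
by rewrite scaler0 add0r addr0 [_ *: _]mulr1.
Qed.

Definition o0 : 'I_3 := @Ordinal 3 0 isT.
Definition o1 : 'I_3 := @Ordinal 3 1 isT.
Definition o2 : 'I_3 := @Ordinal 3 2 isT.

Lemma dot3_coord (x y : pt) : dot3 x y = coord3 o0 x * coord3 o0 y + coord3 o1 x * coord3 o1 y + coord3 o2 x * coord3 o2 y.
Proof. by []. Qed.

Lemma ord3P i : i = o0 \/ i = o1 \/ i = o2.
Proof.
by case: i => [[|[|[|//]]] i3]; [left|right; left|right; right]; exact: val_inj.
Qed.

Lemma dsqr i j x : is_derive x (ebasis j) (fun y => coord3 i y * coord3 i y) (2 * coord3 i x * (i == j)%:R).
Proof.
have -> : 2 * coord3 i x * (i == j)%:R = coord3 i x *: ((i == j)%:R : R) + coord3 i x *: ((i == j)%:R : R).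
  by rewrite /GRing.scale /=; ring.
by apply: is_deriveM; exact: coord_derive.
Qed.

Lemma dot3_derive i x : is_derive x (ebasis i) (fun y : pt => dot3 y y) (2 * coord3 i x).
Proof.
have -> : (fun y : pt => dot3 y y) =
  (fun y : pt => coord3 o0 y * coord3 o0 y + coord3 o1 y * coord3 o1 y + coord3 o2 y * coord3 o2 y) by [].
have -> : 2 * coord3 i x = 2 * coord3 o0 x * (o0 == i)%:R + 2 * coord3 o1 x * (o1 == i)%:R + 2 * coord3 o2 x * (o2 == i)%:R.
  by have [->|[->|->]] := ord3P i; rewrite /= ?mulr1 ?mulr0 ?addr0 ?add0r.
by apply: is_deriveD; [apply: is_deriveD|]; exact: dsqr.
Qed.

Lemma enorm_derive i x : 0 < enorm x -> is_derive x (ebasis i) (@enorm R) (coord3 i x / enorm x).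
Proof.
move=> x0; have d0 : 0 < dot3 x x by move: x0; rewrite /enorm sqrtr_gt0.
have D := @D1_sqrt id (fun=> 1) (fun _ h => h) (@D1_id) _ d0.
have -> : coord3 i x / enorm x = 1 / (2 * Num.sqrt (dot3 x x)) * (2 * coord3 i x).
  by rewrite -/(enorm x); field; rewrite gt_eqF.
exact: (chain_dir (dot3_derive i x) D).
Qed.

(** The value at the origin is a separate argument because a profile is meaningful at positive radii
    only; [F0] is its limit there when continuity is wanted. *)
Definition radf (F0 : R) F x : R := if 0 < enorm x then F (enorm x) else F0.

Lemma rad_pos (F0 : R) F x : 0 < enorm x -> radf F0 F x = F (enorm x).
Proof. by rewrite /radf => ->. Qed.

Lemma enorm0 : enorm (0 : pt) = 0.
Proof. by rewrite /enorm /dot3 /= !mulr0 !addr0 sqrtr0. Qed.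

Lemma enorm_le0 x : (0 < enorm x) = false -> x = 0.
Proof.
move=> /negbT; rewrite -leNgt => h; have e0 : enorm x = 0 by apply/eqP; rewrite eq_le h enorm_ge0.
have [h1 h2 h3] := coords_le_enorm x; move: h1 h2 h3; rewrite e0 !normr_le0.
by case: x {h e0} => [[a b] c] /= /eqP -> /eqP -> /eqP ->.
Qed.

Lemma rad0 (F0 : R) F : radf F0 F 0 = F0.
Proof. by rewrite /radf enorm0 ltxx. Qed.

Lemma near_enorm_gt0 x : 0 < enorm x -> \forall y \near x, 0 < enorm y.
Proof. by move=> x0; apply: (cvgr_gt _ (@continuous_enorm x)). Qed.

Lemma continuous_rad (F0 : R) F : cpos F -> F r @[r --> 0^'+] --> F0 -> continuous (radf F0 F).
Proof.
move=> cF F00 x; have [x0|x0] := boolP (0 < enorm x).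
  rewrite /continuous_at rad_pos//.
  apply: (@cvg_trans _ ((fun y => F (enorm y)) @ x)).
    by apply: near_eq_cvg; have := near_enorm_gt0 x0; apply: filterS => y y0; rewrite rad_pos.
  by apply: (@continuous_comp _ _ _ (@enorm R) F); [exact: continuous_enorm|exact: cF].
have {x0} -> : x = 0 by apply: enorm_le0; exact: negbTE.
rewrite /continuous_at rad0; apply/cvgrPdist_lt => e e0.
move/cvgrPdist_lt : F00 => /(_ e e0); rewrite near_withinE => -[d /= d0 hd].
have : \forall y \near (0 : pt), enorm y < d.
  by apply: (cvgr_lt _ (@continuous_enorm 0)); rewrite enorm0.
apply: filterS => y yd; rewrite /radf; case: ifP => y0; last by rewrite subrr normr0.
by apply: hd => //=; rewrite sub0r normrN ger0_norm ?enorm_ge0.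
Qed.

Lemma rad_derive (F0 G0 : R) F F' i x : D1 F F' -> 0 < enorm x ->
  is_derive x (ebasis i) (radf F0 F) (coord3 i x * radf G0 (fun r => F' r / r) x).
Proof.
move=> dF x0; rewrite rad_pos//.
have -> : coord3 i x * (F' (enorm x) / enorm x) = F' (enorm x) * (coord3 i x / enorm x) by ring.
apply: (near_eq_is_derive _ (chain_dir (enorm_derive i x0) (dF _ x0))).
by have := near_enorm_gt0 x0; apply: filterS => y y0; rewrite rad_pos.
Qed.

Lemma coord_line i (t : R) : [/\ enorm (t *: ebasis i : pt) = `|t| & coord3 i (t *: ebasis i) = t].
Proof.
split; last by have [->|[->|->]] := ord3P i; rewrite /coord3 /ebasis /= /GRing.scale /= ?mulr1.
rewrite -sqrtr_sqr; congr Num.sqrt.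
by have [->|[->|->]] := ord3P i; rewrite dot3E /ebasis /= /GRing.scale /= ?mulr1 ?mulr0 ?expr0n /= ?addr0 ?add0r.
Qed.

Lemma rad_derive0 (F0 C : R) F i : (\forall r \near 0^'+, `|F r - F0| <= C * r ^+ 2) -> 0 <= C ->
  is_derive (0 : pt) (ebasis i) (radf F0 F) (0 : R).
Proof.
rewrite near_withinE => -[d /= d0 hd] C0.
pose f (t : R) := if (0 < `|t|) && (`|t| < d) then F `|t| - F0 else 0.
have fC t : `|f t| <= C * t ^+ 2.
  rewrite /f; case: ifP => [/andP[t0 td]|_]; last by rewrite normr0 mulr_ge0 ?sqr_ge0.
  by rewrite -(real_normK (num_real t)); apply: hd => //=; rewrite sub0r normrN normr_id.
have f0 : f 0 = 0 by rewrite /f normr0 ltxx.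
have Df := is_derive_flat f0 fC.
have Df2 : is_derive (0 : R) (1 : R) (fun t => F0 + f t) (0 + 0) by exact: is_deriveD.
apply: (@line_is_derive _ _ _ _ (fun t => radf F0 F (t *: ebasis i)) 0); first by move=> h; rewrite !addr0.
rewrite -[X in is_derive _ _ _ X](addr0 0).
apply: (near_eq_is_derive _ Df2).
have : \forall t \near (0 : R), `|t| < d by apply: (cvgr_lt _ (@norm_continuous _ _ (0 : R))); rewrite normr0.
apply: filterS => t td; rewrite /radf (coord_line i t).1 /f td andbT.
by case: ifP => _; rewrite ?addr0// addrC subrK.
Qed.

(* [F] is constant, equal to [c], near the origin; then [radf c F] is as smooth as [F]. *)
Definition flat0 (c a : R) F := 0 < a /\ forall r, 0 < r -> r < a -> F r = c.

(** A syntactic class closed under partial derivatives, so that smoothness to all orders follows by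
    induction. It contains the tests used below: radial cut-offs constant near 0, coordinates, and
    bumps in one coordinate. *)
Inductive tclass : (pt -> R) -> Prop :=
| tc_rad c a w of smooth w & flat0 c a w : tclass (radf c w)
| tc_coord i : tclass (coord3 i)
| tc_cst (k : R) : tclass (fun=> k)
| tc_add f g of tclass f & tclass g : tclass (fun x => f x + g x)
| tc_mul f g of tclass f & tclass g : tclass (fun x => f x * g x)
| tc_flat n (c d : R) i : tclass (fun x => ef n (c * coord3 i x + d)).

Lemma flat0_cvg (c a : R) F : flat0 c a F -> F r @[r --> 0^'+] --> c.
Proof.
move=> [a0 h]; apply: (@cvg_trans _ ((fun=> c) @ 0^'+)); last exact: cvg_cst.
apply: near_eq_cvg; near=> r.
by rewrite h//; near: r; exact: nbhs_right_lt.
Unshelve. all: by end_near. Qed.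

Lemma ef_continuous n : continuous (@ef n).
Proof. by move=> t; apply/differentiable_continuous/derivable1_diffP; exact: (@ex_derive _ _ _ _ _ _ _ (ef_derive n t)). Qed.

Lemma tclass_cont f : tclass f -> continuous f.
Proof.
elim=> {f}.
- by move=> c a w sw fw; apply: continuous_rad; [exact: smooth_cpos|exact: flat0_cvg fw].
- exact: continuous_coord.
- by move=> k x; exact: cvg_cst.
- by move=> f g _ cf _ cg x; apply: cvgD; [exact: cf|exact: cg].
- by move=> f g _ cf _ cg x; apply: cvgM; [exact: cf|exact: cg].
- move=> n c d i x; apply: (@continuous_comp _ _ _ (fun x => c * coord3 i x + d) (ef n)); last exact: ef_continuous.
  by apply: cvgD; [apply: cvgM; [exact: cvg_cst|exact: continuous_coord]|exact: cvg_cst].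
Qed.

Lemma flat0_deriv (c a : R) F F' : D1 F F' -> flat0 c a F -> flat0 0 a F'.
Proof.
move=> dF [a0 h]; split => // r r0 ra; have d0 : is_derive r 1 F 0.
  apply: (near_eq_is_derive _ (is_derive_cst c r 1)); near=> t; rewrite h//.
    by near: t; exact: lt_nbhsr.
  by near: t; exact: lt_nbhsl.
have <- := @derive_val _ _ _ _ _ _ _ (dF r r0).
by have <- := @derive_val _ _ _ _ _ _ _ d0.
Unshelve. all: by end_near. Qed.

Lemma rad_flat_derive (c a : R) w w' i x : D1 w w' -> flat0 c a w ->
  is_derive x (ebasis i) (radf c w) (coord3 i x * radf 0 (fun r => w' r / r) x).
Proof.
move=> dw fw; have [x0|x0] := boolP (0 < enorm x); first exact: rad_derive.
have {x0} -> : x = 0 by apply: enorm_le0; exact: negbTE.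
have [a0 h] := fw.
rewrite rad0 mulr0; apply: (@rad_derive0 _ 0) => //; near=> r.
by rewrite h// subrr normr0 mul0r.
Unshelve. all: by end_near. Qed.

Lemma smooth_divr w : smooth w -> smooth (fun r => w r / r).
Proof. by move=> sw; apply: smoothM => //; apply: smoothV; [move=> r r0; rewrite gt_eqF|exact: smooth_id]. Qed.

Lemma flat0_div (a : R) w : flat0 0 a w -> flat0 0 a (fun r => w r / r).
Proof. by move=> [a0 h]; split => // r r0 ra; rewrite h// mul0r. Qed.

Lemma tclass_derive f i : tclass f -> exists2 g, tclass g & forall x, is_derive x (ebasis i) f (g x).
Proof.
elim=> {f}.
- move=> c a w sw fw; have [w' dw sw'] := smooth_deriv sw.
  exists (fun x => coord3 i x * radf 0 (fun r => w' r / r) x).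
    apply: tc_mul; first exact: tc_coord.
    by apply: (@tc_rad 0 a); [exact: smooth_divr|apply: flat0_div; exact: flat0_deriv fw].
  by move=> x; exact: rad_flat_derive fw.
- by move=> j; exists (fun=> (j == i)%:R); [exact: tc_cst|move=> x; exact: coord_derive].
- by move=> k; exists (fun=> 0); [exact: tc_cst|move=> x; exact: is_derive_cst].
- move=> f g _ [f' tf df] _ [g' tg dg]; exists (fun x => f' x + g' x); first exact: tc_add.
  by move=> x; apply: is_deriveD.
- move=> f g tf [f' tf' df] tg [g' tg' dg]; exists (fun x => f x * g' x + g x * f' x).
    by apply: tc_add; apply: tc_mul.
  by move=> x; exact: is_deriveM.
- move=> n c d j; exists (fun x => (- n%:R * ef n.+1 (c * coord3 j x + d) + ef n.+2 (c * coord3 j x + d)) * (c * (j == i)%:R)).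
    apply: tc_mul; last exact: tc_cst.
    by apply: tc_add; [apply: tc_mul; [exact: tc_cst|exact: tc_flat]|exact: tc_flat].
  move=> x; apply: (@chain_dir (fun y => c * coord3 j y + d)); last exact: ef_derive.
  have -> : c * (j == i)%:R = c *: ((j == i)%:R : R) + coord3 j x *: (0 : R) + 0.
    by rewrite /GRing.scale /= mulr0 !addr0.
  by apply: is_deriveD; apply: is_deriveM; exact: coord_derive.
Qed.

Lemma tclass_smooth f : tclass f -> smooth3 f.
Proof.
move=> tf l; have [g tg <-] : exists2 g, tclass g & g = dpart l f.
  elim: l => [|i l [g tg E]]; first by exists f.
  have [g' tg' dg] := tclass_derive i tg; exists g' => //.
  by apply/funext => x; rewrite /= -E; have := dg x => /@derive_val.
split; first exact: tclass_cont.
by move=> i x; have [g' _ dg] := tclass_derive i tg; have := dg x => /@ex_derive.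
Qed.

Lemma tclass_test f : tclass f -> bsupp f -> test_fun f.
Proof. by move=> tf bf; split; [exact: tclass_smooth|]. Qed.

Lemma T1_flat0 (a b : R) w : T1 a b w -> flat0 0 a w.
Proof. by move=> [a0 sw hw]; split => // r r0 ra; rewrite hw// ra. Qed.

Lemma tc_T1 (a b : R) w : T1 a b w -> tclass (radf 0 w).
Proof. by move=> h; have [_ sw _] := h; exact: tc_rad (T1_flat0 h). Qed.

Lemma bsupp_T1 (a b : R) w : T1 a b w -> bsupp (radf 0 w).
Proof.
move=> [a0 _ h]; exists b => x bx; rewrite /radf; case: ifP => // x0.
by apply: h => //; rewrite bx orbT.
Qed.

Lemma bsuppM (f g : pt -> R) : bsupp f -> bsupp (fun x => g x * f x).
Proof. by move=> [M h]; exists M => x Mx; rewrite h// mulr0. Qed.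

Lemma bsuppMl (f g : pt -> R) : bsupp f -> bsupp (fun x => f x * g x).
Proof. by move=> [M h]; exists M => x Mx; rewrite h// mul0r. Qed.

Lemma dpart1E (f g : pt -> R) i : (forall x, is_derive x (ebasis i) f (g x)) -> dpart [:: i] f = g.
Proof. by move=> df; apply/funext => x /=; have := df x => /@derive_val. Qed.

End Radial.

(** * The fundamental lemma in three variables *)

Lemma setI_RG : setI_closed (@RGenOpens.G R).
Proof.
move=> _ _ [a [b ->]] [c [e ->]]; exists (Num.max a c), (Num.min b e).
apply/seteqP; split => x /=; rewrite !in_itv /= gt_max lt_min.
  by move=> [/andP[-> ->] /andP[-> ->]].
by move=> /andP[/andP[-> ->] /andP[-> ->]].
Qed.

Lemma zero_ae1 (f : R -> R) (M : R) : lebesgue_measure.-integrable setT (EFin \o f) ->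
  (forall x, M < `|x| -> f x = 0) ->
  (forall a b : R, \int[lebesgue_measure]_(x in `]a, b[) (f x)%:E = 0)%E ->
  {ae leb, forall x, f x = 0}.
Proof.
move=> fi fM h; apply: zero_ae => // A mA.
have := @zero_integrals _ _ mR mR R leb f id setT fi (@measurable_id _ _ _) measurableT
  (@RGenOpens.G R) (@RGenOpens.measurableE R) setI_RG.
have z : (\int[lebesgue_measure]_(x in setT) (f x)%:E = 0)%E.
  rewrite -(h (- (`|M| + 1)) (`|M| + 1)) [RHS]integral_mkcond; apply: eq_integral => t _.
  rewrite /patch; case: ifPn => // hx; rewrite fM// ltNge; apply: contra hx => hx.
  rewrite inE /= in_itv /= -ltr_norml; apply: le_lt_trans hx _.
  by rewrite (le_lt_trans (ler_norm M))// ltrDl.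
move=> /(_ z) H; have H2 (B : set mR) : RGenOpens.G B -> (\int[lebesgue_measure]_(x in id @^-1` B `&` setT) (f x)%:E = 0)%E.
  by move=> [a [b ->]]; rewrite setIT; exact: h.
by have := H H2 A mA; rewrite setIT.
Qed.

Lemma bp_continuous (k a b : R) : continuous (bp k a b).
Proof.
have aff (c e : R) : continuous (fun t => ef 0 (c * t + e)).
  move=> t; apply: (@continuous_comp _ _ _ (fun t => c * t + e) (ef 0)); last exact: ef_continuous.
  by apply: cvgD; [apply: cvgM; [exact: cvg_cst|exact: cvg_id]|exact: cvg_cst].
by move=> t; apply: (@cvgM _ _ _ _ (fun r => ef 0 (k * r + - (k * a))) (fun r => ef 0 (- k * r + k * b))); exact: aff.
Qed.

Section FundamentalLemma3.
Variable f : pt -> R.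
Hypothesis fi : int3 f.
Hypothesis fb : bsupp f.
Local Open Scope ereal_scope.

Definition boxset (A B C : set R) : set pt := [set x | [/\ A x.1.1, B x.1.2 & C x.2]].

Lemma meas_boxset (A B C : set mR) : measurable A -> measurable B -> measurable C ->
  measurable (boxset A B C).
Proof.
move=> mA mB mC; rewrite (_ : boxset A B C = (A `*` B) `*` C); last first.
  by apply/seteqP; split => x /= => [[]|[[]]].
by apply: measurableX => //; exact: measurableX.
Qed.

(** Open intervals are enlarged to Borel sets one coordinate at a time, then products to measurable
    sets of the plane and of the space, each time through [zero_integrals]. *)
Lemma boxset_zero :
  (forall a1 b1 a2 b2 a3 b3 : R,
    \int[mu3]_(x in boxset `]a1, b1[ `]a2, b2[ `]a3, b3[) (f x)%:E = 0) ->
  forall A, measurable A -> \int[mu3]_(x in A) (f x)%:E = 0.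
Proof.
move=> h0; have [M hM] := fb; pose N : R := (`|M| + 1)%R.
have MN : (M < N)%R by rewrite (le_lt_trans (ler_norm M))// ltrDl.
(* As [f] vanishes outside a ball, sets agreeing in a larger ball have the same integral; in
   particular a large bounded box stands for the whole space. *)
have big (A B : set pt) : (forall x : pt, (enorm x <= N)%R -> A x <-> B x) ->
    \int[mu3]_(x in A) (f x)%:E = \int[mu3]_(x in B) (f x)%:E.
  move=> AB; rewrite integral_mkcond [RHS]integral_mkcond; apply: eq_integral => x _.
  have [xN|xN] := leP (enorm x) N; last by rewrite /patch hM ?(lt_trans MN)//; case: ifP; case: ifP.
  rewrite /patch; have [h1 h2] := AB x xN.
  rewrite (_ : (x \in A) = (x \in B))//; apply/idP/idP; rewrite !inE => h; [exact: h1|exact: h2].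
have inN (x : R) : (`|x| <= N)%R -> [set` `](- (N + 1))%R, (N + 1)%R[] x.
  by move=> xN; rewrite /= in_itv /= -ltr_norml; apply: (le_lt_trans xN); rewrite ltrDl.
have m11 : measurable_fun setT (fun x : pt => x.1.1 : mR).
  by apply: measurableT_comp measurable_fst; exact: measurable_fst.
have m12 : measurable_fun setT (fun x : pt => x.1.2 : mR).
  by apply: measurableT_comp measurable_fst; exact: measurable_snd.
have m2 : measurable_fun setT (fun x : pt => x.2 : mR) by exact: measurable_snd.
have step (phi : pt -> mR) (K : set pt) : measurable_fun setT phi -> (forall x, `|phi x| <= enorm x)%R ->
    measurable K -> (forall a b : R, \int[mu3]_(x in phi @^-1` `]a, b[ `&` K) (f x)%:E = 0) ->
    forall A, measurable A -> \int[mu3]_(x in phi @^-1` A `&` K) (f x)%:E = 0.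
  move=> mp pb mK h; apply: (zero_integrals fi mp mK (@RGenOpens.measurableE R) setI_RG) => //; last first.
    by move=> B [a [b ->]]; exact: h.
  rewrite -(h (- (N + 1))%R (N + 1)%R); apply: big => x xN; split => [Kx|[]//].
  by split => //; apply: inN; exact: le_trans xN.
have s1 (A : set mR) a2 b2 a3 b3 : measurable A -> \int[mu3]_(x in boxset A `]a2, b2[ `]a3, b3[) (f x)%:E = 0.
  move=> mA; have E B : (fun x : pt => x.1.1) @^-1` B `&` boxset setT `]a2, b2[ `]a3, b3[ = boxset B `]a2, b2[ `]a3, b3[.
    by apply/seteqP; split => x /= => [[? []]|[]].
  rewrite -E; apply: (step _ _ m11) => //; [by move=> x; have [] := coords_le_enorm x|exact: meas_boxset|].
  by move=> a b; rewrite E; exact: h0.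
have s2 (A B : set mR) a3 b3 : measurable A -> measurable B -> \int[mu3]_(x in boxset A B `]a3, b3[) (f x)%:E = 0.
  move=> mA mB; have E C : (fun x : pt => x.1.2) @^-1` C `&` boxset A setT `]a3, b3[ = boxset A C `]a3, b3[.
    by apply/seteqP; split => x /= => [[? []]|[]].
  rewrite -E; apply: (step _ _ m12) => //; [by move=> x; have [] := coords_le_enorm x|exact: meas_boxset|].
  by move=> a b; rewrite E; exact: s1.
have s3 (C : set (mR * mR)) a3 b3 : measurable C -> \int[mu3]_(x in C `*` `]a3, b3[) (f x)%:E = 0.
  move=> mC; pose K : set pt := setT `*` `]a3, b3[.
  have mK : measurable K by apply: measurableX.
  have E B : (fun x : pt => x.1) @^-1` B `&` K = B `*` `]a3, b3[.
    by apply/seteqP; split => x /= => [[? []]|[]].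
  rewrite -E; apply: (zero_integrals fi (@measurable_fst _ _ _ _) mK (@measurable_prod_measurableType _ _ mR mR)) => //.
  - move=> _ _ [A1 mA1 [B1 mB1 <-]] [A2 mA2 [B2 mB2 <-]]; exists (A1 `&` A2); first exact: measurableI.
    by exists (B1 `&` B2); [exact: measurableI|rewrite setXI].
  - by rewrite -(s2 setT setT a3 b3); [|exact: measurableT|exact: measurableT]; apply: big => x xN;
      split => [[]|[]].
  - move=> _ [A1 mA1 [B1 mB1 <-]]; rewrite E -(s2 A1 B1 a3 b3)//; apply: big => x xN.
    by split => [[[]]|[]].
have s4 (C : set (mR * mR)) (D : set mR) : measurable C -> measurable D -> \int[mu3]_(x in C `*` D) (f x)%:E = 0.
  move=> mC mD; have E B : (fun x : pt => x.2) @^-1` B `&` (C `*` setT) = C `*` B.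
    by apply/seteqP; split => x /= => [[? []]|[]].
  rewrite -E; apply: (step _ _ m2) => //; [by move=> x; have [] := coords_le_enorm x|exact: measurableX|].
  by move=> a b; rewrite E; exact: s3.
move=> A mA.
rewrite -[A]setIT; apply: (zero_integrals fi (@measurable_id _ _ setT) measurableT (@measurable_prod_measurableType _ _ (mR * mR)%type mR)) => //.
- move=> _ _ [A1 mA1 [B1 mB1 <-]] [A2 mA2 [B2 mB2 <-]]; exists (A1 `&` A2); first exact: measurableI.
  by exists (B1 `&` B2); [exact: measurableI|rewrite setXI].
- by rewrite -(s4 setT setT); [apply: big => x _; split => [[]|]|exact: measurableT|exact: measurableT].
- by move=> _ [A1 mA1 [B1 mB1 <-]]; rewrite setIT; exact: s4.
Qed.

(** The products of sharpening bumps converge boundedly to the indicator of an open box, so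
    dominated convergence gives zero integrals over boxes. *)
Lemma fund3 :
  (forall n (a1 b1 a2 b2 a3 b3 : R), Int3
    (fun x => f x * (bp n.+1%:R a1 b1 x.1.1 * bp n.+1%:R a2 b2 x.1.2 * bp n.+1%:R a3 b3 x.2)) = 0)%R ->
  {ae mu3, forall x, f x = 0%R}.
Proof.
move=> h; apply: zero_ae => //; apply: boxset_zero => a1 b1 a2 b2 a3 b3.
pose B n (x : pt) := (bp n.+1%:R a1 b1 x.1.1 * bp n.+1%:R a2 b2 x.1.2 * bp n.+1%:R a3 b3 x.2)%R.
have mf : measurable_fun setT f by exact: (ig_meas fi).
have cbp := @bp_continuous.
have [c1 c2 c3] := @coord_cont.
have cB n : continuous (B n).
  move=> x; apply: cvgM; [apply: cvgM|].
  + by apply: (@continuous_comp _ _ _ (fun x : pt => x.1.1) (bp n.+1%:R a1 b1)); [exact: c1|exact: cbp].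
  + by apply: (@continuous_comp _ _ _ (fun x : pt => x.1.2) (bp n.+1%:R a2 b2)); [exact: c2|exact: cbp].
  + by apply: (@continuous_comp _ _ _ (fun x : pt => x.2) (bp n.+1%:R a3 b3)); [exact: c3|exact: cbp].
pose chi (x : pt) : R := (((a1 < x.1.1) && (x.1.1 < b1))%:R * ((a2 < x.1.2) && (x.1.2 < b2))%:R * ((a3 < x.2) && (x.2 < b3))%:R)%R.
have bnd n (x : pt) : setT x -> (`|f x * B n x| <= `|f x|)%R.
  move=> _; rewrite normrM ler_piMr// /B.
  have b01 k a b t : (0 <= @bp k a b t <= 1)%R by rewrite bp_ge0 bp_le1.
  have /andP[p1 q1] := b01 n.+1%:R a1 b1 x.1.1.
  have /andP[p2 q2] := b01 n.+1%:R a2 b2 x.1.2.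
  have /andP[p3 q3] := b01 n.+1%:R a3 b3 x.2.
  have p12 := mulr_ge0 p1 p2; have p123 := mulr_ge0 p12 p3.
  by rewrite (ger0_norm p123); apply: mulr_ile1 => //; exact: mulr_ile1.
have lim (x : pt) : setT x -> (f x * B n x)%R @[n --> \oo] --> (f x * chi x)%R.
  by move=> _; apply: cvgM; [exact: cvg_cst|apply: cvgM; [apply: cvgM|]; exact: bp_cvg].
have [ic cc] := @DCT _ _ _ mu3 setT measurableT (fun n x => (f x * B n x)%R) (fun x => (f x * chi x)%R) (fun x => `|f x|%R)
  (fun n => measurable_funM mf (cont_measurable3 (cB n))) (igabs measurableT fi) bnd lim.
have z : Int3 (fun x => f x * chi x)%R = 0%R.
  rewrite -(cvg_lim _ cc)//; apply: cvg_lim => //.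
  by under eq_fun do rewrite h; exact: cvg_cst.
rewrite -[RHS]/((0%R)%:E) -z /Rintegral fineK; last by apply: integrable_fin_num.
rewrite [LHS]integral_mkcond; apply: eq_integral => x _; rewrite /patch /chi.
case: ifPn => hx.
  by move: hx; rewrite inE => -[]; rewrite /= !in_itv /= => -> -> ->; rewrite !mulr1.
congr EFin; apply/esym.
have [k1|] := boolP ((a1 < x.1.1) && (x.1.1 < b1))%R; last by rewrite !mul0r mulr0.
have [k2|] := boolP ((a2 < x.1.2) && (x.1.2 < b2))%R; last by rewrite mulr0 mul0r mulr0.
have [k3|] := boolP ((a3 < x.2) && (x.2 < b3))%R; last by rewrite !mulr0.
by move: hx; rewrite notin_setE => -[]; split; rewrite /= in_itv.
Qed.

End FundamentalLemma3.

(** * Polar coordinates *)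

Section Polar.

Lemma ig_rad_T1 (a b : R) w : T1 a b w -> int3 (radf 0 w).
Proof. by move=> tw; apply: csupp_integrable; [exact: (tclass_cont (tc_T1 tw))|exact: bsupp_T1 tw]. Qed.

(* Divergence theorem for the field [xi(|x|) x] with [xi = eta / r ^ 3]. *)
Lemma polar_div (a b : R) eta eta' : T1 a b eta -> D1 eta eta' ->
  Int3 (radf 0 (fun r => eta' r / r ^+ 2)) = 0.
Proof.
move=> te de; have [a0 se ue] := te.
have s3 : smooth (fun r : R => (r ^+ 3)^-1).
  by apply: smoothV; [move=> r r0; rewrite gt_eqF// exprn_gt0|apply: smoothX; exact: smooth_id].
pose xi r := eta r * (r ^+ 3)^-1; have tx : T1 a b xi by exact: T1M.
pose xi' r := eta' r / r ^+ 3 - 3 * eta r / r ^+ 4.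
have dx : D1 xi xi'.
  have dV : D1 (fun r : R => (r ^+ 3)^-1) (fun r => - (3%:R * r ^+ 2 * 1) / (r ^+ 3) ^+ 2).
    by apply: (D1V (F := fun r => r ^+ 3)); [move=> r r0; rewrite gt_eqF// exprn_gt0|exact: (D1X (F := id) 2 (@D1_id))].
  apply: (D1_ext _ _ (D1M de dV)) => // r r0; rewrite /xi'; field; by rewrite gt_eqF.
have [_ sx ux] := tx; have sx' := smooth_D1 sx dx.
have fx := T1_flat0 tx; have fx' := flat0_deriv dx fx.
have tr : tclass (radf 0 xi) by exact: tc_T1 tx.
have tr' : tclass (radf 0 (fun r => xi' r / r)) by apply: (@tc_rad 0 a); [exact: smooth_divr|exact: flat0_div].
have bx : bsupp (radf 0 xi) by exact: bsupp_T1 tx.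
pose d i x := coord3 i x * (coord3 i x * radf 0 (fun r => xi' r / r) x) + radf 0 xi x * (i == i)%:R.
have dE i x : is_derive x (ebasis i) (fun y => coord3 i y * radf 0 xi y) (d i x).
  by apply: is_deriveM; [exact: coord_derive|exact: rad_flat_derive fx].
have td i : tclass (d i).
  by apply: tc_add; apply: tc_mul => //; [exact: tc_coord|apply: tc_mul => //; exact: tc_coord|exact: tc_cst].
have bf i : bsupp (fun y => coord3 i y * radf 0 xi y) by exact: bsuppM.
have z i : Int3 (d i) = 0 by exact: (int_partial (dE i) (tclass_cont (td i)) (bf i)).
have id3 i : int3 (d i).
  by apply: csupp_integrable; [exact: tclass_cont|exact: (bsupp_derive (dE i) (bf i))].
have [_ eg] := ig3 measurableT 1 1 (id3 o0) (id3 o1) (id3 o2).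
transitivity (Int3 (fun x => d o0 x + 1 * d o1 x + 1 * d o2 x)); last by rewrite eg !z !mulr0 !addr0.
apply: eq_RintD => x _; rewrite /d !eqxx !mul1r !mulr1.
have [x0|x0] := boolP (0 < enorm x); last first.
  have E : x = 0 by apply: enorm_le0; exact: negbTE.
  by rewrite E !rad0 !mulr0 !addr0.
rewrite !rad_pos//; have := enorm_sqr x; rewrite dot3_coord; move: (enorm x) x0 => r r0.
move: (coord3 o0 x) (coord3 o1 x) (coord3 o2 x) => y0 y1 y2 E.
have -> : y0 * (y0 * (xi' r / r)) + xi r + (y1 * (y1 * (xi' r / r)) + xi r) + (y2 * (y2 * (xi' r / r)) + xi r) =
  (y0 * y0 + y1 * y1 + y2 * y2) * (xi' r / r) + 3 * xi r by ring.
by rewrite -E /xi' /xi; field; rewrite gt_eqF.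
Qed.

Lemma rad_lin (k l : R) f g : radf 0 (fun r => k * f r + l * g r) = (fun x : pt => k * radf 0 f x + l * radf 0 g x).
Proof. by apply/funext => x; rewrite /radf; case: ifP => _ //; rewrite !mulr0 addr0. Qed.

Lemma rad_ext (c : R) f g : (forall r, 0 < r -> f r = g r) -> radf c f = radf c g :> (pt -> R).
Proof. by move=> h; apply/funext => x; rewrite /radf; case: ifP => // /h. Qed.

Lemma smooth_sqr : smooth (fun r : R => r ^+ 2).
Proof. by apply: smoothX; exact: smooth_id. Qed.

Lemma smooth_sqrV : smooth (fun r : R => (r ^+ 2)^-1).
Proof. by apply: smoothV; [move=> r r0; rewrite gt_eqF// exprn_gt0|exact: smooth_sqr]. Qed.

(** The form sending [w] to the integral of [w(|x|) / |x|^2] vanishes on derivatives of tests by the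
    divergence theorem, hence on tests of zero integral; it is therefore a multiple of [Ip]. *)
Lemma polar_T1 : exists2 k : R, 0 <= k &
  forall a b w, T1 a b w -> Int3 (radf 0 w) = k * Ip (fun r => w r * r ^+ 2).
Proof.
have one (w : R -> R) : Ip (fun r => w r * 1) = Ip w by apply: eq_RintD => r _; rewrite mulr1.
have [||||c hc] := @form_multiple (fun w => Int3 (radf 0 (fun r => w r * (r ^+ 2)^-1))) (fun=> 1).
- exact: smooth_cst.
- by [].
- move=> a b w z k l _ tw tz.
  have [_ <-] := ig2 measurableT k l (ig_rad_T1 (T1M tw smooth_sqrV)) (ig_rad_T1 (T1M tz smooth_sqrV)).
  by rewrite -rad_lin; congr Rintegral; apply: rad_ext => r r0; ring.
- move=> a b w ab tw; rewrite one => w0; have [_ sw _] := tw.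
  exact: (polar_div (T1_prim tw w0) (prim_D1 (smooth_cpos sw) (ip_T1 tw))).
have [e [te e0 Ie]] := exists_bump (@ltr01 R) (ltr1n R 2).
exists c => [|a b w tw].
  rewrite -(pmulr_lge0 _ Ie) -[X in _ * X]one -(hc _ _ _ te); apply: Rintegral_ge0 => x _.
  by rewrite /radf; case: ifP => // _; rewrite mulr_ge0 ?invr_ge0 ?sqr_ge0.
rewrite -[X in _ * X]one -(hc _ _ _ (T1M tw smooth_sqr)); congr Rintegral; apply: rad_ext => r r0.
by rewrite mulfK// expf_neq0// gt_eqF.
Qed.

Lemma polar_itv (k : R) : (forall a b w, T1 a b w -> Int3 (radf 0 w) = k * Ip (fun r => w r * r ^+ 2)) ->
  forall a b : R, 0 < a -> a < b ->
  Int3 (radf 0 (fun r => ((a < r) && (r < b))%:R)) = k * Ip (fun r => ((a < r) && (r < b))%:R * r ^+ 2).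
Proof.
move=> hk a b a0 ab; pose B n := @bp n.+1%:R a b; pose X (r : R) : R := ((a < r) && (r < b))%:R.
have tB n : T1 a b (B n) by apply: bp_T1.
have bX n r : `|B n r| <= X r.
  rewrite /X ger0_norm ?bp_ge0//; case: ltP => ar /=; last by rewrite /B bp_out ?ar.
  by case: ltP => br; [exact: bp_le1|rewrite /B bp_out ?br ?orbT].
have [mB fB] := @mu3_ball b.
have ic : mu3.-integrable [set x : pt | enorm x <= b] (EFin \o cst (1 : R)).
  by apply: measurable_bounded_integrable => //; exists 1; split; rewrite ?num_real// => x Cx y _; rewrite /= normr1 ltW.
have id3 : int3 ((cst (1 : R)) \_ [set x : pt | enorm x <= b]) by apply: ig_restr.
have d3 n (x : pt) : setT x -> `|radf 0 (B n) x| <= ((cst (1 : R)) \_ [set x : pt | enorm x <= b]) x.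
  move=> _; apply: (@le_trans _ _ (radf 0 X x)).
    by rewrite /radf; case: ifP => _; [exact: bX|rewrite normr0].
  rewrite /radf /patch /X; case: ifPn => _; last by case: ifP.
  case: ifPn; first by case: (_ && _).
  by rewrite notin_setE /= => /negP; rewrite -ltNge => bx; rewrite (ltNge (enorm x)) (ltW bx) andbF.
have l3 (x : pt) : setT x -> radf 0 (B n) x @[n --> \oo] --> radf 0 X x.
  by move=> _; rewrite /radf; case: ifP => _; [exact: bp_cvg|exact: cvg_cst].
have [_ c3] := DCT measurableT (fun n => ig_meas (ig_rad_T1 (tB n))) id3 d3 l3.
have i1 : ip (fun r => X r * r ^+ 2).
  have iab : leb.-integrable `]a, b[ (EFin \o (fun r : R => r ^+ 2)).
    apply: (@cpos_igS _ a b) => //; first exact: cposX (@cpos_id).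
    by move=> r /=; rewrite !in_itv /= => /andP[/ltW -> /ltW ->].
  have sI : `]a, b[ `<=` pos by move=> r; rewrite /= in_itv /= => /andP[ar _]; apply/in_pos; exact: lt_trans ar.
  have J : ip ((fun r : R => r ^+ 2) \_ `]a, b[) by apply: ig_restr.
  apply: (ig_eq mpos _ J) => r _; rewrite /X /patch [in LHS](_ : (r \in _) = (a < r) && (r < b)); last by apply/idP/idP; rewrite inE /= in_itv.
  by case: (_ && _); rewrite ?mul1r ?mul0r.
have d1 n r : pos r -> `|B n r * r ^+ 2| <= X r * r ^+ 2.
  by move=> _; rewrite normrM (ger0_norm (sqr_ge0 r)) ler_wpM2r ?sqr_ge0.
have l1 r : pos r -> B n r * r ^+ 2 @[n --> \oo] --> X r * r ^+ 2.
  by move=> _; apply: cvgM; [exact: bp_cvg|exact: cvg_cst].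
have [_ c1] := DCT mpos (fun n => ig_meas (ip_T1 (T1M (tB n) smooth_sqr))) i1 d1 l1.
have c1' : k * Ip (fun r => B n r * r ^+ 2) @[n --> \oo] --> k * Ip (fun r => X r * r ^+ 2).
  by apply: cvgM => //; exact: cvg_cst.
have e : (fun n => Int3 (radf 0 (B n))) = (fun n => k * Ip (fun r => B n r * r ^+ 2)).
  by apply/funext => n; exact: hk (tB n).
by rewrite -e in c1'; exact: (cvg_unique _ c3 c1').
Qed.

Definition pden (k r : R) : R := k * r ^+ 2.

Lemma mpden k : measurable_fun setT (pden k).
Proof. by apply: measurable_funM => //; apply: measurable_funX; exact: measurable_id. Qed.

Lemma pden_ge0 k : 0 <= k -> forall r, 0 <= pden k r.
Proof. by move=> k0 r; rewrite mulr_ge0 ?sqr_ge0. Qed.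

Lemma menorm : measurable_fun setT (@enorm R : pt -> mR).
Proof. exact: cont_measurable3 (@continuous_enorm). Qed.

Lemma polar_shell (k a b : R) (k0 : 0 <= k) :
  (forall a b : R, 0 < a -> a < b ->
  Int3 (radf 0 (fun r => ((a < r) && (r < b))%:R)) = k * Ip (fun r => ((a < r) && (r < b))%:R * r ^+ 2)) ->
  0 < a -> (pushforward mu3 (@enorm R : pt -> mR) `]a, b[ = dmeas leb (mpden k) (pden_ge0 k0) `]a, b[)%E.
Proof.
move=> h a0; have [ab|ba] := ltP a b; last first.
  have -> : `]a, b[%classic = set0 :> set mR.
    by apply/seteqP; split => r //=; rewrite in_itv /= => /andP[h1 h2]; have := lt_trans h1 h2; rewrite ltNge ba.
  transitivity (0%E : \bar R); last by rewrite /dmeas integral_set0.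
  by rewrite /pushforward preimage_set0; exact: (@measure0 _ _ _ mu3).
have mI : @measurable _ mR `]a, b[ by exact: measurable_itv.
have sI : `]a, b[ `<=` pos by move=> r; rewrite /= in_itv /= => /andP[ar _]; apply/in_pos; exact: lt_trans ar.
have [mB fB] := @mu3_ball b.
have mE : measurable ((@enorm R : pt -> mR) @^-1` `]a, b[) by rewrite -[X in measurable X]setTI; exact: menorm.
have fE : (mu3 ((@enorm R : pt -> mR) @^-1` `]a, b[) < +oo)%E.
  apply: le_lt_trans fB; apply: le_measure; rewrite ?inE// => x /=; rewrite in_itv /= => /andP[_ /ltW]//.
have iab : leb.-integrable `]a, b[ (EFin \o pden k).
  apply: (@cpos_igS _ a b) => //; first by apply: cposM; [exact: cpos_cst|exact: cposX (@cpos_id)].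
  by move=> r /=; rewrite !in_itv /= => /andP[/ltW -> /ltW ->].
have := h a b a0 ab; rewrite /pushforward /dmeas.
have -> : Int3 (radf 0 (fun r => ((a < r) && (r < b))%:R)) = fine (mu3 ((@enorm R : pt -> mR) @^-1` `]a, b[)).
  rewrite /Rintegral; congr fine.
  transitivity (\int[mu3]_x (\1_((@enorm R : pt -> mR) @^-1` `]a, b[) x : R)%:E)%E; last by rewrite integral_indic// setIT.
  apply: eq_integral => x _; rewrite indicE /radf; congr EFin.
  rewrite [in RHS](_ : (x \in _) = (a < enorm x) && (enorm x < b)); last by apply/idP/idP; rewrite inE /= in_itv.
  by case: ifPn => //; rewrite -leNgt => x0; rewrite ltNge (le_trans x0 (ltW a0)).
have -> : k * Ip (fun r => ((a < r) && (r < b))%:R * r ^+ 2) = \int[leb]_(r in `]a, b[) pden k r.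
  have i2 : leb.-integrable `]a, b[ (EFin \o (fun r : R => r ^+ 2)).
    apply: (@cpos_igS _ a b) => //; first exact: cposX (@cpos_id).
    by move=> r /=; rewrite !in_itv /= => /andP[/ltW -> /ltW ->].
  rewrite /pden RintZ//; congr (_ * _); rewrite (Rint_restr leb (fun r : R => r ^+ 2) mI sI).
  apply: eq_RintD => r _; rewrite /patch [in RHS](_ : (r \in _) = (a < r) && (r < b)); last by apply/idP/idP; rewrite inE /= in_itv.
  by case: (_ && _); rewrite ?mul1r ?mul0r.
move=> E; rewrite -[LHS]fineK ?ge0_fin_numE// E /Rintegral fineK//.
exact: integrable_fin_num iab.
Qed.

(** Both measures agree on intervals away from 0. They are finite on each annulus
    [1/(n+1) < r < n+1], where uniqueness applies, and the annuli exhaust the positive radii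
    monotonically. *)
Lemma polar_meas : exists (k : R) (k0 : 0 <= k), forall A : set mR, measurable A -> A `<=` pos ->
  pushforward mu3 (@enorm R : pt -> mR) A = dmeas leb (mpden k) (pden_ge0 k0) A.
Proof.
have [k k0 hk] := polar_T1; exists k, k0.
pose M1 := pushforward mu3 (@enorm R : pt -> mR); pose M2 := dmeas leb (mpden k) (pden_ge0 k0).
pose I n : set mR := `]n.+1%:R^-1, n.+1%:R[%classic.
have mI n : @measurable _ mR (I n) by exact: measurable_itv.
have q n A : measurable A -> M1 (A `&` I n) = M2 (A `&` I n).
  move=> mA.
  have := @measure_unique _ R mR (@RGenOpens.G R) (fun n => `](- (n%:R))%R, n%:R[%classic) (@RGenOpens.measurableE R) setI_RG _ _
    (mrestr M1 (mI n)) (mrestr M2 (mI n)) _ _ A mA; apply.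
  - by move=> i; exists (- i%:R), i%:R.
  - apply/seteqP; split => // t _; exists (Num.truncn `|t|).+1 => //=.
    by rewrite in_itv /= -ltr_norml truncnS_gt.
  - exact: menorm.
  - move=> Hm _ [a [b ->]]; rewrite -[LHS]/(M1 (`]a, b[%classic `&` I n)) -[RHS]/(M2 (`]a, b[%classic `&` I n)).
    have -> : `]a, b[ `&` I n = `](Num.max a n.+1%:R^-1), (Num.min b n.+1%:R)[%classic.
      apply/seteqP; split => x; rewrite /I /= !in_itv /= gt_max lt_min.
        by move=> [/andP[-> ->] /andP[-> ->]].
      by move=> /andP[/andP[-> ->] /andP[-> ->]].
    apply: polar_shell; first exact: polar_itv hk.
    by rewrite lt_max invr_gt0 ltr0n orbT.
  - move=> Hm i; have [mB fB] := @mu3_ball n.+1%:R.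
    pose Y := (@enorm R : pt -> mR) @^-1` (`](- i%:R), i%:R[%classic `&` I n).
    have mY : measurable Y.
      rewrite -[X in measurable X]setTI; apply: menorm => //; apply: measurableI => //; exact: measurable_itv.
    change (mu3 Y < +oo)%E.
    apply: (@le_lt_trans _ _ (mu3 [set x : pt | enorm x <= n.+1%:R])) fB.
    apply: le_measure; rewrite ?inE//.
    by move=> x [_]; rewrite /I /= in_itv /= => /andP[_ /ltW].
move=> A mA Ap.
have AE : A = \bigcup_n (A `&` I n).
  apply/seteqP; split => [r Ar|r [n _ []]//].
  have r0 := pos_gt0 (Ap _ Ar).
  exists (maxn (Num.truncn r) (Num.truncn r^-1)) => //; split => //; rewrite /I /= in_itv /=; apply/andP; split.
    rewrite -[ltRHS]invrK ltf_pV2 ?posrE ?invr_gt0//; apply: lt_le_trans (truncnS_gt _) _.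
    by rewrite ler_nat ltnS leq_maxr.
  by apply: lt_le_trans (truncnS_gt _) _; rewrite ler_nat ltnS leq_maxl.
have mAI n : measurable (A `&` I n) by exact: measurableI.
have nd : nondecreasing_seq (fun n => A `&` I n).
  move=> m n mn; apply/subsetPset => r [Ar]; rewrite /I /= !in_itv /= => /andP[h1 h2]; split => //.
  apply/andP; split; last by apply: lt_le_trans h2 _; rewrite ler_nat ltnS.
  by apply: le_lt_trans h1; rewrite lef_pV2 ?posrE ?ltr0n// ler_nat ltnS.
have mU : measurable (\bigcup_n (A `&` I n)) by exact: bigcupT_measurable.
have e1 := @nondecreasing_cvg_mu _ _ _ (pushforward mu3 (@enorm R : pt -> mR)) _ mAI mU nd.
have e2 := @nondecreasing_cvg_mu _ _ _ (dmeas leb (mpden k) (pden_ge0 k0)) _ mAI mU nd.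
have E : pushforward mu3 (@enorm R : pt -> mR) \o (fun n => A `&` I n) = dmeas leb (mpden k) (pden_ge0 k0) \o (fun n => A `&` I n).
  by apply/funext => n; exact: q.
have e1' := e1 menorm; rewrite E in e1'.
by have := cvg_unique _ e1' e2; rewrite -AE; apply.
Qed.

Lemma mu3_0 : mu3 [set x : pt | ~~ (0 < enorm x)] = 0%E.
Proof.
have -> : [set x : pt | ~~ (0 < enorm x)] = ([set 0] `*` [set 0]) `*` [set 0].
  apply/seteqP; split => [x /= /negbTE /enorm_le0 -> //|[[a b] c] /= [[-> ->] ->]].
  by rewrite [((_, _), _)](_ : _ = 0 :> pt)// enorm0 ltxx.
rewrite /Defs.mu3 product_measure1E//; last by apply: measurableX.
by rewrite [X in (_ * X)%E](lebesgue_measure_set1 (0 : R)) mule0.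
Qed.

Lemma meas_en0 : measurable [set x : pt | ~~ (0 < enorm x)].
Proof.
have -> : [set x : pt | ~~ (0 < enorm x)] = (@enorm R : pt -> mR) @^-1` `]-oo, 0].
  by apply/seteqP; split => x /=; rewrite in_itv /= leNgt.
by rewrite -[X in measurable X]setTI; apply: menorm.
Qed.

Lemma ae_en_gt0 : {ae mu3, forall x : pt, 0 < enorm x}.
Proof. by exists [set x : pt | ~~ (0 < enorm x)]; split; [exact: meas_en0|exact: mu3_0|move=> x /= /negP]. Qed.

Local Open Scope ereal_scope.

Theorem polar : exists2 k : R, (0 < k)%R & forall f : R -> \bar R, measurable_fun setT f -> (forall r, 0 <= f r) ->
  \int[mu3]_x f (enorm x) = \int[leb]_(r in pos) (f r * (k * r ^+ 2)%:E).
Proof.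
have [k [k0 hk]] := polar_meas.
have P (f : R -> \bar R) : measurable_fun setT f -> (forall r, 0 <= f r) ->
    \int[mu3]_x f (enorm x) = \int[leb]_(r in pos) (f r * (k * r ^+ 2)%:E).
  move=> mf f0; have mpre : measurable ((@enorm R : pt -> mR) @^-1` pos) by rewrite -[X in measurable X]setTI; exact: menorm.
  have mfe : measurable_fun setT (fun x : pt => f (enorm x)) by exact: (measurableT_comp mf menorm).
  transitivity (\int[mu3]_(x in (@enorm R : pt -> mR) @^-1` pos) f (enorm x)).
    have -> : (@enorm R : pt -> mR) @^-1` pos = setT `\` [set x : pt | ~~ (0 < enorm x)%R].
      apply/seteqP; split => x; first by move=> /in_pos h; split => //=; rewrite h.
      by move=> [_ /negP]; rewrite negbK => h; apply/in_pos.
    by rewrite -ge0_negligible_integral//; [exact: meas_en0|exact: mu3_0].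
  transitivity (\int[dmeas leb (mpden k) (pden_ge0 k0)]_(r in pos) f r); last first.
    by rewrite integral_dmeas//; exact: measurable_funTS.
  transitivity (\int[pushforward mu3 (@enorm R : pt -> mR)]_(r in pos) f r).
    by rewrite ge0_integral_pushforward//; [exact: menorm|exact: measurable_funTS].
  by apply: eq_measure_integral; [exact: menorm|move=> Hm A mA Ap; exact: hk].
(* For [k = 0] the formula with [f = 1] would give the whole space measure 0, although the unit cube
   has measure 1. *)
exists k => //; rewrite lt_neqAle k0 andbT; apply/eqP => k00.
have := P (cst 1) (measurable_cst _) (fun _ => lee01).
rewrite [RHS]integral0_eq; last by move=> r _; rewrite -k00 mul0r mule0.
rewrite integral_cst// mul1e => z.
pose I : set R := `[(0 : R)%R, (1 : R)%R]%classic.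
have : mu3 ((I `*` I) `*` I) = 0.
  apply/eqP; rewrite eq_le measure_ge0 andbT -z; apply: le_measure; rewrite ?inE//.
  by apply: measurableX; [apply: measurableX|]; exact: measurable_itv.
have mI : measurable I by exact: measurable_itv.
have II : leb I = 1 by rewrite lebesgue_measure_itv /= lte01 sube0.
have -> : mu3 ((I `*` I) `*` I) = (leb I * leb I * leb I)%E.
  rewrite /Defs.mu3 product_measure1E//; last exact: measurableX.
  by congr (_ * _)%E; exact: product_measure1E.
by rewrite !II !mul1e => /eqP; rewrite onee_eq0.
Qed.

End Polar.

Definition kap : R := s2val (cid2 (@polar)).

Lemma kap_gt0 : 0 < kap.
Proof. exact: (s2valP (cid2 (@polar))). Qed.

Lemma kapE : forall f : R -> \bar R, measurable_fun setT f -> (forall r, 0 <= f r)%E ->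
  (\int[mu3]_x f (enorm x) = \int[leb]_(r in pos) (f r * (kap * r ^+ 2)%:E))%E.
Proof. exact: (s2valP' (cid2 (@polar))). Qed.

Lemma meas_patch (F : R -> R) : measurable_fun pos F -> measurable_fun setT (F \_ pos).
Proof. by move=> mF; apply/(measurable_restrictT _ mpos). Qed.

Lemma radf_patch (F0 : R) F (x : pt) : radf F0 F x = (F \_ pos) (enorm x) + (if 0 < enorm x then 0 else F0).
Proof.
rewrite /radf /patch; case: ifPn => x0.
  by rewrite mem_set ?addr0//; apply/in_pos.
by rewrite memNset ?add0r// => /in_pos h; rewrite h in x0.
Qed.

Lemma meas_en_gt0 : measurable_fun setT (fun x : pt => 0 < enorm x).
Proof.
by apply: (measurable_fun_ltr (f := fun=> 0) (g := @enorm R)) => //; exact: menorm.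
Qed.

Lemma meas_radf (F0 : R) F : measurable_fun pos F -> measurable_fun setT (radf F0 F : pt -> R).
Proof.
move=> mF; rewrite (_ : radf F0 F = fun x : pt => (F \_ pos) (enorm x) + (if 0 < enorm x then 0 else F0)); last first.
  by apply/funext => x; exact: radf_patch.
apply: measurable_funD; first exact: (measurableT_comp (meas_patch mF) menorm).
by apply: measurable_fun_ifT => //; exact: meas_en_gt0.
Qed.

Lemma radf_ae (F0 G0 : R) F : {ae mu3, forall x : pt, radf F0 F x = radf G0 F x}.
Proof. by have := @ae_en_gt0; apply: filterS => x x0; rewrite /radf x0. Qed.

Lemma radf_norm (F0 : R) F (x : pt) : `|radf F0 F x| = radf `|F0| (fun r => `|F r|) x.
Proof. by rewrite /radf; case: ifP. Qed.

Lemma meas_wr2 (F : R -> R) : measurable_fun pos F -> measurable_fun pos (fun r => F r * r ^+ 2).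
Proof. by move=> mF; apply: measurable_funM => //; apply: cpos_meas; exact: cposX (@cpos_id). Qed.

Lemma polar_ge0 (f : R -> R) : measurable_fun pos f -> (forall r, 0 < r -> 0 <= f r) ->
  (\int[mu3]_x (radf 0 f x)%:E = kap%:E * \int[leb]_(r in pos) (f r * r ^+ 2)%:E)%E.
Proof.
move=> mf f0; have p0 r : 0 <= (f \_ pos) r.
  by rewrite /patch; case: ifPn => //; rewrite inE => /in_pos; exact: f0.
have := @kapE (EFin \o (f \_ pos)) _ _.
move=> /(_ _ _)/[dup]; rewrite -(ge0_integralZl)//; last 3 first.
- by apply/measurable_EFinP; exact: meas_wr2.
- by move=> r /in_pos r0; rewrite lee_fin mulr_ge0 ?sqr_ge0// f0.
- by rewrite lee_fin ltW// kap_gt0.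
move=> H _; transitivity (\int[mu3]_x ((f \_ pos) (enorm x))%:E)%E.
  by apply: eq_integral => x _; rewrite radf_patch; case: ifP; rewrite addr0.
rewrite H; first last.
- by move=> r; rewrite lee_fin.
- by apply/measurable_EFinP; exact: meas_patch.
apply: eq_integral => r; rewrite inE => rp; rewrite /= /patch mem_set// -!EFinM; congr EFin; ring.
Qed.

Lemma polar_ig (f : R -> R) : measurable_fun pos f ->
  (int3 (radf 0 f) <-> ip (fun r => f r * r ^+ 2)).
Proof.
move=> mf; have ma : measurable_fun pos (fun r => `|f r|) by exact: measurableT_comp.
have E := polar_ge0 ma (fun r _ => normr_ge0 (f r)).
have e1 : (\int[mu3]_x `|(radf 0 f x)%:E| = \int[mu3]_x (radf 0 (fun r => `|f r|) x)%:E)%E.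
  by apply: eq_integral => x _; rewrite /= radf_norm normr0.
have e2 : (\int[leb]_(r in pos) `|(f r * r ^+ 2)%:E| = \int[leb]_(r in pos) (`|f r| * r ^+ 2)%:E)%E.
  by apply: eq_integral => r _; rewrite /= normrM (ger0_norm (sqr_ge0 r)).
have p0 : (0 <= \int[leb]_(r in pos) (`|f r| * r ^+ 2)%:E)%E.
  by apply: integral_ge0 => r _; rewrite lee_fin mulr_ge0 ?sqr_ge0.
have K (I : \bar R) : (0 <= I)%E -> ((kap%:E * I < +oo) = (I < +oo))%E.
  by case: I => [x| |] //= _; [rewrite -EFinM !ltry|rewrite gt0_muley// lte_fin kap_gt0].
split => /integrableP [_ h]; apply/integrableP; split.
- by apply/measurable_EFinP; exact: meas_wr2.
- have h' : (\int[mu3]_x `|(radf 0 f x)%:E| < +oo)%E := h.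
  by change (\int[leb]_(r in pos) `|(f r * r ^+ 2)%:E| < +oo)%E; rewrite e2 -K// -E -e1.
- by apply/measurable_EFinP; exact: meas_radf.
- have h' : (\int[leb]_(r in pos) `|(f r * r ^+ 2)%:E| < +oo)%E := h.
  by change (\int[mu3]_x `|(radf 0 f x)%:E| < +oo)%E; rewrite e1 E K// -e2.
Qed.

(** Integrability is equivalent on the two sides, and both integrals are 0 when it fails. The
    formula is thus usable for the integrals in the weak equations before their integrability is
    known. *)
Lemma polar_int (f : R -> R) : measurable_fun pos f ->
  Int3 (radf 0 f) = kap * Ip (fun r => f r * r ^+ 2).
Proof.
move=> mf; have m2 := meas_wr2 mf.
have [ig|nig] := pselect (ip (fun r => f r * r ^+ 2)); last first.
  rewrite (Rint_non_ig mpos m2 nig) mulr0; apply: Rint_non_ig => //; first exact: meas_radf.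
  by move=> /(polar_ig mf).
pose f1 r := Num.max (f r) 0; pose f2 r := Num.max (- f r) 0.
have m1 : measurable_fun pos f1 by apply: measurable_maxr => //; exact: measurable_cst.
have m2' : measurable_fun pos f2 by apply: measurable_maxr; [exact: measurableT_comp|exact: measurable_cst].
have P1 (r : R) : 0 < r -> 0 <= f1 r by rewrite le_max lexx orbT.
have P2 (r : R) : 0 < r -> 0 <= f2 r by rewrite le_max lexx orbT.
have B1 r : pos r -> `|f1 r * r ^+ 2| <= `|f r * r ^+ 2|.
  move=> _; rewrite !normrM ler_wpM2r// /f1; case: (leP (f r) 0) => h; rewrite ?normr0//.
have B2 r : pos r -> `|f2 r * r ^+ 2| <= `|f r * r ^+ 2|.
  move=> _; rewrite !normrM ler_wpM2r// /f2; case: (leP (- f r) 0) => h; rewrite ?normr0 ?normrN//.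
have i1 : ip (fun r => f1 r * r ^+ 2) by exact: (ig_dom mpos (meas_wr2 m1) (igabs mpos ig) B1).
have i2 : ip (fun r => f2 r * r ^+ 2) by exact: (ig_dom mpos (meas_wr2 m2') (igabs mpos ig) B2).
have j1 := (polar_ig m1).2 i1; have j2 := (polar_ig m2').2 i2.
have fE r : f r = f1 r - f2 r.
  by rewrite /f1 /f2; case: (leP (f r) 0); case: (leP (- f r) 0) => ? ?; lra.
have G (g : R -> R) : measurable_fun pos g -> (forall r : R, 0 < r -> 0 <= g r) -> ip (fun r => g r * r ^+ 2) ->
    Int3 (radf 0 g) = kap * Ip (fun r => g r * r ^+ 2).
  by move=> mg g0 ig2; rewrite /Rintegral polar_ge0// fineM//; exact: integrable_fin_num ig2.
have [_ e3] := ig2 measurableT 1 (-1) j1 j2; have [_ e1] := ig2 mpos 1 (-1) i1 i2.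
transitivity (Int3 (fun x => 1 * radf 0 f1 x + -1 * radf 0 f2 x)).
  by apply: eq_RintD => x _; rewrite /radf; case: ifP => _; [rewrite fE; ring|ring].
rewrite e3 !G//; transitivity (kap * Ip (fun r => 1 * (f1 r * r ^+ 2) + -1 * (f2 r * r ^+ 2))).
  by rewrite e1; ring.
by congr (_ * _); apply: eq_RintD => r _; rewrite fE; ring.
Qed.

Lemma ae_polar (P : R -> Prop) : {ae leb, forall r, pos r -> P r} -> {ae mu3, forall x : pt, 0 < enorm x -> P (enorm x)}.
Proof.
move=> [N [mN N0 hN]]; pose M := N `&` pos.
have mM : @measurable _ mR M by exact: measurableI.
exists ((@enorm R : pt -> mR) @^-1` M); split.
- by rewrite -[X in measurable X]setTI; exact: menorm.
- have := @kapE (EFin \o \1_M) _ _; rewrite (_ : (fun x : pt => (EFin \o \1_M) (enorm x)) = (fun x : pt => (\1_((@enorm R : pt -> mR) @^-1` M) x)%:E))//.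
  move=> H; transitivity (\int[mu3]_x (\1_((@enorm R : pt -> mR) @^-1` M) x : R)%:E)%E.
    by rewrite integral_indic ?setIT// -[X in measurable X]setTI; exact: menorm.
  rewrite H; last 2 first.
  + by apply/measurable_EFinP; exact: measurable_indic.
  + by move=> r; rewrite lee_fin.
  transitivity (\int[leb]_(r in M) (kap * r ^+ 2)%:E)%E.
    rewrite [RHS]integral_mkcond [LHS]integral_mkcond; apply: eq_integral => r _; rewrite /patch /= indicE.
    have [h|h] := boolP (r \in M).
      by rewrite mul1e ifT//; move: h; rewrite !inE => -[].
    by rewrite mul0e; case: ifP.
  apply: null_set_integral => //.
    by apply/measurable_EFinP; apply: measurable_funTS; exact: mpden.
  apply/eqP; rewrite eq_le measure_ge0 andbT -N0; apply: le_measure; rewrite ?inE//; exact: subIsetl.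
- move=> x /= /not_implyP [x0 nP]; split; last by apply/in_pos.
  by apply: hN => /= h; apply: nP; apply: h; exact/in_pos.
Qed.

Lemma polar_ae0 (f : R -> R) : measurable_fun pos f -> {ae mu3, forall x : pt, 0 < enorm x -> f (enorm x) = 0} ->
  {ae leb, forall r, pos r -> f r = 0}.
Proof.
move=> mf h; have ma : measurable_fun pos (fun r => `|f r|) by exact: measurableT_comp.
have : (\int[mu3]_x (radf 0 (fun r => `|f r|) x)%:E = 0)%E.
  rewrite (ae_eq_integral (cst 0%E))//; first by rewrite integral0.
    by apply/measurable_EFinP; exact: meas_radf.
  by move: h; apply: filterS => x hx _; rewrite /radf /=; case: ifP => // /hx ->; rewrite normr0.
rewrite polar_ge0// => /eqP; rewrite mule_eq0 eqe gt_eqF ?kap_gt0//= => /eqP z.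
have := @ae_eq_integral_abs _ _ _ leb pos mpos (fun r => (f r * r ^+ 2)%:E).
move=> /(_ _)[]; first by apply/measurable_EFinP; exact: meas_wr2.
move=> + _ => /(_ _); move=> H; have : ae_eq leb pos (fun r => (f r * r ^+ 2)%:E) (cst 0%E).
  apply: H; rewrite -[RHS]z; apply: eq_integral => r _; rewrite /= normrM (ger0_norm (sqr_ge0 r))//.
apply: filterS => r hr rp; have /= [] := hr rp; move/eqP; rewrite mulf_eq0 expf_eq0 /= => /orP[/eqP//|/eqP r0].
by have := pos_gt0 rp; rewrite r0 ltxx.
Qed.

Definition locpos (f : R -> R) := measurable_fun pos f /\
  forall a b : R, 0 < a -> a < b -> leb.-integrable `[a, b] (EFin \o f).

Lemma cpos_locpos f : cpos f -> locpos f.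
Proof. by move=> cf; split; [exact: cpos_meas|move=> a b a0 ab; exact: cpos_ig_seg]. Qed.

Lemma ip_locpos f : ip f -> locpos f.
Proof.
move=> hf; split; first exact: (ig_meas hf).
by move=> a b a0 ab; apply: (igS mpos) => //; exact: seg_pos.
Qed.

Lemma locposD f g : locpos f -> locpos g -> locpos (fun r => f r + g r).
Proof.
move=> [mf hf] [mg hg]; split; first exact: measurable_funD.
by move=> a b a0 ab; apply: igD; [exact: measurable_itv|exact: hf|exact: hg].
Qed.

Lemma locposM f g : cpos f -> locpos g -> locpos (fun r => f r * g r).
Proof.
move=> cf [mg hg]; split; first by apply: measurable_funM => //; exact: cpos_meas.
move=> a b a0 ab; have [C C0 hC] := cpos_seg_bounded b cf a0.
apply: (@ig_dom _ _ _ leb _ _ _ (fun r => C * `|g r|)).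
- exact: measurable_itv.
- by apply: (measurable_funS mpos); [exact: seg_pos|apply: measurable_funM => //; exact: cpos_meas].
- by apply: igZ; [exact: measurable_itv|apply: igabs; [exact: measurable_itv|exact: hg]].
- by move=> r /= ri; rewrite normrM ler_wpM2r// hC.
Qed.

Lemma ip_locT1 f (a b : R) e : locpos f -> T1 a b e -> a < b -> ip (fun r => f r * e r).
Proof.
move=> lf [a0 se ue] ab; have [_ h] := lf; have [m hm] := locposM (smooth_cpos se) lf.
have J : ip ((fun r => e r * f r) \_ `[a, b]).
  by apply: ig_restr => //; [exact: seg_pos|exact: hm].
apply: (ig_eq mpos _ J) => r /in_pos r0; rewrite /patch; case: ifPn => hr; first by rewrite mulrC.
rewrite ue ?mulr0//; move: hr; rewrite notin_setE /= in_itv /= => /negP; rewrite negb_and -!ltNge//.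
Qed.

(** Sharpening bumps give zero integrals over intervals compactly contained in the half-line; the
    function restricted to each []1/(n+1), n+1[] then vanishes almost everywhere. *)
Lemma fund1_loc f : locpos f -> (forall a b e, a < b -> T1 a b e -> Ip (fun r => f r * e r) = 0) ->
  {ae leb, forall r, pos r -> f r = 0}.
Proof.
move=> lf h; have [mf hf] := lf.
have z a b : 0 < a -> a < b -> (\int[leb]_(r in `]a, b[) (f r)%:E = 0)%E.
  move=> a0 ab; have i1 := hf a b a0 ab.
  have mI : @measurable _ mR `[a, b] by exact: measurable_itv.
  have mJ : @measurable _ mR `]a, b[ by exact: measurable_itv.
  have sJ : `]a, b[ `<=` `[a, b] by move=> r /=; rewrite !in_itv /= => /andP[/ltW -> /ltW ->].
  pose B n := @bp n.+1%:R a b; pose X (r : R) : R := ((a < r) && (r < b))%:R.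
  have tB n : T1 a b (B n) by apply: bp_T1.
  have iB n := ip_locT1 lf (tB n) ab.
  have bnd n r : pos r -> `|f r * B n r| <= ((fun r => `|f r|) \_ `[a, b]) r.
    move=> _; rewrite normrM (ger0_norm (bp_ge0 _ _ _ _)) /patch; case: ifPn => hr.
      by rewrite ler_piMr// bp_le1.
    rewrite /B bp_out ?mulr0//; move: hr; rewrite notin_setE /= in_itv /= => /negP; rewrite negb_and -!ltNge => /orP[/ltW ->//|/ltW ->]; exact: orbT.
  have lim r : pos r -> f r * B n r @[n --> \oo] --> f r * X r.
    by move=> _; apply: cvgM; [exact: cvg_cst|exact: bp_cvg].
  have J : ip ((fun r => `|f r|) \_ `[a, b]).
    by apply: ig_restr => //; [exact: seg_pos|exact: igabs].
  have [iX cX] := DCT mpos (fun n => ig_meas (iB n)) J bnd lim.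
  have e0 : Ip (fun r => f r * X r) = 0.
    rewrite -(cvg_lim _ cX)//; apply: cvg_lim => //.
    by under eq_fun => n do rewrite (h _ _ _ ab (tB n)); exact: cvg_cst.
  have sp : `]a, b[ `<=` pos by apply: subset_trans sJ _; exact: seg_pos.
  have iJ : leb.-integrable `]a, b[ (EFin \o f) by exact: (igS mI).
  have := Rint_restr leb f mJ sp; rewrite (_ : Rintegral leb pos (f \_ `]a, b[) = 0).
    by rewrite /Rintegral => E; rewrite -[LHS]fineK ?E//; exact: integrable_fin_num iJ.
  rewrite -[RHS]e0; apply: eq_RintD => r _; rewrite /patch /X [in LHS](_ : (r \in _) = (a < r) && (r < b)); last by apply/idP/idP; rewrite inE /= in_itv.
  by case: (_ && _); rewrite ?mulr1 ?mulr0.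
pose I n : set R := `]n.+1%:R^-1, n.+1%:R[%classic.
have mI n : @measurable _ mR (I n) by exact: measurable_itv.
have n0 n : 0 < (n.+1%:R : R)^-1 by rewrite invr_gt0.
have n12 n : (n.+1%:R : R)^-1 < n.+2%:R.
  by apply: (@le_lt_trans _ _ 1); [rewrite invf_le1// ler1n|rewrite ltr1n].
have sI n : I n `<=` `[n.+1%:R^-1, n.+2%:R].
  by move=> r; rewrite /I /= !in_itv /= => /andP[/ltW -> /ltW h1]; apply: (le_trans h1); rewrite ler_nat.
have aen n : {ae leb, forall r : R, (f \_ (I n)) r = 0}.
  apply: (@zero_ae1 _ n.+1%:R).
  - apply: ig_restr => //; apply: (igS _ (mI n) (sI n)); [exact: measurable_itv|exact: hf].
  - move=> x nx; rewrite /patch; case: ifPn => //; rewrite inE /I /= in_itv /= => /andP[h1 h2].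
    have x0 : 0 < x by exact: lt_trans h1.
    by move: nx; rewrite gtr0_norm// ltNge ltW.
  - move=> a b; pose a' := Num.max a n.+1%:R^-1; pose b' := Num.min b n.+1%:R.
    have -> : (\int[leb]_(x in `]a, b[) ((f \_ (I n)) x)%:E = \int[leb]_(x in `]a', b'[) (f x)%:E)%E.
      have -> : `]a', b'[%classic = `]a, b[ `&` I n.
        apply/seteqP; split => x; rewrite /I /= !in_itv /= gt_max lt_min.
          by move=> /andP[/andP[-> ->] /andP[-> ->]].
        by move=> [/andP[-> ->] /andP[-> ->]].
      rewrite integral_mkcondr; apply: eq_integral => x _; rewrite /patch; by case: ifP.
    have [ab|ba] := ltP a' b'; first by apply: z => //; rewrite /a' lt_max n0 orbT.
    have -> : `]a', b'[%classic = set0 :> set mR.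
      by apply/seteqP; split => r //=; rewrite in_itv /= => /andP[h1 h2]; have := lt_trans h1 h2; rewrite ltNge ba.
    by rewrite integral_set0.
have := ae_foralln aen; apply: filterS => r hr /in_pos r0.
pose n := maxn (Num.truncn r) (Num.truncn r^-1).
have := hr n; rewrite /patch ifT// inE /I /= in_itv /=; apply/andP; split.
  rewrite -[ltRHS]invrK ltf_pV2 ?posrE ?invr_gt0//; apply: lt_le_trans (truncnS_gt _) _.
  by rewrite ler_nat ltnS leq_maxr.
by apply: lt_le_trans (truncnS_gt _) _; rewrite ler_nat ltnS leq_maxl.
Qed.

Lemma dbr1_loc f : locpos f ->
  (forall a b e e', a < b -> T1 a b e -> D1 e e' -> Ip (fun r => f r * e' r) = 0) ->
  exists c : R, {ae leb, forall r, pos r -> f r = c}.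
Proof.
move=> lf h; have [c hc] := orth_deriv (fun a b w ab tw => ip_locT1 lf tw ab) h; exists c.
have := fund1_loc (locposD lf (cpos_locpos (@cpos_cst (- c)))) hc.
by apply: filterS => r hr rp; apply/eqP; rewrite -subr_eq0; apply/eqP; exact: hr.
Qed.

(** * From regular profiles to C^2 functions and their weak gradients *)

Section RadialC2.
Implicit Types (i j : 'I_3) (x : pt).

(** The difference quotient at 0 is [g] itself, so continuity of [g] is enough; this handles
    [x_i g(|x|)] at the origin. *)
Lemma mul_id_derive0 (g : R -> R) : {for 0, continuous g} -> is_derive (0 : R) (1 : R) (fun t => t * g t) (g 0).
Proof.
move=> cg; have h : (fun h : R => h^-1 *: ((fun t => t * g t) (h *: 1 + 0) - 0 * g 0)) @ 0^' --> g 0.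
  have : g h @[h --> 0^'] --> g 0 by apply: cvg_within_filter; exact: cg.
  apply: cvg_trans; apply: near_eq_cvg; near=> h.
  have h0 : h != 0 by near: h; exact: nbhs_dnbhs_neq.
  by rewrite mul0r subr0 addr0 [h *: 1]mulr1 /GRing.scale /= mulrA mulVf// mul1r.
by apply: DeriveDef; [apply/cvg_ex; exists (g 0)|apply/cvg_lim].
Unshelve. all: by end_near. Qed.

Section VectorField.
Variables (g g' : R -> R) (g0 : R).
Hypothesis dg : D1 g g'.
Hypothesis cg' : cpos g'.
Hypothesis lg : g r @[r --> 0^'+] --> g0.
Hypothesis lg' : r * g' r @[r --> 0^'+] --> (0 : R).

Definition dvec i j x : R := (i == j)%:R * radf g0 g x + coord3 i x * coord3 j x * radf 0 (fun r => g' r / r) x.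

Lemma cont_radg : continuous (radf g0 g : pt -> R).
Proof. by apply: continuous_rad; [exact: D1_cpos dg|exact: lg]. Qed.

Lemma vec_derive i j x : is_derive x (ebasis j) (fun y => coord3 i y * radf g0 g y) (dvec i j x).
Proof.
have [x0|x0] := boolP (0 < enorm x).
  have -> : dvec i j x = coord3 i x *: (coord3 j x * radf 0 (fun r => g' r / r) x) + radf g0 g x *: ((i == j)%:R : R).
    by rewrite /dvec /GRing.scale /=; ring.
  by apply: is_deriveM; [exact: coord_derive|exact: rad_derive].
have {x0} -> : x = 0 by apply: enorm_le0; exact: negbTE.
have -> : dvec i j 0 = (i == j)%:R * g0 by rewrite /dvec !rad0 mulr0 addr0.
pose h (t : R) := (i == j)%:R * radf g0 g (t *: ebasis j : pt).
have h0 : h 0 = (i == j)%:R * g0 by rewrite /h scale0r rad0.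
rewrite -h0; apply: (@line_is_derive _ _ _ _ (fun t => t * h t) 0); last first.
  apply: mul_id_derive0; apply: cvgM; first exact: cvg_cst.
  apply: (@continuous_comp _ _ _ (fun t : R => t *: ebasis j : pt) (radf g0 g)); last exact: cont_radg.
  exact: scalel_continuous.
move=> t; rewrite !addr0 /h mulrA; congr (_ * _).
have [->|[->|->]] := ord3P i; have [->|[->|->]] := ord3P j; by rewrite /coord3 /ebasis /= /GRing.scale /= ?mulr1 ?mulr0.
Qed.

(** Away from 0 everything is continuous; at 0 the second term is bounded by [r |g'|], which tends
    to 0 by hypothesis. *)
Lemma dvec_cont i j : continuous (dvec i j).
Proof.
move=> x; apply: cvgD; first by apply: cvgM; [exact: cvg_cst|exact: cont_radg].
have [x0|x0] := boolP (0 < enorm x).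
  apply: cvgM; first by apply: cvgM; exact: continuous_coord.
  rewrite rad_pos//.
  apply: (@cvg_trans _ ((fun y => g' (enorm y) / enorm y) @ x)).
    by apply: near_eq_cvg; have := near_enorm_gt0 x0; apply: filterS => y y0; rewrite rad_pos.
  have cw : cpos (fun r => g' r / r).
    by apply: cposM => //; apply: cposV; [move=> r r0; rewrite gt_eqF|exact: cpos_id].
  apply: (@continuous_comp _ _ _ (@enorm R) (fun r => g' r / r)); [exact: continuous_enorm|exact: cw].
have {x0} -> : x = 0 by apply: enorm_le0; exact: negbTE.
rewrite rad0 mulr0; apply/norm_cvg0P.
have k0 : (radf 0 (fun r => r * g' r) : pt -> R) y @[y --> (0 : pt)] --> (0 : R).
  have : continuous (radf 0 (fun r => r * g' r) : pt -> R).
    by apply: continuous_rad => //; apply: cposM => //; exact: cpos_id.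
  by move=> /(_ 0); rewrite /continuous_at rad0.
apply: (@squeeze_cvgr _ _ _ _ (fun=> 0) (fun y => `|radf 0 (fun r => r * g' r) y|)).
- near=> y; rewrite normr_ge0 /= !normrM /radf; case: ifPn => y0; last by rewrite !normr0 mulr0.
  rewrite !normrM (ger0_norm (enorm_ge0 y)).
  have e1 := coord_le_enorm i y; have e2 := coord_le_enorm j y.
  have -> : enorm y * `|g' (enorm y)| = enorm y * enorm y * (`|g' (enorm y)| * `|(enorm y)^-1|).
    by rewrite (ger0_norm (x := (enorm y)^-1)) ?invr_ge0 ?enorm_ge0//; field; rewrite gt_eqF.
  by apply: ler_wpM2r; [exact: mulr_ge0|exact: ler_pM].
- exact: cvg_cst.
- by apply/norm_cvg0P.
Unshelve. all: by end_near. Qed.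

End VectorField.

Definition vecr (G : pt -> R) (x : pt) : pt := (x.1.1 * G x, x.1.2 * G x, x.2 * G x).

Lemma coord_vecr i G x : coord3 i (vecr G x) = coord3 i x * G x.
Proof. by have [->|[->|->]] := ord3P i. Qed.

Lemma enorm_vecr G x : enorm (vecr G x) = enorm x * `|G x|.
Proof.
rewrite -(ger0_norm (enorm_ge0 x)) -normrM -(sqrtr_sqr (enorm x * G x)) exprMn enorm_sqr; congr Num.sqrt.
by rewrite /dot3 /=; ring.
Qed.

Lemma reg2_quad (f f' f'' : R -> R) (f0 k : R) : reg2 f f' f'' f0 k ->
  \forall r \near 0^'+, `|f r - f0| <= (`|k| + 1) * r ^+ 2.
Proof.
move=> [df df' cf'' lf [lk _]]; have cf' := D1_cpos df'.
move/cvgrPdist_lt : lk => /(_ 1 ltr01); rewrite near_withinE => -[d /= d0 hd].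
have b t : 0 < t -> t < d -> `|f' t| <= (`|k| + 1) * t.
  move=> t0 td; have := hd t; rewrite /= sub0r normrN (ger0_norm (ltW t0)) => /(_ td t0) h.
  have : `|f' t / t| <= `|k| + 1.
    by have := ler_normB k (k - f' t / t); rewrite opprB addrC subrK => q; apply: (le_trans q); rewrite lerD2l ltW.
  have t1 : `|t^-1| = t^-1 by rewrite ger0_norm// invr_ge0 ltW.
  by rewrite normrM t1 ler_pdivrMr.
near=> r; have r0 : 0 < r by near: r; exact: nbhs_right_gt.
have rd : r < d by near: r; exact: nbhs_right_lt.
have key s : 0 < s -> s <= r -> `|f r - f s| <= (`|k| + 1) * r ^+ 2.
  move=> s0 sr.
  have dG : D1 (fun t => (`|k| + 1) * r * t) (fun=> (`|k| + 1) * r).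
    by apply: D1_ext (D1Z ((`|k| + 1) * r) (@D1_id)) => // t _; rewrite mulr1.
  have := D1_cmp df cf' dG (@cpos_cst _) s0 sr; move=> H; apply: le_trans (H _) _.
    move=> t st tr; apply: le_trans (b t _ _) _; [exact: lt_le_trans st|exact: le_lt_trans rd|].
    by rewrite ler_wpM2l.
  have q : 0 <= (`|k| + 1) * r * s by apply: mulr_ge0; [apply: mulr_ge0 => //; exact: ltW|exact: ltW].
  by rewrite expr2 mulrA lerBlDr lerDl.
have L : `|f r - f s| @[s --> 0^'+] --> `|f r - f0|.
  by apply: cvg_norm; apply: cvgB => //; exact: cvg_cst.
rewrite -(cvg_lim _ L)//; apply: limr_le; first by apply/cvg_ex; exists `|f r - f0|.
near=> s; apply: key; first by near: s; exact: nbhs_right_gt.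
by near: s; exact: nbhs_right_le.
Unshelve. all: by end_near. Qed.

Section Reg2.
Variables (f f' f'' : R -> R) (f0 k : R).
Hypothesis rf : reg2 f f' f'' f0 k.

(** The scalar factor of the gradient [x gradf(x)]; using [f' / r] with limit [k] avoids the
    direction [x / |x|], which has no limit at the origin. *)
Definition gradf : pt -> R := radf k (fun r => f' r / r).

Lemma reg2_vec : [/\ D1 (fun r => f' r / r) (fun r => f'' r / r - f' r / r ^+ 2),
  cpos (fun r => f'' r / r - f' r / r ^+ 2), f' r / r @[r --> 0^'+] --> k &
  r * (f'' r / r - f' r / r ^+ 2) @[r --> 0^'+] --> (0 : R)].
Proof.
have [df df' cf'' lf [lk lk2]] := rf.
have cV n : cpos (fun r : R => (r ^+ n)^-1).
  by apply: cposV; [move=> r r0; rewrite expf_neq0 ?gt_eqF|apply: cposX; exact: cpos_id].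
split => //.
- have dV : D1 (fun r : R => r^-1) (fun r => - 1 / r ^+ 2).
    by apply: (D1V _ (@D1_id)) => r r0; rewrite gt_eqF.
  apply: (D1_ext _ _ (D1M df' dV)) => // r r0; field; by rewrite gt_eqF.
- by apply: cposB; apply: cposM => //; [exact: (cV 1%N)|exact: D1_cpos df'].
- apply: (near_right_ext (f := fun r => f'' r - f' r / r)).
    by move=> r r0; field; rewrite gt_eqF.
  by rewrite -[X in _ --> X](subrr k); apply: cvgB.
Qed.

Lemma reg2_cont : continuous (radf f0 f : pt -> R).
Proof. by have [df df' cf'' lf _] := rf; apply: continuous_rad => //; exact: D1_cpos df. Qed.

Lemma reg2_grad i x : is_derive x (ebasis i) (radf f0 f) (coord3 i x * gradf x).
Proof.
have [df _ _ _ _] := rf.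
have [x0|x0] := boolP (0 < enorm x); first exact: rad_derive.
have {x0} -> : x = 0 by apply: enorm_le0; exact: negbTE.
have -> : coord3 i (0 : pt) * gradf 0 = 0 by rewrite /coord3; case: ifP => _; [|case: ifP => _]; rewrite mul0r.
by apply: (rad_derive0 (C := `|k| + 1)); [exact: reg2_quad rf|rewrite addr_ge0].
Qed.

Lemma gradf_cont i : continuous (fun x : pt => coord3 i x * gradf x).
Proof.
have [dg _ lg _] := reg2_vec.
by move=> x; apply: cvgM; [exact: continuous_coord|rewrite /gradf; exact: (cont_radg dg lg)].
Qed.

Lemma reg2_C2 : C2 (radf f0 f : pt -> R).
Proof.
have [dg cg' lg lg'] := reg2_vec.
have e1 i : dpart [:: i] (radf f0 f) = (fun x => coord3 i x * gradf x).
  by apply: dpart1E => x; exact: reg2_grad.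
have e2 i j : dpart [:: j; i] (radf f0 f) = dvec (fun r => f' r / r) (fun r => f'' r / r - f' r / r ^+ 2) k i j.
  by apply/funext => x; change ('D_(ebasis j) (dpart [:: i] (radf f0 f)) x = dvec (fun r => f' r / r) (fun r => f'' r / r - f' r / r ^+ 2) k i j x); rewrite e1; have := vec_derive dg lg i j x => /@derive_val.
case=> [|i [|j [|//]]] _.
- split; first exact: reg2_cont.
  by move=> _ i x; have := reg2_grad i x => /@ex_derive.
- rewrite e1; split; first exact: gradf_cont.
  by move=> _ j x; have := vec_derive dg lg i j x => /@ex_derive.
- by rewrite e2; split => //; exact: dvec_cont.
Qed.

End Reg2.
Lemma cont_loc (f : pt -> R) : continuous f -> loc_integrable f.
Proof.
move=> cf; split; first exact: cont_measurable3.
move=> M; have [mB fB] := @mu3_ball M; have [C C0 hC] := box_bounded M cf.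
have i1 : mu3.-integrable [set x : pt | enorm x <= M] (EFin \o cst C).
  by apply: measurable_bounded_integrable => //; exists C; split; rewrite ?num_real// => x Cx y _; rewrite /= ger0_norm// ltW.
apply: (@ig_dom _ _ _ mu3 [set x : pt | enorm x <= M] _ f (cst C)) => //.
by apply: measurable_funTS; exact: cont_measurable3.
Qed.

Lemma test_cont (v : pt -> R) : test_fun v -> [/\ continuous v, bsupp v,
  forall i x, is_derive x (ebasis i) v (dpart [:: i] v x) & forall i, continuous (dpart [:: i] v)].
Proof.
move=> [sv bv]; split => //; first by have [] := sv [::].
- by move=> i x; apply: derivableP; have [_] := sv [::]; apply.
- by move=> i; have [] := sv [:: i].
Qed.

Lemma ibp3 (f d v : pt -> R) i : (forall x, is_derive x (ebasis i) f (d x)) -> continuous f -> continuous d ->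
  test_fun v -> [/\ int3 (fun x => f x * dpart [:: i] v x),
    int3 (fun x => d x * v x) &
    Int3 (fun x => f x * dpart [:: i] v x) = - Int3 (fun x => d x * v x)].
Proof.
move=> df cf cd tv; have [cv bv dv cdv] := test_cont tv.
have bdv : bsupp (dpart [:: i] v) by exact: (bsupp_derive (dv i) bv).
have i1 : int3 (fun x => f x * dpart [:: i] v x).
  by apply: csupp_integrable; [move=> x; apply: cvgM; [exact: cf|exact: cdv]|exact: bsuppM].
have i2 : int3 (fun x => d x * v x).
  by apply: csupp_integrable; [move=> x; apply: cvgM; [exact: cd|exact: cv]|exact: bsuppM].
split => //.
have D x : is_derive x (ebasis i) (fun y => f y * v y) (f x * dpart [:: i] v x + v x * d x) by exact: is_deriveM.
have cD : continuous (fun x => f x * dpart [:: i] v x + v x * d x).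
  by move=> x; apply: cvgD; apply: cvgM; [exact: cf|exact: cdv|exact: cv|exact: cd].
have := int_partial D cD (bsuppM f bv).
have [_ E] := ig2 measurableT 1 1 i1 i2.
rewrite (@eq_RintD _ _ _ mu3 setT _ (fun x => 1 * (f x * dpart [:: i] v x) + 1 * (d x * v x))); last by move=> x _; ring.
by rewrite E !mul1r => /eqP; rewrite addr_eq0 => /eqP.
Qed.

Lemma weak_grad_radial (f f' f'' : R -> R) (f0 k : R) : reg2 f f' f'' f0 k ->
  weak_grad (radf f0 f) (vecr (gradf f' k)).
Proof.
move=> rf; split; first by apply: cont_loc; exact: reg2_cont rf.
split.
  move=> i; rewrite (_ : (fun x => _) = (fun x => coord3 i x * gradf f' k x)); last by apply/funext => x; exact: coord_vecr.
  by apply: cont_loc; exact: gradf_cont rf i.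
move=> v tv i; have cg : continuous (fun x => coord3 i x * gradf f' k x) by exact: gradf_cont rf i.
have [_ _ ->] := ibp3 (reg2_grad rf i) (reg2_cont rf) cg tv.
by congr (- _); apply: eq_RintD => x _; rewrite coord_vecr.
Qed.

Lemma radf_comp (h : R -> R) (f0 : R) (f : R -> R) x : h (radf f0 f x) = radf (h f0) (fun r => h (f r)) x.
Proof. by rewrite /radf; case: ifP. Qed.

Lemma ig_radf (f0 : R) (f : R -> R) : measurable_fun pos f -> ip (fun r => f r * r ^+ 2) ->
  int3 (radf f0 f : pt -> R).
Proof.
move=> mf /(polar_ig mf) h; apply: (ig_ae measurableT _ h); first exact: meas_radf.
by have := @radf_ae 0 f0 f; apply: filterS => x ->.
Qed.

Lemma int_radf (f0 : R) (f : R -> R) : measurable_fun pos f ->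
  Int3 (radf f0 f) = kap * Ip (fun r => f r * r ^+ 2).
Proof.
move=> mf; rewrite -polar_int//; apply: eq_Rint_ae; [exact: measurableT|exact: meas_radf|exact: meas_radf|].
by have := @radf_ae f0 0 f; apply: filterS => x hx _; exact: hx.
Qed.

Lemma enorm_gradf (f' : R -> R) (k : R) x : enorm (vecr (gradf f' k) x) = radf 0 (fun r => `|f' r|) x.
Proof.
rewrite enorm_vecr /gradf /radf; case: ifPn => x0.
  by rewrite normrM normfV (ger0_norm (enorm_ge0 x)); field; rewrite gt_eqF.
by have -> : x = 0 by [apply: enorm_le0; exact: negbTE]; rewrite enorm0 mul0r.
Qed.

Lemma dot_CS (a b : pt) : dot3 a b ^+ 2 <= enorm a ^+ 2 * enorm b ^+ 2.
Proof.
rewrite !enorm_sqr /dot3; case: a b => [[a1 a2] a3] [[b1 b2] b3] /=.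
have := sqr_ge0 (a1 * b2 - a2 * b1); have := sqr_ge0 (a1 * b3 - a3 * b1); have := sqr_ge0 (a2 * b3 - a3 * b2).
by nra.
Qed.

Lemma norm_enorm_le (x y : pt) : `|enorm x - enorm y| <= enorm (x - y).
Proof.
have CS (a b : pt) : dot3 a b <= enorm a * enorm b.
  have h : dot3 a b ^+ 2 <= (enorm a * enorm b) ^+ 2 by rewrite exprMn; exact: dot_CS.
  apply: le_trans (ler_norm _) _.
  by rewrite -(ler_pXn2r (n := 2)) ?nnegrE ?mulr_ge0 ?enorm_ge0// real_normK ?num_real.
rewrite -(ler_pXn2r (n := 2)) ?nnegrE ?enorm_ge0// real_normK ?num_real// enorm_sqr.
have -> : dot3 (x - y) (x - y) = dot3 x x - 2 * dot3 x y + dot3 y y.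
  by case: x y => [[x1 x2] x3] [[y1 y2] y3]; rewrite /dot3 /=; ring.
by rewrite -!enorm_sqr; have := CS x y; nra.
Qed.

Lemma dot_cgrad (G v : pt -> R) x : dot3 (vecr G x) (cgrad v x) =
  coord3 o0 x * G x * dpart [:: o0] v x + coord3 o1 x * G x * dpart [:: o1] v x + coord3 o2 x * G x * dpart [:: o2] v x.
Proof.
have e0 : (0 : 'I_3) = o0 by exact: val_inj.
have e1 : (1 : 'I_3) = o1 by exact: val_inj.
have e2 : (2 : 'I_3) = o2 by exact: val_inj.
by rewrite dot3_coord /cgrad e2 e1 e0.
Qed.

(** Integration by parts for the field [x g(|x|)], whose divergence is [3 g + r g']. *)
Lemma div_radial (g g' : R -> R) (g0 : R) (v : pt -> R) : D1 g g' -> cpos g' -> g r @[r --> 0^'+] --> g0 ->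
  r * g' r @[r --> 0^'+] --> (0 : R) -> test_fun v ->
  [/\ int3 (fun x => dot3 (vecr (radf g0 g) x) (cgrad v x)),
      int3 (fun x => radf (3 * g0) (fun r => 3 * g r + r * g' r) x * v x) &
      Int3 (fun x => dot3 (vecr (radf g0 g) x) (cgrad v x)) =
      - Int3 (fun x => radf (3 * g0) (fun r => 3 * g r + r * g' r) x * v x)].
Proof.
move=> dg cg' lg lg' tv.
have cf i : continuous (fun x => coord3 i x * radf g0 g x).
  by move=> x; apply: cvgM; [exact: continuous_coord|exact: (cont_radg dg lg)].
have B i := ibp3 (vec_derive dg lg i i) (cf i) (dvec_cont dg cg' lg lg' (i := i) (j := i)) tv.
have [a0 b0 E0] := B o0; have [a1 b1 E1] := B o1; have [a2 b2 E2] := B o2.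
have [A EA] := ig3 measurableT 1 1 a0 a1 a2; have [C EC] := ig3 measurableT 1 1 b0 b1 b2.
have PA x : coord3 o0 x * radf g0 g x * dpart [:: o0] v x + 1 * (coord3 o1 x * radf g0 g x * dpart [:: o1] v x)
    + 1 * (coord3 o2 x * radf g0 g x * dpart [:: o2] v x) = dot3 (vecr (radf g0 g) x) (cgrad v x).
  by rewrite dot_cgrad !mul1r.
have PC x : dvec g g' g0 o0 o0 x * v x + 1 * (dvec g g' g0 o1 o1 x * v x) + 1 * (dvec g g' g0 o2 o2 x * v x) =
    radf (3 * g0) (fun r => 3 * g r + r * g' r) x * v x.
  rewrite /dvec !eqxx !mul1r -!mulrDl; congr (_ * _).
  have [x0|x0] := boolP (0 < enorm x).
    rewrite !rad_pos//; have := enorm_sqr x; rewrite dot3_coord; move: (enorm x) x0 => r r0.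
    move: (coord3 o0 x) (coord3 o1 x) (coord3 o2 x) => y0 y1 y2 E.
    transitivity (3 * g r + (y0 * y0 + y1 * y1 + y2 * y2) * (g' r / r)); first by ring.
    by rewrite -E; field; rewrite gt_eqF.
  by rewrite (enorm_le0 (negbTE x0)) !rad0; ring.
split.
- by apply: (ig_eq measurableT _ A) => x _; exact: PA.
- by apply: (ig_eq measurableT _ C) => x _; exact: PC.
- have TA := etrans (esym (@eq_RintD _ _ _ mu3 setT _ _ (fun x _ => PA x))) EA.
  have TC := etrans (esym (@eq_RintD _ _ _ mu3 setT _ _ (fun x _ => PC x))) EC.
  have H (A' B' C' a' b' c' L M : R) : L = A' + 1 * B' + 1 * C' -> M = a' + 1 * b' + 1 * c' ->
    A' = - a' -> B' = - b' -> C' = - c' -> L = - M by move=> -> -> -> -> ->; ring.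
  exact: (H _ _ _ _ _ _ _ _ TA TC E0 E1 E2).
Qed.

End RadialC2.

(** * The action of a radial pair *)

Section RadialAction.
Variable p : R.
Hypothesis p2 : 2 < p.

Lemma Rint_radial_ae (F : pt -> R) (f : R -> R) : measurable_fun setT F -> measurable_fun pos f ->
  {ae mu3, forall x : pt, 0 < enorm x -> F x = f (enorm x)} ->
  Int3 F = kap * Ip (fun r => f r * r ^+ 2).
Proof.
move=> mF mf h; rewrite -(int_radf 0 mf).
apply: eq_Rint_ae; [exact: measurableT|exact: mF|exact: meas_radf|].
have h0 := @ae_en_gt0; apply: filterS2 h h0 => x h x0 _; rewrite /radf x0; exact: h.
Qed.

Lemma D1_cubeV : D1 (fun r : R => (r ^+ 3)^-1) (fun r => - 3 / r ^+ 4).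
Proof.
have h : D1 (fun r : R => (r ^+ 3)^-1) (fun r => - (3%:R * r ^+ 2 * 1) / (r ^+ 3) ^+ 2).
  by apply: (D1V (F := fun r => r ^+ 3)); [move=> r r0; rewrite gt_eqF// exprn_gt0|exact: (D1X (F := id) 2 (@D1_id))].
apply: (D1_ext _ _ h) => // r r0; field; by rewrite gt_eqF.
Qed.

Lemma sqrt_bi (U : R -> R) r : 0 < r -> Num.sqrt (1 - fS U r ^+ 2) = r ^+ 2 / SS U r.
Proof.
move=> r0; have S0 := SS_gt0 U r0.
have -> : 1 - fS U r ^+ 2 = (r ^+ 2 / SS U r) ^+ 2.
  by rewrite /fS !expr_div_n SS_sqr; field; rewrite -SS_sqr expf_neq0// gt_eqF.
by rewrite sqrtr_sqr ger0_norm// divr_ge0 ?sqr_ge0// ltW.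
Qed.

Lemma meas_enorm (g : pt -> pt) : (forall i, measurable_fun setT (fun x => coord3 i (g x))) ->
  measurable_fun setT (fun x => enorm (g x)).
Proof.
move=> mg; have mc (f : R -> R) (h : pt -> R) : continuous f -> measurable_fun setT h -> measurable_fun setT (fun x => f (h x)).
  by move=> cf mh; apply: (measurableT_comp _ mh); exact: continuous_measurable_fun.
apply: (mc Num.sqrt); first exact: sqrt_continuous.
by apply: measurable_funD; [apply: measurable_funD|]; apply: measurable_funM; [exact: (mg o0)|exact: (mg o0)|exact: (mg o1)|exact: (mg o1)|exact: (mg o2)|exact: (mg o2)].
Qed.

Lemma powabs_cont : continuous (fun t : R => `|t| `^ (p + 1)).
Proof.
move=> t; apply/differentiable_continuous/derivable1_diffP.
by have p1 : 1 < p by [have := p2; lra]; have := powabs_derive t p1 => /@ex_derive.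
Qed.

(** The hypotheses hold almost everywhere and involve the gradients only through their lengths, so
    that the formula serves both the constructed ground state and an arbitrary radial weak
    solution. *)
Lemma action_radial (V V' : R -> R) (v : pt -> R) (gv : pt -> pt) (psi : pt -> R) (gpsi : pt -> pt) :
  Kp V V' -> D1 (fun r => r ^+ 2 * V' r) (rhs p (pot V) V) ->
  measurable_fun setT v -> measurable_fun setT psi ->
  (forall i, measurable_fun setT (fun x => coord3 i (gv x))) ->
  (forall i, measurable_fun setT (fun x => coord3 i (gpsi x))) ->
  {ae mu3, forall x : pt, 0 < enorm x -> v x = V (enorm x)} ->
  {ae mu3, forall x : pt, 0 < enorm x -> enorm (gv x) = `|V' (enorm x)|} ->
  {ae mu3, forall x : pt, 0 < enorm x -> psi x = pot V (enorm x)} ->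
  {ae mu3, forall x : pt, 0 < enorm x -> enorm (gpsi x) = fS V (enorm x)} ->
  F_action p v gv psi gpsi = kap * PP p V V' 1.
Proof.
move=> KV dH mv mpsi mgv mgpsi ev egv epsi egpsi.
have [dV cV' iA iC] := KV; have cV := D1_cpos dV.
have cp := cpos_pot cV iC; have cf := cpos_fS cV iC; have cSS := cpos_SS cV iC.
have [i4 <-] := action_PP p KV.
have tr (F : pt -> R) (f : R -> R) : measurable_fun setT F -> cpos f ->
    {ae mu3, forall x : pt, 0 < enorm x -> F x = f (enorm x)} -> Int3 F = kap * Ip (fun r => f r * r ^+ 2).
  by move=> mF cf'; apply: Rint_radial_ae mF (cpos_meas cf').
have men := meas_enorm mgv; have men2 := meas_enorm mgpsi.
have mX (F : pt -> R) : measurable_fun setT F -> measurable_fun setT (fun x => F x ^+ 2).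
  by move=> mF; apply: measurable_funX.
have mc (f : R -> R) (h : pt -> R) : continuous f -> measurable_fun setT h -> measurable_fun setT (fun x => f (h x)).
  by move=> cf' mh; apply: (measurableT_comp _ mh); exact: continuous_measurable_fun.
have e1 := @tr (fun x => enorm (gv x) ^+ 2 + v x ^+ 2) (fun r => V' r ^+ 2 + V r ^+ 2).
have e2 := @tr (fun x => psi x * v x ^+ 2) (fun r => pot V r * V r ^+ 2).
have e3 := @tr (fun x => `|v x| `^ (p + 1)) (fun r => `|V r| `^ (p + 1)).
have e4 := @tr (fun x => 1 - Num.sqrt (1 - enorm (gpsi x) ^+ 2)) (fun r => 1 - r ^+ 2 / SS V r).
rewrite /F_action e1; first last.
- by apply: filterS2 egv ev => x h1 h2 x0; rewrite h1// h2// real_normK ?num_real.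
- by apply: cposD; exact: cposX.
- by apply: measurable_funD; exact: mX.
rewrite e2; first last.
- by apply: filterS2 epsi ev => x h1 h2 x0; rewrite h1// h2.
- by apply: cposM => //; exact: cposX.
- by apply: measurable_funM => //; exact: mX.
rewrite e3; first last.
- by apply: filterS ev => x h2 x0; rewrite h2.
- by apply: (@cpos_comp (fun t => `|t| `^ (p + 1)) V) => //; exact: powabs_cont.
- by apply: (mc (fun t => `|t| `^ (p + 1)) v) => //; exact: powabs_cont.
rewrite e4; first last.
- by apply: filterS egpsi => x h x0; rewrite h// sqrt_bi.
- apply: cposB; first exact: cpos_cst.
  by apply: cposM; [apply: cposX; exact: cpos_id|apply: cposV => // r r0; rewrite gt_eqF// SS_gt0].
- apply: measurable_funB; first exact: measurable_cst.
  by apply: (mc Num.sqrt); [exact: sqrt_continuous|apply: measurable_funB; [exact: measurable_cst|exact: mX]].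
have [_ E1] := ig2 mpos 1 1 iA iC.
rewrite (@eq_RintD _ _ _ leb pos _ (fun r => 1 * fA V' r + 1 * fC V r)); last by move=> r _; rewrite /fA /fC; ring.
rewrite E1 (@eq_RintD _ _ _ leb pos _ (fun r => pot V r * fC V r)); last by move=> r _; rewrite /fC; ring.
rewrite (@eq_RintD _ _ _ leb pos (fun r => (1 - r ^+ 2 / SS V r) * r ^+ 2) (fun r => r ^+ 2 * (1 - r ^+ 2 / SS V r))); last by move=> r _; ring.
rewrite -/(fD p V); ring.
Qed.

End RadialAction.

Lemma flux_alg (y0 y1 y2 d0 d1 d2 m S r : R) : 0 < r -> 0 < S ->
  (y0 * (- (m / S) / r) * d0 + y1 * (- (m / S) / r) * d1 + y2 * (- (m / S) / r) * d2) / (r ^+ 2 / S) =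
  y0 * - (m / r ^+ 3) * d0 + y1 * - (m / r ^+ 3) * d1 + y2 * - (m / r ^+ 3) * d2.
Proof. by move=> r0 S0; field; rewrite !gt_eqF. Qed.

Lemma flux_div_alg (m U v r : R) : 0 < r ->
  - ((3 * - (m / r ^+ 3) + r * (3 * m / r ^+ 4 - U ^+ 2 * r ^+ 2 / r ^+ 3)) * v) = U ^+ 2 * v.
Proof. by move=> r0; field; rewrite gt_eqF. Qed.

(** * The ground state in space *)

Section GroundState.
Variable p : R.
Hypothesis p2 : 2 < p.
Hypothesis p5 : p < 5.
Variables (U U' U'' : R -> R) (U0 k f0 kp : R).
Hypothesis KU : Kp U U'.
Hypothesis C0 : 0 < Ip (fC U).
Hypothesis dH : D1 (fun r => r ^+ 2 * U' r) (rhs p (pot U) U).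
Hypothesis rU : reg2 U U' U'' U0 k.
Hypothesis rP : reg2 (pot U) (fun r => - fS U r) (potd2 U) f0 kp.

Let u : pt -> R := radf U0 U.
Let gu : pt -> pt := vecr (gradf U' k).
Let phi : pt -> R := radf f0 (pot U).
Let gphi : pt -> pt := vecr (gradf (fun r => - fS U r) kp).
Let dU : D1 U U'. Proof. by have [] := KU. Qed.
Let cU : cpos U := D1_cpos dU.
Let cU' : cpos U'. Proof. by have [] := KU. Qed.
Let iU : ip (fC U). Proof. by have [] := KU. Qed.
Let iA : ip (fA U'). Proof. by have [] := KU. Qed.
Let cp : cpos (pot U) := cpos_pot cU iU.
Let cf : cpos (fS U) := cpos_fS cU iU.

Lemma ground_H1 : H1_with_grad u gu /\ radial u.
Proof.
split; last by move=> x y xy; rewrite /u /radf xy.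
split; [|split; first exact: weak_grad_radial rU].
- rewrite /L2 (_ : (fun x => (u x ^+ 2)%:E) = EFin \o (radf (U0 ^+ 2) (fun r => U r ^+ 2) : pt -> R)); last first.
    by apply/funext => x; rewrite /= -(radf_comp (fun t => t ^+ 2)).
  by apply: ig_radf; [apply: cpos_meas; exact: cposX|exact: iU].
- rewrite /L2 (_ : (fun x => (enorm (gu x) ^+ 2)%:E) = EFin \o (radf (0 ^+ 2) (fun r => `|U' r| ^+ 2) : pt -> R)); last first.
    by apply/funext => x; rewrite /= enorm_gradf (radf_comp (fun t => t ^+ 2)).
  apply: ig_radf; first by apply: cpos_meas; apply: cposX; exact: cpos_abs.
  by apply: (ig_eq mpos _ iA) => r _; rewrite /fA real_normK ?num_real.
Qed.

(** Coulomb decay: [fS <= M / t^2] is integrated from [r] to [s], and the potential vanishes as [s]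
    tends to infinity. It is what places the potential in L^6. *)
Lemma pot_le_inv r : 0 < r -> pot U r <= Ip (fC U) / r.
Proof.
move=> r0; set M := Ip (fC U).
have dG : D1 (fun t => - (M * t^-1)) (fun t => M * t ^- 2).
  have dV : D1 (fun r : R => r^-1) (fun r => - 1 / r ^+ 2) by apply: (D1V _ (@D1_id)) => t t0; rewrite gt_eqF.
  by apply: (D1_ext _ _ (D1N (D1Z M dV))) => // t t0; rewrite mulNr mul1r mulrN opprK.
have cG : cpos (fun t : R => M * t ^- 2).
  by apply: cposM; [exact: cpos_cst|apply: cposV; [move=> t t0; rewrite expf_neq0// gt_eqF|apply: cposX; exact: cpos_id]].
have key s : r <= s -> pot U r - pot U s <= M / r.
  move=> rs; have cN : cpos (fun t => - fS U t) by exact: cposN.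
  have := D1_cmp (pot_D1 cU iU) cN dG cG r0 rs => H.
  have h : `|pot U s - pot U r| <= - (M * s^-1) - - (M * r^-1).
    by apply: H => t rt ts; rewrite normrN ger0_norm ?fS_ge0//; apply: fS_le2 => //; exact: lt_le_trans rt.
  have s0 : 0 < s by exact: lt_le_trans rs.
  have q : 0 <= M * s^-1 by apply: mulr_ge0; [exact: IpC_ge0|rewrite invr_ge0 ltW].
  have := ler_norm (- (pot U s - pot U r)); rewrite normrN => h2; move: h h2 q; lra.
have L : pot U r - pot U s @[s --> +oo] --> pot U r - 0 by apply: cvgB; [exact: cvg_cst|exact: pot_cvgy].
rewrite subr0 in L; rewrite -(cvg_lim _ L)//; apply: limr_le; first by apply/cvg_ex; exists (pot U r).
by near=> s; apply: key; near: s; exact: nbhs_pinfty_ge (num_real r).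
Unshelve. all: by end_near. Qed.

Lemma pot_lip a b : 0 < a -> a <= b -> `|pot U b - pot U a| <= b - a.
Proof.
move=> a0 ab; have cN : cpos (fun t => - fS U t) by exact: cposN.
apply: (D1_cmp (pot_D1 cU iU) cN (@D1_id) (@cpos_cst 1) a0 ab) => t _ _.
by rewrite normrN ger0_norm ?fS_ge0// fS_le1.
Qed.

Lemma phi_lip x y : `|phi x - phi y| <= enorm (x - y).
Proof.
apply: le_trans (norm_enorm_le x y).
have lim0 b : 0 < b -> `|pot U b - f0| <= b.
  move=> b0; have lp : pot U r @[r --> 0^'+] --> f0 by have [_ _ _ lp _] := rP.
  have L : `|pot U b - pot U s| @[s --> 0^'+] --> `|pot U b - f0|.
    by apply: cvg_norm; apply: cvgB => //; exact: cvg_cst.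
  rewrite -(cvg_lim _ L)//; apply: limr_le; first by apply/cvg_ex; exists `|pot U b - f0|.
  near=> s; have s0 : 0 < s by near: s; exact: nbhs_right_gt.
  apply: le_trans (pot_lip s0 _) _; first by near: s; exact: nbhs_right_le.
  by rewrite gerBl ltW.
have pp a b : 0 < a -> 0 < b -> `|pot U b - pot U a| <= `|b - a|.
  move=> a0 b0; have [ab|/ltW ba] := leP a b; first by rewrite [leRHS]ger0_norm ?subr_ge0//; exact: pot_lip.
  by rewrite distrC [leRHS]distrC [leRHS]ger0_norm ?subr_ge0//; exact: pot_lip.
rewrite /phi /radf; case: ifPn => x0; case: ifPn => y0; first exact: pp.
- by rewrite (enorm_le0 (negbTE y0)) enorm0 subr0 [leRHS]ger0_norm ?enorm_ge0//; exact: lim0.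
- by rewrite (enorm_le0 (negbTE x0)) enorm0 sub0r normrN [leRHS]ger0_norm ?enorm_ge0// distrC; exact: lim0.
- by rewrite subrr normr0.
Unshelve. all: by end_near. Qed.

(** The two bounds combine to [2 C / (1 + r^2)], integrable through the arctangent. *)
Lemma ip_inv2 (g : R -> R) (C : R) : cpos g -> 0 <= C -> (forall r, 0 < r -> `|g r| <= C /\ `|g r| <= C / r ^+ 2) -> ip g.
Proof.
move=> cg Cge hg.
have i1 : ip (fun r => C * 2 * (1 + r ^+ 2)^-1).
  apply: igZ => //; apply: (@ip_bounded_prim (@atan R) _ pi).
  - by move=> r r0; exact: is_derive1_atan.
  - apply: cposV; first by move=> r r0; rewrite gt_eqF// ltr_wpDr// sqr_ge0.
    by apply: cposD; [exact: cpos_cst|apply: cposX; exact: cpos_id].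
  - by move=> r r0; rewrite invr_ge0 addr_ge0// sqr_ge0.
  - move=> r r0; rewrite ler_norml; have := @atan_gtNpi2 R r; have := @atan_ltpi2 R r; have := @pi_gt0 R; lra.
apply: (ig_dom mpos (cpos_meas cg) i1) => r /pos_gt0 r0.
have [h1 h2] := hg r r0; have q : 0 < 1 + r ^+ 2 by rewrite ltr_wpDr// sqr_ge0.
rewrite ler_pdivlMr//; rewrite ler_pdivlMr ?exprn_gt0// in h2; lra.
Qed.

Lemma ground_X : X_with_grad phi gphi /\ radial phi.
Proof.
split; last by move=> x y xy; rewrite /phi /radf xy.
split; [split; [|split; first exact: weak_grad_radial rP]|split].
- rewrite /L6 (_ : (fun x => (phi x ^+ 6)%:E) = EFin \o (radf (f0 ^+ 6) (fun r => pot U r ^+ 6) : pt -> R)); last first.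
    by apply/funext => x; rewrite /= -(radf_comp (fun t => t ^+ 6)).
  apply: ig_radf; first by apply: cpos_meas; exact: cposX.
  pose F0 := Ip (fS U); pose M := Ip (fC U).
  have F00 : 0 <= F0 by apply: Rintegral_ge0 => r _; exact: fS_ge0.
  have M0 : 0 <= M by exact: IpC_ge0.
  (* From [pot <= F0] and [r pot <= M]: [pot^6 r^2] is [(r pot)^2 pot^4], and also [(r pot)^4 pot^2]
     divided by [r^2]. *)
  apply: (@ip_inv2 _ (M ^+ 2 * F0 ^+ 4 + M ^+ 4 * F0 ^+ 2)).
  + by apply: cposM; apply: cposX => //; exact: cpos_id.
  + by apply: addr_ge0; apply: mulr_ge0; rewrite exprn_ge0.
  move=> r r0; have h1 := pot_ge0 cU iU r; have h2 := pot_le U r.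
  have h3 := pot_le_inv r0; rewrite -/F0 in h2; rewrite -/M ler_pdivlMr// in h3.
  have A n : (pot U r * r) ^+ n <= M ^+ n by apply: lerXn2r; rewrite ?nnegrE ?mulr_ge0// ltW.
  have B n : pot U r ^+ n <= F0 ^+ n by apply: lerXn2r; rewrite ?nnegrE.
  have P n : 0 <= pot U r ^+ n by exact: exprn_ge0.
  have Q n : 0 <= (pot U r * r) ^+ n by apply: exprn_ge0; apply: mulr_ge0 => //; exact: ltW.
  rewrite ger0_norm; last by apply: mulr_ge0 => //; exact: sqr_ge0.
  have D1' : 0 <= M ^+ 2 * F0 ^+ 4 by apply: mulr_ge0; exact: exprn_ge0.
  have D2' : 0 <= M ^+ 4 * F0 ^+ 2 by apply: mulr_ge0; exact: exprn_ge0.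
  split.
    have -> : pot U r ^+ 6 * r ^+ 2 = (pot U r * r) ^+ 2 * pot U r ^+ 4 by ring.
    by apply: (@le_trans _ _ (M ^+ 2 * F0 ^+ 4)); [exact: ler_pM|rewrite lerDl].
  rewrite ler_pdivlMr ?exprn_gt0//.
  have -> : pot U r ^+ 6 * r ^+ 2 * r ^+ 2 = (pot U r * r) ^+ 4 * pot U r ^+ 2 by ring.
  by apply: (@le_trans _ _ (M ^+ 4 * F0 ^+ 2)); [exact: ler_pM|rewrite lerDr].
- rewrite /L2 (_ : (fun x => (enorm (gphi x) ^+ 2)%:E) = EFin \o (radf (0 ^+ 2) (fun r => `|- fS U r| ^+ 2) : pt -> R)); last first.
    by apply/funext => x; rewrite /= enorm_gradf (radf_comp (fun t => t ^+ 2)).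
  apply: ig_radf; first by apply: cpos_meas; apply: cposX; apply: cpos_abs; exact: cposN.
  have i1 := ip_fS cU iU.
  have i2 : ip (fun r => Ip (fC U) * fS U r) by exact: igZ.
  apply: (ig_dom mpos _ i2).
    by apply: cpos_meas; apply: cposM; [apply: cposX; apply: cpos_abs; exact: cposN|apply: cposX; exact: cpos_id].
  move=> r /pos_gt0 r0; rewrite normrN (ger0_norm (fS_ge0 U r)).
  have a := fS_ge0 U r; have b := fS_le2 iU r0; rewrite ler_pdivlMr ?exprn_gt0// in b.
  rewrite ger0_norm; last by apply: mulr_ge0; exact: sqr_ge0.
  by have q := ler_wpM2l a b; apply: le_trans (le_trans _ q) _; rewrite le_eqVlt; apply/orP; left; apply/eqP; ring.
- by exists 1 => x y; rewrite mul1r; exact: phi_lip.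
- apply: aeW => x; rewrite enorm_gradf /radf; case: ifP => _; last exact: ler01.
  by rewrite normrN ger0_norm ?fS_ge0// fS_le1.
Qed.

Lemma sol_div r : 0 < r -> 3 * (U' r / r) + r * (U'' r / r - U' r / r ^+ 2) = (1 + pot U r) * U r - nlin p (U r).
Proof.
move=> r0; have [_ dU' cU'' _ _] := rU.
have := @sol_laplace p U U' U'' dU' dH r r0; rewrite /rhs => h.
by rewrite h; field; rewrite gt_eqF.
Qed.

Lemma ground_eq1 v : test_fun v ->
  Int3 (fun x => dot3 (gu x) (cgrad v x) + u x * v x + phi x * u x * v x)
     = Int3 (fun x => `|u x| `^ (p - 1) * u x * v x).
Proof.
move=> tv; have [dg cg' lg lg'] := reg2_vec rU.
have [cv bv _ _] := test_cont tv.
have p1 : 1 < p by have := p2; lra.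
have [i1 i2 E] := div_radial dg cg' lg lg' tv.
have cu : continuous u := reg2_cont rU; have cphi : continuous phi := reg2_cont rP.
pose W x := (1 + phi x) * u x * v x.
have cW : continuous (fun x => (1 + phi x) * u x).
  by move=> x; apply: cvgM; [apply: cvgD; [exact: cvg_cst|exact: cphi]|exact: cu].
have iW : int3 W.
  by apply: csupp_integrable; [move=> x; apply: cvgM; [exact: cW|exact: cv]|exact: bsuppM].
have [j1 F1] := ig2 measurableT 1 1 i1 iW; have [j2 F2] := ig2 measurableT 1 (-1) iW i2.
rewrite (@eq_RintD _ _ _ mu3 setT _ (fun x => 1 * dot3 (gu x) (cgrad v x) + 1 * W x)); last first.
  by move=> x _; rewrite /W; ring.
rewrite F1 E; set Q := (fun x => radf _ _ x * v x) in F2 *.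
transitivity (Int3 (fun x => 1 * W x + -1 * Q x)); first by rewrite F2; ring.
have cn : continuous (fun x => nlin p (u x)).
  by move=> x; apply: (@continuous_comp _ _ _ u (nlin p)); [exact: cu|exact: nlin_continuous].
apply: eq_Rint_ae => //.
- exact: (ig_meas j2).
- by apply: cont_measurable3 => x; apply: cvgM; [exact: cn|exact: cv].
have := @ae_en_gt0; apply: filterS => x x0 _.
rewrite /W /Q /u /phi !rad_pos// sol_div//; rewrite -/(nlin p (U (enorm x))); ring.
Qed.

(** The electric displacement is [- m x / r^3], and it extends across the origin because [m / r^3]
    has a limit. Its divergence is [- U^2]. *)
Lemma ground_eq2 psi : test_fun psi ->
  Int3 (fun x => dot3 (gphi x) (cgrad psi x) / Num.sqrt (1 - enorm (gphi x) ^+ 2))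
     = Int3 (fun x => u x ^+ 2 * psi x).
Proof.
move=> tv; have [cv bv _ _] := test_cont tv.
have [_ _ _ lU _] := rU.
have hm := mass_cubic KU lU; have dm := mass_D1 cU iU.
pose a (r : R) := - (mass U r / r ^+ 3); pose a' (r : R) := 3 * mass U r / r ^+ 4 - fC U r / r ^+ 3.
have da : D1 a a'.
  apply: (D1_ext _ _ (D1N (D1M dm (@D1_cubeV)))) => // r r0; rewrite /a'; field; by rewrite gt_eqF.
have cV n : cpos (fun r : R => (r ^+ n)^-1).
  by apply: cposV; [move=> r r0; rewrite expf_neq0 ?gt_eqF|apply: cposX; exact: cpos_id].
have ca' : cpos a'.
  apply: cposB; apply: cposM => //; last exact: cpos_fC.
  by apply: cposM; [exact: cpos_cst|exact: cpos_mass].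
have la : a r @[r --> 0^'+] --> - (U0 ^+ 2 / 3) by apply: cvgN.
have la' : r * a' r @[r --> 0^'+] --> (0 : R).
  apply: (near_right_ext (f := fun r => 3 * (mass U r / r ^+ 3) - U r ^+ 2)).
    by move=> r r0; rewrite /a' /fC; field; rewrite gt_eqF.
  rewrite -[X in _ --> X](_ : 3 * (U0 ^+ 2 / 3) - U0 ^+ 2 = 0); last by field.
  by apply: cvgB; [apply: cvgM; [exact: cvg_cst|exact: hm]|rewrite expr2; under eq_fun do rewrite expr2; apply: cvgM].
have [i1 i2 E] := div_radial da ca' la la' tv.
transitivity (Int3 (fun x => dot3 (vecr (radf (- (U0 ^+ 2 / 3)) a) x) (cgrad psi x))).
  apply: eq_RintD => x _; rewrite !dot_cgrad enorm_gradf.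
  have [x0|x0] := boolP (0 < enorm x); last first.
    have c0 i : coord3 i (0 : pt) = 0 by rewrite /coord3; case: ifP => _; [|case: ifP].
    have z (e1 e2 e3 e4 e5 e6 : R) : 0 * e1 * e2 + 0 * e3 * e4 + 0 * e5 * e6 = 0 by ring.
    by rewrite (enorm_le0 (negbTE x0)) !c0 !z mul0r.
  rewrite /gradf !rad_pos// normrN (ger0_norm (fS_ge0 U _)) sqrt_bi// /a /fS.
  exact: (flux_alg _ _ _ _ _ _ _ x0 (SS_gt0 U x0)).
rewrite E -RintN_all; apply: eq_Rint_ae => //.
- exact: (ig_meas (igN measurableT i2)).
- apply: cont_measurable3 => x; apply: cvgM; last exact: cv.
  by rewrite expr2; under eq_fun do rewrite expr2; apply: cvgM; exact: (reg2_cont rU).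
have := @ae_en_gt0; apply: filterS => x x0 _.
rewrite /u !rad_pos// /a /a' /fC; exact: (flux_div_alg _ _ _ x0).
Qed.

Lemma ground_nontrivial : nontrivial u.
Proof.
move=> h; have mU : measurable_fun pos (fun r => U r ^+ 2) by apply: cpos_meas; exact: cposX.
have : Int3 (radf 0 (fun r => U r ^+ 2) : pt -> R) = 0.
  transitivity (Int3 (fun=> 0 : R)); last exact: Rint_cst0.
  apply: (@eq_Rint_ae _ _ _ mu3 setT measurableT _ (fun=> 0)); [exact: (meas_radf 0 mU)|exact: measurable_cst|].
  by apply: filterS h => x; rewrite /u /radf; case: ifP => // _ -> _; rewrite expr0n.
rewrite int_radf// => /eqP; rewrite mulf_eq0 gt_eqF ?kap_gt0//= => /eqP e.
by have := C0; rewrite /fC e ltxx.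
Qed.

Lemma ground_action : F_action p u gu phi gphi = kap * PP p U U' 1.
Proof.
apply: action_radial => //.
- exact: cont_measurable3 (reg2_cont rU).
- exact: cont_measurable3 (reg2_cont rP).
- move=> i; rewrite (_ : (fun x => _) = (fun x => coord3 i x * gradf U' k x)); last by apply/funext => x; exact: coord_vecr.
  by apply: cont_measurable3; exact: gradf_cont rU i.
- move=> i; rewrite (_ : (fun x => _) = (fun x => coord3 i x * gradf (fun r => - fS U r) kp x)); last by apply/funext => x; exact: coord_vecr.
  by apply: cont_measurable3; exact: gradf_cont rP i.
- by apply: aeW => x x0; rewrite /u rad_pos.
- by apply: aeW => x x0; rewrite enorm_gradf rad_pos.
- by apply: aeW => x x0; rewrite /phi rad_pos.
- by apply: aeW => x x0; rewrite enorm_gradf rad_pos// normrN ger0_norm ?fS_ge0.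
Qed.

End GroundState.

Theorem ground_state (p : R) : 2 < p -> p < 5 ->
  exists (u : pt -> R) gu phi gphi,
    [/\ H1_with_grad u gu /\ radial u, X_with_grad phi gphi /\ radial phi,
        weak_solution p u gu phi gphi /\ nontrivial u,
        F_action p u gu phi gphi <= kap * clev p & C2 u /\ C2 phi].
Proof.
move=> p2 p5.
have [U [U' [U'' [KU C0 hP dH [[U0 [k rU]] [f0 [kp rP]]]]]]] := ground_profile p2 p5.
exists (radf U0 U), (vecr (gradf U' k)), (radf f0 (pot U)), (vecr (gradf (fun r => - fS U r) kp)); split.
- exact: ground_H1 KU rU.
- exact: ground_X KU rP.
- split; last exact: ground_nontrivial KU C0.
  split => v tv; first exact: (ground_eq1 p2 dH rU rP tv).
  by eapply ground_eq2; eassumption.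
- by rewrite (ground_action p2 KU dH rU rP) ler_wpM2l// ltW// kap_gt0.
- by split; [exact: reg2_C2 rU|exact: reg2_C2 rP].
Qed.

(** * Averages over spheres *)

Section Nonnegative.
Variable h : pt -> R.
Hypothesis mh : measurable_fun setT h.
Hypothesis h0 : forall x, 0 <= h x.
Hypothesis hi : int3 h.

Let pre (A : set mR) : set pt := (@enorm R : pt -> mR) @^-1` A.
Let mpre A : measurable A -> measurable (pre A).
Proof. by move=> mA; rewrite -[X in measurable X]setTI; exact: menorm. Qed.

(** The image under [|x|] of the measure with density [h]. The hypotheses on [h] are arguments so
    that the finite measure structure can be attached to the term. *)
Definition cem of measurable_fun setT h & (forall x, 0 <= h x) & int3 h :=
  fun A : set mR => (\int[mu3]_(x in (@enorm R : pt -> mR) @^-1` A) (h x)%:E)%E.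
Local Notation nu := (cem mh h0 hi).

Let cem0 : nu set0 = 0%E. Proof. by rewrite /cem preimage_set0 integral_set0. Qed.
Let cem_ge0 A : (0 <= nu A)%E. Proof. by apply: integral_ge0 => x _; rewrite lee_fin. Qed.
Let cem_add : semi_sigma_additive nu.
Proof.
move=> F mF tF mUF; rewrite /cem preimage_bigcup.
apply: (@semi_sigma_additive_nng_induced _ _ _ mu3 (EFin \o h)) => //.
- exact/measurable_EFinP.
- by move=> n; exact: mpre.
- by move=> i j _ _ [x [Fi Fj]]; apply: tF => //; exists (enorm x).
- by apply: bigcup_measurable => n _; exact: mpre.
Qed.
HB.instance Definition _ := isMeasure.Build _ _ _ nu cem0 cem_ge0 cem_add.

Let cem_fin : fin_num_fun nu.
Proof. by move=> A mA; apply: integrable_fin_num; [exact: mpre|apply: (integrableS measurableT _ _ hi) => //; exact: mpre]. Qed.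
HB.instance Definition _ := Measure_isFinite.Build _ _ _ nu cem_fin.

(** By polar coordinates a null set of radii has a null preimage in space. *)
Lemma cem_dom : nu `<< leb.
Proof.
apply/null_content_dominatesP => A mA A0.
have P : {ae leb, forall r, pos r -> ~ A r}.
  by exists A; split => //= r /=; apply: contra_notP => h' _.
have Q : {ae mu3, forall x : pt, ~ pre A x}.
  by have := ae_polar P; have := @ae_en_gt0; apply: filterS2 => x x0; apply.
have [N [mN N0 hN]] := Q.
have z : mu3 (pre A) = 0%E.
  apply/eqP; rewrite eq_le measure_ge0 andbT -N0; apply: le_measure; rewrite ?inE//; first exact: mpre.
  by move=> x Ax; apply: hN => /=; apply.
apply: null_set_integral => //; first exact: mpre.
by apply/measurable_EFinP; exact: measurable_funTS.
Qed.

Lemma cem_integral (f : R -> R) : measurable_fun setT f -> (forall r, 0 <= f r) ->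
  (\int[nu]_r (f r)%:E = \int[mu3]_x ((f (enorm x)) * h x)%:E)%E.
Proof.
move=> mf f0.
transitivity (\int[pushforward (dmeas mu3 mh h0) (@enorm R : pt -> mR)]_r (f r)%:E)%E.
  by apply: eq_measure_integral; [exact: menorm|move=> Hm A mA _].
rewrite ge0_integral_pushforward//; first last.
- by move=> r _; rewrite lee_fin.
- exact/measurable_EFinP.
- exact: menorm.
rewrite preimage_setT integral_dmeas//.
- by apply/measurable_EFinP; exact: (measurableT_comp mf menorm).
- by move=> x; rewrite /= lee_fin.
Qed.

(** Conditioning on the radius: [b] is the Radon-Nikodym density of the image measure with respect
    to Lebesgue measure. *)
Lemma cond_exp0 : exists b : R -> R, [/\ measurable_fun setT b, leb.-integrable setT (EFin \o b) &
  forall (f : R -> R) (C : R), measurable_fun setT f -> (forall r, `|f r| <= C) ->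
    Int3 (fun x => f (enorm x) * h x) = Rintegral leb setT (fun r => f r * b r)].
Proof.
pose D := Radon_Nikodym_SigmaFinite.f nu leb.
have D0 := Radon_Nikodym_SigmaFinite.f_ge0 cem_dom.
have Df := Radon_Nikodym_SigmaFinite.f_fin_num cem_dom.
have Di := Radon_Nikodym_SigmaFinite.f_integrable cem_dom.
pose b r := fine (D r); have bE r : (b r)%:E = D r by rewrite fineK.
have ib : leb.-integrable setT (EFin \o b).
  by rewrite (_ : EFin \o b = D)//; apply/funext => r; exact: bE.
have mb : measurable_fun setT b by exact: (ig_meas ib).
have b0 r : 0 <= b r by rewrite -lee_fin bE.
have key (f : R -> R) : measurable_fun setT f -> (forall r, 0 <= f r) ->
    Int3 (fun x => f (enorm x) * h x) = Rintegral leb setT (fun r => f r * b r).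
  move=> mf f0; rewrite /Rintegral -cem_integral//; congr fine.
  have cov := Radon_Nikodym_SigmaFinite.change_of_variables cem_dom.
  rewrite -(cov (EFin \o f) setT)//; last exact/measurable_EFinP.
  by apply: eq_integral => r _; rewrite /= EFinM bE.
exists b; split => // f C mf hC.
have C0 : 0 <= C by apply: le_trans (hC 0).
(* A bounded signed [f] is handled as the difference of the nonnegative functions [f + C] and
   [C]. *)
have fC r : 0 <= f r + C by have := hC r; rewrite ler_norml => /andP[]; lra.
have k1 := key (fun r => f r + C) (measurable_funD mf (measurable_cst _)) fC.
have k2 := key (fun=> C) (measurable_cst _) (fun _ => C0).
have bound (g : R -> R) (K : R) : measurable_fun setT g -> (forall r, `|g r| <= K) ->
    int3 (fun x => g (enorm x) * h x) /\ leb.-integrable setT (EFin \o (fun r => g r * b r)).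
  move=> mg hg; split.
    apply: (@ig_dom _ _ _ mu3 setT measurableT _ (fun x => K * h x)).
    - by apply: measurable_funM => //; exact: (measurableT_comp mg menorm).
    - exact: igZ.
    - by move=> x _; rewrite normrM (ger0_norm (h0 x)) ler_wpM2r.
  apply: (@ig_dom _ _ _ leb setT measurableT _ (fun r => K * b r)).
  - exact: measurable_funM.
  - exact: igZ.
  - by move=> x _; rewrite normrM (ger0_norm (b0 x)) ler_wpM2r.
have b1 r : `|f r + C| <= C + C by apply: le_trans (ler_normD _ _) _; rewrite lerD// ger0_norm.
have cC (r : R) : `|C| <= C by rewrite ger0_norm.
have [i1 j1] := bound _ _ (measurable_funD mf (measurable_cst _)) b1.
have [i2 j2] := bound (fun=> C) C (measurable_cst _) cC.
have [_ E1] := ig2 measurableT 1 (-1) i1 i2; have [_ E2] := ig2 measurableT 1 (-1) j1 j2.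
rewrite (@eq_RintD _ _ _ mu3 setT _ (fun x => 1 * ((f (enorm x) + C) * h x) + -1 * (C * h x))); last by move=> x _; ring.
rewrite E1 k1 k2 -E2; apply: eq_RintD => r _ /=; ring.
Qed.
End Nonnegative.

Lemma cond_exp (g : pt -> R) : int3 g ->
  exists b : R -> R, [/\ measurable_fun setT b, leb.-integrable setT (EFin \o b) &
  forall (f : R -> R) (C : R), measurable_fun setT f -> (forall r, `|f r| <= C) ->
    Int3 (fun x => f (enorm x) * g x) = Rintegral leb setT (fun r => f r * b r)].
Proof.
move=> ig; have mg : measurable_fun setT g := ig_meas ig.
pose g1 x := Num.max (g x) 0; pose g2 x := Num.max (- g x) 0.
have m1 : measurable_fun setT g1 by apply: measurable_maxr => //; exact: measurable_cst.
have m2 : measurable_fun setT g2 by apply: measurable_maxr; [exact: measurableT_comp|exact: measurable_cst].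
have P1 x : 0 <= g1 x by rewrite le_max lexx orbT.
have P2 x : 0 <= g2 x by rewrite le_max lexx orbT.
have gE x : g x = g1 x - g2 x.
  by rewrite /g1 /g2; case: (leP (g x) 0); case: (leP (- g x) 0) => ? ?; lra.
have B1 x : setT x -> `|g1 x| <= `|g x| by move=> _; rewrite /g1; case: (leP (g x) 0) => ?; rewrite ?normr0.
have B2 x : setT x -> `|g2 x| <= `|g x| by move=> _; rewrite /g2; case: (leP (- g x) 0) => ?; rewrite ?normr0 ?normrN.
have i1 : int3 g1.
  by apply: (@ig_dom _ _ _ mu3 setT measurableT _ (fun x => `|g x|)) => //; exact: igabs.
have i2 : int3 g2.
  by apply: (@ig_dom _ _ _ mu3 setT measurableT _ (fun x => `|g x|)) => //; exact: igabs.
have [b1 [mb1 ib1 E1]] := cond_exp0 m1 P1 i1; have [b2 [mb2 ib2 E2]] := cond_exp0 m2 P2 i2.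
exists (fun r => b1 r - b2 r); split.
- exact: measurable_funB.
- exact: igB.
move=> f C mf hC; have C0 : 0 <= C by apply: le_trans (hC 0).
have bound3 (h : pt -> R) : int3 h -> int3 (fun x => f (enorm x) * h x).
  move=> ih; apply: (@ig_dom _ _ _ mu3 setT measurableT _ (fun x => C * `|h x|)).
  - by apply: measurable_funM; [exact: (measurableT_comp mf menorm)|exact: (ig_meas ih)].
  - by apply: igZ => //; exact: igabs.
  - by move=> x _; rewrite normrM ler_wpM2r.
have bound1 (h : R -> R) : leb.-integrable setT (EFin \o h) -> leb.-integrable setT (EFin \o (fun x => f x * h x)).
  move=> ih; apply: (@ig_dom _ _ _ leb setT measurableT _ (fun x => C * `|h x|)).
  - by apply: measurable_funM => //; exact: (ig_meas ih).
  - by apply: igZ => //; exact: igabs.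
  - by move=> x _; rewrite normrM ler_wpM2r.
have [_ F1] := ig2 measurableT 1 (-1) (bound3 _ i1) (bound3 _ i2).
have [_ F2] := ig2 measurableT 1 (-1) (bound1 _ ib1) (bound1 _ ib2).
rewrite (@eq_RintD _ _ _ mu3 setT _ (fun x => 1 * (f (enorm x) * g1 x) + -1 * (f (enorm x) * g2 x))); last first.
  by move=> x _; rewrite gE; ring.
rewrite F1 (E1 f C)// (E2 f C)// -F2; apply: eq_RintD => r _; ring.
Qed.

(* The weight [1 / (1 + r ^ 2)] is square integrable in R^3, so it makes an L^2 function integrable. *)
Lemma radial_average (g : pt -> R) : measurable_fun setT g -> L2 g ->
  exists2 b : R -> R, locpos b & forall a e z, a < e -> T1 a e z ->
    int3 (fun x => g x * radf 0 z x) /\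
    Int3 (fun x => g x * radf 0 z x) = Ip (fun r => b r * z r).
Proof.
move=> mg g2; pose rho (r : R) := (1 + r ^+ 2)^-1.
have q r : 0 < 1 + r ^+ 2 :> R by rewrite ltr_wpDr// sqr_ge0.
have crho : cpos rho.
  by apply: cposV; [move=> r _; rewrite gt_eqF|apply: cposD; [exact: cpos_cst|apply: cposX; exact: cpos_id]].
have ir : ip (fun r => rho r ^+ 2 * r ^+ 2).
  apply: (@ip_inv2 _ 1) => //; first by apply: cposM; apply: cposX => //; exact: cpos_id.
  move=> r r0; have s0 := sqr_ge0 r.
  have e1 : rho r ^+ 2 * r ^+ 2 = r ^+ 2 / (1 + r ^+ 2) ^+ 2 by rewrite /rho exprVn mulrC.
  rewrite e1 ger0_norm ?divr_ge0 ?sqr_ge0//; split.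
    by rewrite ler_pdivrMr ?exprn_gt0// mul1r; nra.
  by rewrite ler_pdivrMr ?exprn_gt0// mulrAC ler_pdivlMr ?exprn_gt0// mul1r; nra.
have crho2 : cpos (fun r => rho r ^+ 2) by exact: cposX.
have irho := ig_radf (rho 0 ^+ 2) (cpos_meas crho2) ir.
have ig : int3 (fun x => rho (enorm x) * g x).
  have mr : measurable_fun setT (fun x : pt => rho (enorm x)).
    apply: cont_measurable3 => x; apply: cvgV; first by rewrite gt_eqF.
    by apply: cvgD; [exact: cvg_cst|rewrite expr2; under eq_fun do rewrite expr2; apply: cvgM; exact: continuous_enorm].
  apply: (@ig_dom _ _ _ mu3 setT measurableT _ (fun x => g x ^+ 2 + radf (rho 0 ^+ 2) (fun r => rho r ^+ 2) x)).
  - exact: measurable_funM.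
  - exact: igD.
  - move=> x _; have -> : radf (rho 0 ^+ 2) (fun r => rho r ^+ 2) x = rho (enorm x) ^+ 2.
      by rewrite /radf; case: ifPn => // /negbTE /enorm_le0 ->; rewrite enorm0.
    rewrite normrM -[in leRHS](real_normK (num_real (g x))) -[in leRHS](real_normK (num_real (rho _))).
    by move: `|g x| `|rho (enorm x)| => A B; nra.
have [b [mb ib E]] := cond_exp ig.
have lb : locpos (fun r => (1 + r ^+ 2) * b r).
  apply: locposM; first by apply: cposD; [exact: cpos_cst|apply: cposX; exact: cpos_id].
  by apply: ip_locpos; apply: (igS measurableT).
(* The factor [1 + r^2] undoes the weight [rho] introduced for integrability; it is harmless on the
   compact support of [z]. *)
exists (fun r => (1 + r ^+ 2) * b r) => // a e z ae tz; have [a0 sz uz] := tz; have cz := smooth_cpos sz.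
pose F r := (z \_ pos) r * (1 + r ^+ 2).
have mF : measurable_fun setT F.
  apply: measurable_funM; first exact: meas_patch (cpos_meas cz).
  by apply: measurable_funD => //; apply: measurable_funX; exact: measurable_id.
have [K K0 hK] := cpos_seg_bounded e cz a0.
have FK r : `|F r| <= K * (1 + e ^+ 2).
  have K1 : 0 <= K * (1 + e ^+ 2) by apply: mulr_ge0 => //; exact: ltW.
  rewrite /F /patch; case: ifPn; last by rewrite mul0r normr0.
  rewrite inE => /in_pos r0; have [re|er] := leP r e; last by rewrite uz ?er ?orbT// mul0r normr0.
  have [ar|ra] := leP a r; last by rewrite uz ?ra// mul0r normr0.
  rewrite normrM (ger0_norm (ltW (q r))); apply: ler_pM => //; first exact: ltW.
    by apply: hK; rewrite in_itv /= ar re.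
  by rewrite lerD2l lerXn2r// nnegrE; [exact: ltW|apply: le_trans re; exact: ltW].
have FE x : F (enorm x) * (rho (enorm x) * g x) = g x * radf 0 z x.
  rewrite /F /rho radf_patch if_same addr0; field; by rewrite gt_eqF.
split.
  apply: (@ig_eq _ _ _ mu3 setT measurableT (fun x => F (enorm x) * (rho (enorm x) * g x))) => [x _|]; first exact: FE.
  apply: (@ig_dom _ _ _ mu3 setT measurableT _ (fun x => K * (1 + e ^+ 2) * `|rho (enorm x) * g x|)).
  - by apply: measurable_funM; [exact: (measurableT_comp mF menorm)|exact: (ig_meas ig)].
  - by apply: igZ => //; exact: igabs.
  - by move=> x _; rewrite normrM ler_wpM2r.
rewrite -(@eq_RintD _ _ _ mu3 setT _ _ (fun x _ => FE x)) (E F _ mF FK).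
rewrite (Rint_restr leb (D := setT) (fun r => (1 + r ^+ 2) * b r * z r) mpos)//.
by apply: eq_RintD => r _; rewrite /F /patch; case: ifP => _; [ring|rewrite !mul0r].
Qed.

(** * Locally absolutely continuous profiles *)

Definition stp (x y t : R) : R := (t <= y)%R%:R - (t <= x)%R%:R.

Lemma stp_le1 x y t : `|stp x y t| <= 1.
Proof. by rewrite /stp; case: (t <= y); case: (t <= x); rewrite ?subrr ?subr0 ?sub0r ?normrN ?normr0 ?normr1. Qed.

Lemma stp_out x y a e t : a <= x -> a <= y -> x <= e -> y <= e -> t \notin `[a, e] -> stp x y t = 0.
Proof.
move=> ax ay xe ye; rewrite in_itv /= negb_and -!ltNge => /orP[ta|et]; rewrite /stp.
  by rewrite (ltW (lt_le_trans ta ay)) (ltW (lt_le_trans ta ax)) subrr.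
by rewrite !leNgt (le_lt_trans ye et) (le_lt_trans xe et) subrr.
Qed.

Lemma stp_add x y z t : stp x z t = stp x y t + stp y z t.
Proof. by rewrite /stp; ring. Qed.

Lemma meas_stp x y : measurable_fun setT (stp x y).
Proof.
have m z : measurable_fun setT (fun t : R => (t <= z)%R%:R : R).
  rewrite (_ : (fun t : R => (t <= z)%R%:R) = \1_(`]-oo, z]%classic : set R)); last first.
    by apply/funext => t; rewrite indicE; congr (nat_of_bool _)%:R; apply/idP/idP; rewrite inE /= in_itv.
  by apply: measurable_indic; exact: measurable_itv.
exact: measurable_funB.
Qed.

Lemma ig_loc_dom (b f : R -> R) (a e K : R) : locpos b -> 0 < a -> a < e -> measurable_fun pos f ->
  (forall t, 0 < t -> `|f t| <= K) -> (forall t, 0 < t -> t \notin `[a, e] -> f t = 0) ->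
  ip (fun t => b t * f t) /\ `|Ip (fun t => b t * f t)| <= K * \int[leb]_(t in `[a, e]) `|b t|.
Proof.
move=> [mb lb] a0 ae mf fK f0.
have mI : @measurable _ mR `[a, e] by exact: measurable_itv.
have sI : `[a, e] `<=` pos by exact: seg_pos.
have ia : leb.-integrable `[a, e] (EFin \o (fun t => `|b t|)) by apply: igabs => //; exact: lb.
have J : ip ((fun t => `|b t|) \_ `[a, e]) by apply: ig_restr.
have KJ := igZ mpos K J.
have bd t : pos t -> `|b t * f t| <= K * ((fun t => `|b t|) \_ `[a, e]) t.
  move=> /in_pos t0; rewrite /patch; case: ifPn => h; first by rewrite normrM mulrC ler_wpM2r// fK.
  by rewrite f0 ?mulr0 ?normr0//; apply: contra h => h; rewrite inE.
have i1 : ip (fun t => b t * f t) by apply: (ig_dom mpos _ KJ) => //; exact: measurable_funM.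
split => //; rewrite (Rint_restr leb (fun t => `|b t|) mI sI) -(RintZ mpos K J).
exact: (abs_Rint mpos i1 KJ).
Qed.

Lemma ig_stp (b : R -> R) x y : locpos b -> 0 < x -> 0 < y -> ip (fun t => b t * stp x y t).
Proof.
move=> lb x0 y0; pose a := Num.min x y; pose e := Num.max x y + 1.
have a0 : 0 < a by rewrite lt_min x0.
have ae : a < e by rewrite /a /e; case: (leP x y) => h; lra.
have ms : measurable_fun pos (stp x y) by apply: measurable_funTS; exact: meas_stp.
have [] // := @ig_loc_dom b (stp x y) a e 1 lb a0 ae ms (fun t _ => stp_le1 x y t).
move=> t _; apply: stp_out; rewrite /a /e ?ge_min ?lexx ?orbT//.
- by have : x <= Num.max x y by [rewrite le_max lexx]; lra.
- by have : y <= Num.max x y by [rewrite le_max lexx orbT]; lra.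
Qed.

(** [C] is locally absolutely continuous with derivative [b]. Since [stp x y] is the indicator of
    the interval between [x] and [y], with sign given by their order, one formula covers both
    orders. *)
Definition acont (C b : R -> R) := locpos b /\
  forall x y, 0 < x -> 0 < y -> C y - C x = Ip (fun t => b t * stp x y t).

Lemma exists_acont b : locpos b -> exists C, acont C b.
Proof.
move=> lb; exists (fun r => Ip (fun t => b t * stp 1 r t)); split => // x y x0 y0.
have i1 := ig_stp lb ltr01 x0; have i2 := ig_stp lb x0 y0.
have [_ E] := ig2 mpos 1 1 i1 i2.
rewrite (@eq_RintD _ _ _ leb pos (fun t => b t * stp 1 y t) (fun t => 1 * (b t * stp 1 x t) + 1 * (b t * stp x y t))).
  by rewrite E; ring.
by move=> t _; rewrite (stp_add 1 x y); ring.
Qed.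

Lemma D1_acont F f : D1 F f -> cpos f -> acont F f.
Proof.
move=> dF cf; split; first exact: cpos_locpos.
have key x y : 0 < x -> x <= y -> F y - F x = Ip (fun t => f t * stp x y t).
  move=> x0 xy; rewrite -(FTC2 dF cf x0 xy).
  have mI : @measurable _ mR `]x, y] by exact: measurable_itv.
  have sI : `]x, y] `<=` pos by move=> t; rewrite /= in_itv /= => /andP[xt _]; apply/in_pos; exact: lt_trans xt.
  transitivity (\int[leb]_(t in `]x, y]) f t).
    rewrite /Rintegral integral_itv_obnd_cbnd//.
    by apply/measurable_EFinP; apply: (measurable_funS mpos) => //; exact: cpos_meas.
  rewrite (Rint_restr leb f mI sI); apply: eq_RintD => t _.
  rewrite /patch [in LHS](_ : (t \in _) = (x < t) && (t <= y)); last by apply/idP/idP; rewrite inE /= in_itv.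
  rewrite /stp; case: (leP t x) => tx /=; first by rewrite (le_trans tx xy) subrr mulr0.
  by case: (t <= y); rewrite ?subr0 ?mulr1 ?mulr0.
move=> x y x0 y0; have [xy|/ltW yx] := leP x y; first exact: key.
rewrite -[LHS]opprB (key _ _ y0 yx) -RintN_all; apply: eq_RintD => t _; rewrite /stp; ring.
Qed.

Lemma approx_lim (K L : R) (x eps : nat -> R) : (forall n, `|x n - L| <= K * eps n) ->
  eps n @[n --> \oo] --> (0 : R) -> x n @[n --> \oo] --> L.
Proof.
move=> h e0; apply/subr_cvg0/norm_cvg0P.
apply: (@squeeze_cvgr _ _ _ _ (fun=> 0) (fun n => K * eps n)).
- by apply: nearW => n; rewrite normr_ge0 h.
- exact: cvg_cst.
- by rewrite -[X in _ --> X](mulr0 K); apply: cvgM => //; exact: cvg_cst.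
Qed.

(* L^1 approximation of the derivative gives uniform C^1 approximation of the function. *)
Lemma acont_approx C b (a e : R) : acont C b -> 0 < a -> a < e -> exists (F f : nat -> R -> R) (eps : nat -> R),
  [/\ (forall n, D1 (F n) (f n)), (forall n, cpos (f n)), eps n @[n --> \oo] --> (0 : R),
      (forall n r, a <= r -> r <= e -> `|F n r - C r| <= eps n) &
      forall n, eps n = \int[leb]_(t in `[a, e]) `|b t + - f n t|].
Proof.
move=> [lb hC] a0 ae; have [mb lbi] := lb.
have mI : @measurable _ mR `[a, e] by exact: measurable_itv.
have fin : (leb `[a, e] < +oo)%E.
  by rewrite lebesgue_measure_itv /=; case: ifP => _; rewrite ?ltry// -EFinB ltry.
have [g [cg ig lim]] := approximation_continuous_integrable mI fin (lbi a e a0 ae).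
have cpg n : cpos (g n) by move=> r _; exact: cg.
have [G hG] : exists G : nat -> R -> R, forall n, D1 (G n) (g n).
  have h n : {F | D1 F (g n)} by apply: cid; exact: exists_prim (cpg n).
  by exists (fun n => sval (h n)) => n; exact: svalP (h n).
pose eps n := \int[leb]_(t in `[a, e]) `|b t + - g n t|.
have lbg n : locpos (fun t => b t + - g n t).
  by apply: locposD => //; apply: cpos_locpos; exact: cposN.
exists (fun n r => G n r + (C a - G n a)), g, eps; split => //.
- move=> n; apply: D1_ext (D1D (hG n) (D1_cst _)) => // r _; rewrite addr0//.
- have h : (fine \o (fun n => \int[leb]_(z in `[a, e]) `|(b z - g n z)%:E|)%E) n @[n --> \oo] --> (0 : R) by apply: fine_cvg.
  exact: h.
- move=> n r ar re; have r0 : 0 < r by exact: lt_le_trans ar.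
  have [_ hGn] := D1_acont (hG n) (cpg n).
  have E1 := hC a r a0 r0; have E2 := hGn a r a0 r0.
  have i1 := ig_stp lb a0 r0; have i2 := ig_stp (cpos_locpos (cpg n)) a0 r0.
  have [_ E3] := ig2 mpos 1 (-1) i1 i2.
  have ms : measurable_fun pos (stp a r) by apply: measurable_funTS; exact: meas_stp.
  have [_ B] := @ig_loc_dom _ (stp a r) a e 1 (lbg n) a0 ae ms (fun t _ => stp_le1 a r t)
    (fun t _ => stp_out (lexx a) ar (ltW ae) re).
  rewrite mul1r in B; apply: le_trans B.
  have -> : Ip (fun t => (b t + - g n t) * stp a r t) = (C r - C a) - (G n r - G n a).
    rewrite E1 E2; transitivity (Ip (fun t => 1 * (b t * stp a r t) + -1 * (g n t * stp a r t))); last by rewrite E3; ring.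
    by apply: eq_RintD => t _; ring.
  by rewrite distrC le_eqVlt; apply/orP; left; apply/eqP; congr (`|_|); ring.
Qed.

Lemma acont_cpos C b : acont C b -> cpos C.
Proof.
move=> hC r r0; have a0 : 0 < r / 2 by rewrite divr_gt0.
have ae : r / 2 < 2 * r by lra.
have [F [f [eps [dF cf e0 hF _]]]] := acont_approx hC a0 ae.
apply/cvgrPdist_lt => d d0; have d3 : 0 < d / 3 by rewrite divr_gt0.
move/cvgrPdist_lt : (e0) => /(_ _ d3) [n _ /(_ n (leqnn n))]; rewrite /= sub0r normrN => en.
have cF := D1_cpos (dF n) r0; move/cvgrPdist_lt : cF => /(_ _ d3) hn.
have en' := le_lt_trans (ler_norm _) en.
near=> y.
have y1 : r / 2 <= y by near: y; apply: (cvgr_ge r); [exact: cvg_id|lra].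
have y2 : y <= 2 * r by near: y; apply: (cvgr_le r); [exact: cvg_id|lra].
have h1 := hF n y y1 y2; have h2 := hF n r (ltW _) (ltW _).
have h3 : `|F n r - F n y| < d / 3 by near: y.
have h2' : `|F n r - C r| <= eps n by apply: hF; lra.
have -> : C r - C y = - (F n r - C r) + (F n r - F n y) + (F n y - C y) by ring.
apply: le_lt_trans (ler_normD _ _) _; have := ler_normD (- (F n r - C r)) (F n r - F n y); rewrite normrN.
by move: (h1) (h2') (h3) (en'); lra.
Unshelve. all: try by end_near. all: lra. Qed.

Lemma acont_ibp C b (a e : R) z z' : acont C b -> a < e -> T1 a e z -> D1 z z' ->
  Ip (fun r => C r * z' r) = - Ip (fun r => b r * z r).
Proof.
move=> hC ae tz dz; have [a0 sz uz] := tz; have [lb _] := hC.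
have cz := smooth_cpos sz; have uz' := supp_D1 dz uz; have cz' := smooth_cpos (smooth_D1 sz dz).
have cC := acont_cpos hC.
have [F [f [eps [dF cf e0 hF epsE]]]] := acont_approx hC a0 ae.
have i1 n : ip (fun r => F n r * z' r) by exact: (ip_supp a0 (D1_cpos (dF n)) cz' uz').
have i2 n : ip (fun r => f n r * z r) by exact: (ip_supp a0 (cf n) cz uz).
have i3 : ip (fun r => C r * z' r) by exact: (ip_supp a0 cC cz' uz').
have i4 : ip (fun r => b r * z r) by exact: ip_locT1 tz ae.
have eqn n : Ip (fun r => F n r * z' r) = - Ip (fun r => f n r * z r) by exact: ibp_T1 (dF n) (cf n) tz dz.
have iz : ip (fun r => `|z' r|) by apply: igabs => //; apply: (ip_csupp cz' a0 uz').
have c1 : Ip (fun r => F n r * z' r) @[n --> \oo] --> Ip (fun r => C r * z' r).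
  apply: (@approx_lim (Ip (fun r => `|z' r|)) _ _ eps) => // n.
  have [i E] := ig2 mpos 1 (-1) (i1 n) i3.
  have -> : Ip (fun r => F n r * z' r) - Ip (fun r => C r * z' r) = Ip (fun r => 1 * (F n r * z' r) + -1 * (C r * z' r)).
    by rewrite E; ring.
  rewrite mulrC -(RintZ mpos _ iz); apply: (abs_Rint mpos i); first exact: igZ.
  move=> r /in_pos r0; have -> : 1 * (F n r * z' r) + -1 * (C r * z' r) = (F n r - C r) * z' r by ring.
  rewrite normrM; have [ar|ra] := leP a r; last by rewrite uz' ?ra// normr0 !mulr0.
  have [re|er] := leP r e; last by rewrite uz' ?er ?orbT// normr0 !mulr0.
  by apply: ler_wpM2r => //; exact: hF.
have [K K0 hK] := cpos_seg_bounded e cz a0.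
have c2 : - Ip (fun r => f n r * z r) @[n --> \oo] --> - Ip (fun r => b r * z r).
  apply: cvgN; apply: (@approx_lim K _ _ eps) => // n.
  have [i E] := ig2 mpos 1 (-1) i4 (i2 n).
  have -> : Ip (fun r => f n r * z r) - Ip (fun r => b r * z r) = - Ip (fun r => (b r + - f n r) * z r).
    transitivity (- Ip (fun r => 1 * (b r * z r) + -1 * (f n r * z r))); first by rewrite E; ring.
    by congr (- _); apply: eq_RintD => r _; ring.
  rewrite normrN epsE.
  have lbg : locpos (fun t => b t + - f n t) by apply: locposD => //; apply: cpos_locpos; exact: cposN.
  have zout t : 0 < t -> t \notin `[a, e] -> z t = 0.
    by move=> t0; rewrite in_itv /= negb_and -!ltNge => h; exact: uz.
  have zK t : 0 < t -> `|z t| <= K.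
    move=> t0; have [h|h] := boolP (t \in `[a, e]); first exact: hK.
    by rewrite zout// normr0.
  by have [] := ig_loc_dom lbg a0 ae (cpos_meas cz) zK zout.
have E : (fun n => Ip (fun r => F n r * z' r)) = (fun n => - Ip (fun r => f n r * z r)) by apply/funext => n; exact: eqn.
by rewrite E in c1; exact: (cvg_unique _ c1 c2).
Qed.

Lemma bsupp_bounded (f : pt -> R) : continuous f -> bsupp f -> exists2 C : R, 0 <= C & forall x, `|f x| <= C.
Proof.
move=> cf [M hM]; have [C C0 hC] := box_bounded M cf; exists C => // x.
by have [h|h] := leP (enorm x) M; [exact: hC|rewrite hM// normr0].
Qed.

Lemma loc_mul (f chi : pt -> R) : loc_integrable f -> continuous chi -> bsupp chi ->
  int3 (fun x => f x * chi x).
Proof.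
move=> [mf lf] cc bc; have [C C0 hC] := bsupp_bounded cc bc; have [M hM] := bc.
have [mB _] := @mu3_ball M.
have ia : mu3.-integrable [set x : pt | enorm x <= M] (EFin \o (fun x => `|f x|)) by apply: igabs => //; exact: lf.
have J : int3 ((fun x => `|f x|) \_ [set x : pt | enorm x <= M]) by apply: ig_restr.
apply: (@ig_dom _ _ _ mu3 setT measurableT _ (fun x => C * ((fun x => `|f x|) \_ [set x : pt | enorm x <= M]) x)).
- by apply: measurable_funM => //; exact: cont_measurable3.
- exact: igZ.
- move=> x _; rewrite /patch; case: ifPn => h; first by rewrite normrM mulrC ler_wpM2r.
  by rewrite hM ?mulr0 ?normr0// ltNge; apply: contra h => h; rewrite inE.
Qed.

(** For factors supported in a shell, integrals over space are controlled by the L^1 norm of [b] on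
    the segment of radii; this transfers the approximation of profiles to space. *)
Lemma shell_ig (b : R -> R) (th : pt -> R) (a e K : R) : locpos b -> 0 < a -> a < e -> 0 <= K ->
  measurable_fun setT th -> (forall x, `|th x| <= K) -> (forall x, enorm x \notin `[a, e] -> th x = 0) ->
  int3 (fun x => radf 0 b x * th x) /\
  `|Int3 (fun x => radf 0 b x * th x)| <= K * kap * e ^+ 2 * \int[leb]_(t in `[a, e]) `|b t|.
Proof.
move=> lb a0 ae K0 mth thK th0; have [mb lbi] := lb.
have mI : @measurable _ mR `[a, e] by exact: measurable_itv.
have sI : `[a, e] `<=` pos by exact: seg_pos.
pose B := (fun t => `|b t|) \_ `[a, e].
have mB : measurable_fun pos B.
  apply: measurable_funTS; apply/(measurable_restrictT _ mI); apply: (measurable_funS mpos) => //.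
  exact: measurableT_comp.
have iB : ip B by apply: ig_restr => //; apply: igabs => //; exact: lbi.
have Bge t : 0 <= B t by rewrite /B /patch; case: ifP.
have B2 t : pos t -> `|B t * t ^+ 2| <= e ^+ 2 * B t.
  move=> /in_pos t0; have P : 0 <= B t * t ^+ 2 by apply: mulr_ge0; [exact: Bge|exact: sqr_ge0].
  rewrite (ger0_norm P) (mulrC (B t)) /B /patch; case: ifPn => h; last by rewrite !mulr0.
  move: h; rewrite inE /= in_itv /= => /andP[_ te].
  by rewrite ler_wpM2r// lerXn2r// nnegrE; apply: ltW => //; exact: lt_le_trans te.
have iBe := igZ mpos (e ^+ 2) iB.
have iB2 : ip (fun t => B t * t ^+ 2) by exact: (ig_dom mpos (meas_wr2 mB) iBe B2).
have i3 := (polar_ig mB).2 iB2.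
have bd x : setT x -> `|radf 0 b x * th x| <= K * radf 0 B x.
  move=> _; rewrite normrM /radf; case: ifPn => x0; last by rewrite normr0 mul0r mulr0.
  rewrite /B /patch; case: ifPn => h; first by rewrite mulrC ler_wpM2r.
  by rewrite th0 ?normr0 ?mulr0//; apply: contra h => h; rewrite inE.
have i4 : int3 (fun x => K * radf 0 B x) by exact: igZ.
have i5 : int3 (fun x => radf 0 b x * th x).
  apply: (@ig_dom _ _ _ mu3 setT measurableT _ (fun x => K * radf 0 B x)) => //.
  by apply: measurable_funM => //; exact: meas_radf.
split => //; apply: le_trans (abs_Rint measurableT i5 i4 bd) _.
rewrite (RintZ measurableT K i3) polar_int// (Rint_restr leb (fun t => `|b t|) mI sI) -/B -!mulrA.
apply: ler_wpM2l => //; apply: ler_wpM2l; first by apply: ltW; exact: kap_gt0.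
rewrite mulrA -expr2 -(RintZ mpos (e ^+ 2) iB); apply: le_Rint => // t tp.
by apply: le_trans (ler_norm _) (B2 t tp).
Qed.

(** The weak gradient of [V(|x|)] away from the origin is [b(|x|) x / |x|]. For approximating C^1
    profiles it is [int_partial]; both sides pass to the limit under L^1 convergence of the
    derivatives. *)
Lemma acont_ibp3 (V b : R -> R) (a e : R) w (B : pt -> R) i : acont V b -> a < e -> T1 a e w -> tclass B ->
  Int3 (fun x => radf 0 V x * dpart [:: i] (fun y => radf 0 w y * B y) x) =
  - Int3 (fun x => radf 0 b x * (coord3 i x * radf 0 (fun r => r^-1) x * (radf 0 w x * B x))).
Proof.
move=> hV ae tw tB; have [a0 sw uw] := tw; have [lb _] := hV; have cV := acont_cpos hV.
have [w' dw sw'] := smooth_deriv sw; have uw' := supp_D1 dw uw; have fw := T1_flat0 tw; have fw' := flat0_deriv dw fw.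
have [B' tB' dB] := tclass_derive i tB.
pose chi (x : pt) := radf 0 w x * B x.
pose dchi (x : pt) := radf 0 w x * B' x + B x * (coord3 i x * radf 0 (fun r => w' r / r) x).
have dE x : is_derive x (ebasis i) chi (dchi x) by apply: is_deriveM; exact: rad_flat_derive fw.
rewrite (dpart1E dE).
have tr := tc_T1 tw.
have tr' : tclass (radf 0 (fun r => w' r / r) : pt -> R) by apply: (@tc_rad 0 a); [exact: smooth_divr|exact: flat0_div].
have tchi : tclass chi by exact: tc_mul.
have tdchi : tclass dchi.
  by apply: tc_add; apply: tc_mul => //; apply: tc_mul => //; exact: tc_coord.
have bchi : bsupp chi by apply: bsuppMl; exact: bsupp_T1 tw.
have bdchi : bsupp dchi := bsupp_derive dE bchi.
have out (x : pt) : enorm x \notin `[a, e] -> radf 0 w x = 0 /\ radf 0 (fun r => w' r / r) x = 0.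
  rewrite in_itv /= negb_and -!ltNge => h; rewrite /radf; case: ifPn => // x0.
  by rewrite uw// uw'// mul0r.
have out1 x : enorm x \notin `[a, e] -> chi x = 0 by move=> /out [h _]; rewrite /chi h mul0r.
have out2 x : enorm x \notin `[a, e] -> dchi x = 0 by move=> /out [h1 h2]; rewrite /dchi h1 h2 !mulr0 mul0r addr0.
pose th x := coord3 i x * radf 0 (fun r => r^-1) x * chi x.
have [K K0 hK] := bsupp_bounded (tclass_cont tchi) bchi.
have [K2 K20 hK2] := bsupp_bounded (tclass_cont tdchi) bdchi.
have cinv : cpos (fun r : R => r^-1) by apply: cposV; [move=> r r0; rewrite gt_eqF|exact: cpos_id].
have mth : measurable_fun setT th.
  apply: measurable_funM; last by apply: cont_measurable3; exact: tclass_cont.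
  by apply: measurable_funM; [apply: cont_measurable3; exact: continuous_coord|apply: meas_radf; exact: cpos_meas].
have thK x : `|th x| <= K.
  rewrite /th normrM; apply: le_trans (_ : 1 * K <= _); last by rewrite mul1r.
  apply: ler_pM => //; rewrite normrM /radf; case: ifPn => x0; last by rewrite normr0 mulr0.
  by rewrite (normfV (enorm x)) (ger0_norm (enorm_ge0 x)) ler_pdivrMr// mul1r; exact: coord_le_enorm.
have th0 x : enorm x \notin `[a, e] -> th x = 0 by move=> /out1 h; rewrite /th h mulr0.
have [F [f [eps [dF cf e0 hF epsE]]]] := acont_approx hV a0 ae.
have mdchi : measurable_fun setT dchi by apply: cont_measurable3; exact: tclass_cont.
have S1 (bb : R -> R) : locpos bb -> _ := fun lbb => shell_ig lbb a0 ae K20 mdchi hK2 out2.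
have S2 (bb : R -> R) : locpos bb -> _ := fun lbb => shell_ig lbb a0 ae K0 mth thK th0.
have lF n : locpos (F n) by apply: cpos_locpos; exact: D1_cpos (dF n).
have lf n : locpos (f n) by exact: cpos_locpos.
have lV := cpos_locpos cV.
have eqn n : Int3 (fun x => radf 0 (F n) x * dchi x) = - Int3 (fun x => radf 0 (f n) x * th x).
  pose G r := F n r * w r; pose G' r := f n r * w r + F n r * w' r.
  have dG : D1 G G' by exact: D1M.
  have fG : flat0 0 a G by split => // r r0 ra; rewrite /G uw ?ra// mulr0.
  have fG' : flat0 0 a G' := flat0_deriv dG fG.
  pose H (x : pt) := radf 0 G x * B x.
  pose dH (x : pt) := radf 0 G x * B' x + B x * (coord3 i x * radf 0 (fun r => G' r / r) x).
  have dHE x : is_derive x (ebasis i) H (dH x) by apply: is_deriveM; exact: rad_flat_derive fG.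
  have cG' : cpos (fun r => G' r / r).
    by apply: cposM => //; apply: cposD; apply: cposM => //; [exact: smooth_cpos|exact: D1_cpos (dF n)|exact: smooth_cpos].
  have cdH : continuous dH.
    move=> x; apply: cvgD; apply: cvgM.
    - by apply: (continuous_rad (D1_cpos dG)); exact: flat0_cvg fG.
    - exact: tclass_cont.
    - exact: tclass_cont.
    - apply: cvgM; first exact: continuous_coord.
      by apply: continuous_rad => //; exact: (flat0_cvg (flat0_div fG')).
  have bH : bsupp H.
    exists e => x ex; rewrite /H /radf; case: ifPn => x0; last by rewrite mul0r.
    by rewrite /G uw ?ex ?orbT// mulr0 mul0r.
  have z := int_partial dHE cdH bH.
  have [i1 _] := S1 _ (lF n); have [i2 _] := S2 _ (lf n).
  have [_ E] := ig2 measurableT 1 1 i1 i2.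
  have : Int3 (fun x => 1 * (radf 0 (F n) x * dchi x) + 1 * (radf 0 (f n) x * th x)) = 0.
    rewrite -[RHS]z; apply: eq_RintD => x _; rewrite /dH /dchi /th /chi.
    have [x0|x0] := boolP (0 < enorm x); last by rewrite (enorm_le0 (negbTE x0)) !rad0 !mul0r !mulr0 !addr0.
    rewrite !rad_pos// /G /G'; field; by rewrite gt_eqF.
  by rewrite E !mul1r => /eqP; rewrite addr_eq0 => /eqP.
have c1 : Int3 (fun x => radf 0 (F n) x * dchi x) @[n --> \oo] --> Int3 (fun x => radf 0 V x * dchi x).
  have idc : int3 (fun x => `|dchi x|).
    by apply: igabs => //; apply: csupp_integrable => //; exact: tclass_cont.
  apply: (@approx_lim (Int3 (fun x => `|dchi x|)) _ _ eps) => // n.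
  have [i1 _] := S1 _ (lF n); have [i2 _] := S1 _ lV.
  have [ii E] := ig2 measurableT 1 (-1) i1 i2.
  have -> : Int3 (fun x => radf 0 (F n) x * dchi x) - Int3 (fun x => radf 0 V x * dchi x) =
    Int3 (fun x => 1 * (radf 0 (F n) x * dchi x) + -1 * (radf 0 V x * dchi x)) by rewrite E mul1r mulN1r.
  rewrite mulrC -(RintZ measurableT (eps n) idc); apply: (abs_Rint measurableT ii); first exact: igZ.
  move=> x _; have -> : 1 * (radf 0 (F n) x * dchi x) + -1 * (radf 0 V x * dchi x) = (radf 0 (F n) x - radf 0 V x) * dchi x by ring.
  rewrite normrM; have [h|h] := boolP (enorm x \in `[a, e]); last by rewrite out2// normr0 !mulr0.
  move: h; rewrite in_itv /= => /andP[ax xe]; apply: ler_wpM2r => //.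
  by rewrite !rad_pos ?(lt_le_trans a0)//; exact: hF.
have c2 : - Int3 (fun x => radf 0 (f n) x * th x) @[n --> \oo] --> - Int3 (fun x => radf 0 b x * th x).
  apply: cvgN; apply: (@approx_lim (K * kap * e ^+ 2) _ _ eps) => // n.
  have [i1 _] := S2 _ lb; have [i2 _] := S2 _ (lf n).
  have [ii E] := ig2 measurableT 1 (-1) i1 i2.
  have lbg : locpos (fun t => b t + - f n t) by apply: locposD => //; apply: cpos_locpos; exact: cposN.
  have [_ bd] := S2 _ lbg; rewrite epsE distrC; apply: le_trans bd.
  have -> : Int3 (fun x => radf 0 b x * th x) - Int3 (fun x => radf 0 (f n) x * th x) =
    Int3 (fun x => 1 * (radf 0 b x * th x) + -1 * (radf 0 (f n) x * th x)) by rewrite E mul1r mulN1r.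
  rewrite le_eqVlt; apply/orP; left; apply/eqP; congr (`|_|); apply: eq_RintD => x _.
  by rewrite /radf; case: ifP => _; ring.
have E : (fun n => Int3 (fun x => radf 0 (F n) x * dchi x)) = (fun n => - Int3 (fun x => radf 0 (f n) x * th x)).
  by apply/funext => n; exact: eqn.
by rewrite E in c1; exact: (cvg_unique _ c1 c2).
Qed.

Lemma meas_dot (y z : pt -> pt) : (forall i, measurable_fun setT (fun x => coord3 i (y x))) ->
  (forall i, measurable_fun setT (fun x => coord3 i (z x))) -> measurable_fun setT (fun x => dot3 (y x) (z x)).
Proof.
move=> my mz; by apply: measurable_funD; [apply: measurable_funD|]; apply: measurable_funM;
  [exact: (my o0)|exact: (mz o0)|exact: (my o1)|exact: (mz o1)|exact: (my o2)|exact: (mz o2)].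
Qed.

(** * Profiles of radial weakly differentiable functions *)

Section Fixed.
Variables (u : pt -> R) (g : pt -> pt).
Hypothesis ru : radial u.
Hypothesis wg : weak_grad u g.
Hypothesis g2 : L2 (fun x => enorm (g x)).

Let V0 (r : R) := u (r, 0, 0).
Let lu : loc_integrable u. Proof. by have [] := wg. Qed.
Let lg i : loc_integrable (fun x => coord3 i (g x)). Proof. by have [_ [+ _]] := wg; apply. Qed.
Let mg i : measurable_fun setT (fun x => coord3 i (g x)). Proof. by have [] := lg i. Qed.

Lemma radial_profile x : u x = V0 (enorm x).
Proof.
by apply: ru; rewrite [RHS]/enorm dot3E /= expr0n /= !addr0 sqrtr_sqr ger0_norm ?enorm_ge0.
Qed.

Lemma profile_locpos : locpos V0.
Proof.
have [mu lu2] := lu.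
have m0 : measurable_fun setT (fun r : R => ((r, 0), 0) : pt).
  by apply: measurable_fun_pair; [apply: measurable_fun_pair|].
have mV : measurable_fun setT V0 by exact: (measurableT_comp mu m0).
have mVp : measurable_fun pos V0 by exact: measurable_funTS.
have lz : locpos (fun r => V0 r * r ^+ 2).
  split; first exact: meas_wr2.
  move=> a e a0 ae.
  have mI : @measurable _ mR `[a, e] by exact: measurable_itv.
  have sI : `[a, e] `<=` pos by exact: seg_pos.
  have mf : measurable_fun pos (V0 \_ `[a, e]).
    by apply: measurable_funTS; apply/(measurable_restrictT _ mI); exact: measurable_funTS.
  have i3 : int3 (radf 0 (V0 \_ `[a, e])).
    have [mB _] := @mu3_ball e.
    have ia : mu3.-integrable [set x : pt | enorm x <= e] (EFin \o (fun x => `|u x|)) by apply: igabs => //; exact: lu2.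
    have J : int3 ((fun x => `|u x|) \_ [set x : pt | enorm x <= e]) by apply: ig_restr.
    apply: (@ig_dom _ _ _ mu3 setT measurableT _ ((fun x => `|u x|) \_ [set x : pt | enorm x <= e])) => //; first exact: meas_radf.
    move=> x _; rewrite /radf /patch radial_profile.
    case: ifPn => x0; last by case: ifP => _; rewrite normr0.
    case: ifPn => h1; case: ifPn => h2 //; rewrite ?normr0//.
    by move: h1 h2; rewrite inE notin_setE /= in_itv /= => /andP[_ ->].
  have i1 := (polar_ig mf).1 i3.
  have i2 : leb.-integrable `[a, e] (EFin \o (fun r => (V0 \_ `[a, e]) r * r ^+ 2)) by exact: (igS mpos).
  by apply: (ig_eq mI _ i2) => r rI; rewrite /patch mem_set.
have lz2 : locpos (fun r => (r ^+ 2)^-1 * (V0 r * r ^+ 2)).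
  by apply: locposM => //; exact: smooth_cpos (@smooth_sqrV).
split => // a e a0 ae; have [_ h] := lz2; have mI : @measurable _ mR `[a, e] by exact: measurable_itv.
apply: (ig_eq mI _ (h a e a0 ae)) => r /(seg_pos a0) /in_pos r0; field; by rewrite gt_eqF.
Qed.

Let gam (x : pt) : R := dot3 (g x) x / enorm x.

Lemma meas_gam : measurable_fun setT gam.
Proof.
have md := meas_dot mg (fun i => cont_measurable3 (@continuous_coord i)).
rewrite (_ : gam = fun x => dot3 (g x) x * radf 0 (fun r => r^-1) x); last first.
  apply/funext => x; rewrite /gam /radf; case: ifPn => // /negbTE /enorm_le0 ->.
  by rewrite enorm0 invr0 mulr0.
apply: measurable_funM => //; apply: meas_radf; apply: cpos_meas; apply: cposV; last exact: cpos_id.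
by move=> r r0; rewrite gt_eqF.
Qed.

Lemma L2_gam : L2 gam.
Proof.
apply: (@ig_dom _ _ _ mu3 setT measurableT _ (fun x => enorm (g x) ^+ 2)) => //.
  by apply: measurable_funX; exact: meas_gam.
move=> x _; rewrite ger0_norm ?sqr_ge0// /gam expr_div_n.
have [x0|x0] := boolP (0 < enorm x); last first.
  by rewrite (enorm_le0 (negbTE x0)) enorm0 expr0n /= invr0 mulr0 sqr_ge0.
by rewrite ler_pdivrMr ?exprn_gt0//; exact: dot_CS.
Qed.

(** The weak gradient is tested with the three components of the field [x w(|x|)], and the results
    are added. *)
Lemma weak_div (a e : R) w w' : T1 a e w -> D1 w w' ->
  Int3 (fun x => u x * radf 0 (fun r => 3 * w r + r * w' r) x) =
  - Int3 (fun x => dot3 (g x) x * radf 0 w x).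
Proof.
move=> tw dw; have fw := T1_flat0 tw; have [a0 sw uw] := tw; have fw' := flat0_deriv dw fw.
have tr : tclass (radf 0 w : pt -> R) by exact: tc_T1 tw.
have tr' : tclass (radf 0 (fun r => w' r / r) : pt -> R).
  by apply: (@tc_rad 0 a); [apply: smooth_divr; exact: smooth_D1 dw|exact: flat0_div].
have bw : bsupp (radf 0 w : pt -> R) by exact: bsupp_T1 tw.
pose chi i (x : pt) := coord3 i x * radf 0 w x.
pose d i (x : pt) := coord3 i x * (coord3 i x * radf 0 (fun r => w' r / r) x) + radf 0 w x * (i == i)%:R.
have dE i x : is_derive x (ebasis i) (chi i) (d i x).
  by apply: is_deriveM; [exact: coord_derive|exact: rad_flat_derive fw].
have td i : tclass (d i).
  by apply: tc_add; apply: tc_mul => //; [exact: tc_coord|apply: tc_mul => //; exact: tc_coord|exact: tc_cst].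
have tchi i : tclass (chi i) by apply: tc_mul => //; exact: tc_coord.
have bchi i : bsupp (chi i) by exact: bsuppM.
have W i : Int3 (fun x => u x * d i x) = - Int3 (fun x => coord3 i (g x) * chi i x).
  have [_ [_ h]] := wg; have := h (chi i) (tclass_test (tchi i) (bchi i)) i.
  by rewrite (dpart1E (dE i)).
have i1 i : int3 (fun x => u x * d i x).
  by apply: loc_mul => //; [exact: tclass_cont|exact: bsupp_derive (dE i) (bchi i)].
have i2 i : int3 (fun x => coord3 i (g x) * chi i x).
  by apply: loc_mul => //; exact: tclass_cont.
have [_ E1] := ig3 measurableT 1 1 (i1 o0) (i1 o1) (i1 o2).
have [_ E2] := ig3 measurableT 1 1 (i2 o0) (i2 o1) (i2 o2).
have P1 x : u x * d o0 x + 1 * (u x * d o1 x) + 1 * (u x * d o2 x) = u x * radf 0 (fun r => 3 * w r + r * w' r) x.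
  rewrite !mul1r -!mulrDr; congr (_ * _); rewrite /d !eqxx !mulr1.
  have [x0|x0] := boolP (0 < enorm x); last by rewrite (enorm_le0 (negbTE x0)) !rad0 !mulr0 !addr0.
  rewrite !rad_pos//; have := enorm_sqr x; rewrite dot3_coord; move: (enorm x) x0 => r r0.
  move: (coord3 o0 x) (coord3 o1 x) (coord3 o2 x) => y0 y1 y2 E.
  transitivity ((y0 * y0 + y1 * y1 + y2 * y2) * (w' r / r) + 3 * w r); first by ring.
  by rewrite -E; field; rewrite gt_eqF.
have P2 x : coord3 o0 (g x) * chi o0 x + 1 * (coord3 o1 (g x) * chi o1 x) + 1 * (coord3 o2 (g x) * chi o2 x) =
    dot3 (g x) x * radf 0 w x.
  by rewrite dot3_coord /chi; ring.
have T1' := etrans (esym (@eq_RintD _ _ _ mu3 setT _ _ (fun x _ => P1 x))) E1.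
have T2' := etrans (esym (@eq_RintD _ _ _ mu3 setT _ _ (fun x _ => P2 x))) E2.
have H (A' B' C' a' b' c' L M : R) : L = A' + 1 * B' + 1 * C' -> M = a' + 1 * b' + 1 * c' ->
  A' = - a' -> B' = - b' -> C' = - c' -> L = - M by move=> -> -> -> -> ->; ring.
exact: (H _ _ _ _ _ _ _ _ T1' T2' (W o0) (W o1) (W o2)).
Qed.

Lemma smooth_powV n : smooth (fun r : R => (r ^+ n)^-1).
Proof. by apply: smoothV; [move=> r r0; rewrite gt_eqF// exprn_gt0|apply: smoothX; exact: smooth_id]. Qed.

(** Only the radial component [gam] of the gradient matters. Its spherical average is a weak
    derivative of the profile, and by the lemma of du Bois-Reymond the profile differs from a
    primitive by a constant almost everywhere. *)
Lemma profile_acont : exists V b : R -> R, acont V b /\ {ae leb, forall r, pos r -> V0 r = V r}.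
Proof.
have [b0 lb0 hb0] := radial_average meas_gam L2_gam.
have k0 : kap != 0 :> R by rewrite gt_eqF// kap_gt0.
pose b r := kap^-1 * (r ^+ 2)^-1 * b0 r.
have lb : locpos b by apply: locposM => //; apply: cposM; [exact: cpos_cst|exact: smooth_cpos (smooth_powV 2)].
have lV := profile_locpos.
have wk a e z z' : a < e -> T1 a e z -> D1 z z' -> Ip (fun r => V0 r * z' r) = - Ip (fun r => b r * z r).
  (* The field [x z(r) / r^3] has divergence [z'(r) / r^2], which the Jacobian of polar coordinates
     turns into [z']. *)
  move=> ae tz dz; have tw := T1M tz (smooth_powV 3); have dw := D1M dz D1_cubeV.
  have tz2 := T1M tz (smooth_powV 2).
  have [_ E0] := hb0 _ _ _ ae tz2.
  have := weak_div tw dw.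
  have -> : Int3 (fun x => dot3 (g x) x * radf 0 (fun r => z r * (r ^+ 3)^-1) x) = kap * Ip (fun r => b r * z r).
    transitivity (Int3 (fun x => gam x * radf 0 (fun r => z r * (r ^+ 2)^-1) x)).
      apply: eq_RintD => x _; rewrite /gam /radf; case: ifPn => x0; last by rewrite !mulr0.
      by field; rewrite gt_eqF.
    rewrite E0 -RintZ//; last exact: ip_locT1 tz ae.
    by apply: eq_RintD => r /in_pos r0; rewrite /b; field; rewrite k0 gt_eqF.
  have -> : Int3 (fun x => u x * radf 0 (fun r => 3 * (z r * (r ^+ 3)^-1) + r * (z' r * (r ^+ 3)^-1 + z r * (- 3 / r ^+ 4))) x) = kap * Ip (fun r => V0 r * z' r).
    have mf : measurable_fun pos (fun r => V0 r * z' r * (r ^+ 2)^-1).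
      apply: measurable_funM; last by apply: cpos_meas; exact: smooth_cpos (smooth_powV 2).
      have [mV _] := lV; apply: measurable_funM => //; apply: cpos_meas; apply: smooth_cpos.
      by have [_ sz _] := tz; exact: smooth_D1 dz.
    transitivity (Int3 (radf 0 (fun r => V0 r * z' r * (r ^+ 2)^-1))).
      apply: eq_RintD => x _; rewrite radial_profile /radf; case: ifPn => x0; last by rewrite mulr0.
      by field; rewrite gt_eqF.
    rewrite polar_int//; congr (_ * _); apply: eq_RintD => r /in_pos r0; field; by rewrite gt_eqF.
  by rewrite -mulrN => /(mulfI k0).
have [C hC] := exists_acont lb.
have cC := acont_cpos hC; have lC := cpos_locpos cC.
have lD : locpos (fun r => V0 r + - C r) by apply: locposD => //; apply: cpos_locpos; exact: cposN.
have [c hc] : exists c : R, {ae leb, forall r, pos r -> V0 r + - C r = c}.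
  apply: (dbr1_loc lD) => a e z z' ae tz dz; have tz' : T1 a e z'.
    by have [a0 sz uz] := tz; split => //; [exact: smooth_D1 dz|exact: supp_D1 uz].
  have i1 := ip_locT1 lV tz' ae; have i2 := ip_locT1 lC tz' ae.
  have [_ E] := ig2 mpos 1 (-1) i1 i2.
  transitivity (Ip (fun r => 1 * (V0 r * z' r) + -1 * (C r * z' r))); first by apply: eq_RintD => r _; ring.
  by rewrite E (wk _ _ _ _ ae tz dz) (acont_ibp hC ae tz dz); ring.
exists (fun r => C r + c), b; split.
  by have [_ h] := hC; split => // x y x0 y0; rewrite -(h x y x0 y0); ring.
by apply: filterS hc => r h rp; rewrite -(h rp); ring.
Qed.

(** Averaging controls only the radial component; that the gradient has no tangential part follows
    because [x b / |x|] has the same integrals against all cut-off box bumps. *)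
Theorem radial_weak : exists V b : R -> R, [/\ acont V b,
  {ae mu3, forall x : pt, 0 < enorm x -> u x = V (enorm x)} &
  {ae mu3, forall x : pt, 0 < enorm x -> forall i, coord3 i (g x) = coord3 i x * (b (enorm x) / enorm x)}].
Proof.
have [V [b [hV eV]]] := profile_acont; have [lb _] := hV; have cV := acont_cpos hV.
have eu : {ae mu3, forall x : pt, 0 < enorm x -> u x = V (enorm x)}.
  by have := ae_polar eV; apply: filterS => x h x0; rewrite radial_profile h.
exists V, b; split => //.
have mur : measurable_fun setT (radf 0 V : pt -> R) by apply: meas_radf; exact: cpos_meas.
have cinv : cpos (fun r : R => r^-1) by apply: cposV; [move=> r r0; rewrite gt_eqF|exact: cpos_id].
have minv : measurable_fun setT (radf 0 (fun r => r^-1) : pt -> R) by apply: meas_radf; exact: cpos_meas.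
have mc i : measurable_fun setT (@coord3 R i) by apply: cont_measurable3; exact: continuous_coord.
have key i n : {ae mu3, forall x : pt, (coord3 i (g x) - radf 0 b x * (coord3 i x * radf 0 (fun r => r^-1) x)) *
    radf 0 (bp 1 n.+1%:R^-1 n.+2%:R) x = 0}.
  (* A cut-off positive on an annulus removes the origin and infinity. The upper end [n + 2] keeps
     the annulus nonempty for [n = 0], and the annuli cover all positive radii. *)
  pose a : R := n.+1%:R^-1; pose e : R := n.+2%:R; pose w := @bp 1 a e.
  have a0 : 0 < a by rewrite invr_gt0.
  have ae : a < e by apply: (@le_lt_trans _ _ 1); [rewrite invf_le1// ler1n|rewrite ltr1n].
  have tw : T1 a e w by apply: bp_T1.
  have [_ sw uw] := tw.
  have tr := tc_T1 tw; have bw := bsupp_T1 tw; have cw := tclass_cont tr.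
  pose th x := coord3 i x * radf 0 (fun r => r^-1) x * radf 0 w x.
  have [K K0 hK] := bsupp_bounded cw bw.
  have mth : measurable_fun setT th.
    by apply: measurable_funM; [exact: measurable_funM|exact: cont_measurable3].
  have thK x : `|th x| <= K.
    rewrite /th normrM; apply: le_trans (_ : 1 * K <= _); last by rewrite mul1r.
    apply: ler_pM => //; rewrite normrM /radf; case: ifPn => x0; last by rewrite normr0 mulr0.
    by rewrite (normfV (enorm x)) (ger0_norm (enorm_ge0 x)) ler_pdivrMr// mul1r; exact: coord_le_enorm.
  have th0 x : enorm x \notin `[a, e] -> th x = 0.
    rewrite in_itv /= negb_and -!ltNge => h; rewrite /th /radf; case: ifPn => x0; last by rewrite !mulr0.
    by rewrite uw// mulr0.
  have [i2 _] := shell_ig lb a0 ae K0 mth thK th0.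
  have i1 := loc_mul (lg i) cw bw.
  have [iG _] := ig2 measurableT 1 (-1) i1 i2.
  pose G x := 1 * (coord3 i (g x) * radf 0 w x) + -1 * (radf 0 b x * th x).
  have bG : bsupp G.
    exists e => x ex; have z : radf 0 w x = 0 by rewrite /radf; case: ifP => // x0; rewrite uw// ex orbT.
    by rewrite /G /th z !mulr0 addr0.
  have : {ae mu3, forall x, G x = 0}.
    apply: (fund3 iG bG) => m a1 b1 a2 b2 a3 b3.
    pose B (x : pt) := bp m.+1%:R a1 b1 x.1.1 * bp m.+1%:R a2 b2 x.1.2 * bp m.+1%:R a3 b3 x.2.
    have tb k c d j : tclass (fun x => @bp k c d (coord3 j x)) by apply: tc_mul; exact: tc_flat.
    have tB : tclass B by apply: tc_mul; [apply: tc_mul; [exact: (tb _ _ _ o0)|exact: (tb _ _ _ o1)]|exact: (tb _ _ _ o2)].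
    pose chi x := radf 0 w x * B x.
    have tchi : tclass chi by exact: tc_mul.
    have bchi : bsupp chi by exact: bsuppMl.
    have tst := tclass_test tchi bchi.
    have [dchi tdchi dE] := tclass_derive i tchi.
    have [_ [_ h]] := wg; have W := h chi tst i.
    have X := acont_ibp3 i hV ae tw tB.
    have j1 := loc_mul (lg i) (tclass_cont tchi) bchi.
    pose thB x := coord3 i x * radf 0 (fun r => r^-1) x * (radf 0 w x * B x).
    have [K3 K30 hK3] := bsupp_bounded (tclass_cont tchi) bchi.
    have mthB : measurable_fun setT thB.
      by apply: measurable_funM; [exact: measurable_funM|apply: cont_measurable3; exact: tclass_cont].
    have thBK x : `|thB x| <= K3.
      rewrite /thB normrM; apply: le_trans (_ : 1 * K3 <= _); last by rewrite mul1r.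
      apply: ler_pM => //; [|exact: hK3]; rewrite normrM /radf; case: ifPn => x0; last by rewrite normr0 mulr0.
      by rewrite (normfV (enorm x)) (ger0_norm (enorm_ge0 x)) ler_pdivrMr// mul1r; exact: coord_le_enorm.
    have thB0 x : enorm x \notin `[a, e] -> thB x = 0.
      rewrite in_itv /= negb_and -!ltNge => hh; rewrite /thB /radf; case: ifPn => x0; last by rewrite mul0r !mulr0.
      by rewrite uw// mul0r mulr0.
    have [j2 _] := shell_ig lb a0 ae K30 mthB thBK thB0.
    have [_ E] := ig2 measurableT 1 (-1) j1 j2.
    transitivity (Int3 (fun x => 1 * (coord3 i (g x) * chi x) + -1 * (radf 0 b x * thB x))).
      by apply: eq_RintD => x _; rewrite /G /thB /th /chi /B; ring.
    have U : Int3 (fun x => u x * dpart [:: i] chi x) = Int3 (fun x => radf 0 V x * dpart [:: i] chi x).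
      have md : measurable_fun setT (dpart [:: i] chi).
        by rewrite (dpart1E dE); apply: cont_measurable3; exact: tclass_cont.
      have [mu _] := lu.
      apply: (@eq_Rint_ae _ _ _ mu3 setT measurableT); [exact: measurable_funM|exact: measurable_funM|].
      by have h0 := @ae_en_gt0; apply: filterS2 eu h0 => x h1 x0 _; rewrite h1// rad_pos.
    rewrite E; move: W X; rewrite -/chi U => -> /eqP; rewrite eqr_opp => /eqP ->; rewrite mul1r mulN1r subrr//.
  by apply: filterS => x h; apply: etrans h; rewrite /G /th; ring.
have key2 i := ae_foralln (key i).
have all3 : {ae mu3, forall x : pt, [/\ forall n, (coord3 o0 (g x) - radf 0 b x * (coord3 o0 x * radf 0 (fun r => r^-1) x)) * radf 0 (bp 1 n.+1%:R^-1 n.+2%:R) x = 0,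
   forall n, (coord3 o1 (g x) - radf 0 b x * (coord3 o1 x * radf 0 (fun r => r^-1) x)) * radf 0 (bp 1 n.+1%:R^-1 n.+2%:R) x = 0 &
   forall n, (coord3 o2 (g x) - radf 0 b x * (coord3 o2 x * radf 0 (fun r => r^-1) x)) * radf 0 (bp 1 n.+1%:R^-1 n.+2%:R) x = 0]}.
  by apply: filterS3 (key2 o0) (key2 o1) (key2 o2) => x p1 p2 p3; split.
apply: filterS all3 => x [p0 p1 p2] x0 i; pose r := enorm x.
pose n := maxn (Num.truncn r) (Num.truncn r^-1).
have ar : n.+1%:R^-1 < r.
  rewrite -[ltRHS]invrK ltf_pV2 ?posrE ?invr_gt0//; apply: lt_le_trans (truncnS_gt _) _.
  by rewrite ler_nat ltnS leq_maxr.
have re : r < n.+2%:R by apply: lt_le_trans (truncnS_gt _) _; rewrite ler_nat ltnS (leq_trans (leq_maxl _ _) (leqnSn _)).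
have w0 : bp 1 n.+1%:R^-1 n.+2%:R r != 0 by rewrite gt_eqF// bp_gt0.
have fin j : (coord3 j (g x) - radf 0 b x * (coord3 j x * radf 0 (fun r => r^-1) x)) * radf 0 (bp 1 n.+1%:R^-1 n.+2%:R) x = 0 ->
    coord3 j (g x) = coord3 j x * (b (enorm x) / enorm x).
  rewrite !rad_pos// => /eqP; rewrite mulf_eq0 (negbTE w0) orbF subr_eq0 => /eqP ->; ring.
by have [->|[->|->]] := ord3P i; apply: fin.
Qed.

End Fixed.

(** * The action of an arbitrary radial weak solution *)

Section Competitor.

Lemma coord_cgrad i (f : pt -> R) x : coord3 i (cgrad f x) = dpart [:: i] f x.
Proof.
have e0 : (0 : 'I_3) = o0 by exact: val_inj.
have e1 : (1 : 'I_3) = o1 by exact: val_inj.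
have e2 : (2 : 'I_3) = o2 by exact: val_inj.
by rewrite /cgrad e2 e1 e0; case: (ord3P i) => [->|[->|->]].
Qed.

Lemma cgrad_radf (c a : R) w w' (x : pt) i : D1 w w' -> flat0 c a w -> 0 < enorm x ->
  coord3 i (cgrad (radf c w) x) = coord3 i x * (w' (enorm x) / enorm x).
Proof.
move=> dw fw x0; rewrite coord_cgrad (dpart1E (fun y => rad_flat_derive i y dw fw)).
by rewrite rad_pos.
Qed.

Lemma dot_collinear (y z x : pt) (c k : R) : 0 < enorm x ->
  (forall i, coord3 i y = coord3 i x * (c / enorm x)) ->
  (forall i, coord3 i z = coord3 i x * (k / enorm x)) -> dot3 y z = c * k.
Proof.
move=> x0 hy hz; have := enorm_sqr x; rewrite !dot3_coord !hy !hz.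
move: (coord3 o0 x) (coord3 o1 x) (coord3 o2 x) => p q r.
move: (enorm x) x0 => n n0 h.
have -> : p * (c / n) * (p * (k / n)) + q * (c / n) * (q * (k / n)) + r * (c / n) * (r * (k / n)) =
  (p * p + q * q + r * r) * (c * k) / n ^+ 2 by field; rewrite gt_eqF.
by rewrite -h; field; rewrite gt_eqF.
Qed.

Lemma enorm_collinear (y x : pt) (c : R) : 0 < enorm x ->
  (forall i, coord3 i y = coord3 i x * (c / enorm x)) -> enorm y = `|c|.
Proof. by move=> x0 hy; rewrite /enorm (dot_collinear x0 hy hy) -expr2 sqrtr_sqr. Qed.

(** Inversion is discontinuous at 0, but on the values of the square root it coincides with its
    restriction to positive numbers extended by 0. *)
Lemma meas_inv_sqrt d (T : measurableType d) (S : set T) (f : T -> R) : measurable S -> measurable_fun S f ->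
  measurable_fun S (fun x => (Num.sqrt (1 - f x ^+ 2))^-1).
Proof.
move=> mS mf; have m1 : measurable_fun S (fun x => 1 - f x ^+ 2).
  by apply: measurable_funB; [exact: measurable_cst|exact: measurable_funX].
have ms : measurable_fun setT (@Num.sqrt R) by apply: continuous_measurable_fun; exact: sqrt_continuous.
have mi : measurable_fun setT ((fun y : R => y^-1) \_ pos).
  apply: meas_patch; apply: cpos_meas; apply: cposV; last exact: cpos_id.
  by move=> r r0; rewrite gt_eqF.
rewrite (_ : (fun x => _) = (fun y : R => y^-1) \_ pos \o (@Num.sqrt R \o (fun x => 1 - f x ^+ 2))).
  exact: (measurableT_comp mi (measurableT_comp ms m1)).
apply/funext => x /=; rewrite /patch; case: ifPn => // h.
have : ~~ (0 < Num.sqrt (1 - f x ^+ 2)) by apply: contra h => h; rewrite inE; apply/in_pos.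
by rewrite -leNgt => h2; have /eqP -> : Num.sqrt (1 - f x ^+ 2) == 0; rewrite ?invr0// eq_le h2 sqrtr_ge0.
Qed.

Lemma ip_radial_ae (F : pt -> R) (f : R -> R) : int3 F -> measurable_fun pos f ->
  {ae mu3, forall x : pt, 0 < enorm x -> F x = f (enorm x)} -> ip (fun r => f r * r ^+ 2).
Proof.
move=> iF mf h; apply/(polar_ig mf).
apply: (@ig_ae _ _ _ mu3 setT measurableT F) => //; first exact: meas_radf.
have h0 := @ae_en_gt0; apply: filterS2 h h0 => x h x0 _; rewrite /radf x0; exact: h.
Qed.

Lemma acont_ae (C b c : R -> R) : acont C b -> acont C c -> {ae leb, forall r, pos r -> b r = c r}.
Proof.
move=> hb hc; have [lb _] := hb; have [lc _] := hc.
have lmc : locpos (fun r => - 1 * c r) by apply: locposM => //; exact: cpos_cst.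
have : {ae leb, forall r, pos r -> b r + -1 * c r = 0}.
  apply: (fund1_loc (locposD lb lmc)) => a e z ae tz; have [a0 sz uz] := tz.
  have [z' dz _] := smooth_deriv sz.
  have [_ E] := ig2 mpos 1 (-1) (ip_locT1 lb tz ae) (ip_locT1 lc tz ae).
  transitivity (Ip (fun r => 1 * (b r * z r) + -1 * (c r * z r))); first by apply: eq_RintD => r _; ring.
  rewrite E; have := acont_ibp hb ae tz dz; rewrite (acont_ibp hc ae tz dz) => /eqP.
  by rewrite eqr_opp => /eqP ->; ring.
by apply: filterS => r h rp; have := h rp; rewrite mulN1r => /eqP; rewrite subr_eq0 => /eqP.
Qed.

Lemma div_le_alg (x y z t c : R) : 0 < c -> c <= t -> `|x / y * z| <= c^-1 * `|x / y * t * z|.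
Proof.
move=> c0 ct; have t0 : 0 < t by exact: lt_le_trans ct.
have -> : x / y * t * z = t * (x / y * z) by rewrite (mulrC _ t) mulrA.
by rewrite (normrM t) (gtr0_norm t0) mulrA ler_peMl// mulrC ler_pdivlMr// mul1r.
Qed.

Lemma gron_alg (t V q c K : R) : 0 < t -> t ^- 2 + t ^+ 2 * `|c| <= K ->
  2 * (V * (q / t ^+ 2)) + 2 * (q * (t ^+ 2 * (c * V))) <= K * (V ^+ 2 + q ^+ 2).
Proof.
move=> t0 hK; have t2 : 0 < t ^+ 2 by rewrite exprn_gt0.
have -> : 2 * (V * (q / t ^+ 2)) + 2 * (q * (t ^+ 2 * (c * V))) = (2 * V * q) * (t ^- 2 + t ^+ 2 * c) by ring.
apply: le_trans (ler_norm _) _; rewrite normrM mulrC; apply: ler_pM => //.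
  apply: le_trans hK; apply: le_trans (ler_normD _ _) _; rewrite normrM.
  have t3 : 0 <= t ^- 2 by rewrite invr_ge0 ltW.
  by rewrite (gtr0_norm t2) (ger0_norm t3).
have := abs2uv_le V q; by rewrite addrC.
Qed.

(** Inverts the Born-Infeld relation between field and displacement. If the square root were 0, the
    quotient would take the default value 0, against [0 < m]; otherwise squaring gives
    [(be S)^2 = m^2] and the sign is fixed. *)
Lemma beta_alg (be m r S : R) : 0 < r -> 0 < m -> `|be| <= 1 -> 0 < S -> S ^+ 2 = (r ^+ 2) ^+ 2 + m ^+ 2 ->
  be / Num.sqrt (1 - be ^+ 2) * r ^+ 2 = - m -> be = - (m / S).
Proof.
move=> r0 m0 b1 S0 hS h; set s := Num.sqrt _ in h.
have b2 : be ^+ 2 <= 1 by rewrite -real_normK ?num_real// exprn_ile1.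
have hs : s ^+ 2 = 1 - be ^+ 2 by rewrite /s sqr_sqrtr// subr_ge0.
have s0 : 0 < s.
  rewrite lt_neqAle sqrtr_ge0 andbT eq_sym; apply/eqP => z; move: h; rewrite z invr0 mulr0 mul0r => /eqP.
  by rewrite eq_sym oppr_eq0 gt_eqF.
have r2 : 0 < r ^+ 2 by rewrite exprn_gt0.
have h2 : be * r ^+ 2 = - (m * s).
  by rewrite -mulNr -h; field; rewrite gt_eqF.
have h3 : be ^+ 2 * S ^+ 2 = m ^+ 2.
  rewrite hS mulrDr -[X in X + _]exprMn h2 sqrrN exprMn hs; ring.
have bn : be <= 0.
  by rewrite -(pmulr_lle0 _ r2) h2 oppr_le0 mulr_ge0 ?ltW.
have h4 : (be * S - m) * (be * S + m) = 0 by rewrite -subr_sqr exprMn h3 subrr.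
have /eqP := h4; rewrite mulf_eq0 => /orP[/eqP h5|/eqP h5].
  have : be * S <= 0 by rewrite pmulr_lle0.
  by move: m0 h5; lra.
have : be * S = - m by move: h5; lra.
by move=> h6; rewrite -mulNr -h6; field; rewrite gt_eqF.
Qed.

Variable p : R.
Hypothesis p2 : 2 < p.
Hypothesis p5 : p < 5.
Variables (v : pt -> R) (gv : pt -> pt) (psi : pt -> R) (gpsi : pt -> pt).
Hypothesis Hv : H1_with_grad v gv.
Hypothesis Hpsi : X_with_grad psi gpsi.
Hypothesis sol : weak_solution p v gv psi gpsi.
Hypothesis nz : nontrivial v.

Let p1 : 1 < p. Proof. by have := p2; lra. Qed.
Let mv : measurable_fun setT v. Proof. by have [_ [[[]]]] := Hv. Qed.
Let mgv i : measurable_fun setT (fun x => coord3 i (gv x)).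
Proof. by have [_ [[_ [h _]] _]] := Hv; have [] := h i. Qed.
Let mpsi : measurable_fun setT psi. Proof. by have [[_ [[[]]]]] := Hpsi. Qed.
Let mgpsi i : measurable_fun setT (fun x => coord3 i (gpsi x)).
Proof. by have [[_ [[_ [h _]] _]] _] := Hpsi; have [] := h i. Qed.

Section Profiles.
Variables V b Psi bt : R -> R.
Hypothesis aV : acont V b.
Hypothesis ev : {ae mu3, forall x : pt, 0 < enorm x -> v x = V (enorm x)}.
Hypothesis egv : {ae mu3, forall x : pt, 0 < enorm x -> forall i, coord3 i (gv x) = coord3 i x * (b (enorm x) / enorm x)}.
Hypothesis aP : acont Psi bt.
Hypothesis eP : {ae mu3, forall x : pt, 0 < enorm x -> psi x = Psi (enorm x)}.
Hypothesis egP : {ae mu3, forall x : pt, 0 < enorm x -> forall i, coord3 i (gpsi x) = coord3 i x * (bt (enorm x) / enorm x)}.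

Let cV : cpos V := acont_cpos aV.
Let cP : cpos Psi := acont_cpos aP.
Let lb : locpos b. Proof. by have [] := aV. Qed.
Let mb : measurable_fun pos b. Proof. by have [] := lb. Qed.
Let lbt : locpos bt. Proof. by have [] := aP. Qed.
Let mbt : measurable_fun pos bt. Proof. by have [] := lbt. Qed.
Let c2 : cpos (fun r : R => r ^+ 2). Proof. by apply: cposX; exact: cpos_id. Qed.

Let mcg (t : pt -> R) : test_fun t -> forall i, measurable_fun setT (fun x => coord3 i (cgrad t x)).
Proof.
move=> tt i; have [_ _ _ h] := test_cont tt.
rewrite (_ : (fun x => _) = dpart [:: i] t); first exact: cont_measurable3.
by apply/funext => x; exact: coord_cgrad.
Qed.

Lemma mass_integrable : ip (fC V).
Proof.
have [h _] := Hv; apply: (ip_radial_ae (F := fun x => v x ^+ 2) (f := fun r => V r ^+ 2) h).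
  by apply: cpos_meas; exact: cposX.
by apply: filterS ev => x h1 x0; rewrite h1.
Qed.
Let iC := mass_integrable.

(** With a radial test the gradients are collinear, and polar coordinates give [b w1 r^2];
    integrating by parts once more yields the twice integrated form that [weak_ode] accepts for a
    merely continuous [V]. *)
Lemma schrodinger_ode : exists V' V'', [/\ D1 V V', D1 V' V'', cpos V'' & D1 (fun r => r ^+ 2 * V' r) (rhs p Psi V)].
Proof.
apply: weak_ode => //; first exact: cpos_rhs.
move=> a e w w1 w2 tw0 d1 d2; have [a0 sw _] := tw0.
pose e' := `|e| + a + 1; have ae : a < e' by rewrite /e'; have := normr_ge0 e; lra.
have tw : T1 a e' w by apply: (T1_W a0 _ _ tw0) => //; rewrite /e'; have := ler_norm e; lra.
have [_ _ uw] := tw; have sw1 := smooth_D1 sw d1.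
have tw1 : T1 a e' w1 by split => //; exact: supp_D1 uw.
pose z r := w1 r * r ^+ 2; pose z' r := w2 r * r ^+ 2 + w1 r * (2 * r).
have tz : T1 a e' z := T1M tw1 smooth_sqr.
have dr2 : D1 (fun r : R => r ^+ 2) (fun r => 2 * r).
  by apply: D1_ext (D1X 1 (@D1_id)) => // r _; rewrite expr1 mulr1.
have dz : D1 z z' := D1M d2 dr2.
have tt : test_fun (radf 0 w : pt -> R) by apply: tclass_test; [exact: tc_T1 tw|exact: bsupp_T1 tw].
have fw := T1_flat0 tw; have cw := smooth_cpos sw; have [ct _ _ _] := test_cont tt.
have mw1 : measurable_fun pos w1 by apply: cpos_meas; exact: smooth_cpos.
have cn : cpos (fun r => nlin p (V r)) by exact: cpos_nlin.
pose g2 r := (1 + Psi r) * V r * r ^+ 2 * w r; pose g3 r := nlin p (V r) * r ^+ 2 * w r.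
have cPV : cpos (fun r => (1 + Psi r) * V r) by apply: cposM => //; apply: cposD => //; exact: cpos_cst.
have i1 : ip (fun r => b r * z r) by exact: ip_locT1 tz ae.
have i2 : ip g2 by apply: (ip_supp a0 _ cw uw); exact: cposM.
have i3 : ip g3 by apply: (ip_supp a0 _ cw uw); exact: cposM.
have [E1 _] := sol; have {E1} E1 := E1 _ tt.
have k0 : kap != 0 :> R by rewrite gt_eqF// kap_gt0.
have L := @Rint_radial_ae _ (fun r => b r * w1 r + (1 + Psi r) * V r * w r) _ _ _.
rewrite L in E1; last first.
- have h0 := @ae_en_gt0; apply: filterS3 ev egv eP => x h1 h2 h3 x0.
  rewrite (dot_collinear x0 (h2 x0) (fun i => cgrad_radf i d1 fw x0)) h1// h3// rad_pos//; ring.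
- apply: measurable_funD; first exact: measurable_funM.
  by apply: cpos_meas; exact: cposM.
- apply: measurable_funD; [apply: measurable_funD|].
  + by apply: meas_dot => //; exact: mcg.
  + by apply: measurable_funM => //; exact: cont_measurable3.
  + by apply: measurable_funM; [exact: measurable_funM|exact: cont_measurable3].
rewrite (@Rint_radial_ae _ (fun r => nlin p (V r) * w r)) in E1; last first.
- by apply: filterS ev => x h1 x0; rewrite h1// rad_pos.
- by apply: cpos_meas; exact: cposM.
- apply: measurable_funM; last exact: cont_measurable3.
  have mn : measurable_fun setT (nlin p) by apply: continuous_measurable_fun; exact: nlin_continuous.
  exact: (measurableT_comp mn mv).
move/(mulfI k0) : E1 => E1.
have [_ F1] := ig2 mpos 1 1 i1 i2; have [_ F2] := ig2 mpos 1 (-1) i2 i3.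
have e1 : Ip (fun r => (b r * w1 r + (1 + Psi r) * V r * w r) * r ^+ 2) = Ip (fun r => 1 * (b r * z r) + 1 * g2 r).
  by apply: eq_RintD => r _; rewrite /z /g2; ring.
have e2 : Ip (fun r => nlin p (V r) * w r * r ^+ 2) = Ip g3 by apply: eq_RintD => r _; rewrite /g3; ring.
have e3 : Ip (fun r => rhs p Psi V r * w r) = Ip (fun r => 1 * g2 r + -1 * g3 r).
  by apply: eq_RintD => r _; rewrite /g2 /g3 /rhs; ring.
have e4 : Ip (fun r => V r * (2 * r * w1 r + r ^+ 2 * w2 r)) = Ip (fun r => V r * z' r).
  by apply: eq_RintD => r _; rewrite /z'; ring.
rewrite e3 F2 e4 (acont_ibp aV ae tz dz).
have alg (A B C : R) : 1 * A + 1 * B = C -> - A = 1 * B + -1 * C.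
  by move=> <-; rewrite !mul1r mulN1r opprD addrCA subrr addr0.
by apply: alg; rewrite -F1 -e1 -e2.
Qed.

(** The test is the primitive of [eta] shifted by its total integral: it vanishes for large radii
    and equals [- Ip eta] near the origin, so it is smooth across 0 and has derivative [eta]. *)
Lemma flux_radial (a e : R) eta : T1 a e eta ->
  Ip (fun r => bt r / Num.sqrt (1 - bt r ^+ 2) * eta r * r ^+ 2) =
  Ip (fun r => V r ^+ 2 * (prim eta r - Ip eta) * r ^+ 2).
Proof.
move=> te; have [a0 se ue] := te; have ie := ip_T1 te; have ce := smooth_cpos se.
pose w r := prim eta r - Ip eta.
have dw : D1 w eta.
  by apply: (D1_ext _ _ (D1B (prim_D1 ce ie) (@D1_cst (Ip eta)))) => // r _; rewrite subr0.
have sw : smooth w by exact: D1_smooth dw se.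
have fw : flat0 (- Ip eta) a w.
  split => // r r0 ra; rewrite /w prim_const0 ?add0r// => t t0 tr.
  by apply: ue => //; rewrite (le_lt_trans tr ra).
have bw : bsupp (radf (- Ip eta) w : pt -> R).
  exists (Num.max e 0) => x; rewrite gt_max => /andP[ex x0]; rewrite rad_pos// /w prim_full ?subrr// => t t0 tr.
  by apply: ue => //; rewrite (lt_trans ex tr) orbT.
have tt : test_fun (radf (- Ip eta) w : pt -> R) by apply: tclass_test => //; exact: tc_rad fw.
have [ct _ _ _] := test_cont tt; have cw := smooth_cpos sw.
have [_ E] := sol; have {E} E := E _ tt.
rewrite (@Rint_radial_ae _ (fun r => bt r / Num.sqrt (1 - bt r ^+ 2) * eta r)) in E; last first.
- apply: filterS egP => x h x0; rewrite (dot_collinear x0 (h x0) (fun i => cgrad_radf i dw fw x0)).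
  by rewrite (enorm_collinear x0 (h x0)) real_normK ?num_real//; ring.
- apply: measurable_funM; last exact: cpos_meas.
  by apply: measurable_funM => //; exact: (meas_inv_sqrt mpos mbt).
- apply: measurable_funM; first by apply: meas_dot => //; exact: mcg.
  exact: (meas_inv_sqrt measurableT (meas_enorm mgpsi)).
rewrite (@Rint_radial_ae _ (fun r => V r ^+ 2 * w r)) in E; last first.
- by apply: filterS ev => x h x0; rewrite h// rad_pos.
- by apply: cpos_meas; apply: cposM => //; exact: cposX.
- by apply: measurable_funM; [exact: measurable_funX|exact: cont_measurable3].
by apply: (mulfI _ E); rewrite gt_eqF// kap_gt0.
Qed.

Lemma profile_nonzero : exists2 r, 0 < r & V r != 0.
Proof.
apply: contrapT => h; apply: nz; have h0 := @ae_en_gt0; apply: filterS2 ev h0 => x h1 x0.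
rewrite h1//; apply: contrapT => h2; apply: h; exists (enorm x) => //; exact/eqP.
Qed.

(* If the flux were not integrable near some point, its (junk) integral against a suitable
   strictly positive test would vanish, which forces V = 0. *)
Lemma flux_locpos : locpos (fun r => bt r / Num.sqrt (1 - bt r ^+ 2) * r ^+ 2).
Proof.
have [r1 r10 Vr1] := profile_nonzero.
have mq : measurable_fun pos (fun r => bt r / Num.sqrt (1 - bt r ^+ 2) * r ^+ 2).
  by apply: measurable_funM; [apply: measurable_funM => //; exact: (meas_inv_sqrt mpos mbt)|exact: cpos_meas].
split => // a e a0 ae.
(* The support is enlarged to contain [[a, e]] and the point [r1] where [V] does not vanish; then
   [w r1 > 0] and the right-hand side is nonzero. *)
pose A : R := Num.min a r1 / 2; pose B : R := 2 * Num.max e r1.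
have m0 : 0 < Num.min a r1 by rewrite lt_min a0.
have A0 : 0 < A by rewrite divr_gt0.
have Aa : A < a by have : Num.min a r1 <= a by [rewrite ge_min lexx]; rewrite /A; lra.
have Ar : A < r1 by have : Num.min a r1 <= r1 by [rewrite ge_min lexx orbT]; rewrite /A; lra.
have eB : e < B by have : e <= Num.max e r1 by [rewrite le_max lexx]; rewrite /B; lra.
have rB : r1 < B by have : r1 <= Num.max e r1 by [rewrite le_max lexx orbT]; rewrite /B; lra.
pose eta := bp 1 A B; have te : T1 A B eta by apply: bp_T1.
have [_ se ue] := te; have ie := ip_T1 te; have ce := smooth_cpos se.
have eta0 r : 0 <= eta r by exact: bp_ge0.
pose w r := Ip eta - prim eta r.
have w0 r : 0 <= w r by rewrite subr_ge0; apply: prim_le_Ip.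
have wle r : w r <= Ip eta by rewrite gerBl; apply: prim_ge0.
have wr1 : 0 < w r1.
  have wB : prim eta B <= Ip eta by apply: prim_le_Ip.
  have dp := prim_D1 ce ie.
  have hp t : t \in `]r1, B[ -> is_derive t 1 (prim eta) (eta t).
    by rewrite in_itv /= => /andP[t1 _]; apply: dp; exact: lt_trans t1.
  have [c + Ec] := @MVT R (prim eta) eta r1 B rB hp (cpos_within (D1_cpos dp) r10).
  rewrite in_itv /= => /andP[c1 c3]; have : 0 < eta c * (B - r1).
    by rewrite mulr_gt0 ?subr_gt0//; apply: bp_gt0 => //; exact: lt_trans c1.
  by rewrite -Ec /w; lra.
have cw : cpos w by apply: cposB; [exact: cpos_cst|exact: D1_cpos (prim_D1 ce ie)].
have cCw : cpos (fun r => fC V r * w r) by apply: cposM => //; exact: cpos_fC.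
have Iw : ip (fun r => fC V r * w r).
  apply: (ig_dom mpos (cpos_meas cCw) (igZ mpos (Ip eta) iC)) => r _.
  by rewrite normrM (ger0_norm (fC_ge0 _ _)) ger0_norm// mulrC ler_wpM2r// fC_ge0.
have pw : 0 < Ip (fun r => fC V r * w r).
  apply: (Ip_gt0 (r := r1)) => //; first by move=> t _; rewrite mulr_ge0// fC_ge0.
  by rewrite mulf_neq0 ?(gt_eqF wr1)// /fC mulf_neq0// expf_neq0// gt_eqF.
pose q r := bt r / Num.sqrt (1 - bt r ^+ 2) * eta r * r ^+ 2.
have mqe : measurable_fun pos q.
  rewrite /q; apply: measurable_funM; last exact: cpos_meas.
  by apply: measurable_funM; [apply: measurable_funM => //; exact: (meas_inv_sqrt mpos mbt)|exact: cpos_meas].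
have iq : ip q.
  apply: contrapT => nq; have := flux_radial te; rewrite (Rint_non_ig mpos mqe nq) => E.
  have : Ip (fun r => fC V r * w r) = 0.
    rewrite -[RHS]oppr0 {}E -RintN_all; apply: eq_RintD => r _; rewrite /fC /w; ring.
  by move=> h; rewrite h ltxx in pw.
have [c + hc] := EVT_min (ltW ae) (cpos_within ce a0).
rewrite in_itv /= => /andP[c1 c3].
have ec0 : 0 < eta c by apply: bp_gt0 => //; [exact: lt_le_trans c1|exact: le_lt_trans eB].
have mI : @measurable _ mR `[a, e] by exact: measurable_itv.
have sI : `[a, e] `<=` pos by exact: seg_pos.
apply: (@ig_dom _ _ _ leb `[a, e]%classic mI _ (fun r => (eta c)^-1 * `|q r|)).
- exact: (measurable_funS mpos).
- by apply: igZ => //; apply: (igS mpos) => //; exact: igabs.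
- by move=> r rI; apply: div_le_alg => //; exact: hc.
Qed.

(** Gauss' law. Integration by parts turns the charge against [prim eta - Ip eta] into minus the
    mass against [eta], and the fundamental lemma applies because the flux is locally integrable. *)
Lemma flux_ae : {ae leb, forall r, pos r -> bt r / Num.sqrt (1 - bt r ^+ 2) * r ^+ 2 = - mass V r}.
Proof.
have lq := flux_locpos; have cm := cpos_mass cV iC; have dm := mass_D1 cV iC.
have : {ae leb, forall r, pos r -> bt r / Num.sqrt (1 - bt r ^+ 2) * r ^+ 2 + mass V r = 0}.
  apply: (fund1_loc (locposD lq (cpos_locpos cm))) => a e eta ae te; have [a0 se ue] := te.
  have ie := ip_T1 te; have ce := smooth_cpos se; have dp := prim_D1 ce ie.
  have i1 := ip_locT1 lq te ae; have i2 : ip (fun r => mass V r * eta r) by exact: (ip_supp a0 cm ce ue).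
  have [_ E] := ig2 mpos 1 1 i1 i2.
  transitivity (Ip (fun r => 1 * (bt r / Num.sqrt (1 - bt r ^+ 2) * r ^+ 2 * eta r) + 1 * (mass V r * eta r))).
    by apply: eq_RintD => r _; ring.
  have [i3 _ E3] := prim_ibp (cpos_fC cV) iC ce ie; have [_ E4] := ig2 mpos 1 (- Ip eta) i3 iC.
  rewrite -/(mass V) in E3.
  rewrite E (_ : Ip (fun r => _ * eta r) = - Ip (fun r => mass V r * eta r)); first by rewrite !mul1r addNr.
  transitivity (Ip (fun r => bt r / Num.sqrt (1 - bt r ^+ 2) * eta r * r ^+ 2)).
    by apply: eq_RintD => r _; ring.
  rewrite (flux_radial te); transitivity (Ip (fun r => 1 * (fC V r * prim eta r) + - Ip eta * fC V r)).
    by apply: eq_RintD => r _; rewrite /fC; ring.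
  by rewrite E4 (canRL (addrK _) E3); ring.
by apply: filterS => r h rp; have := h rp => /eqP; rewrite addr_eq0 => /eqP.
Qed.

Lemma slope_le1 : {ae leb, forall r, pos r -> `|bt r| <= 1}.
Proof.
have [_ [_ h]] := Hpsi.
have : {ae leb, forall r, pos r -> Num.max (`|bt r| - 1) 0 = 0}.
  apply: polar_ae0.
    apply: measurable_maxr; last exact: measurable_cst.
    by apply: measurable_funB; [exact: measurableT_comp|exact: measurable_cst].
  apply: filterS2 h egP => x h1 h2 x0; apply/max_idPr.
  by rewrite subr_le0 -(enorm_collinear x0 (h2 x0)).
apply: filterS => r hr rp; have /max_idPr := hr rp; by rewrite subr_le0.
Qed.

Section Ode.
Variables V' V'' : R -> R.
Hypothesis dV : D1 V V'.
Hypothesis dV' : D1 V' V''.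
Hypothesis dH : D1 (fun r => r ^+ 2 * V' r) (rhs p Psi V).
Let cV' : cpos V' := D1_cpos dV'.

(** Grönwall's inequality for [V^2 + (r^2 V')^2], which vanishes at [r / 2]. *)
Lemma ode_unique r : 0 < r -> (forall t, 0 < t -> t < r -> V t = 0) -> forall s, 0 < s -> V s = 0.
Proof.
move=> r0 hV s s0; have [sr|rs] := ltP s r; first exact: hV.
have [_ hV'] := flat0_deriv dV (conj r0 hV).
pose a : R := r / 2; have a0 : 0 < a by rewrite divr_gt0.
have ar : a < r by rewrite /a; lra.
have as_ : a < s by exact: lt_le_trans rs.
(* Writing the nonlinearity as [|V|^(p-1)] times [V] makes the equation linear in [V] with the
   continuous coefficient [c], bounded on [[a, s]]. *)
pose q t := t ^+ 2 * V' t; pose c t := (1 + Psi t) - `|V t| `^ (p - 1).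
have cc : cpos c.
  apply: cposB; first by apply: cposD => //; exact: cpos_cst.
  by apply: (@cpos_comp (fun x => `|x| `^ (p - 1)) V) => //; apply: powabs_continuous; rewrite subr_gt0.
have cinv : cpos (fun t : R => t ^- 2) by apply: cposV => // t t0; rewrite expf_neq0// gt_eqF.
have cK : cpos (fun t => t ^- 2 + t ^+ 2 * `|c t|).
  by apply: cposD => //; apply: cposM => //; exact: cpos_abs.
have [K K0 hK] := cpos_seg_bounded s cK a0.
pose y t := V t ^+ 2 + q t ^+ 2.
pose y' t := 2 * (V t * V' t) + 2 * (q t * rhs p Psi V t).
have dy : D1 y y'.
  apply: (D1_ext _ _ (D1D (D1X 1 dV) (D1X 1 dH))) => // t t0; rewrite /y' /q !expr1; ring.
(* The integrating factor makes [y E] nonincreasing; the mean value theorem compares its values at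
   [a] and [s]. *)
pose E t := expR (- K * t); pose E' t := expR (- K * t) * (- K * 1).
have dE : D1 E E'.
  by apply: (D1_comp (h := expR) (h' := expR)); exact: D1Z (@D1_id).
have dY := D1M dy dE.
have hY t : t \in `]a, s[ -> is_derive t 1 (fun t => y t * E t) (y' t * E t + y t * E' t).
  by rewrite in_itv /= => /andP[at_ _]; apply: dY; exact: lt_trans at_.
have [t + Et] := @MVT R _ _ a s as_ hY (cpos_within (D1_cpos dY) a0).
rewrite in_itv /= => /andP[at_ ts]; have t0 : 0 < t by exact: lt_trans at_.
have ya : y a = 0 by rewrite /y /q hV// hV'// mulr0 !expr0n addr0.
have le : y' t <= K * y t.
  have hh : V' t = q t / t ^+ 2 by rewrite /q; field; rewrite gt_eqF.
  have -> : y' t = 2 * (V t * (q t / t ^+ 2)) + 2 * (q t * (t ^+ 2 * (c t * V t))).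
    by rewrite /y' -hh /rhs /c /nlin; ring.
  apply: gron_alg => //; apply: le_trans (ler_norm _) _; apply: hK; by rewrite in_itv /= !ltW.
have Es : 0 < E s by exact: expR_gt0.
have Y0 : y s * E s <= 0.
  have : (y' t * E t + y t * E' t) * (s - a) <= 0.
    rewrite pmulr_lle0 ?subr_gt0// /E'; rewrite -/(E t).
    have -> : y' t * E t + y t * (E t * (- K * 1)) = (y' t - K * y t) * E t by ring.
    by rewrite pmulr_lle0 ?expR_gt0// subr_le0.
  by rewrite -Et ya mul0r subr0.
move: Y0; rewrite pmulr_lle0// => ys.
have : V s ^+ 2 <= 0 by apply: le_trans ys; rewrite lerDl sqr_ge0.
by move=> h; apply/eqP; rewrite -sqrf_eq0 eq_le h sqr_ge0.
Qed.

(** Zero mass up to [r] means [V = 0] near the origin, hence everywhere by [ode_unique]. Strict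
    positivity is what lets [beta_alg] exclude the default quotient. *)
Lemma mass_gt0 r : 0 < r -> 0 < mass V r.
Proof.
move=> r0; rewrite lt_neqAle mass_ge0 andbT eq_sym; apply/eqP => m0.
have dm := mass_D1 cV iC.
have hm : flat0 0 r (mass V).
  split => // t t0 tr; apply/eqP; rewrite eq_le mass_ge0 andbT -m0.
  by apply: prim_mono => //; [exact: cpos_fC|move=> s _; exact: fC_ge0|exact: ltW].
have [_ hC] := flat0_deriv dm hm.
have z t : 0 < t -> t < r -> V t = 0.
  move=> t0 tr; have /eqP := hC t t0 tr; rewrite /fC mulf_eq0 !sqrf_eq0 (gt_eqF t0) orbF.
  by move/eqP.
have [s s0] := profile_nonzero; by rewrite (ode_unique r0 z s0) eqxx.
Qed.

Lemma slope_ae : {ae leb, forall r, pos r -> bt r = - fS V r}.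
Proof.
have h1 := slope_le1; have h2 := flux_ae; apply: filterS2 h1 h2 => r h1 h2 rp.
have r0 : 0 < r by exact/in_pos.
exact: (beta_alg r0 (mass_gt0 r0) (h1 rp) (SS_gt0 V r0) (SS_sqr V r) (h2 rp)).
Qed.

(** Equal derivatives leave a constant [k]. If [k] were nonzero, [|Psi|] would stay above [|k| / 2]
    far away, where [pot V] is small, against the integrability of [Psi^6 r^2]. *)
Lemma potential_eq r : 0 < r -> Psi r = pot V r.
Proof.
have aQ : acont (pot V) (fun r => - fS V r).
  by apply: D1_acont; [exact: pot_D1|apply: cposN; exact: cpos_fS].
pose k := Psi 1 - pot V 1.
have hk s : 0 < s -> Psi s = pot V s + k.
  move=> s0; have [l1 e1] := aP; have [l2 e2] := aQ.
  have := e1 1 s ltr01 s0; have := e2 1 s ltr01 s0.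
  rewrite (@eq_Rint_ae _ _ _ leb pos mpos (fun t => bt t * stp 1 s t) (fun t => - fS V t * stp 1 s t)).
  - by move=> <-; rewrite /k; lra.
  - exact: (ig_meas (ig_stp l1 ltr01 s0)).
  - exact: (ig_meas (ig_stp l2 ltr01 s0)).
  - by have h := slope_ae; apply: filterS h => t h rp; rewrite h.
move=> r0; rewrite hk//; have [->|k0] := eqVneq k 0; first by rewrite addr0.
have i6 : ip (fun r => Psi r ^+ 6 * r ^+ 2).
  have [[h _] _] := Hpsi; apply: (ip_radial_ae (F := fun x => psi x ^+ 6) (f := fun r => Psi r ^+ 6) h).
    by apply: cpos_meas; exact: cposX.
  by apply: filterS eP => x h1 x0; rewrite h1.
have kn : 0 < `|k| / 2 by rewrite divr_gt0// normr_gt0.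
have /cvgrPdist_lt /(_ _ kn) [N [_ hN]] := pot_cvgy cV iC.
have c6 : cpos (fun r => Psi r ^+ 6 * r ^+ 2) by apply: cposM => //; exact: cposX.
have N0 : 0 < Num.max N 1 by rewrite lt_max ltr01 orbT.
have k6 : 0 < (`|k| / 2) ^+ 6 by rewrite exprn_gt0.
have [s] := ip_small_y c6 i6 (fun r _ => mulr_ge0 (exprn_even_ge0 _ (isT : ~~ odd 6)) (sqr_ge0 r)) k6 N0.
rewrite gt_max => /andP[Ns s1]; have s0 : 0 < s by exact: lt_trans s1.
have := hN s Ns; rewrite sub0r normrN => hp.
have hP : `|k| / 2 <= `|Psi s|.
  rewrite hk//; have := ler_normB (pot V s + k) (pot V s); rewrite addrAC subrr add0r; lra.
move=> h; suff : (`|k| / 2) ^+ 6 < (`|k| / 2) ^+ 6 by rewrite ltxx.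
apply: le_lt_trans h; have -> : s * (Psi s ^+ 6 * s ^+ 2) = Psi s ^+ 6 * s ^+ 3 by ring.
have -> : Psi s ^+ 6 = `|Psi s| ^+ 6 by rewrite -normrX ger0_norm// exprn_even_ge0.
have q1 : (`|k| / 2) ^+ 6 <= `|Psi s| ^+ 6 by apply: lerXn2r hP; rewrite nnegrE// ltW.
have s3 : 1 <= s ^+ 3 by apply: exprn_ege1; exact: ltW.
by apply: le_trans q1 _; rewrite ler_peMr// exprn_ge0.
Qed.

(** The weak derivatives [b] and [bt] are identified almost everywhere with [V'] and [- fS V]; the
    pair then satisfies the coupled radial equation, to which Pohozaev's identity applies. *)
Lemma action_ge : kap * clev p <= F_action p v gv psi gpsi.
Proof.
have ab : {ae leb, forall r, pos r -> b r = V' r} by apply: acont_ae aV _; exact: D1_acont.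
have ab3 := ae_polar ab; have as3 := ae_polar slope_ae.
have eg : {ae mu3, forall x : pt, 0 < enorm x -> enorm (gv x) = `|V' (enorm x)|}.
  apply: filterS2 egv ab3 => x h1 h2 x0; rewrite (enorm_collinear x0 (h1 x0)) h2//; exact/in_pos.
have iA : ip (fA V').
  have [_ [_ h]] := Hv; apply: (ip_radial_ae (F := fun x => enorm (gv x) ^+ 2) (f := fun r => V' r ^+ 2) h).
    by apply: cpos_meas; exact: cposX.
  by apply: filterS eg => x h1 x0; rewrite h1// real_normK ?num_real.
have KV : Kp V V' by split.
have dH' : D1 (fun r => r ^+ 2 * V' r) (rhs p (pot V) V).
  by apply: D1_ext dH => // r r0; rewrite /rhs potential_eq.
have C0 : 0 < Ip (fC V).
  have [r r0 Vr] := profile_nonzero; apply: (Ip_gt0 (r := r)) => //; first exact: cpos_fC.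
    by move=> t _; exact: fC_ge0.
  by rewrite /fC mulf_neq0// expf_neq0// gt_eqF.
rewrite (action_radial p2 KV dH' mv mpsi mgv mgpsi ev eg).
- by rewrite ler_pM2l ?kap_gt0//; exact: clev_le_sol.
- by apply: filterS eP => x h x0; rewrite h// potential_eq.
- apply: filterS2 egP as3 => x h1 h2 x0; rewrite (enorm_collinear x0 (h1 x0)) h2.
    by rewrite normrN ger0_norm// fS_ge0.
  exact: x0.
Qed.

End Ode.
End Profiles.

Lemma solution_action_ge : radial v -> radial psi -> kap * clev p <= F_action p v gv psi gpsi.
Proof.
move=> rv rpsi; have [_ [wv gv2]] := Hv; have [[_ [wpsi gpsi2]] _] := Hpsi.
have [V [b [aV ev egv]]] := radial_weak rv wv gv2.
have [Psi [bt [aP eP egP]]] := radial_weak rpsi wpsi gpsi2.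
have [V' [V'' [d1 d2 _ d3]]] := schrodinger_ode aV ev egv aP eP.
exact: (action_ge aV ev egv aP eP egP d1 d2 d3).
Qed.

End Competitor.

End HalfLine.

Theorem theorem1p2 (R : realType) (p : R) :
  5%:R / 2%:R < p -> p < 5%:R ->
  exists (u : pt -> R) (gu : pt -> pt) (phi : pt -> R) (gphi : pt -> pt),
    [/\ H1_with_grad u gu /\ radial u,
        X_with_grad phi gphi /\ radial phi,
        weak_solution p u gu phi gphi /\ nontrivial u,
        (forall (v : pt -> R) (gv : pt -> pt) (psi : pt -> R) (gpsi : pt -> pt),
           H1_with_grad v gv -> radial v ->
           X_with_grad psi gpsi -> radial psi ->
           weak_solution p v gv psi gpsi -> nontrivial v ->
           F_action p u gu phi gphi <= F_action p v gv psi gpsi)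
      & C2 u /\ C2 phi].
Proof.
move=> hp p5; have p2 : 2 < p by apply: lt_trans hp; lra.
have [u [gu [phi [gphi [H1 HX sol act hC2]]]]] := ground_state p2 p5.
exists u, gu, phi, gphi; split => // v gv psi gpsi Hv rv Hpsi rpsi solv nz.
exact: le_trans act (solution_action_ge p2 p5 Hv Hpsi solv nz rv rpsi).
Qed.
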